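(* For any reductive pair $(\mathfrak g,K)$ (with associated reductive Lie group $G$) there exist finitely many constructible Borel subalgebras $\mathfrak q_1,\dots,\mathfrak q_r$ of $\mathfrak g$ whose Levi factors $L_1,\dots,L_r\subseteq G$ have the property that the union of their $G$-conjugates covers a dense subset of $G$.
   Context: A reductive pair $(\mathfrak g,K)$ (Knapp-Vogan, Cohomological Induction and Unitary Representations, Ch. IV) corresponds to a real reductive Lie group $G$ with finitely many components, Cartan involution $\theta$ and maximal compact subgroup $K$; $\mathfrak g$ is the complexification of $\mathfrak g_0=\mathrm{Lie}(G)$. A parabolic subalgebra $\mathfrak q\subseteq\mathfrak g$ is germane if it has a Levi factor $\mathfrak l$ which is the complexification of a $\theta$-stable real $\mathfrak l_0\subseteq\mathfrak g_0$; its Levi factor $L\subseteq G$ is the intersection of the normalizers of $\mathfrak q$ and $\theta(\mathfrak q)$ in $G$. $\mathfrak q$ is constructible if it is germane and there exist parabolic subalgebras $\mathfrak q=\mathfrak q_{(k)}\subseteq\mathfrak q_{(k-1)}\subseteq\cdots\subseteq\mathfrak q_{(0)}=\mathfrak g$ with Levi decompositions $\mathfrak q_{(i)}=\mathfrak l_{(i)}+\mathfrak u_{(i)}$ such that for all $0\le i<k$ the parabolic subalgebra $\mathfrak q_{(i+1)}\cap\mathfrak l_{(i)}\subseteq\mathfrak l_{(i)}$ is a real or $\theta$-stable parabolic subalgebra of the reductive pair $(\mathfrak l_{(i)},L_{(i)}\cap K)$. Here Levi factors and Cartan subalgebras are always $\theta$-stable and defined over $\mathbf R$. *)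

(* Defs.v *)
From HB Require Import structures.
From mathcomp Require Import all_boot all_order all_algebra.
From mathcomp Require Import all_classical all_reals all_analysis.
From mathcomp Require Import complex.

Set Implicit Arguments.
Unset Strict Implicit.
Unset Printing Implicit Defensive.

Import Order.TTheory GRing.Theory Num.Theory.
Import numFieldNormedType.Exports.

Local Open Scope classical_set_scope.
Local Open Scope ring_scope.

(* [Ck_on k A f] is meant for A open in a finite-dimensional space, where
   continuity of all iterated directional derivatives is the usual C^k. *)
Fixpoint Ck_on (R : realType) (E F : normedModType R) (k : nat) (A : set E)
    (f : E -> F) : Prop :=
  (forall x, A x -> {for x, continuous f}) /\
  (if k is k'.+1 then
     forall v, (forall x, A x -> derivable f x v) /\ Ck_on k' A ('D_v f)
   else True).

Definition smooth_on (R : realType) (E F : normedModType R) (A : set E)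
    (f : E -> F) : Prop := forall k, Ck_on k A f.

(* [chart_map] is only meaningful on [chart_dom], and [chart_inv] only on its
   image by [chart_map]. *)
Record chart (M E : Type) := Chart {
  chart_dom : set M;
  chart_map : M -> E;
  chart_inv : E -> M }.

Definition is_chart (M E : topologicalType) (c : chart M E) : Prop :=
  [/\ open (chart_dom c),
      open (chart_map c @` chart_dom c),
      (forall x, chart_dom c x -> chart_inv c (chart_map c x) = x),
      (forall x, chart_dom c x -> {for x, continuous (chart_map c)}) &
      (forall x, chart_dom c x ->
         {for chart_map c x, continuous (chart_inv c)})].

Definition prod_chart (M N E F : Type) (c : chart M E) (d : chart N F) :
    chart (M * N) (E * F) :=
  {| chart_dom := chart_dom c `*` chart_dom d;
     chart_map := fun p => (chart_map c p.1, chart_map d p.2);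
     chart_inv := fun p => (chart_inv c p.1, chart_inv d p.2) |}.

Definition id_chart (E : Type) : chart E E :=
  {| chart_dom := setT; chart_map := id; chart_inv := id |}.

Definition smooth_in (R : realType) (M N : Type) (E F : normedModType R)
    (c : chart M E) (d : chart N F) (f : M -> N) : Prop :=
  smooth_on (chart_map c @` (chart_dom c `&` f @^-1` chart_dom d))
            (fun e => chart_map d (f (chart_inv c e))).

(* The smooth structure is given by an atlas with one distinguished chart
   around each point. *)
HB.mixin Record isLieGroup (R : realType) (n : nat) G
    of Topological G & Group G := {
  chart_at : G -> chart G 'rV[R]_n;
  chart_atP : forall x, is_chart (chart_at x);
  chart_at_dom : forall x, chart_dom (chart_at x) x;
  chart_at_compat : forall x y, smooth_in (chart_at x) (chart_at y) id;
  lie_hausdorff : hausdorff_space G;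
  lie_second_countable : @second_countable G;
  mulg_continuous : continuous (fun p : G * G => p.1 * p.2)%g;
  mulg_smooth : forall x y z,
    smooth_in (prod_chart (chart_at x) (chart_at y)) (chart_at z)
              (fun p : G * G => p.1 * p.2)%g;
  invg_continuous : continuous (fun x : G => x^-1)%g;
  invg_smooth : forall x y,
    smooth_in (chart_at x) (chart_at y) (fun x : G => x^-1)%g
}.

#[short(type="lieGroupType")]
HB.structure Definition LieGroup (R : realType) (n : nat) :=
  {G of isLieGroup R n G & Topological G & Group G}.

Definition smooth_endo (R : realType) (n : nat) (G : lieGroupType R n)
    (f : G -> G) : Prop :=
  continuous f /\
  forall x y, smooth_in (@chart_at R n G x) (@chart_at R n G y) f.

Definition smooth_vec (R : realType) (n : nat) (G : lieGroupType R n)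
    (f : G -> 'rV[R]_n) : Prop :=
  continuous f /\
  forall x, smooth_in (@chart_at R n G x) (id_chart 'rV[R]_n) f.

(* The Lie algebra g_0 = T_1 G is the space 'rV[R]_n of coordinates in the
   distinguished chart around 1. *)
Section LieAlgebra.
Context (R : realType) (n : nat) (G : lieGroupType R n).

Let phi : chart G 'rV[R]_n := @chart_at R n G 1%g.

(* Ad g is the differential at 1 of x |-> g x g^-1. *)
Definition Ad (g : G) (X : 'rV[R]_n) : 'rV[R]_n :=
  'D_X (fun e => chart_map phi (g * chart_inv phi e * g^-1)%g)
       (chart_map phi 1%g).

(* The bracket is the differential of Ad: ad = d(Ad)_1. *)
Definition lbr (X Y : 'rV[R]_n) : 'rV[R]_n :=
  'D_X (fun e => Ad (chart_inv phi e) Y) (chart_map phi 1%g).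

Definition one_param (X : 'rV[R]_n) (gam : R -> G) : Prop :=
  [/\ continuous gam,
      (forall s t, gam (s + t) = (gam s * gam t)%g) &
      is_derive (0 : R) (1 : R) (chart_map phi \o gam) X].

Definition expG (X : 'rV[R]_n) : G :=
  xget 1%g [set g | exists2 gam, one_param X gam & gam 1 = g].

(* By Cartan's closed subgroup theorem this is the Lie algebra of K when K is
   a closed subgroup. *)
Definition lie_of (K : set G) : set 'rV[R]_n :=
  [set X | forall t : R, K (expG (t *: X))].

End LieAlgebra.

(* Throughout this section br is meant to be bilinear. *)
Section LieSubspaces.
Context (F : fieldType) (V : vectType F) (br : V -> V -> V).
Implicit Types U W q l u b : {vspace V}.

(* This is the span of all brackets [x, y], x in U, y in W. *)
Definition brv U W : {vspace V} :=
  <<[seq br x y | x <- vbasis U, y <- vbasis W]>>%VS.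

Definition lie_subalg U : Prop := (brv U U <= U)%VS.

Definition lie_ideal U W : Prop := (U <= W)%VS /\ (brv W U <= U)%VS.

Definition lie_solvable U : Prop :=
  exists k, iter k (fun W => brv W W) U = 0%VS.

Definition lie_reductive U : Prop :=
  lie_subalg U /\
  forall a, lie_ideal a U ->
    exists2 b, lie_ideal b U & (a + b = U)%VS /\ (a :&: b = 0)%VS.

Definition lie_radical U W : Prop :=
  [/\ lie_ideal W U, lie_solvable W &
      forall a, lie_ideal a U -> lie_solvable a -> (a <= W)%VS].

Definition borel_in U b : Prop :=
  [/\ (b <= U)%VS, lie_subalg b, lie_solvable b &
      forall c, (b <= c)%VS -> (c <= U)%VS -> lie_subalg c -> lie_solvable c ->
        c = b].

Definition parabolic_in U q : Prop :=
  [/\ (q <= U)%VS, lie_subalg q & exists2 b, borel_in U b & (b <= q)%VS].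

(* u = [q, rad q] is the nilpotent radical of q. The largest nilpotent ideal of
   q would also contain the center of the ambient reductive Lie algebra. *)
Definition levi_decomposition q l u : Prop :=
  [/\ (exists2 r, lie_radical q r & u = brv q r),
      lie_reductive l, (l + u = q)%VS & (l :&: u = 0)%VS].

End LieSubspaces.

(* The reductive pair (g, K) together with its group: G is reductive with
   maximal compact subgroup K, Cartan involution theta of g_0 and invariant
   form B (Knapp-Vogan, Ch. IV). The automorphisms Ad g are not assumed to be
   inner. *)
Record reductive_group (R : realType) (n : nat) (G : lieGroupType R n)
    (K : set G) (theta : {linear 'rV[R]_n -> 'rV[R]_n})
    (B : 'rV[R]_n -> 'rV[R]_n -> R) : Prop := ReductiveGroup {
  red_K1 : K 1%g;
  red_KM : forall x y, K x -> K y -> K (x * y)%g;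
  red_KV : forall x, K x -> K x^-1%g;
  red_Kcompact : compact K;
  red_g0 : lie_reductive (@lbr R n G) fullv;
  red_theta_inv : involutive theta;
  red_theta_br : forall X Y, theta (@lbr R n G X Y) = lbr G (theta X) (theta Y);
  red_k0 : forall X, theta X = X <-> lie_of K X;
  red_B_lin : forall X, scalar (B X);
  red_B_sym : forall X Y, B X Y = B Y X;
  red_B_Ad : forall (g : G) X Y, B (Ad g X) (Ad g Y) = B X Y;
  red_B_theta : forall X Y, B (theta X) (theta Y) = B X Y;
  red_B_orth : forall X Y, theta X = X -> theta Y = - Y -> B X Y = 0;
  red_B_p0 : forall X, theta X = - X -> X != 0 -> 0 < B X X;
  red_B_k0 : forall X, theta X = X -> X != 0 -> B X X < 0;
  (* (k, X) |-> k exp X is a diffeomorphism of K x p_0 onto G. The map is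
     smooth and K is an embedded submanifold, so this amounts to a smooth
     two-sided inverse g |-> (kap g, xi g). *)
  red_polar : exists (kap : G -> G) (xi : G -> 'rV[R]_n),
    [/\ smooth_endo kap, smooth_vec xi,
        (forall g, [/\ K (kap g), theta (xi g) = - xi g &
                       (kap g * expG G (xi g))%g = g]) &
        (forall k X, K k -> theta X = - X ->
           kap (k * expG G X)%g = k /\ xi (k * expG G X)%g = X)]
}.

Section Complexification.
Context (R : realType) (n : nat).
Implicit Types (X Y : 'rV[R]_n) (Z W : 'rV[R[i]]_n).

Definition reV Z : 'rV[R]_n := map_mx (@complex.Re R) Z.
Definition imV Z : 'rV[R]_n := map_mx (@complex.Im R) Z.
Definition cplxV X Y : 'rV[R[i]]_n := \row_j (X 0 j +i* Y 0 j)%C.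

Definition conjV Z := cplxV (reV Z) (- imV Z).

Definition cplx_map (f : 'rV[R]_n -> 'rV[R]_n) Z :=
  cplxV (f (reV Z)) (f (imV Z)).

Definition cplx_br (br : 'rV[R]_n -> 'rV[R]_n -> 'rV[R]_n) Z W :=
  cplxV (br (reV Z) (reV W) - br (imV Z) (imV W))
        (br (reV Z) (imV W) + br (imV Z) (reV W)).

Definition cplx_vspace (U : {vspace 'rV[R]_n}) : {vspace 'rV[R[i]]_n} :=
  <<[seq cplxV X 0 | X <- vbasis U]>>%VS.

(* This is the image of U when f is linear or antilinear. *)
Definition imgv (f : 'rV[R[i]]_n -> 'rV[R[i]]_n) (U : {vspace 'rV[R[i]]_n}) :
    {vspace 'rV[R[i]]_n} :=
  <<[seq f Z | Z <- vbasis U]>>%VS.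

End Complexification.

Section Constructible.
Context (R : realType) (n : nat) (G : lieGroupType R n).
Context (theta : {linear 'rV[R]_n -> 'rV[R]_n}).
Implicit Types q l : {vspace 'rV[R[i]]_n}.

Definition gbr : 'rV[R[i]]_n -> 'rV[R[i]]_n -> 'rV[R[i]]_n :=
  cplx_br (@lbr R n G).

Definition theta_stable q : Prop := imgv (cplx_map theta) q = q.

Definition conj_stable q : Prop := imgv (@conjV R n) q = q.

Definition theta_stable_real l : Prop :=
  exists2 l0 : {vspace 'rV[R]_n},
    l = cplx_vspace l0 & forall X, X \in l0 -> theta X \in l0.

Definition germane q : Prop :=
  parabolic_in gbr fullv q /\
  exists l u, levi_decomposition gbr q l u /\ theta_stable_real l.

(* A parabolic subalgebra of (l, L n K), for l theta-stable and defined over the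
   reals, is real or theta-stable with respect to the restrictions to l of the
   conjugation and of theta. *)
Definition constructible q : Prop :=
  germane q /\
  exists (k : nat) (qs ls us : nat -> {vspace 'rV[R[i]]_n}),
    [/\ qs 0%N = fullv, qs k = q,
        (forall i, (i <= k)%N ->
           [/\ parabolic_in gbr fullv (qs i),
               levi_decomposition gbr (qs i) (ls i) (us i) &
               theta_stable_real (ls i)]) &
        (forall i, (i < k)%N ->
           [/\ (qs i.+1 <= qs i)%VS,
               parabolic_in gbr (ls i) (qs i.+1 :&: ls i)%VS &
               conj_stable (qs i.+1 :&: ls i)%VS \/
               theta_stable (qs i.+1 :&: ls i)%VS])].

Definition normalizer q : set G :=
  [set g | imgv (cplx_map (Ad g)) q = q].

Definition levi_subgroup q : set G :=
  normalizer q `&` normalizer (imgv (cplx_map theta) q).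

End Constructible.

Arguments levi_subgroup {R n} G theta q.

Definition conjugates_of (G : groupType) (L : set G) : set G :=
  [set (g * x * g^-1)%g | g in [set: G] & x in L].

(* Main.v *)
(* On g_0 use the inner product <X, Y> = - B(X, theta Y); on g let star be
   - theta o conj, so that ad (star Z) is the adjoint of ad Z.

   In a given nonempty open subset of G choose u such that (X - 1)^r divides
   the characteristic polynomial of Ad on the whole subset, while (X - 1)^(r+1)
   does not divide that of Ad u. Minimizing the trace norm of Ad over the
   closure of the conjugacy class of u gives h = k exp xi with Ad h normal. Let
   t = ker (Ad h - 1). Near h every element is conjugate to some h exp Y with Y
   in t, so Ad (exp Y) is unipotent on t; hence tr ((ad Y)^2) = 0 on t, and t,
   being theta-stable, is abelian. As Ad h acts on the centralizer of t with
   central fixed points only, Kreknin's argument shows that this centralizer is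
   abelian. So the open set contains a conjugate of an element of Z_G(t).

   For such t let D = X + i Y with X in the p-part and Y in the k-part of t,
   generic, and Y small. The span q of the eigenspaces of ad D with eigenvalues
   >= 0 is a Borel subalgebra: the Levi factor of its parabolic subalgebra is
   the abelian centralizer of t. It is constructible in two steps, a real
   parabolic subalgebra given by X followed by a theta-stable one given by Y,
   and its Levi factor contains Z_G(t).

   Up to conjugation by K, t lies in one of finitely many fixed tori. Each of
   these is diagonal in a fixed basis of g, and q is spanned by a part of that
   basis, so that finitely many q suffice. *)
Require Import Defs.
From HB Require Import structures.
From mathcomp Require Import all_boot all_order all_algebra.
From mathcomp Require Import all_classical all_reals all_analysis.
From mathcomp Require Import complex spectral.
From mathcomp Require Import ring lra.

Set Implicit Arguments.
Unset Strict Implicit.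
Unset Printing Implicit Defensive.

Import Order.TTheory GRing.Theory Num.Theory.
Import numFieldNormedType.Exports.

Local Open Scope classical_set_scope.
Local Open Scope ring_scope.

(** * Strict differentiability *)

(** [G] may be disconnected and [Ad g] an outer automorphism, so neither one-parameter groups nor
    regular elements of the Lie algebra reach every element; the argument starts from the group
    element itself. Its conjugacy class need not be closed, and the normal [h] found in the closure
    need not be conjugate to it. Two facts survive the limit: the characteristic polynomial of [Ad]
    is constant on the closure, and conjugates of the open set come arbitrarily close to [h], hence
    contain some [h exp Y0] with [Y0] in [t]. Unipotence on [t] gives
    [tr (P Ad (h exp (s Y))) = tr P] for [s] near 1, where [P] is the orthogonal projection to [t].
    Its second derivative makes [tr (P (ad Y)^2)] vanish for [Y] near [Y0]; being quadratic in [Y],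
    it vanishes on all of [t]. On the k-part [ad] is skew and on the p-part symmetric, so this trace
    is definite up to sign and kills the bracket. Since [h] may act by an outer automorphism, [t]
    can be smaller than its centralizer; this is why the centralizer needs an argument of its
    own. *)

Section StrictDifferentiability.
Context {R : realType}.

(* Strict differentiability: it makes the chain rule and the inverse function
   theorem one-line estimates. *)
Definition sdiff (E F : normedModType R) (f : E -> F) (x : E) (L : E -> F) :=
  [/\ linear L, (exists K, forall v, `|L v| <= K * `|v|) &
      forall e, 0 < e -> exists2 d, 0 < d &
        forall y z, `|y - x| < d -> `|z - x| < d ->
          `|f y - f z - L (y - z)| <= e * `|y - z|].

Lemma sdiff_bound (E F : normedModType R) (f : E -> F) x L :
  sdiff f x L -> exists2 K, 0 < K & forall v, `|L v| <= K * `|v|.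
Proof.
case=> _ [K hK] _; exists (`|K| + 1); first by rewrite ltr_wpDl.
move=> v; apply: (le_trans (hK v)); rewrite ler_wpM2r //.
by rewrite (le_trans (ler_norm K)) // lerDl.
Qed.

Lemma sdiff_lin (E F : normedModType R) (f : E -> F) x L : sdiff f x L ->
  [/\ forall v w, L (v + w) = L v + L w, forall v w, L (v - w) = L v - L w,
      forall a v, L (a *: v) = a *: L v & L 0 = 0].
Proof.
case=> hl _ _.
have L0 : L 0 = 0 by have := hl (-1) 0 0; rewrite scaler0 add0r scaleN1r addNr.
split=> //.
- by move=> v w; have := hl 1 v w; rewrite !scale1r.
- by move=> v w; rewrite addrC -scaleN1r hl scaleN1r addrC.
- by move=> a v; have := hl a v 0; rewrite !addr0 L0 addr0.
Qed.

Lemma sdiff_lipschitz (E F : normedModType R) (f : E -> F) x L : sdiff f x L ->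
  exists2 K, 0 < K & exists2 d, 0 < d &
    forall y z, `|y - x| < d -> `|z - x| < d -> `|f y - f z| <= K * `|y - z|.
Proof.
move=> hf; have [K K0 hK] := sdiff_bound hf; exists (K + 1); first by rewrite addr_gt0.
have [_ _ /(_ 1 ltr01) [d d0 hd]] := hf; exists d => // y z hy hz.
have := hd y z hy hz; have := hK (y - z) => h1 h2.
rewrite -[f y - f z](subrK (L (y - z))) (le_trans (ler_normD _ _)) //.
by rewrite mulrDl addrC lerD.
Qed.

Lemma nbhs_norm_lt (E : normedModType R) (x : E) (A : set E) :
  nbhs x A <-> exists2 d : R, 0 < d & forall y, `|y - x| < d -> A y.
Proof.
split.
- move=> /nbhs_ballP [d /= d0 hd]; exists d => // y hy; apply: hd.
  by rewrite -ball_normE /= distrC.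
- move=> [d d0 hd]; apply/nbhs_ballP; exists d => //= y.
  by rewrite -ball_normE /= distrC => /hd.
Qed.

Lemma sdiff_cont (E F : normedModType R) (f : E -> F) x L :
  sdiff f x L -> {for x, continuous f}.
Proof.
move=> /sdiff_lipschitz [K K0 [d d0 hd]].
apply/cvgrPdist_lt => e e0; apply/nbhs_norm_lt.
exists (Num.min d (e / K)); first by rewrite lt_min d0 divr_gt0.
move=> y; rewrite lt_min => /andP[h1 h2].
rewrite distrC (le_lt_trans (hd y x h1 _)) ?subrr ?normr0 //.
by rewrite mulrC -ltr_pdivlMr.
Qed.

Lemma sdiff_near (E F : normedModType R) (f g : E -> F) x L :
  (\forall y \near x, f y = g y) -> sdiff f x L -> sdiff g x L.
Proof.
move=> /nbhs_norm_lt [d0 d0p h0] [h1 h2 h3]; split=> // e /h3 [d dp hd].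
exists (Num.min d d0); first by rewrite lt_min dp d0p.
move=> y z; rewrite !lt_min => /andP[a b] /andP[a' b'].
by rewrite -!h0 //; apply: hd.
Qed.

Lemma sdiff_derive (E F : normedModType R) (f : E -> F) x L v : sdiff f x L ->
  is_derive x v f (L v).
Proof.
move=> hf; have [lD lB lZ l0] := sdiff_lin hf.
have cv : h^-1 *: (f (h *: v + x) - f x) @[h --> (0:R)^'] --> L v.
  apply/cvgrPdist_le => e e0.
  have [_ _ h3] := hf.
  have e1 : 0 < e / (`|v| + 1) by rewrite divr_gt0 // ltr_wpDl.
  have [d d0 hd] := h3 _ e1.
  near=> h.
  have h0 : h != 0 by near: h; exact: nbhs_dnbhs_neq.
  have hlt : `|h| < d / (`|v| + 1).
    by near: h; apply: dnbhs0_lt; rewrite divr_gt0 // ltr_wpDl.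
  rewrite distrC.
  have -> : h^-1 *: (f (h *: v + x) - f x) - L v =
            h^-1 *: (f (h *: v + x) - f x - L (h *: v + x - x)).
    by rewrite addrK lZ [in RHS]scalerBr scalerA mulVf // scale1r.
  rewrite normrZ normfV ler_pdivrMl ?normr_gt0 //.
  have hv : `|h| * `|v| <= d * (`|v| / (`|v| + 1)).
    by rewrite mulrCA mulrC ler_wpM2l // ltW.
  have v1 : `|v| / (`|v| + 1) < 1 by rewrite ltr_pdivrMr ?ltr_wpDl // mul1r ltrDl.
  apply: (le_trans (hd _ _ _ _)).
  - by rewrite addrK normrZ (le_lt_trans hv) // gtr_pMr.
  - by rewrite subrr normr0.
  - rewrite addrK normrZ mulrCA ler_wpM2l // -mulrA ler_piMr ?(ltW e0) //.
    by rewrite mulrC ltW.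
split; [exact: cvgP cv | exact: cvg_lim cv].
Unshelve. all: by end_near. Qed.

Lemma sdiff_uniq (E F : normedModType R) (f : E -> F) x L L' :
  sdiff f x L -> sdiff f x L' -> L =1 L'.
Proof.
move=> h1 h2 v; have [_ <-] := sdiff_derive v h1.
by have [_ <-] := sdiff_derive v h2.
Qed.

Lemma sdiff_comp (E F G : normedModType R) (f : E -> F) (g : F -> G) x L M :
  sdiff f x L -> sdiff g (f x) M -> sdiff (g \o f) x (M \o L).
Proof.
move=> hf hg; have [lfD lfB lfZ lf0] := sdiff_lin hf.
have [lgD lgB lgZ lg0] := sdiff_lin hg.
have [K K0 hK] := sdiff_bound hf; have [K' K'0 hK'] := sdiff_bound hg.
split.
- by move=> a u v; rewrite /= lfD lfZ lgD lgZ.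
- exists (K' * K) => v; apply: (le_trans (hK' _)).
  by rewrite -mulrA ler_wpM2l // ltW.
move=> e e0.
have [C C0 [d0 d0p hC]] := sdiff_lipschitz hf.
have e1 : 0 < e / 2 / C by rewrite !divr_gt0.
have e2 : 0 < e / 2 / K' by rewrite !divr_gt0.
have [_ _ /(_ _ e1) [d1 d1p h1]] := hg.
have [_ _ /(_ _ e2) [d2 d2p h2]] := hf.
exists (Num.min d0 (Num.min d2 (d1 / C))).
  by rewrite !lt_min d0p d2p divr_gt0.
move=> y z; rewrite !lt_min => /and3P[a1 a2 a3] /and3P[b1 b2 b3] /=.
have cx : `|x - x| < d0 by rewrite subrr normr0.
have lip w : `|w - x| < d0 -> `|w - x| < d1 / C -> `|f w - f x| < d1.
  by move=> w1 w2; rewrite (le_lt_trans (hC w x w1 cx)) // mulrC -ltr_pdivlMr.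
have := h1 (f y) (f z) (lip y a1 a3) (lip z b1 b3).
have := h2 y z a2 b2 => s2 s1.
have -> : g (f y) - g (f z) - M (L (y - z)) =
  (g (f y) - g (f z) - M (f y - f z)) + M (f y - f z - L (y - z)).
  by rewrite [M (_ - L _)]lgB addrA subrK.
rewrite (le_trans (ler_normD _ _)) // [e](splitr e) mulrDl lerD //.
- apply: (le_trans s1); rewrite mulrAC ler_pdivrMr // -[leRHS]mulrA.
  by rewrite ler_wpM2l ?divr_ge0 ?(ltW e0) // mulrC; apply: hC.
- apply: (le_trans (hK' _)).
  rewrite -(ler_pdivlMl _ _ K'0) mulrA [K'^-1 * _]mulrC.
  exact: s2.
Qed.

Lemma norm_pairE (E F : normedModType R) (x : E * F) :
  `|x| = Num.max `|x.1| `|x.2|.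
Proof. by []. Qed.

Lemma sdiff_pair (E F G : normedModType R) (f : E -> F) (g : E -> G) x L M :
  sdiff f x L -> sdiff g x M ->
  sdiff (fun e => (f e, g e)) x (fun v => (L v, M v)).
Proof.
move=> hf hg; have [lfD lfB lfZ lf0] := sdiff_lin hf.
have [lgD lgB lgZ lg0] := sdiff_lin hg.
have [K K0 hK] := sdiff_bound hf; have [K' K'0 hK'] := sdiff_bound hg.
split.
- by move=> a u v; rewrite lfD lfZ lgD lgZ.
- exists (K + K') => v; rewrite norm_pairE ge_max mulrDl /=.
  apply/andP; split; [apply: (le_trans (hK v))|apply: (le_trans (hK' v))].
    by rewrite lerDl mulr_ge0 // ltW.
  by rewrite lerDr mulr_ge0 // ltW.
move=> e e0; have [_ _ /(_ _ e0) [d1 d1p h1]] := hf.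
have [_ _ /(_ _ e0) [d2 d2p h2]] := hg.
exists (Num.min d1 d2); first by rewrite lt_min d1p d2p.
move=> y z; rewrite !lt_min => /andP[a1 a2] /andP[b1 b2].
by rewrite norm_pairE ge_max /= h1 // h2.
Qed.

Lemma linear_sdiff (E F : normedModType R) (L : E -> F) K x :
  linear L -> (forall v, `|L v| <= K * `|v|) -> sdiff L x L.
Proof.
move=> lL hK; split=> //; first by exists K.
move=> e e0; exists 1 => // y z _ _.
have -> : L (y - z) = L y - L z.
  by rewrite addrC -scaleN1r lL scaleN1r addrC.
by rewrite subrr normr0 mulr_ge0 // ltW.
Qed.

Lemma sdiff_id (E : normedModType R) (x : E) : sdiff id x id.
Proof. by apply: (@linear_sdiff _ _ _ 1) => // v; rewrite mul1r. Qed.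

Lemma sdiff_cst (E F : normedModType R) (c : F) (x : E) :
  sdiff (fun=> c) x (fun=> 0).
Proof.
split.
- by move=> a u v; rewrite scaler0 addr0.
- by exists 0 => v; rewrite normr0 mul0r.
- by move=> e e0; exists 1 => // y z _ _; rewrite !subrr normr0 mulr_ge0 // ltW.
Qed.

Lemma sdiff_add (E F : normedModType R) (f g : E -> F) x L M :
  sdiff f x L -> sdiff g x M ->
  sdiff (fun e => f e + g e) x (fun v => L v + M v).
Proof.
move=> hf hg.
have := sdiff_comp (sdiff_pair hf hg) (g := fun p => p.1 + p.2)
  (M := fun p => p.1 + p.2); apply.
apply: (@linear_sdiff _ _ _ 2).
- by move=> a [u v] [u' v'] /=; rewrite scalerDr addrACA.
- move=> [u v]; rewrite /= mulrDl mul1r (le_trans (ler_normD _ _)) //.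
  by rewrite norm_pairE lerD // le_max lexx ?orbT.
Qed.

Lemma sdiff_scale (E F : normedModType R) (f : E -> R) (g : E -> F) x L M :
  sdiff f x L -> sdiff g x M ->
  sdiff (fun e => f e *: g e) x (fun v => L v *: g x + f x *: M v).
Proof.
move=> hf hg; have [lfD lfB lfZ lf0] := sdiff_lin hf.
have [lgD lgB lgZ lg0] := sdiff_lin hg.
have [K K0 hK] := sdiff_bound hf; have [K' K'0 hK'] := sdiff_bound hg.
split.
- move=> a u v; rewrite lfD lfZ lgD lgZ scalerDl !scalerDr addrACA !scalerA.
  by congr (_ + _ + _); rewrite ?scalerA // mulrC.
- exists (K * `|g x| + `|f x| * K') => v.
  rewrite (le_trans (ler_normD _ _)) // !normrZ mulrDl lerD //.
    by rewrite mulrAC ler_wpM2r.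
  by rewrite -mulrA ler_wpM2l.
have [C C0 [d0 d0p hC]] := sdiff_lipschitz hf.
have [C' C'0 [d0' d0'p hC']] := sdiff_lipschitz hg.
move=> e e0.
pose e1 := e / 4 / (`|g x| + 1); pose e2 := e / 4 / (`|f x| + 1).
have gx1 : 0 < `|g x| + 1 by rewrite ltr_wpDl.
have fx1 : 0 < `|f x| + 1 by rewrite ltr_wpDl.
have e1p : 0 < e1 by rewrite !divr_gt0.
have e2p : 0 < e2 by rewrite !divr_gt0.
have [_ _ /(_ _ e1p) [d1 d1p h1]] := hf.
have [_ _ /(_ _ e2p) [d2 d2p h2]] := hg.
pose d3 := e / 4 / (C * C').
have d3p : 0 < d3 by rewrite !divr_gt0 // mulr_gt0.
exists (Num.min (Num.min d0 d0') (Num.min (Num.min d1 d2) d3)).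
  by rewrite !lt_min d0p d0'p d1p d2p d3p.
move=> y z; rewrite !lt_min => /andP[/andP[a0 a0'] /andP[/andP[a1 a2] a3]].
move=> /andP[/andP[b0 b0'] /andP[/andP[b1 b2] b3]].
(* The error splits into four terms, each allotted a quarter of [e]: two products of increments,
   controlled by the Lipschitz constants and [d3], and the two first-order errors scaled by [g x]
   and [f x]. *)
have -> : f y *: g y - f z *: g z - (L (y - z) *: g x + f x *: M (y - z)) =
  ((f y - f z) *: (g y - g x) + (f y - f z - L (y - z)) *: g x) +
  ((f z - f x) *: (g y - g z) + f x *: (g y - g z - M (y - z))).
  have e3 : (f y - f z) *: (g y - g x) + (f y - f z - L (y - z)) *: g x =
      (f y - f z) *: g y - L (y - z) *: g x.
    by rewrite scalerBr [(_ - L _) *: _]scalerBl addrA subrK.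
  have e4 : (f z - f x) *: (g y - g z) + f x *: (g y - g z - M (y - z)) =
      f z *: (g y - g z) - f x *: M (y - z).
    by rewrite scalerBl [f x *: (_ - M _)]scalerBr addrA subrK.
  by rewrite e3 e4 addrACA -opprD scalerBl scalerBr addrA subrK.
have nx : `|x - x| < d0 by rewrite subrr normr0.
have nx' : `|x - x| < d0' by rewrite subrr normr0.
have e4 : e = (e / 4 + e / 4) + (e / 4 + e / 4) by lra.
rewrite [e in leRHS]e4 !mulrDl.
have q1 : `|(f y - f z) *: (g y - g x)| <= e / 4 * `|y - z|.
  rewrite normrZ (le_trans (ler_pM _ _ (hC y z a0 b0) (hC' y x a0' nx'))) //.
  rewrite mulrACA mulrCA mulrC ler_wpM2r //.
  rewrite mulrC -ler_pdivlMr ?mulr_gt0 //.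
  by rewrite ltW.
have q2 : `|(f y - f z - L (y - z)) *: g x| <= e / 4 * `|y - z|.
  rewrite normrZ (le_trans (ler_wpM2r _ (h1 y z a1 b1))) //.
  rewrite mulrAC ler_wpM2r // /e1 mulrAC ler_pdivrMr // ler_wpM2l ?divr_ge0 ?(ltW e0) //.
  by rewrite lerDl.
have q3 : `|(f z - f x) *: (g y - g z)| <= e / 4 * `|y - z|.
  rewrite normrZ (le_trans (ler_pM _ _ (hC z x b0 nx) (hC' y z a0' b0'))) //.
  rewrite mulrACA mulrA ler_wpM2r // mulrC -ler_pdivlMr ?mulr_gt0 //.
  by rewrite ltW.
have q4 : `|f x *: (g y - g z - M (y - z))| <= e / 4 * `|y - z|.
  rewrite normrZ (le_trans (ler_wpM2l _ (h2 y z a2 b2))) //.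
  rewrite mulrA ler_wpM2r // /e2 mulrC mulrAC ler_pdivrMr // ler_wpM2l ?divr_ge0 ?(ltW e0) //.
  by rewrite lerDl.
rewrite (le_trans (ler_normD _ _)) // lerD // (le_trans (ler_normD _ _)) // lerD //.
Qed.

End StrictDifferentiability.

(** * Strict differentiability of C^1 maps in finite dimension *)

Section FiniteDimensionalCalculus.
Context {R : realType}.

Lemma mx_norm_le m n (x : 'M[R]_(m, n)) (M : R) : 0 <= M ->
  (forall i j, `|x i j| <= M) -> `|x| <= M.
Proof.
move=> M0 h; rewrite /Num.Def.normr /= mx_normrE bigmax_le // => i _.
Qed.

Lemma le_mx_norm m n (x : 'M[R]_(m, n)) i j : `|x i j| <= `|x|.
Proof.
rewrite [leRHS]/Num.Def.normr /= mx_normrE.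
exact: (@le_bigmax _ _ _ 0 (fun p => `|x p.1 p.2|) (i, j)).
Qed.

Lemma real_mvt_le (g : R -> R) (a b w e : R) : a <= b ->
  (forall s, a <= s <= b -> derivable g s 1 /\ `|'D_1 g s - w| <= e) ->
  `|g b - g a - (b - a) * w| <= e * (b - a).
Proof.
move=> ab h.
have [||c /[!in_itv] /= cab ->] := @MVT_segment R g (fun s => 'D_1 g s) a b ab.
- move=> x /[!in_itv] /= /andP[ax xb]; apply/derivableP.
  by have [] := h x; rewrite ?(ltW ax) ?(ltW xb).
- apply: derivable_within_continuous => x /[!in_itv] /= hx.
  by have [] := h x.
- rewrite [_ * (b - a)]mulrC -mulrBr normrM ger0_norm ?subr_ge0 // mulrC.
  by rewrite ler_wpM2r ?subr_ge0 //; have [] := h c.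
Qed.

(** The norm of a row is the maximum of its entries, so the scalar mean value theorem applied
    entrywise loses nothing. The symmetric range of [s] covers both signs of [c]. *)
Lemma mvt_le n (g : R -> 'rV[R]_n) (c : R) (w : 'rV[R]_n) e :
  (forall s, `|s| <= `|c| -> derivable g s 1 /\ `|'D_1 g s - w| <= e) ->
  `|g c - g 0 - c *: w| <= e * `|c|.
Proof.
move=> h; have [_ /(le_trans (normr_ge0 _)) e0] := h 0 ltac:(by rewrite normr0).
apply: mx_norm_le => [|i j]; first by rewrite mulr_ge0.
have hj s : `|s| <= `|c| -> derivable (fun x => g x i j) s 1 /\
     `|'D_1 (fun x => g x i j) s - w i j| <= e.
  move=> /h [d1 d2]; split; first exact: (derivable_mxP _ _ _).1 d1 i j.
  apply: le_trans d2; move: (le_mx_norm ('D_1 g s - w) i j).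
  by rewrite derive_mx // !mxE.
rewrite !mxE; case: (leP 0 c) => c0.
- have := @real_mvt_le (fun x => g x i j) 0 c (w i j) e c0.
  rewrite subr0 (ger0_norm c0); apply => s /andP[s0 sc].
  by apply: hj; rewrite !ger0_norm.
- have -> : g c i j - g 0 i j - c * w i j =
    - (g 0 i j - g c i j - (0 - c) * w i j) by ring.
  rewrite normrN (ltr0_norm c0) -[X in _ <= _ * X]sub0r.
  apply: (@real_mvt_le (fun x => g x i j) c 0 (w i j) e (ltW c0)) => s /andP[sc s0].
  by apply: hj; rewrite !ler0_norm ?lerN2 // ltW.
Qed.

Lemma is_derive_line (E F : normedModType R) (f : E -> F) p b (s : R) :
  derivable f (p + s *: b) b ->
  is_derive s 1 (fun s => f (p + s *: b)) ('D_b f (p + s *: b)).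
Proof.
have eqf : (fun h : R => h^-1 *: (((fun s => f (p + s *: b)) \o shift s) (h *: 1) - f (p + s *: b))) =
   (fun h : R => h^-1 *: ((f \o shift (p + s *: b)) (h *: b) - f (p + s *: b))).
  apply/funext => h /=; congr (_ *: (f _ - _)).
  by rewrite scalerDl [h *: 1]mulr1 addrCA.
move=> df; split; first by rewrite /derivable eqf.
by rewrite /derive eqf.
Qed.

(** Multiplication in charts lives on a product of row spaces, which is not itself a row space; this
    interface treats both alike. The two unit bounds replace any comparison of norms. *)
Record coords (E : normedModType R) (m : nat) := Coords {
  cbas : 'I_m -> E;
  ccoef : 'I_m -> E -> R;
  ccoefE : forall v, v = \sum_i ccoef i v *: cbas i;
  ccoef_lin : forall i a u v, ccoef i (a *: u + v) = a * ccoef i u + ccoef i v;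
  ccoef_le : forall i v, `|ccoef i v| <= `|v|;
  cbas_le : forall i, `|cbas i| <= 1 }.

Definition rV_coords n : coords 'rV[R]_n n.
Proof.
refine (@Coords 'rV[R]_n n (fun i => delta_mx 0 i) (fun i v => v 0 i) _ _ _ _).
- by move=> v; rewrite {1}[v]row_sum_delta.
- by move=> i a u v; rewrite !mxE.
- by move=> i v; exact: le_mx_norm.
- move=> i; apply: mx_norm_le => // k l; rewrite !mxE.
  by case: eqP; case: eqP => /=; rewrite ?normr1 ?normr0.
Defined.

Definition pair_coords E F m n (c : coords E m) (d : coords F n) :
  coords (E * F)%type (m + n).
Proof.
refine (@Coords (E * F)%type (m + n)
  (fun k => match fintype.split k with inl i => (cbas c i, 0) | inr j => (0, cbas d j) end)
  (fun k v => match fintype.split k with inl i => ccoef c i v.1 | inr j => ccoef d j v.2 end)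
  _ _ _ _).
- move=> [v w]; rewrite big_split_ord /=.
  under eq_bigr do rewrite (unsplitK (inl _)).
  under [X in _ + X]eq_bigr do rewrite (unsplitK (inr _)).
  rewrite [in LHS](ccoefE c v) [in LHS](ccoefE d w).
  have s1 (r : 'I_m -> R) : \sum_i r i *: (cbas c i, 0 : F) = (\sum_i r i *: cbas c i, 0).
    apply: (big_rec2 (fun x y => x = (y, 0))) => // i x y _ ->.
    by rewrite [LHS]surjective_pairing /= scaler0 addr0.
  have s2 (r : 'I_n -> R) : \sum_i r i *: (0 : E, cbas d i) = (0, \sum_i r i *: cbas d i).
    apply: (big_rec2 (fun x y => x = (0, y))) => // i x y _ ->.
    by rewrite [LHS]surjective_pairing /= scaler0 addr0.
  by rewrite s1 s2 [RHS]surjective_pairing /= addr0 add0r.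
- by move=> k a [u u'] [v v'] /=; case: fintype.split => i; rewrite ccoef_lin.
- move=> k v; rewrite norm_pairE; case: fintype.split => i.
    by rewrite le_max ccoef_le.
  by rewrite le_max ccoef_le orbT.
- move=> k; case: fintype.split => i; rewrite norm_pairE /= normr0 ge_max cbas_le ler01 //.
Defined.

(** The total differential assembled from partial derivatives, because ['D_v f] is not known to be
    linear in [v] before strict differentiability is proved. *)
Definition jac (E : normedModType R) m (c : coords E m) n (f : E -> 'rV[R]_n)
  (x v : E) := \sum_i ccoef c i v *: 'D_(cbas c i) f x.

Lemma jac_linear (E : normedModType R) m (c : coords E m) n (f : E -> 'rV[R]_n) x :
  linear (jac c f x).
Proof.
move=> a u v; rewrite /jac scaler_sumr -big_split /=; apply: eq_bigr => i _.
by rewrite ccoef_lin scalerDl scalerA.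
Qed.

(** Walk from [z] to [y] along the coordinate directions and apply the mean value estimate to each
    of the [m] legs. With [v = y - z] of norm below twice [r / (2m + 3)], a point of the path is at
    distance at most [(1 + 2 (m + 1)) r / (2m + 3) = r] from [x], which explains the denominator. *)
Lemma path_estimate (E : normedModType R) m (c : coords E m) n (f : E -> 'rV[R]_n)
    x r e : 
  (forall i p, `|p - x| < r -> derivable f p (cbas c i) /\
     `|'D_(cbas c i) f p - 'D_(cbas c i) f x| <= e) ->
  forall y z, `|y - x| < r / (m + m + 3)%:R -> `|z - x| < r / (m + m + 3)%:R ->
  `|f y - f z - jac c f x (y - z)| <= m%:R * e * `|y - z|.
Proof.
move=> h y z hy hz; set v := y - z.
have r0 : 0 < r.
  have : 0 < r / (m + m + 3)%:R by exact: le_lt_trans (normr_ge0 _) hy.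
  by rewrite pmulr_lgt0 // invr_gt0 ltr0n addnS.
pose P (k : nat) := \sum_(i < m | (i < k)%N) ccoef c i v *: cbas c i.
have P0 : P 0%N = 0 by rewrite /P big_pred0.
have Pm : P m = v.
  by rewrite /P [v in RHS](ccoefE c); apply: eq_bigl => i; rewrite ltn_ord.
have PS (i : 'I_m) : P i.+1 = P i + ccoef c i v *: cbas c i.
  rewrite /P (bigD1 i) //= addrC; congr (_ + _); apply: eq_bigl => j.
  by rewrite ltnS leq_eqVlt -val_eqE /=; case: ltngtP.
have Pn k : `|P k| <= m%:R * `|v|.
  rewrite (le_trans (ler_norm_sum _ _ _)) //.
  rewrite (@le_trans _ _ (\sum_(i < m) `|v|)) //; last first.
    by rewrite sumr_const card_ord mulr_natl.
  rewrite [leRHS](bigID (fun i : 'I_m => (i < k)%N)) /= ler_wpDr ?sumr_ge0 //.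
  apply: ler_sum => i _; rewrite normrZ (le_trans (ler_pM _ _ (ccoef_le c i v) (cbas_le c i))) //.
  by rewrite mulr1.
have vn : `|v| < 2 * (r / (m + m + 3)%:R).
  have -> : v = (y - x) - (z - x) by rewrite opprB addrA subrK.
  by rewrite (le_lt_trans (ler_normB _ _)) // mulr_natl mulr2n ltrD.
have close (i : 'I_m) s : `|s| <= `|ccoef c i v| -> `|z + P i + s *: cbas c i - x| < r.
  move=> hs.
  have -> : z + P i + s *: cbas c i - x = (z - x) + (P i + s *: cbas c i).
    by rewrite -!addrA; congr (_ + _); rewrite [RHS]addrC -addrA.
  rewrite (le_lt_trans (ler_normD _ _)) //.
  apply: (@lt_le_trans _ _ (r / (m + m + 3)%:R + (m%:R + 1) * (2 * (r / (m + m + 3)%:R)))).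
    apply: ltr_leD => //; apply: (le_trans (ler_normD _ _)).
    apply: (@le_trans _ _ ((m%:R + 1) * `|v|)); last by rewrite ler_wpM2l // ltW.
    rewrite mulrDl lerD // mul1r normrZ.
    by rewrite (le_trans (ler_pM _ _ (le_trans hs (ccoef_le c i v)) (cbas_le c i))) // mulr1.
  have q0 : ((m + m + 3)%:R : R) != 0 by rewrite pnatr_eq0 addnS.
  rewrite le_eqVlt; apply/orP; left; apply/eqP.
  by rewrite !natrD in q0 *; field.
have tele : f y - f z = \sum_(i < m) (f (z + P i.+1) - f (z + P i)).
  rewrite -(big_mkord xpredT (fun i => f (z + P i.+1) - f (z + P i))).
  by rewrite telescope_sumr // P0 Pm addr0 /v [z + (_ - _)]addrC subrK.
rewrite tele /jac -sumrB (le_trans (ler_norm_sum _ _ _)) //.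
have -> : m%:R * e * `|v| = \sum_(i < m) e * `|v|.
  by rewrite sumr_const card_ord -mulrA mulr_natl.
apply: ler_sum => i _; rewrite PS addrA.
have := @mvt_le n (fun s => f (z + P i + s *: cbas c i)) (ccoef c i v) ('D_(cbas c i) f x) e.
rewrite scale0r addr0 => H.
have e0 : 0 <= e.
  have [_] := h i x ltac:(by rewrite subrr normr0).
  by rewrite subrr normr0.
apply: le_trans (H _) _; last by rewrite ler_wpM2l // ccoef_le.
move=> s /close hs; have [d1 d2] := h i _ hs.
have [d3 d4] := is_derive_line d1.
by rewrite d4.
Qed.

Lemma jac_bound (E : normedModType R) m (c : coords E m) n (f : E -> 'rV[R]_n) x :
  exists K, forall v, `|jac c f x v| <= K * `|v|.
Proof.
exists (\sum_i `|'D_(cbas c i) f x|) => v.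
rewrite (le_trans (ler_norm_sum _ _ _)) // mulr_suml; apply: ler_sum => i _.
by rewrite normrZ mulrC ler_wpM2l // ccoef_le.
Qed.

Lemma finite_min m (P : 'I_m -> R -> Prop) :
  (forall i d d', d' <= d -> P i d -> P i d') ->
  (forall i, exists2 d, 0 < d & P i d) -> exists2 d, 0 < d & forall i, P i d.
Proof.
move=> mono h; pose d i := sval (cid2 (h i)).
have dp i : 0 < d i by rewrite /d; case: cid2.
have dP i : P i (d i) by rewrite /d; case: cid2.
exists (\big[Num.min/1]_i d i).
  by elim/big_ind: _ => // x y x0 y0; rewrite lt_min x0.
by move=> i; apply: (mono _ (d i)) => //; rewrite (bigD1 i) //= ge_min lexx.
Qed.

(** Continuity of the partial derivatives at [x] bounds their oscillation on a ball, which is all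
    that [path_estimate] asks for; the division by [m + 1] absorbs the [m] legs of the path. *)
Lemma Ck1_sdiff (E : normedModType R) m (c : coords E m) n (f : E -> 'rV[R]_n)
    (A : set E) x : Ck_on 1 A f -> nbhs x A -> sdiff f x (jac c f x).
Proof.
move=> [_ h] Ax; split; [exact: jac_linear|exact: jac_bound|move=> e e0].
have /nbhs_norm_lt [d0 d0p hA] := Ax.
have m1 : 0 < (m%:R + 1 : R) by rewrite ltr_wpDl.
have [d dp hd] : exists2 d, 0 < d & forall i : 'I_m, forall p, `|p - x| < d ->
    `|'D_(cbas c i) f p - 'D_(cbas c i) f x| <= e / (m%:R + 1).
  apply: (finite_min (P := fun i d => forall p, `|p - x| < d ->
    `|'D_(cbas c i) f p - 'D_(cbas c i) f x| <= e / (m%:R + 1))).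
    by move=> i d d' dd' H p /lt_le_trans - /(_ _ dd') /H.
  move=> i; have [_ [cD _]] := h (cbas c i).
  have em : 0 < e / (m%:R + 1) by rewrite divr_gt0.
  have /cvgrPdist_le /(_ _ em) hc := cD x (nbhs_singleton Ax).
  have [d dp hd] := (nbhs_norm_lt x _).1 hc.
  exists d; first exact: dp.
  move=> p pd; have hp := hd p pd.
  by rewrite -normrN opprB.
exists (Num.min d0 d / (m + m + 3)%:R).
  by rewrite divr_gt0 ?lt_min ?d0p // ltr0n addnS.
move=> y z hy hz.
apply: (@le_trans _ _ (m%:R * (e / (m%:R + 1)) * `|y - z|)).
  apply: path_estimate hy hz => i p; rewrite lt_min => /andP[/hA hp /hd hp'].
  by split => //; have [/(_ p hp)] := h (cbas c i).
rewrite ler_wpM2r // mulrC -mulrA ler_piMr ?(ltW e0) //.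
by rewrite mulrC ler_pdivrMr // mul1r lerDl.
Qed.

(* For a C^2 map the error in [sdiff] is quadratic: the dyadic construction of
   the exponential needs this rate. *)
Lemma Ck2_estimate (E : normedModType R) m (c : coords E m) n (f : E -> 'rV[R]_n)
    (A : set E) x : Ck_on 2 A f -> nbhs x A ->
  exists2 C, 0 < C & exists2 d, 0 < d & forall r y z, r <= d ->
    `|y - x| < r -> `|z - x| < r ->
    `|f y - f z - jac c f x (y - z)| <= C * r * `|y - z|.
Proof.
move=> [_ h] Ax.
have /nbhs_norm_lt [d0 d0p hA] := Ax.
have hi (i : 'I_m) : exists K, exists2 d, 0 < d & forall p, `|p - x| < d ->
    `|'D_(cbas c i) f p - 'D_(cbas c i) f x| <= K * `|p - x|.
  have [_ hc] := h (cbas c i).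
  have /sdiff_lipschitz [K K0 [d dp hd]] := Ck1_sdiff c hc Ax.
  exists K, d => // p hp; apply: hd => //; by rewrite subrr normr0.
pose K i := sval (cid (hi i)).
have [d dp hd] : exists2 d, 0 < d & forall i : 'I_m, forall p, `|p - x| < d ->
    `|'D_(cbas c i) f p - 'D_(cbas c i) f x| <= K i * `|p - x|.
  apply: (finite_min (P := fun i d => forall p, `|p - x| < d ->
    `|'D_(cbas c i) f p - 'D_(cbas c i) f x| <= K i * `|p - x|)).
    by move=> i d d' dd' H p /lt_le_trans - /(_ _ dd') /H.
  by move=> i; rewrite /K; case: cid.
pose KK := \sum_i `|K i|.
have KK0 : 0 <= KK by rewrite sumr_ge0.
pose N : R := (m + m + 3)%:R.
have N0 : 0 < N by rewrite ltr0n addnS.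
exists (m%:R * (KK * N) + 1); first by rewrite ltr_wpDl // mulr_ge0 // mulr_ge0 // ltW.
exists (Num.min d0 d / N); first by rewrite divr_gt0 ?lt_min ?d0p.
move=> r y z hr hy hz.
have r0 : 0 < r by exact: le_lt_trans (normr_ge0 _) hy.
apply: (@le_trans _ _ (m%:R * (KK * (N * r)) * `|y - z|)); last first.
  by rewrite ler_wpM2r // mulrDl mul1r !mulrA lerDl ltW.
apply: (@path_estimate _ _ _ _ _ x (N * r)); last 2 first.
- by rewrite mulrAC divff ?mul1r // gt_eqF.
- by rewrite mulrAC divff ?mul1r // gt_eqF.
move=> i p hp.
have : `|p - x| < Num.min d0 d.
  by rewrite (lt_le_trans hp) // mulrC -ler_pdivlMr.
rewrite lt_min => /andP[/hA pA /hd hp']; split.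
  by have [/(_ p pA)] := h (cbas c i).
rewrite (le_trans (hp' i)) // (le_trans (ler_wpM2r _ (ler_norm _))) //.
rewrite ler_pM // ?(ltW hp) // /KK (bigD1 i) //= lerDl sumr_ge0 //.
Qed.

End FiniteDimensionalCalculus.

(** * Newton iteration and dyadic limits *)

Section Iteration.
Context {R : realType} {n : nat}.
Notation V := 'rV[R]_n.

Lemma real_geometric_limit (u : nat -> R) (A q : R) : 0 <= A -> 0 <= q < 1 ->
  (forall k, `|u k.+1 - u k| <= A * q ^+ k) ->
  exists l, forall e, 0 < e -> exists N, forall k, (N <= k)%N -> `|u k - l| <= e.
Proof.
move=> A0 /andP[q0 q1] hu.
have cs : cvgn [normed series (telescope u)].
  apply: (@series_le_cvg _ _ (geometric A q)).
  - by move=> k; exact: normr_ge0.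
  - by move=> k; rewrite /= mulr_ge0 // exprn_ge0.
  - by move=> k; exact: hu.
  - by apply: is_cvg_geometric_series; rewrite ger0_norm.
have cu : cvgn u.
  have -> : u = (fun k => u 0%N + series (telescope u) k).
    by apply/funext => k; exact: eq_sum_telescope.
  have cs' : series (telescope u) @ \oo --> limn (series (telescope u)) by exact: (@normed_cvg R R^o) cs.
  apply/cvg_ex; exists (u 0%N + limn (series (telescope u))).
  by apply: cvgD; [exact: cvg_cst|exact: cs'].
exists (limn u) => e e0.
have /cvgrPdist_le /(_ _ e0) [N _ hN] : u @ \oo --> limn u by exact: cu.
by exists N => k Nk; rewrite -normrN opprB; apply: hN.
Qed.

Lemma geometric_limit (u : nat -> V) (A q : R) : 0 <= A -> 0 <= q < 1 ->
  (forall k, `|u k.+1 - u k| <= A * q ^+ k) ->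
  exists l, forall e, 0 < e -> exists N, forall k, (N <= k)%N -> `|u k - l| <= e.
Proof.
move=> A0 q1 hu.
have hi (i : 'I_n) : exists l, forall e, 0 < e ->
    exists N, forall k, (N <= k)%N -> `|u k 0 i - l| <= e.
  apply: (real_geometric_limit A0 q1) => k; apply: le_trans (hu k).
  by have := le_mx_norm (u k.+1 - u k) 0 i; rewrite !mxE.
exists (\row_i sval (cid (hi i))) => e e0.
have hN i := cid (svalP (cid (hi i)) e e0).
exists (\max_i sval (hN i)) => k hk; apply: mx_norm_le => [|j i]; first exact: ltW.
rewrite !mxE !ord1; apply: (svalP (hN i)).
by apply: leq_trans hk; apply: leq_bigmax.
Qed.

Lemma norm_le_limit (x : V) (M : R) :
  (forall e, 0 < e -> `|x| <= M + e) -> `|x| <= M.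
Proof. by move=> h; apply/ler_addgt0Pr. Qed.

Lemma norm_eq0_limit (x : V) (K : R) : 0 < K ->
  (forall e, 0 < e -> `|x| <= K * e) -> x = 0.
Proof.
move=> K0 h; apply/eqP; rewrite -normr_le0; apply/ler_addgt0Pr => e e0.
by rewrite add0r (le_trans (h (e / K) _)) ?divr_gt0 // mulrC divfK // gt_eqF.
Qed.

(* Surjectivity half of the inverse function theorem, by Newton iteration with
   the fixed right inverse [M] of the differential. *)
Lemma sdiff_surj (E : normedModType R) (f : E -> V) x L (M : V -> E) :
  sdiff f x L -> linear M -> (exists K, forall v, `|M v| <= K * `|v|) ->
  (forall w, L (M w) = w) -> forall r, 0 < r ->
  exists2 d, 0 < d & forall w, `|w - f x| < d -> exists2 e, `|e - x| < r & f e = w.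
Proof.
move=> hf lM [K hK] LM r r0.
have sM : sdiff M 0 M by exact: linear_sdiff lM hK.
have M0 : M 0 = 0 by have [] := sdiff_lin sM.
have sMx : sdiff (fun w => x + M w) 0 (fun w => 0 + M w).
  by apply: sdiff_add sM; exact: sdiff_cst.
(* Precomposition with the right inverse turns the differential into the identity, so that the
   iteration runs in [V] whatever the source [E] is. *)
pose F w := f (x + M w).
have sF : sdiff F 0 (fun w => w).
  have := @sdiff_comp _ _ _ _ (fun w => x + M w) f 0 (fun w => 0 + M w) L sMx.
  rewrite M0 addr0 => /(_ hf) [h1 h2 h3]; split.
  - by move=> a u v.
  - by exists 1 => v; rewrite mul1r.
  - by move=> e /h3 [d d0 hd]; exists d => // y z hy hz; have := hd y z hy hz; rewrite /= add0r LM.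
have K1 : 0 < `|K| + 1 by rewrite ltr_wpDl.
have [_ _ /(_ 2^-1 ltac:(by rewrite invr_gt0)) [d0 d0p hd0]] := sF.
pose rho := Num.min d0 (r / (`|K| + 1)).
have rho0 : 0 < rho by rewrite lt_min d0p divr_gt0.
have hF y z : `|y| < rho -> `|z| < rho -> `|F y - F z - (y - z)| <= 2^-1 * `|y - z|.
  rewrite !lt_min => /andP[h1 _] /andP[h2 _]; by apply: hd0; rewrite subr0.
exists (rho / 4); first by rewrite divr_gt0.
move=> w hw.
pose u := fix u k := if k is k'.+1 then u k' + (w - F (u k')) else 0.
have uS k : u k.+1 - u k = w - F (u k) by rewrite /= addrC addKr.
have half k : (2^-1 : R) ^+ k.+1 = 2^-1 * 2^-1 ^+ k by rewrite exprS.
have hpos k : 0 < (2^-1 : R) ^+ k by rewrite exprn_gt0 // invr_gt0.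
(* The increments halve, starting below [rho / 4], so all iterates stay within [rho / 2] and the
   contraction estimate [hF] keeps applying. *)
have main k : `|u k| <= 2 * (rho / 4) * (1 - 2^-1 ^+ k) /\
              `|u k.+1 - u k| <= rho / 4 * 2^-1 ^+ k.
  elim: k => [|k [h1 h2]].
    rewrite uS /= normr0 expr0 subrr mulr0 lexx mulr1; split=> //.
    by rewrite /F M0 addr0 ltW.
  have b1 : `|u k| < rho.
    by rewrite (le_lt_trans h1) //; have := hpos k; nra.
  have h3 : `|u k.+1| <= 2 * (rho / 4) * (1 - 2^-1 ^+ k.+1).
    rewrite -[u k.+1](subrK (u k)) (le_trans (ler_normD _ _)) // half.
    by move: h1 h2; set a := `|_|; set b := `|_|; set c := _ ^+ k; lra.
  split=> //.
  have b2 : `|u k.+1| < rho.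
    by rewrite (le_lt_trans h3) //; have := hpos k.+1; nra.
  rewrite uS.
  have -> : w - F (u k.+1) = - (F (u k.+1) - F (u k) - (u k.+1 - u k)).
    by rewrite uS opprB opprB addrA subrK.
  rewrite normrN (le_trans (hF _ _ b2 b1)) // half mulrCA.
  by rewrite ler_wpM2l // invr_ge0.
have A1 : 0 <= rho / 4 by rewrite divr_ge0 // ltW.
have A2 : 0 <= (2^-1 : R) < 1 by rewrite invr_ge0 ler0n invf_lt1 // ltr1n.
have [l hl] := geometric_limit A1 A2 (fun k => (main k).2).
have ul : `|l| <= 2 * (rho / 4).
  apply: norm_le_limit => e e0; have [N hN] := hl e e0.
  rewrite -[l](subrK (u N)) addrC; apply: (le_trans (ler_normD _ _)); apply: lerD.
    rewrite (le_trans (main N).1) // ler_piMr ?mulr_ge0 // ?divr_ge0 ?ltW //.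
  by rewrite -normrN opprB hN.
have lrho : `|l| < rho by rewrite (le_lt_trans ul) //; lra.
have Fl : F l = w.
  apply/eqP; rewrite -subr_eq0; apply/eqP.
  apply: (@norm_eq0_limit _ 3) => // e e0; have [N hN] := hl e e0.
  have [N' hN'] : exists N', forall k, (N' <= k)%N -> `|u k.+1 - u k| <= e.
    have e2 : 0 < e / 2 by rewrite divr_gt0.
    have [N' hN'] := hl _ e2; exists N' => k hk.
    have -> : u k.+1 - u k = (u k.+1 - l) - (u k - l) by rewrite opprB addrA subrK.
    rewrite (le_trans (ler_normB _ _)) // [e]splitr lerD // hN' //.
    by rewrite (leq_trans hk).
  pose k := maxn N N'.
  have h1 := hN k (leq_maxl _ _); have h2 := hN' k (leq_maxr _ _).
  have uk : `|u k| < rho.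
    by rewrite (le_lt_trans (main k).1) //; have := hpos k; nra.
  have h3 := hF l (u k) lrho uk.
  have -> : F l - w = (F l - F (u k) - (l - u k)) + ((l - u k) - (u k.+1 - u k)).
    by rewrite uS; apply/rowP => i; rewrite !mxE; ring.
  rewrite (le_trans (ler_normD _ _)) //.
  have h4 : `|l - u k| <= e by rewrite -normrN opprB.
  have h5 := ler_normB (l - u k) (u k.+1 - u k).
  by lra.
exists (x + M l) => //.
rewrite addrC addKr (le_lt_trans (hK l)) //.
rewrite (@le_lt_trans _ _ ((`|K| + 1) * `|l|)) //.
  by rewrite ler_wpM2r // (le_trans (ler_norm K)) // lerDl.
move: lrho; rewrite lt_min => /andP[_ h]; by rewrite mulrC -ltr_pdivlMr.
Qed.

(* [s] is the squaring map of a Lie group in a chart centered at 1, and [E] its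
   exponential: the limit of the iterates s^k (x / 2^k). *)
Lemma dyadic_exp (s : V -> V) (C r0 : R) : 0 < C -> 0 < r0 -> s 0 = 0 ->
  (forall r y z, r <= r0 -> `|y| <= r -> `|z| <= r ->
     `|s y - s z - 2 *: (y - z)| <= C * r * `|y - z|) ->
  exists (E : V -> V) (r1 : R), [/\ 0 < r1 <= r0, E 0 = 0,
    (forall r y z, r <= r1 -> `|y| <= r -> `|z| <= r ->
     `|E y - E z - (y - z)| <= 2 * C * r * `|y - z|),
    (forall x, `|x| <= r1 -> `|E x| <= 2 * `|x|) &
    (forall x, `|x| <= r1 -> s (E (2^-1 *: x)) = E x)].
Proof.
move=> C0 r00 s0 hs.
pose r1 := Num.min r0 (2 * C)^-1.
have r1r0 : r1 <= r0 by rewrite ge_min lexx.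
have C20 : 0 < 2 * C by rewrite mulr_gt0.
have r1p : 0 < r1 by rewrite lt_min r00 invr_gt0.
have Cr1 : C * r1 <= 2^-1.
  have : r1 <= (2 * C)^-1 by rewrite ge_min lexx orbT.
  by rewrite -(ler_pM2l C0) invfM mulrCA divff ?mulr1 // gt_eqF.
pose E := fix E k (x : V) := if k is k'.+1 then s (E k' (2^-1 *: x)) else x.
have nh (x : V) : `|2^-1 *: x| = 2^-1 * `|x| by rewrite normrZ ger0_norm // invr_ge0.
have E0 k : E k 0 = 0 by elim: k => //= k IH; rewrite scaler0 IH s0.
(* The constant reproduces itself: the new squaring contributes [C r], and twice the previous error,
   taken at radius [r / 2] on a halved difference, contributes another [C r]. *)
have P k r y z : r <= r1 -> `|y| <= r -> `|z| <= r ->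
     `|E k y - E k z - (y - z)| <= 2 * C * r * `|y - z|.
  elim: k r y z => [|k IH] r y z hr hy hz.
    rewrite /= subrr normr0 mulr_ge0 // mulr_ge0 ?(ltW C20) //.
    exact: le_trans hy.
  have r_ge0 : 0 <= r by exact: le_trans hy.
  have lip y' z' : `|y'| <= r -> `|z'| <= r ->
      `|E k (2^-1 *: y') - E k (2^-1 *: z')| <= `|y' - z'|.
    move=> h1 h2.
    have := IH (2^-1 * r) (2^-1 *: y') (2^-1 *: z') _ _ _.
    rewrite !nh -scalerBr nh !ler_pM2l ?invr_gt0 // => /(_ _ h1 h2) H.
    have {H}h3 := H ltac:(lra).
    rewrite -[X in `|X|](subrK (2^-1 *: (y' - z'))) (le_trans (ler_normD _ _)) //.
    rewrite nh.
    have : C * r <= 2^-1 by rewrite (le_trans _ Cr1) // ler_wpM2l // ltW.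
    by have := normr_ge0 (y' - z'); nra.
  have bd y' : `|y'| <= r -> `|E k (2^-1 *: y')| <= r.
    move=> h; have := lip y' 0 h; rewrite scaler0 E0 !subr0 normr0 => /(_ r_ge0) h'.
    exact: le_trans h.
  rewrite /=.
  set a := E k (2^-1 *: y); set b := E k (2^-1 *: z).
  have h1 := hs r a b (le_trans hr r1r0) (bd y hy) (bd z hz).
  have -> : s a - s b - (y - z) = (s a - s b - 2 *: (a - b)) + 2 *: (a - b - (2^-1 *: y - 2^-1 *: z)).
    rewrite -scalerBr [2 *: (_ - _ *: _)]scalerBr scalerA divff // scale1r.
    by rewrite addrA subrK.
  have h2 : `|a - b - (2^-1 *: y - 2^-1 *: z)| <= 2 * C * (2^-1 * r) * `|2^-1 *: y - 2^-1 *: z|.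
    by apply: IH; rewrite ?nh ?ler_pM2l ?invr_gt0 //; lra.
  have h3 := lip y z hy hz.
  rewrite -scalerBr nh in h2.
  rewrite (le_trans (ler_normD _ _)) // [X in _ + X]normrZ normr_nat.
  have h4 : C * r * `|a - b| <= C * r * `|y - z|.
    by rewrite ler_wpM2l // mulr_ge0 // ltW.
  rewrite -scalerBr.
  by move: h1 h2 h4; set X := `|_|; set Y := `|_|; set Z := `|_|; set W := `|_|; nra.
have n2 k x : `|x| <= r1 -> `|E k x| <= 2 * `|x|.
  move=> hx.
  have := P k `|x| x 0 hx (lexx _) ltac:(by rewrite normr0).
  rewrite E0 !subr0 => h; rewrite -[E k x](subrK x) (le_trans (ler_normD _ _)) //.
  have : C * `|x| <= 2^-1 by rewrite (le_trans _ Cr1) // ler_wpM2l // ltW.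
  by have := normr_ge0 x; nra.
have slip r y z : r <= r1 -> `|y| <= r -> `|z| <= r -> `|s y - s z| <= 5 / 2 * `|y - z|.
  move=> hr hy hz.
  have := hs r y z (le_trans hr r1r0) hy hz => h.
  rewrite -[s y - s z](subrK (2 *: (y - z))) (le_trans (ler_normD _ _)) //.
  rewrite [X in _ + X]normrZ normr_nat.
  have : C * r <= 2^-1 by rewrite (le_trans _ Cr1) // ler_wpM2l // ltW.
  by have := normr_ge0 (y - z); nra.
have bE k x : `|x| <= r1 -> `|E k (2^-1 *: x)| <= `|x|.
  move=> hx; rewrite (le_trans (n2 k _ _)) ?nh ?mulrA ?divff ?mul1r //.
  by have := normr_ge0 x; lra.
(* The rate is the Lipschitz constant [5 / 2] of [s] times the factor [1 / 4] that halving the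
   argument produces in the quadratic bound. *)
have D k x : `|x| <= r1 -> `|E k.+1 x - E k x| <= C * `|x| ^+ 2 * (5 / 8) ^+ k.
  elim: k x => [|k IH] x hx.
    rewrite expr0 mulr1 /=.
    have := hs `|x| (2^-1 *: x) 0 (le_trans hx r1r0).
    rewrite nh normr0 normr_ge0 s0 !subr0 scalerA divff // scale1r nh => h.
    apply: (le_trans (h _ isT)); first by have := normr_ge0 x; lra.
    by rewrite expr2 [C * (_ * _)]mulrA ler_wpM2l ?mulr_ge0 ?(ltW C0) //; have := normr_ge0 x; lra.
  have h2 : `|2^-1 *: x| <= r1 by rewrite nh; have := normr_ge0 x; lra.
  have := IH _ h2; rewrite nh => h.
  have h3 := slip `|x| (E k.+1 (2^-1 *: x)) (E k (2^-1 *: x)) hx (bE _ _ hx) (bE _ _ hx).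
  apply: (le_trans h3).
  apply: (@le_trans _ _ (5 / 2 * (C * (2^-1 * `|x|) ^+ 2 * (5 / 8) ^+ k))).
    by rewrite ler_wpM2l.
  rewrite [(5 / 8) ^+ k.+1]exprS; set X := `|x|; set Y := (5 / 8) ^+ k.
  by rewrite le_eqVlt; apply/orP; left; apply/eqP; field.
have lim x : exists l, `|x| <= r1 ->
   forall e, 0 < e -> exists N, forall k, (N <= k)%N -> `|E k x - l| <= e.
  case: (leP `|x| r1) => hx; last by exists 0.
  have A1 : 0 <= C * `|x| ^+ 2 by rewrite mulr_ge0 ?exprn_ge0 // ltW.
  have A2 : 0 <= (5 / 8 : R) < 1 by lra.
  have [l hl] := geometric_limit (u := fun k => E k x) A1 A2 (fun k => D k x hx).
  by exists l.
pose F x := sval (cid (lim x)).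
have hF x : `|x| <= r1 ->
   forall e, 0 < e -> exists N, forall k, (N <= k)%N -> `|E k x - F x| <= e.
  by rewrite /F; case: cid.
exists F, r1; split; first by rewrite r1p.
- apply: (@norm_eq0_limit _ 1) => // e e0.
  have [|N hN] := hF 0 _ e e0; first by rewrite normr0 ltW.
  by have := hN N (leqnn _); rewrite E0 sub0r normrN mul1r.
- move=> r y z hr hy hz; apply: norm_le_limit => e e0.
  have e2 : 0 < e / 2 by rewrite divr_gt0.
  have [N1 h1] := hF y (le_trans hy hr) _ e2.
  have [N2 h2] := hF z (le_trans hz hr) _ e2.
  have {}h1 := h1 (maxn N1 N2) (leq_maxl _ _).
  have {}h2 := h2 (maxn N1 N2) (leq_maxr _ _).
  have h3 := P (maxn N1 N2) r y z hr hy hz.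
  move: h1 h2 h3; set a := E _ y; set b := E _ z => h1 h2 h3.
  have -> : F y - F z - (y - z) = (a - b - (y - z)) + ((b - F z) - (a - F y)).
    by apply/rowP => i; rewrite !mxE; ring.
  rewrite (le_trans (ler_normD _ _)) // lerD // (le_trans (ler_normB _ _)) //.
  by rewrite [e]splitr lerD.
- move=> x hx; apply: norm_le_limit => e e0; have [N hN] := hF x hx e e0.
  rewrite -[F x](subrK (E N x)) addrC (le_trans (ler_normD _ _)) // lerD ?n2 //.
  by rewrite -normrN opprB hN.
- move=> x hx; apply/eqP; rewrite -subr_eq0; apply/eqP.
  apply: (@norm_eq0_limit _ 4) => // e e0.
  have h2 : `|2^-1 *: x| <= r1 by rewrite nh; have := normr_ge0 x; lra.
  have [N1 h1] := hF x hx _ e0; have [N2 h2'] := hF _ h2 _ e0.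
  pose k := maxn N1 N2.
  have {}h1 := h1 k.+1 (leq_trans (leq_maxl _ _) (leqnSn _)).
  have {}h2' := h2' k (leq_maxr _ _).
  have bF : `|F (2^-1 *: x)| <= `|x|.
    apply: norm_le_limit => e' e'0; have [N hN] := hF _ h2 e' e'0.
    rewrite -[F _](subrK (E N (2^-1 *: x))) addrC (le_trans (ler_normD _ _)) // lerD ?bE //.
    by rewrite -normrN opprB hN.
  have h3 := slip `|x| (F (2^-1 *: x)) (E k (2^-1 *: x)) hx bF (bE k x hx).
  have -> : s (F (2^-1 *: x)) - F x = (s (F (2^-1 *: x)) - s (E k (2^-1 *: x))) + (E k.+1 x - F x).
    by rewrite /= addrA subrK.
  rewrite (le_trans (ler_normD _ _)) //.
  have : `|F (2^-1 *: x) - E k (2^-1 *: x)| <= e by rewrite -normrN opprB.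
  by lra.
Qed.

(** Going back [k] halvings multiplies the difference of two solutions by about [2 ^ k], while
    first-order agreement makes it [o(2 ^ -k)] there. *)
Lemma dyadic_uniq (s : V -> V) (C r0 K t0 : R) (F1 F2 : R -> V) :
  0 < C -> 0 < r0 -> 0 < K -> 0 < t0 ->
  (forall r y z, r <= r0 -> `|y| <= r -> `|z| <= r ->
     `|s y - s z - 2 *: (y - z)| <= C * r * `|y - z|) ->
  (forall t, `|t| <= t0 -> [/\ `|F1 t| <= K * `|t|, `|F2 t| <= K * `|t|,
     s (F1 (2^-1 * t)) = F1 t & s (F2 (2^-1 * t)) = F2 t]) ->
  (forall e, 0 < e -> exists2 d, 0 < d & forall t, `|t| <= d -> `|F1 t - F2 t| <= e * `|t|) ->
  exists2 t1, 0 < t1 & forall t, `|t| <= t1 -> F1 t = F2 t.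
Proof.
move=> C0 r00 K0 t00 hs hF hd.
pose c := C * K.
have c0 : 0 < c by rewrite mulr_gt0.
pose t1 := Num.min t0 (Num.min (r0 / K) (2 * c)^-1).
have t1p : 0 < t1 by rewrite !lt_min t00 divr_gt0 // invr_gt0 mulr_gt0.
exists t1 => // t ht.
have nt (k : nat) (u : R) : `|2^-1 ^+ k * u| = 2^-1 ^+ k * `|u|.
  by rewrite normrM ger0_norm // exprn_ge0 // invr_ge0.
have step (u : R) : `|u| <= t1 -> `|F1 u - F2 u| <= 2 * (1 + c * `|u|) * `|F1 (2^-1 * u) - F2 (2^-1 * u)|.
  rewrite !le_min => /and3P[hu1 hu2 _].
  have nu : `|2^-1 * u| = 2^-1 * `|u| by rewrite normrM ger0_norm // invr_ge0.
  have hu3 : `|2^-1 * u| <= t0 by rewrite nu; have := normr_ge0 u; lra.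
  have [_ _ <- <-] := hF u hu1.
  have [a1 a2 _ _] := hF _ hu3.
  have := hs (K * `|u|) (F1 (2^-1 * u)) (F2 (2^-1 * u)).
  have l1 : K * `|2^-1 * u| <= K * `|u|.
    by rewrite ler_wpM2l ?(ltW K0) // nu; have := normr_ge0 u; lra.
  rewrite (le_trans a1) // (le_trans a2) // mulrC -ler_pdivlMr // => /(_ hu2 isT isT).
  set X := F1 _; set Y := F2 _ => h.
  rewrite -[_ - _](subrK (2 *: (X - Y))) (le_trans (ler_normD _ _)) //.
  rewrite [X in _ + X]normrZ normr_nat.
  rewrite mulrDr mulr1 mulrDl addrC lerD // (le_trans h) //.
  rewrite /c -!mulrA [`|u| * (K * _)]mulrCA.
  set Z := C * (K * _); have : 0 <= Z by rewrite !mulr_ge0 // ltW.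
  by lra.
(* The constant [4 c] closes the induction because [(1 + z) (1 + 2 z) <= 1 + 4 z] for
   [0 <= z <= 1/2], and [t1] keeps [c |u|] in this range. *)
have iter k (u : R) : `|u| <= t1 ->
    `|F1 u - F2 u| <= 2 ^+ k * (1 + 4 * c * `|u|) * `|F1 (2^-1 ^+ k * u) - F2 (2^-1 ^+ k * u)|.
  elim: k u => [|k IH] u hu.
    rewrite !expr0 !mul1r ler_peMl // lerDl !mulr_ge0 // ltW //.
  have hu2 : `|2^-1 * u| <= t1.
    by rewrite normrM ger0_norm ?invr_ge0 //; have := normr_ge0 u; lra.
  have := IH _ hu2.
  rewrite mulrA -exprSr => h.
  apply: (le_trans (step u hu)).
  set D := `|F1 (2^-1 ^+ k.+1 * u) - _| in h *.
  apply: (@le_trans _ _ (2 * (1 + c * `|u|) * (2 ^+ k * (1 + 4 * c * `|2^-1 * u|) * D))).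
    by rewrite ler_wpM2l // mulr_ge0 // addr_ge0 // mulr_ge0 // ltW.
  rewrite normrM ger0_norm ?invr_ge0 // exprS.
  have -> : 2 * (1 + c * `|u|) * (2 ^+ k * (1 + 4 * c * (2^-1 * `|u|)) * D) =
     (2 * 2 ^+ k * D) * ((1 + c * `|u|) * (1 + 2 * (c * `|u|))) by field.
  have -> : 2 * 2 ^+ k * (1 + 4 * c * `|u|) * D = (2 * 2 ^+ k * D) * (1 + 4 * (c * `|u|)) by ring.
  have hc : c * `|u| <= 2^-1.
    move: hu; rewrite !le_min => /and3P[_ _ hu].
    by move: hu; rewrite -(ler_pM2l c0) invfM mulrCA divff ?mulr1 // gt_eqF.
  have hc0 : 0 <= c * `|u| by rewrite mulr_ge0 // ltW.
  rewrite ler_wpM2l ?mulr_ge0 ?exprn_ge0 ?/D ?normr_ge0 //.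
  by move: hc hc0; set z := c * _; nra.
have hc : c * `|t| <= 2^-1.
  move: (ht); rewrite !le_min => /and3P[_ _ hu].
  by move: hu; rewrite -(ler_pM2l c0) invfM mulrCA divff ?mulr1 // gt_eqF.
apply/eqP; rewrite -subr_eq0; apply/eqP.
apply: (@norm_eq0_limit _ (3 * (`|t| + 1))).
  by rewrite mulr_gt0 // ltr_wpDl.
move=> e e0; have [d d0 hd'] := hd e e0.
have [k hk] : exists k, 2^-1 ^+ k * `|t| <= d.
  have t1' : 0 < `|t| + 1 by rewrite ltr_wpDl.
  have := @cvg_expr R 2^-1.
  rewrite ger0_norm ?invr_ge0 // invf_lt1 // ltr1n => /(_ isT) /cvgrPdist_le.
  move=> /(_ (d / (`|t| + 1)) ltac:(by rewrite divr_gt0)) [k _ hk].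
  exists k; have := hk k (leqnn _) => /=; rewrite sub0r normrN.
  rewrite ger0_norm ?exprn_ge0 ?invr_ge0 // ler_pdivlMr // => h.
  rewrite (le_trans _ h) // ler_wpM2l ?exprn_ge0 ?invr_ge0 //.
  by rewrite lerDl.
have h1 := iter k t ht.
have h2 := hd' (2^-1 ^+ k * t) ltac:(by rewrite nt).
apply: (le_trans h1); rewrite nt in h2.
apply: (@le_trans _ _ (2 ^+ k * (1 + 4 * c * `|t|) * (e * (2^-1 ^+ k * `|t|)))).
  by rewrite ler_wpM2l // mulr_ge0 ?exprn_ge0 // addr_ge0 // !mulr_ge0 // ltW.
rewrite exprVn.
have p2 : (2 ^+ k : R) != 0 by rewrite expf_neq0.
have -> : 2 ^+ k * (1 + 4 * c * `|t|) * (e * ((2 ^+ k)^-1 * `|t|)) =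
  (1 + 4 * (c * `|t|)) * (e * `|t|) by field.
apply: (@le_trans _ _ (3 * (e * `|t|))).
  by rewrite ler_wpM2r ?mulr_ge0 // ?(ltW e0) //; lra.
by rewrite -mulrA ler_wpM2l // mulrC ler_wpM2r // ?(ltW e0) // lerDl.
Qed.

End Iteration.

(** * The exponential and the adjoint representation of a Lie group *)

Section Curves.
Context {R : realType}.

(** Differentiability of a curve as an error estimate, the form that composes directly with
    [sdiff]. *)
Definition cdiff (F : normedModType R) (c : R -> F) (t : R) (X : F) :=
  forall e, 0 < e -> exists2 d, 0 < d &
    forall s, `|s - t| < d -> `|c s - c t - (s - t) *: X| <= e * `|s - t|.

Lemma is_derive_cdiff (F : normedModType R) (c : R -> F) (t : R) (X : F) :
  is_derive t 1 c X -> cdiff c t X.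
Proof.
move=> [dc eX] e e0; move: dc; rewrite /derivable => /cvg_ex [l hl].
have lX : l = X by rewrite -eX /derive; symmetry; apply: cvg_lim.
move/cvgrPdist_le/(_ _ e0) : hl => [d /= d0 hd]; exists d => // s hs.
have [->|st] := eqVneq s t; first by rewrite !subrr scale0r subr0 !normr0 mulr0.
have st0 : s - t != 0 by rewrite subr_eq0.
have := hd (s - t); rewrite /= sub0r normrN => /(_ hs st0).
rewrite [(s - t) *: 1]mulr1 subrK lX => h.
have -> : c s - c t - (s - t) *: X = - ((s - t) *: (X - (s - t)^-1 *: (c s - c t))).
  by rewrite scalerBr scalerA divff // scale1r opprB.
by rewrite normrN normrZ mulrC ler_wpM2r.
Qed.

Lemma cdiff_is_derive (F : normedModType R) (c : R -> F) (t : R) (X : F) :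
  cdiff c t X -> is_derive t 1 c X.
Proof.
move=> h.
have cv : u^-1 *: (c (u *: 1 + t) - c t) @[u --> (0:R)^'] --> X.
  apply/cvgrPdist_le => e e0; have [d d0 hd] := h e e0.
  near=> u.
  have u0 : u != 0 by near: u; exact: nbhs_dnbhs_neq.
  have ud : `|u| < d by near: u; exact: dnbhs0_lt.
  rewrite -normrN opprB.
  have -> : u^-1 *: (c (u *: 1 + t) - c t) - X = u^-1 *: (c (u *: 1 + t) - c t - u *: X).
    by rewrite [in RHS]scalerBr scalerA mulVf // scale1r.
  rewrite normrZ normfV ler_pdivrMl ?normr_gt0 //.
  have := hd (u *: 1 + t); rewrite [u *: 1]mulr1 addrK => /(_ ud).
  by rewrite mulrC.
split; [exact: cvgP cv | exact: cvg_lim cv].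
Unshelve. all: by end_near. Qed.

Lemma cdiff_lipschitz (F : normedModType R) (c : R -> F) (t : R) (X : F) : cdiff c t X ->
  exists2 K, 0 < K & exists2 d, 0 < d &
   forall s, `|s - t| < d -> `|c s - c t| <= K * `|s - t|.
Proof.
move=> /(_ 1 ltr01) [d d0 hd]; exists (1 + `|X|); first by rewrite ltr_pwDl.
exists d => // s /hd h; rewrite -[c s - c t](subrK ((s - t) *: X)).
by rewrite (le_trans (ler_normD _ _)) // mulrDl normrZ [`|X| * _]mulrC lerD.
Qed.

Lemma cdiff_comp (E F : normedModType R) (c : R -> E) (f : E -> F) (t : R) (X : E) L :
  cdiff c t X -> sdiff f (c t) L -> cdiff (f \o c) t (L X).
Proof.
move=> hc hf e e0; have [lD lB lZ l0] := sdiff_lin hf.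
have [K K0 hK] := sdiff_bound hf.
have [C C0 [d0 d0p hC]] := cdiff_lipschitz hc.
have e1 : 0 < e / 2 / C by rewrite !divr_gt0.
have e2 : 0 < e / 2 / K by rewrite !divr_gt0.
have [_ _ /(_ _ e1) [d1 d1p h1]] := hf.
have [d2 d2p h2] := hc _ e2.
exists (Num.min d0 (Num.min d2 (d1 / C))).
  by rewrite !lt_min d0p d2p divr_gt0.
move=> s; rewrite !lt_min => /and3P[a1 a2 a3] /=.
have lip : `|c s - c t| < d1.
  by rewrite (le_lt_trans (hC s a1)) // mulrC -ltr_pdivlMr.
have := h1 (c s) (c t) lip; rewrite subrr normr0 => /(_ d1p) s1.
have s2 := h2 s a2.
have -> : f (c s) - f (c t) - (s - t) *: L X =
  (f (c s) - f (c t) - L (c s - c t)) + L (c s - c t - (s - t) *: X).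
  by rewrite [L (_ - _ *: _)]lB lZ addrA subrK.
rewrite (le_trans (ler_normD _ _)) // [e](splitr e) mulrDl lerD //.
- apply: (le_trans s1); rewrite mulrAC ler_pdivrMr // -[leRHS]mulrA.
  by rewrite ler_wpM2l ?divr_ge0 ?(ltW e0) // mulrC; apply: hC.
- apply: (le_trans (hK _)); rewrite -(ler_pdivlMl _ _ K0) mulrA [K^-1 * _]mulrC.
  exact: s2.
Qed.

Lemma cdiff_uniq (F : normedModType R) (c : R -> F) (t : R) (X Y : F) :
  cdiff c t X -> cdiff c t Y -> X = Y.
Proof. by move=> /cdiff_is_derive[_ <-] /cdiff_is_derive[_ <-]. Qed.

Lemma sdiff_sum (E F : normedModType R) m (f : 'I_m -> E -> F) x
    (L : 'I_m -> E -> F) : (forall i, sdiff (f i) x (L i)) ->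
  sdiff (fun e => \sum_i f i e) x (fun v => \sum_i L i v).
Proof.
elim: m f L => [|m IH] f L h.
  have -> : (fun e => \sum_(i < 0) f i e) = (fun=> 0).
    by apply/funext => e; rewrite big_ord0.
  have -> : (fun e => \sum_(i < 0) L i e) = (fun=> 0).
    by apply/funext => e; rewrite big_ord0.
  exact: sdiff_cst.
have -> : (fun e => \sum_(i < m.+1) f i e) = (fun e => f ord0 e + \sum_(i < m) f (lift ord0 i) e).
  by apply/funext => e; rewrite big_ord_recl.
have -> : (fun e => \sum_(i < m.+1) L i e) = (fun e => L ord0 e + \sum_(i < m) L (lift ord0 i) e).
  by apply/funext => e; rewrite big_ord_recl.
by apply: sdiff_add; [exact: h|exact: IH].
Qed.

End Curves.

(** * The group operations in charts *)

Section Charts.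
Context {R : realType} {n : nat} (G : lieGroupType R n).
Notation V := 'rV[R]_n.
Notation phi a := (chart_map (@chart_at R n G a)).
Notation psi a := (chart_inv (@chart_at R n G a)).
Notation dom a := (chart_dom (@chart_at R n G a)).
Notation e0 := (chart_map (@chart_at R n G 1%g) 1%g).
Notation cc := (pair_coords (rV_coords (R := R) n) (rV_coords n)).

Lemma chart_near a (x : G) (O : set G) : dom a x -> nbhs x O ->
  \forall e \near phi a x, [/\ dom a (psi a e), O (psi a e) & phi a (psi a e) = e].
Proof.
have [h1 h2 h3 h4 h5] := @chart_atP R n G a.
move=> dx Ox.
have n1 : nbhs (phi a x) (phi a @` dom a) by apply: open_nbhs_nbhs; split=> //; exists x.
have n2 : \forall e \near phi a x, O (psi a e).
  by have /= := h5 x dx; apply; rewrite h3.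
near=> e.
have [y dy ye] : (phi a @` dom a) e by near: e.
have Oe : O (psi a e) by near: e.
by split=> //; rewrite -ye h3.
Unshelve. all: by end_near. Qed.

Lemma psi_cont a x : dom a x -> psi a @ phi a x --> x.
Proof.
have [h1 h2 h3 h4 h5] := @chart_atP R n G a.
by move=> dx; have hx := h5 x dx; rewrite -[X in _ --> X](h3 x dx).
Qed.

Lemma phi_cont a x : dom a x -> {for x, continuous (phi a)}.
Proof. by have [h1 h2 h3 h4 h5] := @chart_atP R n G a; exact: h4. Qed.

Lemma phiK a x : dom a x -> psi a (phi a x) = x.
Proof. by have [h1 h2 h3 h4 h5] := @chart_atP R n G a; exact: h3. Qed.

Lemma dom_nbhs a x : dom a x -> nbhs x (dom a).
Proof.
have [h1 h2 h3 h4 h5] := @chart_atP R n G a.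
by move=> dx; apply: open_nbhs_nbhs.
Qed.

Lemma dom_center (a : G) : dom a a. Proof. exact: chart_at_dom. Qed.

Lemma mul_near (g h : G) (O : set G) : nbhs (g * h)%g O ->
  \forall p \near (g, h), O (p.1 * p.2)%g.
Proof. by move=> hO; exact: (@mulg_continuous R n G (g, h) O hO). Qed.

Lemma inv_near (g : G) (O : set G) : nbhs (g^-1)%g O ->
  \forall p \near g, O (p^-1)%g.
Proof. by move=> hO; exact: (@invg_continuous R n G g O hO). Qed.

(** The smoothness axiom speaks of the image of a part of a chart domain; continuity of
    multiplication and of the inverse charts makes this image a neighbourhood. *)
Lemma mul_smooth x y z (g h : G) : dom x g -> dom y h -> dom z (g * h)%g ->
  exists2 A, nbhs (phi x g, phi y h) A &
   forall k, Ck_on k A (fun p : V * V => phi z (psi x p.1 * psi y p.2)%g).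
Proof.
move=> dg dh dz.
exists (chart_map (prod_chart (@chart_at R n G x) (@chart_at R n G y)) @`
  (chart_dom (prod_chart (@chart_at R n G x) (@chart_at R n G y)) `&`
   (fun p : G * G => p.1 * p.2)%g @^-1` dom z)); last first.
  by move=> k; exact: (@mulg_smooth R n G x y z k).
have : \forall p \near (phi x g, phi y h), dom z (psi x p.1 * psi y p.2)%g.
  have [[A B] [/= nA nB] AB] := mul_near (dom_nbhs dz).
  have hx := psi_cont dg nA; have hy := psi_cont dh nB.
  by exists (psi x @^-1` A, psi y @^-1` B) => // -[u v] [/= hu hv]; apply: (AB (_, _)).
have hx := chart_near dg (@filterT _ _ (nbhs_filter g)).
have hy := chart_near dh (@filterT _ _ (nbhs_filter h)).
have : \forall p \near (phi x g, phi y h),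
   (dom x (psi x p.1) /\ phi x (psi x p.1) = p.1) /\
   (dom y (psi y p.2) /\ phi y (psi y p.2) = p.2).
  exists ([set e | dom x (psi x e) /\ phi x (psi x e) = e],
          [set e | dom y (psi y e) /\ phi y (psi y e) = e]) => //=.
  by split; [apply: filterS hx => e [] | apply: filterS hy => e []].
apply: filterS2 => -[u v] [/= [d1 e1] [d2 e2]] dz'.
by exists (psi x u, psi y v) => //=; rewrite e1 e2.
Qed.

Lemma inv_smooth x z (g : G) : dom x g -> dom z (g^-1)%g ->
  exists2 A, nbhs (phi x g) A &
   forall k, Ck_on k A (fun e : V => phi z ((psi x e)^-1)%g).
Proof.
move=> dg dz.
exists (phi x @` (dom x `&` (fun p : G => p^-1)%g @^-1` dom z)); last first.
  by move=> k; exact: (@invg_smooth R n G x z k).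
have := chart_near dg (inv_near (dom_nbhs dz)).
by apply: filterS => e [d1 d2 d3]; exists (psi x e).
Qed.

Lemma mul_sdiff x y z (g h : G) : dom x g -> dom y h -> dom z (g * h)%g ->
  exists L, sdiff (fun p : V * V => phi z (psi x p.1 * psi y p.2)%g)
     (phi x g, phi y h) L.
Proof.
move=> dg dh dz; have [A nA hA] := mul_smooth dg dh dz.
by exists (jac cc (fun p : V * V => phi z (psi x p.1 * psi y p.2)%g) (phi x g, phi y h)); exact: Ck1_sdiff (hA 1%N) nA.
Qed.

(** The intermediate product [g x] need not lie in the chart at 1, so the conjugation passes through
    the chart at [g] and returns after multiplication by [g^-1]. *)
Lemma conj_sdiff (g : G) :
  exists L, sdiff (fun e => phi 1%g (g * psi 1%g e * g^-1)%g) e0 L.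
Proof.
have d1 := dom_center 1%g; have dg := dom_center g; have dv := dom_center (g^-1)%g.
have dg1 : dom g (g * 1)%g by rewrite mulg1.
have d1g : dom 1%g (g * g^-1)%g by rewrite mulgV.
have [L1 h1] := mul_sdiff dg d1 dg1; have [L2 h2] := mul_sdiff dg dv d1g.
have k1 := sdiff_comp (sdiff_pair (sdiff_cst (phi g g) e0) (sdiff_id e0)) h1.
eexists; apply: (@sdiff_near _ _ _ ((fun p : V * V => phi 1%g (psi g p.1 * psi g^-1%g p.2)%g) \o
   (fun e => (phi g (psi g (phi g g) * psi 1%g e)%g, phi g^-1%g g^-1%g)))); last first.
  apply: sdiff_comp; first exact: sdiff_pair k1 (sdiff_cst _ _).
  by rewrite /= !phiK // mulg1; exact: h2.
have : \forall e \near e0, dom g (g * psi 1%g e)%g.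
  have := mul_near (dom_nbhs dg1); rewrite /= => -[[A B] [/= nA nB] AB].
  have hB : \forall e \near e0, B (psi 1%g e) := psi_cont d1 nB.
  move: hB; apply: filterS => e he.
  by apply: (AB (_, _)); split => //=; exact: nbhs_singleton.
apply: filterS => e he /=.
by rewrite !phiK.
Qed.

Notation mu := (fun p : V * V => phi 1%g (psi 1%g p.1 * psi 1%g p.2)%g).
Notation iot := (fun e : V => phi 1%g ((psi 1%g e)^-1)%g).

Lemma psi_e0 : psi 1%g e0 = 1%g. Proof. by rewrite phiK //; exact: dom_center. Qed.

Lemma near_psi (O : set G) : nbhs 1%g O ->
  \forall e \near e0, [/\ dom 1%g (psi 1%g e), O (psi 1%g e) & phi 1%g (psi 1%g e) = e].
Proof. exact: chart_near (dom_center 1%g). Qed.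

Lemma nbhs1V (O : set G) : nbhs 1%g O -> nbhs (1^-1)%g O.
Proof. by rewrite invg1. Qed.

Lemma nbhs1M (O : set G) : nbhs 1%g O -> nbhs (1 * 1)%g O.
Proof. by rewrite mulg1. Qed.

Lemma mu_Ck : exists2 A, nbhs (e0, e0) A & forall k, Ck_on k A mu.
Proof.
by apply: mul_smooth; rewrite ?mulg1; exact: dom_center.
Qed.

Lemma iot_sdiff : exists L, sdiff iot e0 L.
Proof.
have [|A nA hA] := @inv_smooth 1%g 1%g 1%g (dom_center _).
  by rewrite invg1; exact: dom_center.
exists (jac (rV_coords n) iot e0); exact: Ck1_sdiff (hA 1%N) nA.
Qed.

Lemma mu0r : \forall e \near e0, mu (e, e0) = e.
Proof.
have := near_psi (@filterT _ _ (nbhs_filter _)); apply: filterS => e [_ _ h] /=.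
by rewrite psi_e0 mulg1.
Qed.

Lemma mu0l : \forall e \near e0, mu (e0, e) = e.
Proof.
have := near_psi (@filterT _ _ (nbhs_filter _)); apply: filterS => e [_ _ h] /=.
by rewrite psi_e0 mul1g.
Qed.

(** A linear map on a product is determined by its restrictions to both factors, and there the unit
    laws make [mu] the identity. *)
Lemma mu_sdiff : sdiff mu (e0, e0) (fun p => p.1 + p.2).
Proof.
have [A nA hA] := mu_Ck.
have h := Ck1_sdiff cc (hA 1%N) nA; set L := jac _ _ _ in h.
suff -> : (fun p => p.1 + p.2) = L by [].
have [lD _ _ _] := sdiff_lin h.
apply/funext => -[u v] /=.
have -> : (u, v) = (u, 0) + (0, v) :> V * V by rewrite [RHS]surjective_pairing /= addr0 add0r.
rewrite lD; congr (_ + _).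
- have h1 := sdiff_comp (sdiff_pair (sdiff_id e0) (sdiff_cst e0 e0)) h.
  have h2 := sdiff_near mu0r h1.
  exact: (sdiff_uniq (sdiff_id e0) h2 u).
- have h1 := sdiff_comp (sdiff_pair (sdiff_cst e0 e0) (sdiff_id e0)) h.
  have h2 := sdiff_near mu0l h1.
  exact: (sdiff_uniq (sdiff_id e0) h2 v).
Qed.

(** Differentiate the constant map [mu (e, iot e) = e0]. *)
Lemma iot_sdiffN : sdiff iot e0 (fun v => - v).
Proof.
have [L hL] := iot_sdiff.
suff -> : (fun v => - v) = L by [].
apply/funext => v.
have ie : iot e0 = e0 by rewrite /= psi_e0 invg1.
have h1 : sdiff (fun e => mu (e, iot e)) e0 (fun v => v + L v).
  have := sdiff_comp (sdiff_pair (sdiff_id e0) hL); rewrite /= psi_e0 invg1.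
  by move=> /(_ _ _ _ mu_sdiff).
have h2 : \forall e \near e0, mu (e, iot e) = e0.
  have := near_psi (inv_near (nbhs1V (dom_nbhs (dom_center 1%g)))).
  by apply: filterS => e [d1 d2 d3] /=; rewrite phiK // mulgV.
have := sdiff_uniq (sdiff_near h2 h1) (sdiff_cst e0 e0) v.
by rewrite addrC => /eqP; rewrite addr_eq0 => /eqP ->.
Qed.

(** Factoring conjugation through the chart at 1 writes [Ad] with first partial derivatives of [mu]
    at points that move with [e]. Second derivatives of [mu] then make [Ad] differentiable in the
    group variable, which the bracket needs. *)
Lemma Ad_chart (Y : V) : \forall e \near e0,
  Ad (psi 1%g e) Y = jac cc mu (e, iot e) (jac cc mu (e, e0) (0, Y), 0).
Proof.
have [A nA hA] := mu_Ck.
have [L hL] := iot_sdiff.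
have ie : iot e0 = e0 by rewrite /= psi_e0 invg1.
have n1 : \forall e \near e0, nbhs (e, e0) A.
  have c1 : (fun e : V => (e, e0)) @ e0 --> (e0, e0).
    exact: (sdiff_cont (sdiff_pair (sdiff_id e0) (sdiff_cst e0 e0))).
  exact: (c1 _ (nbhs_interior nA)).
have n2 : \forall e \near e0, nbhs (e, iot e) A.
  have c1 : (fun e : V => (e, iot e)) @ e0 --> (e0, e0).
    have c2 : (fun e : V => (e, iot e)) @ e0 --> (e0, iot e0).
      exact: (sdiff_cont (sdiff_pair (sdiff_id e0) hL)).
    by move: c2; rewrite ie.
  exact: (c1 _ (nbhs_interior nA)).
have n3 := near_psi (inv_near (nbhs1V (dom_nbhs (dom_center 1%g)))).
move: n1 n2 n3; apply: filterS3 => e n1 n2 [d1 d2 d3].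
have m1 : mu (e, e0) = e by rewrite /= psi_e0 mulg1.
have s1 : sdiff mu (e, e0) (jac cc mu (e, e0)).
  exact: Ck1_sdiff (hA 1%N) n1.
have s2 : sdiff mu (e, iot e) (jac cc mu (e, iot e)).
  exact: Ck1_sdiff (hA 1%N) n2.
have k1 := sdiff_comp (sdiff_pair (sdiff_cst e e0) (sdiff_id e0)) s1.
have k2 : sdiff (mu \o (fun f => (mu (e, f), iot e))) e0
   (jac cc mu (e, iot e) \o (fun v => (jac cc mu (e, e0) (0, v), 0))).
  apply: (sdiff_comp (sdiff_pair k1 (sdiff_cst (iot e) e0))).
  have -> : (mu (e, e0), iot e) = (e, iot e) by congr pair.
  exact: s2.
have k3 : sdiff (fun f => phi 1%g (psi 1%g e * psi 1%g f * (psi 1%g e)^-1)%g) e0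
   (jac cc mu (e, iot e) \o (fun v => (jac cc mu (e, e0) (0, v), 0))).
  apply: sdiff_near k2.
  have : \forall f \near e0, dom 1%g (psi 1%g e * psi 1%g f)%g.
    have hO : nbhs (psi 1 e * 1)%g (dom 1%g) by rewrite mulg1; exact: dom_nbhs.
    have [[B1 B2] [/= nB1 nB2] AB] := mul_near hO.
    have hB : \forall e \near e0, B2 (psi 1%g e) := psi_cont (dom_center 1%g) nB2.
    move: hB; apply: filterS => f hf.
    by apply: (AB (_, _)); split => //=; exact: nbhs_singleton.
  by apply: filterS => f hf /=; rewrite !phiK.
have [_ E] := sdiff_derive Y k3; exact: E.
Qed.

Lemma Ad_sdiff (Y : V) : exists L, sdiff (fun e => Ad (psi 1%g e) Y) e0 L.
Proof.
have [A nA hA] := mu_Ck.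
have [L hL] := iot_sdiff.
have ie : iot e0 = e0 by rewrite /= psi_e0 invg1.
have sD (v : V * V) : exists M, sdiff ('D_v mu) (e0, e0) M.
  have [_ /(_ v) [_ hk]] := hA 2%N.
  by exists (jac cc ('D_v mu) (e0, e0)); exact: Ck1_sdiff hk nA.
have sJ1 (w : V * V) : exists M, sdiff (fun e => jac cc mu (e, e0) w) e0 M.
  have hk k : exists M, sdiff (fun e => ccoef cc k w *: 'D_(cbas cc k) mu (e, e0)) e0 M.
    have [M hM] := sD (cbas cc k).
    have := sdiff_comp (sdiff_pair (sdiff_id e0) (sdiff_cst e0 e0)) hM.
    by move=> h; have := sdiff_scale (sdiff_cst (ccoef cc k w) e0) h; eexists; eassumption.
  exists (fun v => \sum_k sval (cid (hk k)) v).
  by apply: sdiff_sum => k; exact: svalP (cid (hk k)).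
have [M hM] := sJ1 (0, Y).
pose W e := jac cc mu (e, e0) (0, Y).
have hk k : exists M, sdiff (fun e => ccoef cc k (W e, 0) *: 'D_(cbas cc k) mu (e, iot e)) e0 M.
  have [M1 hM1] := sD (cbas cc k).
  have h1 : sdiff ('D_(cbas cc k) mu \o (fun e => (e, iot e))) e0 (M1 \o (fun v => (v, L v))).
    by apply: sdiff_comp (sdiff_pair (sdiff_id e0) hL) _; rewrite ie.
  have h2 := sdiff_pair hM (sdiff_cst (0 : V) e0).
  have h3 : sdiff (ccoef cc k) (W e0, 0 : V) (ccoef cc k).
    apply: (@linear_sdiff _ _ _ _ 1).
      by move=> a u v; rewrite ccoef_lin.
    by move=> v; rewrite mul1r ccoef_le.
  by eexists; exact: sdiff_scale (sdiff_comp h2 h3) h1.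
exists (fun v => \sum_k sval (cid (hk k)) v).
apply: (@sdiff_near _ _ _ (fun e => \sum_k (ccoef cc k (W e, 0) *: 'D_(cbas cc k) mu (e, iot e)))).
  by have := Ad_chart Y; apply: filterS => e ->.
by apply: sdiff_sum => k; exact: svalP (cid (hk k)).
Qed.

End Charts.

(** * The adjoint representation and tangents of curves *)

Section AdjointRepresentation.
Context {R : realType} {n : nat} {G : lieGroupType R n}.
Notation V := 'rV[R]_n.
Notation phi a := (chart_map (@chart_at R n G a)).
Notation psi a := (chart_inv (@chart_at R n G a)).
Notation dom a := (chart_dom (@chart_at R n G a)).
Notation e0 := (chart_map (@chart_at R n G 1%g) 1%g).
Implicit Types (g h : G) (X Y : V).

Lemma cont_near (S T : topologicalType) (f : S -> T) (x : S) (P : set T) :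
  {for x, continuous f} -> nbhs (f x) P -> nbhs x [set y | P (f y)].
Proof. by move=> cf nP; exact: (cf P nP). Qed.

Lemma Ad_conj g : sdiff (fun e => phi 1%g (g * psi 1%g e * g^-1)%g) e0 (Ad g).
Proof.
have [L hL] := conj_sdiff g.
suff -> : Ad g = L by [].
by apply/funext => X; have [_ E] := sdiff_derive X hL.
Qed.

Lemma Ad_lin g : [/\ forall v w, Ad g (v + w) = Ad g v + Ad g w,
   forall v w, Ad g (v - w) = Ad g v - Ad g w,
   forall a v, Ad g (a *: v) = a *: Ad g v & Ad g 0 = 0].
Proof. exact: sdiff_lin (Ad_conj g). Qed.

Lemma near_conj g (O : set G) : nbhs 1%g O ->
  \forall x \near (1%g : G), O (g * x * g^-1)%g.
Proof.
move=> hO.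
have h1 : nbhs (g * 1 * g^-1)%g O by rewrite mulg1 mulgV.
have [[A B] [/= nA nB] AB] := mul_near h1.
have [[A' B'] [/= nA' nB'] AB'] := mul_near nA.
apply: filterS nB' => x hx; apply: (AB (_, _)); split => /=.
  by apply: (AB' (_, _)); split => //=; exact: nbhs_singleton.
exact: nbhs_singleton.
Qed.

Lemma Ad1 X : Ad (1%g : G) X = X.
Proof.
have h : \forall e \near e0, phi 1%g (1 * psi 1%g e * (1 : G)^-1)%g = e.
  have := near_psi (@filterT _ _ (nbhs_filter (1%g : G))).
  by apply: filterS => e [_ _ h]; rewrite mul1g invg1 mulg1.
exact: (sdiff_uniq (sdiff_near h (Ad_conj 1%g)) (sdiff_id e0) X).
Qed.

Lemma AdM g h X : Ad (g * h)%g X = Ad g (Ad h X).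
Proof.
have ie : phi 1%g (h * psi 1%g e0 * h^-1)%g = e0.
  by rewrite psi_e0 mulg1 mulgV.
have h1 : sdiff ((fun e => phi 1%g (g * psi 1%g e * g^-1)%g) \o
   (fun e => phi 1%g (h * psi 1%g e * h^-1)%g)) e0 (Ad g \o Ad h).
  by apply: (sdiff_comp (Ad_conj h)); rewrite ie; exact: Ad_conj.
have h2 : \forall e \near e0, ((fun e => phi 1%g (g * psi 1%g e * g^-1)%g) \o
   (fun e => phi 1%g (h * psi 1%g e * h^-1)%g)) e = phi 1%g (g * h * psi 1%g e * (g * h)^-1)%g.
  have := near_psi (near_conj h (dom_nbhs (dom_center 1%g))).
  by apply: filterS => e [_ d _] /=; rewrite phiK // invgM !mulgA.
exact: (sdiff_uniq (Ad_conj (g * h)%g) (sdiff_near h2 h1) X).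
Qed.

Lemma AdVK g X : Ad (g^-1)%g (Ad g X) = X.
Proof. by rewrite -AdM mulVg Ad1. Qed.

Lemma AdKV g X : Ad g (Ad (g^-1)%g X) = X.
Proof. by rewrite -AdM mulgV Ad1. Qed.

Lemma lbr_sdiff Y : sdiff (fun e => Ad (psi 1%g e) Y) e0 (fun X => lbr G X Y).
Proof.
have [L hL] := Ad_sdiff G Y.
suff -> : (fun X => lbr G X Y) = L by [].
by apply/funext => X; have [_ E] := sdiff_derive X hL.
Qed.

Lemma cont_mull g : continuous (fun x : G => (g * x)%g).
Proof.
move=> x A hA; have [[B C] [/= nB nC] BC] := mul_near hA.
by apply: filterS nC => y hy; apply: (BC (_, _)); split => //=; exact: nbhs_singleton.
Qed.

Lemma cont_mulr g : continuous (fun x : G => (x * g)%g).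
Proof.
move=> x A hA; have [[B C] [/= nB nC] BC] := mul_near hA.
by apply: filterS nB => y hy; apply: (BC (_, _)); split => //=; exact: nbhs_singleton.
Qed.

Lemma cont_mul (T : topologicalType) (f g : T -> G) : continuous f -> continuous g ->
  continuous (fun x => f x * g x)%g.
Proof.
move=> cf cg x A hA; have [[B C] [/= nB nC] BC] := mul_near hA.
have h1 : \forall y \near x, B (f y) := cf x _ nB.
have h2 : \forall y \near x, C (g y) := cg x _ nC.
suff h : \forall y \near x, A (f y * g y)%g by exact: h.
by move: h1 h2; apply: filterS2 => y hy1 hy2; apply: (BC (_, _)).
Qed.

Lemma Ad_cont1 Y : {for (1%g : G), continuous (fun x : G => Ad x Y)}.
Proof.
have c1 := sdiff_cont (lbr_sdiff Y).
have c2 := phi_cont (dom_center (1%g : G)).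
move=> A /=; rewrite Ad1 => hA.
have h1 : \forall e \near e0, A (Ad (psi 1%g e) Y).
  by have := c1 A; rewrite /= psi_e0 Ad1; apply.
have h2 : \forall x \near (1%g : G), A (Ad (psi 1%g (phi 1%g x)) Y) := c2 _ h1.
have h3 := dom_nbhs (dom_center (1%g : G)).
suff h : \forall x \near (1%g : G), A (Ad x Y) by exact: h.
by move: h2 h3; apply: filterS2 => x /= h d; move: h; rewrite phiK.
Qed.

(** The chart only shows continuity at 1; the identity [Ad x Y = Ad g (Ad (g^-1 x) Y)] and
    continuity of the linear map [Ad g] carry it to [g]. *)
Lemma Ad_cont Y : continuous (fun x : G => Ad x Y).
Proof.
move=> g A hA.
have c0 : {for Y, continuous (Ad g)}.
  have [K _ hK] := sdiff_bound (Ad_conj g).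
  have lA : linear (Ad g) by case: (Ad_conj g).
  exact: sdiff_cont (linear_sdiff Y lA hK).
have c1 : \forall Z \near Y, A (Ad g Z) := c0 _ hA.
pose Q := [set Z | A (Ad g Z)]; pose P := [set x : G | Q (Ad x Y)].
have q1 : nbhs (Ad (1%g : G) Y) Q by rewrite Ad1; exact: c1.
have c2 : nbhs (1%g : G) P := cont_near (@Ad_cont1 Y) q1.
have c2' : nbhs (g^-1 * g)%g P by rewrite mulVg.
have h3 := cont_near (@cont_mull (g^-1)%g g) c2'.
suff h : \forall x \near g, A (Ad x Y) by exact: h.
apply: filterS h3 => x; rewrite /P /Q /= -AdM mulgA mulgV mul1g.
by [].
Qed.

Lemma cdiff_near (F : normedModType R) (c c' : R -> F) (t : R) (X : F) :
  (\forall s \near t, c s = c' s) -> cdiff c t X -> cdiff c' t X.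
Proof.
move=> /nbhs_norm_lt [d0 d0p h0] hc e e0p; have [d dp hd] := hc e e0p.
exists (Num.min d d0); first by rewrite lt_min dp.
move=> s; rewrite lt_min => /andP[/hd h1 /h0 <-].
by rewrite -(h0 t) // subrr normr0.
Qed.

(* The only data of a curve through 1 that the adjoint representation sees. *)
Definition tangent (c : R -> G) (X : V) :=
  [/\ c 0 = 1%g, {for 0, continuous c} & cdiff (phi 1%g \o c) 0 X].

Lemma tangent_near c X (O : set G) : tangent c X -> nbhs 1%g O ->
  \forall t \near (0 : R), O (c t).
Proof. by move=> [c0 cc _] hO; apply: cc; rewrite c0. Qed.

Lemma tangent_conj c X g : tangent c X -> tangent (fun t => g * c t * g^-1)%g (Ad g X).
Proof.
move=> tc; have [c0 cc dc] := tc; split.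
- by rewrite c0 mulg1 mulgV.
- move=> A /=; rewrite c0 mulg1 mulgV => hA.
  exact: tangent_near tc (near_conj g hA).
- apply: (@cdiff_near _ ((fun e => phi 1%g (g * psi 1%g e * g^-1)%g) \o (phi 1%g \o c))).
    have := tangent_near tc (dom_nbhs (dom_center (1%g : G))).
    by apply: filterS => t d /=; rewrite phiK.
  by apply: cdiff_comp dc _; rewrite /= c0; exact: Ad_conj.
Qed.

Lemma cdiff_pair (E F : normedModType R) (c : R -> E) (c' : R -> F) (t : R) (X : E) (Y : F) :
  cdiff c t X -> cdiff c' t Y -> cdiff (fun s => (c s, c' s)) t (X, Y).
Proof.
move=> h1 h2 e e0p; have [d1 d1p k1] := h1 e e0p; have [d2 d2p k2] := h2 e e0p.
exists (Num.min d1 d2); first by rewrite lt_min d1p.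
move=> s; rewrite lt_min => /andP[/k1 a /k2 b].
by rewrite norm_pairE ge_max a.
Qed.

Lemma tangent_mul c c' X Y : tangent c X -> tangent c' Y ->
  tangent (fun t => c t * c' t)%g (X + Y).
Proof.
move=> tc tc'; have [c0 cc dc] := tc; have [c0' cc' dc'] := tc'; split.
- by rewrite c0 c0' mulg1.
- move=> A /=; rewrite c0 c0' => /mul_near [[B C] [/= nB nC] BC].
  have := tangent_near tc nB; have := tangent_near tc' nC.
  by apply: filterS2 => t h1 h2; apply: (BC (_, _)).
- have := cdiff_pair dc dc'.
  move=> /(cdiff_comp (f := fun p : V * V => phi 1%g (psi 1%g p.1 * psi 1%g p.2)%g)
    (L := fun p => p.1 + p.2)) /=; rewrite c0 c0' => /(_ (mu_sdiff G)).
  apply: cdiff_near.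
  have := tangent_near tc (dom_nbhs (dom_center (1%g : G))).
  have := tangent_near tc' (dom_nbhs (dom_center (1%g : G))).
  by apply: filterS2 => t d1 d2 /=; rewrite !phiK.
Qed.

Lemma tangent_inv c X : tangent c X -> tangent (fun t => (c t)^-1)%g (- X).
Proof.
move=> tc; have [c0 cc dc] := tc; split.
- by rewrite c0 invg1.
- move=> A /=; rewrite c0 => /inv_near hA.
  exact: (tangent_near tc hA).
- have := cdiff_comp (f := fun e => phi 1%g ((psi 1%g e)^-1)%g) (L := fun v => - v) dc.
  rewrite /= c0 => /(_ (iot_sdiffN G)); apply: cdiff_near.
  have := tangent_near tc (dom_nbhs (dom_center (1%g : G))).
  by apply: filterS => t d1 /=; rewrite !phiK.
Qed.

Lemma tangent_cst1 : tangent (fun=> 1%g) 0.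
Proof.
split=> //; first exact: cst_continuous.
move=> e e0p; exists 1 => // s _.
by rewrite /= subrr scaler0 subrr normr0 mulr_ge0 // ltW.
Qed.

Lemma tangent_Ad c X Y : tangent c X -> cdiff (fun t => Ad (c t) Y) 0 (lbr G X Y).
Proof.
move=> tc; have [c0 cc dc] := tc.
apply: (@cdiff_near _ ((fun e => Ad (psi 1%g e) Y) \o (phi 1%g \o c))).
  have := tangent_near tc (dom_nbhs (dom_center (1%g : G))).
  by apply: filterS => t d /=; rewrite phiK.
have := @cdiff_comp _ _ _ (phi 1%g \o c) (fun e => Ad (psi 1%g e) Y) 0 X (fun X => lbr G X Y) dc.
by rewrite /= c0; apply; exact: lbr_sdiff.
Qed.

Lemma one_param_tangent X gam : one_param X gam -> tangent gam X.
Proof.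
move=> [cg gM dg].
have g0 : gam 0 = 1%g.
  have := gM 0 0; rewrite addr0 => h.
  by apply: (mulgI (gam 0)); rewrite mulg1 -h.
by split=> //; [exact: cg|exact: is_derive_cdiff].
Qed.

Lemma one_param_Ad X (gam : R -> G) Y (t : R) : one_param X gam ->
  cdiff (fun s => Ad (gam s) Y) t (Ad (gam t) (lbr G X Y)).
Proof.
move=> og; have [cg gM dg] := og.
have h := tangent_Ad Y (one_param_tangent og).
have [K K0 hK] := sdiff_bound (Ad_conj (gam t)).
have [lD lB lZ l0] := Ad_lin (gam t).
move=> e e0p; have [|d d0 hd] := h (e / K); first by rewrite divr_gt0.
exists d => // s hs; have := hd (s - t); rewrite subr0 => /(_ hs).
have [g0 _ _] := one_param_tangent og; rewrite g0 Ad1 => h1.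
have -> : Ad (gam s) Y - Ad (gam t) Y - (s - t) *: Ad (gam t) (lbr G X Y) =
  Ad (gam t) (Ad (gam (s - t)) Y - Y - (s - t) *: lbr G X Y).
  by rewrite !lB lZ -AdM -gM [t + _]addrC subrK.
by rewrite (le_trans (hK _)) // -(ler_pdivlMl _ _ K0) mulrA [K^-1 * _]mulrC.
Qed.

Lemma one_param_conj X gam g : one_param X gam ->
  one_param (Ad g X) (fun t => g * gam t * g^-1)%g.
Proof.
move=> og; have [cg gM dg] := og; split.
- by apply: cont_mul; [apply: cont_mul => //|]; exact: cst_continuous.
- by move=> s t; rewrite gM !mulgA mulgVK.
- by apply: cdiff_is_derive; have [] := tangent_conj g (one_param_tangent og).
Qed.

End AdjointRepresentation.

(** * Existence and uniqueness of one-parameter groups *)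

Section Exponential.
Context {R : realType} {n : nat} {G : lieGroupType R n}.
Notation V := 'rV[R]_n.
Notation phi a := (chart_map (@chart_at R n G a)).
Notation psi a := (chart_inv (@chart_at R n G a)).
Notation dom a := (chart_dom (@chart_at R n G a)).
Notation e0 := (chart_map (@chart_at R n G 1%g) 1%g).
Implicit Types (g h : G) (X Y : V).

Lemma cont_eps (E F : normedModType R) (f : E -> F) (x : E) :
  (forall e, 0 < e -> exists2 d, 0 < d & forall y, `|y - x| < d -> `|f y - f x| <= e) ->
  {for x, continuous f}.
Proof.
move=> h; apply/cvgrPdist_le => e /h [d d0 hd]; apply/nbhs_norm_lt.
by exists d => // y hy; rewrite -normrN opprB; exact: hd.
Qed.

Lemma near0_le (P : R -> Prop) : (\forall t \near (0 : R), P t) ->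
  exists2 d : R, 0 < d & forall t, `|t| <= d -> P t.
Proof.
move=> h; have [d d0 hd] := (nbhs_norm_lt (0 : R^o) _).1 h.
exists (d / 2); first by rewrite divr_gt0.
by move=> t ht; apply: hd; rewrite subr0 (le_lt_trans ht) // ltr_pdivrMr // ltr_pMr // ltr1n.
Qed.

Lemma near_e0_le (P : V -> Prop) : (\forall e \near e0, P e) ->
  exists2 d : R, 0 < d & forall x, `|x| <= d -> P (e0 + x).
Proof.
move=> h; have [d d0 hd] := (nbhs_norm_lt e0 _).1 h.
exists (d / 2); first by rewrite divr_gt0.
by move=> t ht; apply: hd; rewrite addrC addKr (le_lt_trans ht) // ltr_pdivrMr // ltr_pMr // ltr1n.
Qed.

Definition sqc (x : V) : V := phi 1%g (psi 1%g (e0 + x) * psi 1%g (e0 + x))%g - e0.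

Lemma sqc_phi (x : G) : dom 1%g x -> sqc (phi 1%g x - e0) = phi 1%g (x * x)%g - e0.
Proof. by move=> d; rewrite /sqc [e0 + _]addrC subrK phiK. Qed.

(** Squaring is multiplication along the diagonal, so its differential at the origin is
    multiplication by 2, and the C^2 estimate for [mu] makes the error quadratic. *)
Lemma sqc_estimate : exists (C r0 : R), [/\ 0 < C, 0 < r0, sqc 0 = 0 &
  forall r y z, r <= r0 -> `|y| <= r -> `|z| <= r ->
     `|sqc y - sqc z - 2 *: (y - z)| <= C * r * `|y - z|].
Proof.
have [A nA hA] := mu_Ck G.
have [C C0 [d d0 hd]] := Ck2_estimate (pair_coords (rV_coords n) (rV_coords n)) (hA 2%N) nA.
have hj := sdiff_uniq (Ck1_sdiff (pair_coords (rV_coords n) (rV_coords n)) (hA 1%N) nA) (mu_sdiff G).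
(* [Ck2_estimate] wants strict inequalities while here norms may equal [r]; it is applied with
   radius [2 * r], whence both factors 2. *)
exists (2 * C), (d / 2); split; rewrite ?mulr_gt0 ?divr_gt0 //.
  by rewrite /sqc addr0 psi_e0 mulg1 subrr.
move=> r y z hr hy hz.
have [r0|r0] := ltP 0 r; last first.
  have -> : y = 0 by apply/eqP; rewrite -normr_le0 (le_trans hy).
  have -> : z = 0 by apply/eqP; rewrite -normr_le0 (le_trans hz).
  by rewrite !subrr scaler0 subrr normr0 mulr0.
have r2 : 2 * r <= d by rewrite mulrC -ler_pdivlMr.
have ny (w : V) : `|w| <= r -> `|(e0 + w, e0 + w) - (e0, e0)| < 2 * r.
  move=> hw; rewrite norm_pairE /= addrC addKr maxxx (le_lt_trans hw) //.
  by rewrite ltr_pMl // ltr1n.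
have := hd (2 * r) (e0 + y, e0 + y) (e0 + z, e0 + z) r2 (ny y hy) (ny z hz).
rewrite hj /=.
have -> : e0 + y - (e0 + z) + (e0 + y - (e0 + z)) = 2 *: (y - z).
  by apply/rowP => i; rewrite !mxE; ring.
rewrite norm_pairE /= maxxx.
have -> : e0 + y - (e0 + z) = y - z by apply/rowP => i; rewrite !mxE; ring.
have -> : sqc y - sqc z = phi 1%g (psi 1%g (e0 + y) * psi 1%g (e0 + y))%g -
   phi 1%g (psi 1%g (e0 + z) * psi 1%g (e0 + z))%g.
  by rewrite /sqc opprB addrA subrK.
by rewrite [C * (2 * r)]mulrCA mulrA.
Qed.

(** [dyadic_uniq] gives equality near 0, and repeated squaring spreads it to all times. The
    hypotheses hold for one-parameter groups and also for powers and inverses of the curves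
    [Exp (t *: X)], so every functional equation of the exponential comes from this one uniqueness
    statement. *)
Lemma tangent_square_uniq (c1 c2 : R -> G) X :
  (forall t : R, c1 t = (c1 (2^-1 * t)%R * c1 (2^-1 * t)%R)%g) ->
  (forall t : R, c2 t = (c2 (2^-1 * t)%R * c2 (2^-1 * t)%R)%g) ->
  tangent c1 X -> tangent c2 X -> c1 =1 c2.
Proof.
move=> s1 s2 t1 t2.
have [C [r0 [C0 r00 _ hs]]] := sqc_estimate.
have dn := dom_nbhs (dom_center (1%g : G)).
have [d1 d1p h1] := near0_le (tangent_near t1 dn).
have [d2 d2p h2] := near0_le (tangent_near t2 dn).
have [c10 _ k1] := t1; have [c20 _ k2] := t2.
have [K1 K1p [d3 d3p h3]] := cdiff_lipschitz k1.
have [K2 K2p [d4 d4p h4]] := cdiff_lipschitz k2.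
pose t0 := Num.min (Num.min d1 d2) (Num.min d3 d4 / 2).
have t0p : 0 < t0 by rewrite !lt_min d1p d2p divr_gt0 // lt_min d3p.
pose F1 t := phi 1%g (c1 t) - e0; pose F2 t := phi 1%g (c2 t) - e0.
have h2t (t : R) : `|2^-1 * t| <= `|t|.
  by rewrite normrM ger0_norm ?invr_ge0 // ler_piMl // invf_le1 // ler1n.
have [|||u u0 hu] := @dyadic_uniq R n sqc C r0 (K1 + K2) t0 F1 F2 C0 r00 _ t0p hs.
- by rewrite addr_gt0.
- move=> t; rewrite !le_min => /andP[/andP[a1 a2] a3].
  have {}a3 : `|t| < Num.min d3 d4.
    by rewrite (le_lt_trans a3) // ltr_pdivrMr // ltr_pMr ?ltr1n // lt_min d3p.
  move: a3; rewrite lt_min => /andP[a3 a4].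
  have := h3 t; rewrite subr0 => /(_ a3) b3; have := h4 t; rewrite subr0 => /(_ a4) b4.
  rewrite /= c10 in b3; rewrite /= c20 in b4.
  split.
  + by rewrite (le_trans b3) // ler_wpM2r // lerDl ltW.
  + by rewrite (le_trans b4) // ler_wpM2r // lerDr ltW.
  + by rewrite /F1 sqc_phi -?s1 //; apply: h1; exact: le_trans (h2t _) a1.
  + by rewrite /F2 sqc_phi -?s2 //; apply: h2; exact: le_trans (h2t _) a2.
- move=> e e0p; have e2 : 0 < e / 2 by rewrite divr_gt0.
  have [q1 q1p g1] := k1 _ e2; have [q2 q2p g2] := k2 _ e2.
  exists (Num.min q1 q2 / 2); first by rewrite divr_gt0 // lt_min q1p.
  move=> t ht.
  have {}ht : `|t| < Num.min q1 q2.
    by rewrite (le_lt_trans ht) // ltr_pdivrMr // ltr_pMr ?ltr1n // lt_min q1p.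
  move: ht; rewrite lt_min => /andP[a1 a2].
  have := g1 t; rewrite subr0 => /(_ a1); have := g2 t; rewrite subr0 => /(_ a2).
  rewrite /= c10 c20 => b2 b1.
  have -> : F1 t - F2 t = (phi 1%g (c1 t) - e0 - t *: X) - (phi 1%g (c2 t) - e0 - t *: X).
    by rewrite /F1 /F2; apply/rowP => i; rewrite !mxE; ring.
  by rewrite (le_trans (ler_normB _ _)) // [e]splitr mulrDl lerD.
have small t : `|t| <= Num.min u (Num.min d1 d2) -> c1 t = c2 t.
  rewrite !le_min => /and3P[a1 a2 a3].
  have := hu t a1 => /addIr h.
  by rewrite -(phiK (h1 t a2)) -(phiK (h2 t a3)) h.
move=> t.
have [k hk] : exists k : nat, `|2^-1 ^+ k * t| <= Num.min u (Num.min d1 d2).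
  have m0 : 0 < Num.min u (Num.min d1 d2) by rewrite !lt_min u0 d1p.
  have tp : 0 < `|t| + 1 by rewrite ltr_wpDl.
  have := @cvg_expr R 2^-1.
  rewrite ger0_norm ?invr_ge0 // invf_lt1 // ltr1n => /(_ isT) /cvgrPdist_le.
  move=> /(_ (Num.min u (Num.min d1 d2) / (`|t| + 1)) ltac:(by rewrite divr_gt0)) [k _ hk].
  exists k; have := hk k (leqnn _) => /=; rewrite sub0r normrN normrM.
  rewrite ger0_norm ?exprn_ge0 ?invr_ge0 // ler_pdivlMr // => h.
  rewrite (le_trans _ h) // ler_wpM2l ?exprn_ge0 ?invr_ge0 //.
  by rewrite lerDl.
elim: k t hk => [|k IH] t; first by rewrite expr0 mul1r; exact: small.
rewrite exprSr -mulrA => /IH h.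
by rewrite s1 s2 h.
Qed.

Lemma dyadic_small (x rho : R) : 0 <= x -> 0 < rho -> exists k : nat, 2^-1 ^+ k * x <= rho.
Proof.
move=> x0 rho0.
have tp : 0 < x + 1 by rewrite ltr_wpDl.
have := @cvg_expr R 2^-1.
rewrite ger0_norm ?invr_ge0 // invf_lt1 // ltr1n => /(_ isT) /cvgrPdist_le.
move=> /(_ (rho / (x + 1)) ltac:(by rewrite divr_gt0)) [k _ hk].
exists k; have := hk k (leqnn _) => /=; rewrite sub0r normrN.
rewrite ger0_norm ?exprn_ge0 ?invr_ge0 // ler_pdivlMr // => h.
rewrite (le_trans _ h) // ler_wpM2l ?exprn_ge0 ?invr_ge0 //.
by rewrite lerDl.
Qed.

Lemma exp_local : exists (gam : V -> G) (rho : R), [/\ 0 < rho,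
  forall x, `|x| <= rho -> dom 1%g (gam x) /\ gam x = (gam (2^-1 *: x) * gam (2^-1 *: x))%g,
  forall x, `|x| <= rho -> {for x, continuous gam}, gam 0 = 1%g &
  sdiff (fun x => phi 1%g (gam x)) 0 id].
Proof.
have [C [r0 [C0 r00 s0 hs]]] := sqc_estimate.
have [E [r1 [/andP[r1p r1r0] E0 EL E2 Es]]] := dyadic_exp C0 r00 s0 hs.
have hO : nbhs (1%g : G) [set x | dom 1%g x /\ dom 1%g (x * x)%g].
  have n1 := dom_nbhs (dom_center (1%g : G)).
  have n2 : nbhs (1%g : G) [set x | dom 1%g (x * x)%g].
    have [[A B] [/= nA nB] AB] := mul_near (nbhs1M n1).
    by move: nA nB; apply: filterS2 => x a b; apply: (AB (_, _)).
  by move: n1 n2; apply: filterS2.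
have [d d0 hd] := near_e0_le (near_psi hO).
pose rho := Num.min (r1 / 2) (d / 2).
have rho0 : 0 < rho by rewrite lt_min !divr_gt0.
have rr (x : V) : `|x| <= rho -> `|x| <= r1 /\ `|E x| <= d.
  rewrite le_min => /andP[a b].
  have a' : `|x| <= r1 by have := normr_ge0 x; lra.
  by split=> //; rewrite (le_trans (E2 x a')) // mulrC -ler_pdivlMr.
have nh (x : V) : `|2^-1 *: x| <= `|x|.
  by rewrite normrZ ger0_norm ?invr_ge0 // ler_piMl // invf_le1 // ler1n.
exists (fun x => psi 1%g (e0 + E x)), rho; split=> //.
- move=> x hx; have [h1 h2] := rr x hx.
  have [_ [d1 d2] d3] := hd _ h2; split=> //.
  have [h1' h2'] := rr _ (le_trans (nh x) hx).
  have [_ [d1' d2'] d3'] := hd _ h2'.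
  have := Es x h1; rewrite /sqc => <-.
  by rewrite addrC subrK phiK.
- move=> x hx; have [h1 h2] := rr x hx.
  have [_ [d1 d2] d3] := hd _ h2.
  have cE : {for x, continuous (fun x => e0 + E x)}.
    have hx' : `|x| < r1 by move: hx; rewrite le_min => /andP[a _]; lra.
    apply: cont_eps => e ep.
    exists (Num.min (r1 - `|x|) (e / (1 + 2 * C * r1))).
      by rewrite lt_min subr_gt0 hx' divr_gt0 // ltr_wpDr // !mulr_ge0 // ltW.
    move=> y; rewrite lt_min => /andP[y1 y2].
    have hy : `|y| <= r1.
      by rewrite -[y](subrK x) (le_trans (ler_normD _ _)) // -lerBrDr ltW.
    have h := EL r1 y x (lexx _) hy h1.
    have -> : e0 + E y - (e0 + E x) = (E y - E x - (y - x)) + (y - x).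
      by rewrite subrK opprD addrACA subrr add0r.
    rewrite (le_trans (ler_normD _ _)) //.
    apply: (@le_trans _ _ ((1 + 2 * C * r1) * `|y - x|)).
      by rewrite mulrDl mul1r addrC lerD.
    by rewrite mulrC -ler_pdivlMr ?ltW // ltr_wpDr // !mulr_ge0 // ltW.
  have := continuous_comp cE (f := fun x => e0 + E x) (g := psi 1%g); apply.
  have := psi_cont d1.
  by rewrite d3.
- by rewrite E0 addr0 psi_e0.
- split.
  + by move=> a u v.
  + by exists 1 => v; rewrite mul1r.
  + move=> e ep.
    exists (Num.min rho (e / (2 * C))).
      by rewrite lt_min rho0 divr_gt0 // mulr_gt0.
    move=> y z; rewrite !subr0 !lt_min => /andP[y1 y2] /andP[z1 z2].
    rewrite -lt_min in y1; rewrite -lt_min in z1.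
    have [h1 h2] := rr y (ltW y1); have [h1' h2'] := rr z (ltW z1).
    have [_ _ ->] := hd _ h2; have [_ _ ->] := hd _ h2'.
    have rm : Num.min rho (e / (2 * C)) <= r1.
      have : rho <= r1 / 2 by rewrite ge_min lexx.
      by move=> h'; rewrite ge_min; apply/orP; left; lra.
    have y3 : `|y| <= Num.min rho (e / (2 * C)) by rewrite le_min /rho (ltW y1) (ltW y2).
    have z3 : `|z| <= Num.min rho (e / (2 * C)) by rewrite le_min /rho (ltW z1) (ltW z2).
    have h := EL _ y z rm y3 z3.
    have -> : e0 + E y - (e0 + E z) = E y - E z.
      by rewrite opprD addrACA subrr add0r.
    rewrite (le_trans h) // ler_wpM2r //.
    rewrite mulrC -ler_pdivlMr ?mulr_gt0 //.
    by rewrite ge_min lexx orbT.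
Qed.

Definition gsq (x : G) : G := (x * x)%g.

(** [Exp x] is [gam (x / 2^k)] squared [k] times for any [k] that brings the argument into the small
    ball; the local functional equation makes the choice of [k] immaterial. *)
Lemma exp_global : exists Exp : V -> G, [/\
  forall x, Exp x = (Exp (2^-1 *: x) * Exp (2^-1 *: x))%g,
  continuous Exp, Exp 0 = 1%g & sdiff (fun x => phi 1%g (Exp x)) 0 id].
Proof.
have [gam [rho [rho0 gs gc g0 gd]]] := exp_local.
have nh (k : nat) (x : V) : `|2^-1 ^+ k *: x| = 2^-1 ^+ k * `|x|.
  by rewrite normrZ ger0_norm // exprn_ge0 // invr_ge0.
have ex (x : V) := dyadic_small (normr_ge0 x) rho0.
pose Exp (x : V) := iter (sval (cid (ex x))) gsq (gam (2^-1 ^+ sval (cid (ex x)) *: x)).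
have step j x : `|x| <= rho -> gam x = iter j gsq (gam (2^-1 ^+ j *: x)).
  elim: j x => [|j IH] x hx; first by rewrite expr0 scale1r.
  have [_ ->] := gs x hx.
  have hx2 : `|2^-1 *: x| <= rho.
    by apply: le_trans hx; rewrite -(expr1 2^-1) nh expr1 ler_piMl // invf_le1 // ler1n.
  by rewrite iterS (IH _ hx2) scalerA -exprSr.
have ExpE k x : 2^-1 ^+ k * `|x| <= rho -> Exp x = iter k gsq (gam (2^-1 ^+ k *: x)).
  rewrite /Exp; case: cid => m /= hm hk.
  wlog : k m hm hk / (k <= m)%N => [W|km].
    by case/orP: (leq_total k m) => h; [exact: W|symmetry; exact: W].
  rewrite -(subnK km) addnC iterD; congr (iter _ _ _).
  rewrite exprD -scalerA [2^-1 ^+ k *: _]scalerA mulrC -scalerA; symmetry; rewrite (step (m - k)%N) ?nh //.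
have gsqc : continuous gsq by apply: cont_mul => x.
have itc k : continuous (iter k gsq).
  elim: k => [|k IH] x; first exact: cvg_id.
  by apply: (@continuous_comp _ _ _ (iter k gsq) gsq); [exact: IH|exact: gsqc].
exists Exp; split.
- move=> x; have [k hk] := ex x.
  have hk1 : 2^-1 ^+ k.+1 * `|x| <= rho.
    by apply: le_trans hk; rewrite exprS -mulrA ler_piMl ?mulr_ge0 ?exprn_ge0 ?invr_ge0 // invf_le1 // ler1n.
  have hk2 : 2^-1 ^+ k * `|2^-1 *: x| <= rho.
    by rewrite -nh scalerA -exprSr nh.
  by rewrite (ExpE _ _ hk1) (ExpE _ _ hk2) iterS scalerA -exprSr.
- move=> x.
  have rho2 : 0 < rho / 2 by rewrite divr_gt0.
  (* Aiming at [rho / 2] leaves room for a single [k] to serve all points near [x], so near [x] the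
     map is a continuous one followed by a fixed number of squarings. *)
  have [k hk] := dyadic_small (normr_ge0 x) rho2.
  have hk' : `|2^-1 ^+ k *: x| <= rho.
    by rewrite nh (le_trans hk) // ler_pdivrMr // ler_pMr // ler1n.
  have c1 : {for x, continuous (fun y : V => iter k gsq (gam (2^-1 ^+ k *: y)))}.
    apply: (@continuous_comp _ _ _ (fun y : V => gam (2^-1 ^+ k *: y)) (iter k gsq)); last exact: itc.
    apply: (@continuous_comp _ _ _ (fun y : V => 2^-1 ^+ k *: y) gam); last exact: gc.
    exact: scaler_continuous.
  have nE : \forall y \near x, iter k gsq (gam (2^-1 ^+ k *: y)) = Exp y.
    apply/nbhs_norm_lt; exists (rho / 2) => // y hy.
    rewrite -ExpE // -nh.
    have -> : 2^-1 ^+ k *: y = 2^-1 ^+ k *: (y - x) + 2^-1 ^+ k *: x.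
      by rewrite -scalerDr subrK.
    rewrite (le_trans (ler_normD _ _)) // !nh [rho in leRHS]splitr lerD //.
    apply: le_trans (ltW hy); rewrite ler_piMl // exprn_ile1 ?invr_ge0 //.
    by rewrite invf_le1 // ler1n.
  have e1 := nbhs_singleton nE.
  move=> A /=; rewrite -e1 => hA; have := cont_near c1 hA.
  move=> h2; suff h : \forall y \near x, A (Exp y) by exact: h.
  by move: nE h2; apply: filterS2 => y b c; rewrite -b; exact: c.
- have h0 : 2^-1 ^+ 0 * `|0 : V| <= rho by rewrite normr0 mulr0 ltW.
  by rewrite (ExpE _ _ h0) scaler0.
- apply: sdiff_near gd; apply/nbhs_norm_lt; exists rho => // y; rewrite subr0 => hy.
  have h0 : 2^-1 ^+ 0 * `|y| <= rho by rewrite expr0 mul1r ltW.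
  by rewrite (ExpE _ _ h0) expr0 scale1r.
Qed.

Lemma tangent_pow (c : R -> G) X p : tangent c X -> tangent (fun t => c t ^+ p)%g (p%:R *: X).
Proof.
move=> tc; elim: p => [|p IH].
  by rewrite scale0r; exact: tangent_cst1.
have -> : (fun t => c t ^+ p.+1)%g = (fun t => c t * c t ^+ p)%g.
  by apply/funext => t; rewrite expgS.
by rewrite -natr1 scalerDl scale1r addrC; exact: tangent_mul.
Qed.

Lemma hausdorff_eq (x y : G) :
  (forall A B, nbhs x A -> nbhs y B -> exists z, A z /\ B z) -> x = y.
Proof.
move=> h; apply: (@lie_hausdorff R n G) => A B nA nB.
by have [z [a b]] := h A B nA nB; exists z.
Qed.

Lemma dyadic_dense (t e : R) : 0 <= t -> 0 < e ->
  exists K : nat, forall k, (K <= k)%N -> exists p : nat, `|p%:R / 2 ^+ k - t| < e.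
Proof.
move=> t0 ep.
have := @cvg_expr R 2^-1.
rewrite ger0_norm ?invr_ge0 // invf_lt1 // ltr1n => /(_ isT) /cvgrPdist_lt.
move=> /(_ _ ep) [K _ hK]; exists K => k Kk.
have := hK k Kk => /=; rewrite sub0r normrN ger0_norm ?exprn_ge0 ?invr_ge0 // => he.
exists (Num.truncn (t * 2 ^+ k)).
have p2 : 0 < 2 ^+ k :> R by rewrite exprn_gt0.
have tk : 0 <= t * 2 ^+ k by rewrite mulr_ge0 // ltW.
have /andP[h1 h2] := truncn_itv tk.
rewrite -normrN opprB ger0_norm; last first.
  by rewrite subr_ge0 ler_pdivrMr.
rewrite (le_lt_trans _ he) // lerBlDr exprVn -[X in X + _]mul1r -mulrDl ler_pdivlMr //.
by rewrite nat1r ltW.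
Qed.

(** The power law gives additivity for dyadic times with a common denominator; density, continuity
    and the Hausdorff property extend it to nonnegative times, and the inverse law treats the
    remaining signs. *)
Lemma one_param_exists X : exists gam : R -> G, one_param X gam.
Proof.
have [Exp [Es Ec E0 Ed]] := exp_global.
pose gam t := Exp (t *: X).
have cl (Y : V) : continuous (fun t : R => t *: Y).
  by move=> t; exact: scalel_continuous.
have tg (Y : V) : tangent (fun t => Exp (t *: Y)) Y.
  split; first by rewrite scale0r.
  - by apply: (@continuous_comp _ _ _ (fun t : R => t *: Y) Exp); [exact: cl|exact: Ec].
  - have := @cdiff_comp R _ _ (fun t : R => t *: Y) (fun x => phi 1%g (Exp x)) 0 Y id.
    apply; last by rewrite scale0r.
    move=> e ep; exists 1 => // s _.
    by rewrite scale0r !subr0 subrr normr0 mulr_ge0 // ltW.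
have sq2 (Y : V) (t : R) : Exp (t *: Y) = (Exp ((2^-1 * t)%R *: Y) * Exp ((2^-1 * t)%R *: Y))%g.
  by rewrite -scalerA -Es.
have hp p (Y : V) : Exp (p%:R *: Y) = (Exp Y ^+ p)%g.
  have := @tangent_square_uniq (fun t => Exp (t *: (p%:R *: Y))) (fun t => Exp (t *: Y) ^+ p)%g (p%:R *: Y).
  move=> /(_ _ _ _ _ 1); rewrite !scale1r; apply => //.
  - by move=> t; rewrite {1}sq2 expgMn //; exact: commute_refl.
  - exact: tangent_pow.
have hV t : gam (- t) = (gam t)^-1%g.
  have := @tangent_square_uniq (fun t => Exp (t *: - X)) (fun t => (Exp (t *: X))^-1)%g (- X).
  move=> /(_ _ _ _ _ t); rewrite /gam scalerN scaleNr; apply => //.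
  - by move=> u; rewrite {1}sq2 invgM.
  - exact: tangent_inv.
pose dy (p k : nat) : R := p%:R / 2 ^+ k.
have hD k p q : gam (dy p k + dy q k) = (gam (dy p k) * gam (dy q k))%g.
  rewrite /gam /dy -mulrDl -natrD -!scalerA !hp.
  exact: expgnDr.
have gc : continuous gam.
  by move=> t; apply: (@continuous_comp _ _ _ (fun t : R => t *: X) Exp); [exact: cl|exact: Ec].
have pos s t : 0 <= s -> 0 <= t -> gam (s + t) = (gam s * gam t)%g.
  move=> s0 t0; apply: hausdorff_eq => A B nA nB.
  have [[B1 B2] [/= nB1 nB2] BB] := mul_near nB.
  have [d1 d1p h1] := (nbhs_norm_lt (s + t : R^o) _).1 (cont_near (gc (s + t)) nA).
  have [d2 d2p h2] := (nbhs_norm_lt (s : R^o) _).1 (cont_near (gc s) nB1).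
  have [d3 d3p h3] := (nbhs_norm_lt (t : R^o) _).1 (cont_near (gc t) nB2).
  pose d := Num.min (d1 / 2) (Num.min d2 d3).
  have dp : 0 < d by rewrite !lt_min d2p d3p divr_gt0.
  have [K1 k1] := dyadic_dense s0 dp; have [K2 k2] := dyadic_dense t0 dp.
  have [p hp'] := k1 (maxn K1 K2) (leq_maxl _ _); have [q hq] := k2 (maxn K1 K2) (leq_maxr _ _).
  move: hp' hq; rewrite -!/(dy _ _); set a := dy p _; set b := dy q _.
  rewrite !lt_min => /and3P[a1 a2 a3] /and3P[b1 b2 b3].
  exists (gam (a + b)); split.
    apply: h1; have -> : a + b - (s + t) = (a - s) + (b - t) by ring.
    by rewrite (le_lt_trans (ler_normD _ _)) // [d1]splitr ltrD.
  by rewrite hD; apply: (BB (_, _)); split; [exact: h2|exact: h3].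
exists gam; split=> //; last by apply: cdiff_is_derive; have [] := tg X.
move=> s t.
have [s0|s0] := leP 0 s; have [t0|t0] := leP 0 t; first exact: pos.
- have [st|st] := leP 0 (s + t).
    have := pos (s + t) (- t) st ltac:(by rewrite oppr_ge0 ltW).
    by rewrite addrK hV => ->; rewrite mulgVK.
  have := pos (- (s + t)) s ltac:(by rewrite oppr_ge0 ltW) s0.
  have -> : - (s + t) + s = - t by ring.
  by rewrite !hV => /(congr1 (fun x => x^-1)%g); rewrite invgM !invgK => ->; rewrite mulgA mulgV mul1g.
- have [st|st] := leP 0 (s + t).
    have := pos (- s) (s + t) ltac:(by rewrite oppr_ge0 ltW) st.
    by rewrite addKr hV => ->; rewrite mulgA mulgV mul1g.
  have := pos t (- (s + t)) t0 ltac:(by rewrite oppr_ge0 ltW).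
  have -> : t + - (s + t) = - s by ring.
  by rewrite !hV => /(congr1 (fun x => x^-1)%g); rewrite invgM !invgK => ->; rewrite mulgVK.
- have := pos (- t) (- s) ltac:(by rewrite oppr_ge0 ltW) ltac:(by rewrite oppr_ge0 ltW).
  rewrite -opprD !hV -invgM [t + s]addrC => /(congr1 (fun x => x^-1)%g).
  by rewrite !invgK.
Qed.

Lemma one_param_uniq X (gam gam' : R -> G) : one_param X gam -> one_param X gam' -> gam =1 gam'.
Proof.
move=> h1 h2; have [c1 m1 _] := h1; have [c2 m2 _] := h2.
apply: (@tangent_square_uniq _ _ X); last 2 first.
- exact: one_param_tangent.
- exact: one_param_tangent.
- by move=> t; rewrite -m1 -mulrDl -[2^-1]mul1r -splitr mul1r.
- by move=> t; rewrite -m2 -mulrDl -[2^-1]mul1r -splitr mul1r.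
Qed.

(** [expG] is defined by choice, with default 1; rescaling the time of [gam] shows that a value
    exists, and uniqueness of one-parameter groups identifies it. *)
Lemma expG_one_param X gam (t : R) : one_param X gam -> expG G (t *: X) = gam t.
Proof.
move=> og; have [cg gM dg] := og.
have ot : one_param (t *: X) (fun s => gam (s * t)).
  split.
  - move=> s; apply: (@continuous_comp _ _ _ (fun s : R => s * t) gam); last exact: cg.
    exact: mulrr_continuous.
  - by move=> u v; rewrite mulrDl gM.
  - apply: cdiff_is_derive => e ep.
    have [_ _ hc] := one_param_tangent og.
    have t1 : 0 < `|t| + 1 by rewrite ltr_wpDl.
    have [d d0 hd] := hc (e / (`|t| + 1)) ltac:(by rewrite divr_gt0).
    exists (d / (`|t| + 1)); first by rewrite divr_gt0.
    move=> s; rewrite subr0 => hs; rewrite /= mul0r scalerA.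
    have := hd (s * t); rewrite /= subr0 normrM => h.
    apply: (le_trans (h _)).
      rewrite (@le_lt_trans _ _ (`|s| * (`|t| + 1))) ?ler_wpM2l ?lerDl //.
      by rewrite -ltr_pdivlMr.
    rewrite mulrAC ler_pdivrMr // -mulrA ler_wpM2l ?(ltW ep) //.
    by rewrite ler_wpM2l // lerDl.
rewrite /expG; case: xgetP => [g _ [gam' o' <-]|].
  by rewrite (one_param_uniq o' ot) mul1r.
by move=> /(_ (gam t)) []; exists (fun s => gam (s * t)) => //; rewrite mul1r.
Qed.

Lemma expGP X : one_param X (fun t : R => expG G (t *: X)).
Proof.
have [gam og] := one_param_exists X.
suff -> : (fun t : R => expG G (t *: X)) = gam by [].
by apply/funext => t; exact: expG_one_param.
Qed.

Lemma expG_facts : continuous (expG G) /\ sdiff (fun x => phi 1%g (expG G x)) 0 id.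
Proof.
have [Exp [Es Ec E0 Ed]] := exp_global.
suff -> : expG G = Exp by [].
apply/funext => X.
have := @tangent_square_uniq (fun t => expG G (t *: X)) (fun t => Exp (t *: X)) X.
move=> /(_ _ _ _ _ 1); rewrite !scale1r; apply.
- by move=> t; have [_ <- _] := expGP X; rewrite -mulrDl -[2^-1]mul1r -splitr mul1r.
- by move=> t; rewrite -scalerA -Es.
- exact: one_param_tangent (expGP X).
- split; first by rewrite scale0r.
  + apply: (@continuous_comp _ _ _ (fun t : R => t *: X) Exp); last exact: Ec.
    exact: scalel_continuous.
  + have := @cdiff_comp R _ _ (fun t : R => t *: X) (fun x => phi 1%g (Exp x)) 0 X id.
    apply; last by rewrite scale0r.
    move=> e ep; exists 1 => // s _.
    by rewrite scale0r !subr0 subrr normr0 mulr_ge0 // ltW.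
Qed.

End Exponential.

Opaque Ad lbr expG.

(** * Bracket identities and the exponential *)

Section LieAlgebraFacts.
Context {R : realType} {n : nat} {G : lieGroupType R n}.
Notation V := 'rV[R]_n.
Notation phi a := (chart_map (@chart_at R n G a)).
Notation psi a := (chart_inv (@chart_at R n G a)).
Notation dom a := (chart_dom (@chart_at R n G a)).
Notation e0 := (chart_map (@chart_at R n G 1%g) 1%g).
Notation br := (lbr G).
Notation exp := (expG G).
Implicit Types (g h : G) (X Y Z : V).

Lemma expG_tangent X : tangent (fun t : R => exp (t *: X)) X.
Proof. exact: one_param_tangent ((@expGP R n G X)). Qed.

Lemma expGD X (s t : R) : exp ((s + t) *: X) = (exp (s *: X) * exp (t *: X))%g.
Proof. by have [_ h _] := (@expGP R n G X); exact: h. Qed.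

Lemma expG0 : exp 0 = 1%g.
Proof. by have [] := expG_tangent 0; rewrite scale0r. Qed.

Lemma expGN X : exp (- X) = ((exp X)^-1)%g.
Proof.
have := expGD X 1 (-1); rewrite subrr scale0r scale1r scaleN1r expG0 => /esym /mulg1_eq.
by [].
Qed.

Lemma cdiff_linear (E F : normedModType R) (c : R -> E) (L : E -> F) K t (X : E) :
  linear L -> (forall v, `|L v| <= K * `|v|) -> cdiff c t X -> cdiff (L \o c) t (L X).
Proof. by move=> lL hK hc; apply: cdiff_comp hc (linear_sdiff _ lL hK). Qed.

Lemma cdiff_ext (F : normedModType R) (c c' : R -> F) (t : R) (X : F) :
  (forall s, c s = c' s) -> cdiff c t X -> cdiff c' t X.
Proof. by move=> /funext ->. Qed.

Lemma lbrDl X Y Z : br (X + Y) Z = br X Z + br Y Z.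
Proof. by have [h _ _ _] := sdiff_lin (lbr_sdiff (G := G) Z). Qed.

Lemma lbrZl (a : R) X Z : br (a *: X) Z = a *: br X Z.
Proof. by have [_ _ h _] := sdiff_lin (lbr_sdiff (G := G) Z). Qed.

(** Linearity in the first argument is that of a differential. In the second it holds because each
    [Ad (exp (s X))] is linear and derivatives of curves are unique. *)
Lemma lbr_linr X (a : R) Y Z : br X (a *: Y + Z) = a *: br X Y + br X Z.
Proof.
have h1 := tangent_Ad Y (expG_tangent X); have h2 := tangent_Ad Z (expG_tangent X).
have lL : linear (fun p : V * V => a *: p.1 + p.2).
  move=> b [u v] [u' v'] /=.
  by apply/rowP => i; rewrite !mxE; ring.
have bL (p : V * V) : `|a *: p.1 + p.2| <= (`|a| + 1) * `|p|.
  rewrite (le_trans (ler_normD _ _)) // normrZ mulrDl mul1r norm_pairE lerD //.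
    by rewrite ler_wpM2l // le_max lexx.
  by rewrite le_max lexx orbT.
have h3 := cdiff_linear lL bL (cdiff_pair h1 h2).
have h4 := tangent_Ad (a *: Y + Z) (expG_tangent X).
apply: (cdiff_uniq h4); apply: cdiff_ext h3 => s /=.
by have [lD _ lZ _] := Ad_lin (exp (s *: X)); rewrite lD lZ.
Qed.

Lemma lbrDr X Y Z : br X (Y + Z) = br X Y + br X Z.
Proof. by have := lbr_linr X 1 Y Z; rewrite !scale1r. Qed.

Lemma lbr0r X : br X 0 = 0.
Proof. by have := lbrDr X 0 0; rewrite addr0 => /eqP; rewrite -subr_eq0 opprD addrA subrr add0r oppr_eq0 => /eqP. Qed.

Lemma lbrZr (a : R) X Z : br X (a *: Z) = a *: br X Z.
Proof. by have := lbr_linr X a Z 0; rewrite !addr0 lbr0r addr0. Qed.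

Lemma lbr0l X : br 0 X = 0.
Proof. by have := lbrZl 0 0 X; rewrite !scale0r. Qed.

Lemma lbrNl X Y : br (- X) Y = - br X Y.
Proof. by rewrite -scaleN1r lbrZl scaleN1r. Qed.

Lemma lbrNr X Y : br X (- Y) = - br X Y.
Proof. by rewrite -scaleN1r lbrZr scaleN1r. Qed.

Lemma expG_conj g X : (g * exp X * g^-1)%g = exp (Ad g X).
Proof.
have h := one_param_conj g ((@expGP R n G X)).
have := expG_one_param 1 h; rewrite !scale1r.
by move=> ->.
Qed.

Lemma Ad_exp_self X : Ad (exp X) X = X.
Proof.
have h := one_param_conj (exp X) ((@expGP R n G X)).
have e : (fun t : R => exp X * exp (t *: X) * (exp X)^-1)%g = (fun t : R => exp (t *: X)).
  apply/funext => t; rewrite -expGN.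
  have E1 : exp X = exp (1 *: X) by rewrite scale1r.
  have E2 : exp (- X) = exp ((-1) *: X) by rewrite scaleN1r.
  by rewrite E1 E2 -!expGD addrAC subrr add0r.
rewrite e in h.
have [_ _ d1] := one_param_tangent h; have [_ _ d2] := expG_tangent X.
exact: cdiff_uniq d1 d2.
Qed.

Lemma cdiff_cst (F : normedModType R) (x : F) (t : R) : cdiff (fun=> x) t 0.
Proof.
move=> e ep; exists 1 => // s _.
by rewrite scaler0 !subrr normr0 mulr_ge0 // ltW.
Qed.

(** Conjugation by [exp (s X)] leaves the one-parameter group of [X] unchanged, so the curve whose
    derivative defines the bracket is constant. *)
Lemma lbrXX X : br X X = 0.
Proof.
have h := tangent_Ad X (expG_tangent X).
apply: (cdiff_uniq h); apply: cdiff_ext (cdiff_cst X 0) => s; have [->|s0] := eqVneq s 0; first by rewrite scale0r expG0 Ad1.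
have := Ad_exp_self (s *: X); have [_ _ -> _] := Ad_lin (exp (s *: X)).
by move/(scalerI s0).
Qed.

Lemma lbrC X Y : br X Y = - br Y X.
Proof.
have aux (a b c d : V) : a = 0 -> d = 0 -> a + b + (c + d) = 0 -> b = - c.
  by move=> -> ->; rewrite add0r [c + 0]addr0 => /eqP; rewrite addr_eq0 => /eqP.
have e := lbrXX (X + Y); rewrite (lbrDl X Y (X + Y)) (lbrDr X X Y) (lbrDr Y X Y) in e.
exact: aux (lbrXX X) (lbrXX Y) e.
Qed.

Lemma Ad_br g X Y : Ad g (br X Y) = br (Ad g X) (Ad g Y).
Proof.
have h1 := tangent_Ad (Ad g Y) (tangent_conj g (expG_tangent X)).
have [K _ hK] := sdiff_bound (Ad_conj g); have [lA _ _] := Ad_conj g.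
have h2 := cdiff_linear lA hK (tangent_Ad Y (expG_tangent X)).
apply: (cdiff_uniq h2); apply: cdiff_ext h1 => s /=.
by rewrite !AdM AdVK.
Qed.

Lemma lbr_sum X Y : br X Y = \sum_i X 0 i *: br (delta_mx 0 i) Y.
Proof.
rewrite {1}[X]row_sum_delta.
elim/big_rec2: _ => [|i u v _ <-]; first exact: lbr0l.
by rewrite lbrDl lbrZl.
Qed.

Lemma lbr_boundr X : exists K, forall Y, `|br X Y| <= K * `|Y|.
Proof.
have e Y : br X Y = \sum_i Y 0 i *: br X (delta_mx 0 i).
  rewrite lbrC lbr_sum -sumrN; apply: eq_bigr => i _.
  by rewrite lbrC scalerN opprK.
exists (\sum_i `|br X (delta_mx 0 i)|) => Y.
rewrite e (le_trans (ler_norm_sum _ _ _)) // mulr_suml; apply: ler_sum => i _.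
by rewrite normrZ mulrC ler_wpM2l // le_mx_norm.
Qed.

(** Differentiate at 0 the invariance of the bracket under [Ad (exp (s X))]. Writing the bracket in
    coordinates exhibits it as a strictly differentiable function of the pair. *)
Lemma lbr_jacobi X Y Z : br X (br Y Z) = br (br X Y) Z + br Y (br X Z).
Proof.
have hs : sdiff (fun p : V * V => \sum_i p.1 0 i *: br (delta_mx 0 i) p.2) (Y, Z)
   (fun p => \sum_i (p.1 0 i *: br (delta_mx 0 i) Z + Y 0 i *: br (delta_mx 0 i) p.2)).
  apply: sdiff_sum => i; apply: (@sdiff_scale _ _ _ (fun p : V * V => p.1 0 i : R^o)).
    apply: (@linear_sdiff _ _ _ _ 1).
      by move=> a u v; rewrite !mxE.
    by move=> v; rewrite mul1r norm_pairE (le_trans (le_mx_norm _ _ _)) // le_max lexx.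
  have [K hK] := lbr_boundr (delta_mx 0 i).
  apply: (@linear_sdiff _ _ _ _ `|K|).
    by move=> a u v; rewrite /= lbr_linr.
  move=> v; rewrite (le_trans (hK _)) // (@le_trans _ _ (`|K| * `|v.2|)) //.
    by rewrite ler_wpM2r // ler_norm.
  by rewrite ler_wpM2l // norm_pairE le_max lexx orbT.
have h1 := tangent_Ad Y (expG_tangent X); have h2 := tangent_Ad Z (expG_tangent X).
have h3 := cdiff_pair h1 h2.
have h4 := @cdiff_comp _ _ _ _ _ _ _ _ h3.
have := h4 _ _ _; rewrite scale0r expG0 !Ad1 => /(_ _ _ _ hs) h5.
apply: (cdiff_uniq (tangent_Ad (br Y Z) (expG_tangent X))).
have -> : br (br X Y) Z + br Y (br X Z) = \sum_i (br X Y 0 i *: br (delta_mx 0 i) Z + Y 0 i *: br (delta_mx 0 i) (br X Z)).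
  rewrite big_split /=; congr (_ + _); exact: lbr_sum.
apply: cdiff_ext h5 => s /=.
by rewrite -lbr_sum Ad_br.
Qed.

Lemma cdiff0_cst (c : R -> V) : (forall t, cdiff c t 0) -> forall t, c t = c 0.
Proof.
move=> h t; apply/eqP; rewrite -subr_eq0 -normr_le0.
have := @mvt_le R n c t 0 0; rewrite scaler0 subr0 mul0r; apply => s _.
have [d1 d2] := cdiff_is_derive (h s); split=> //.
by rewrite d2 subrr normr0.
Qed.

Lemma Ad_exp_deriv X Y (t : R) :
  cdiff (fun s : R => Ad (exp (s *: X)) Y) t (Ad (exp (t *: X)) (br X Y)).
Proof. exact: one_param_Ad ((@expGP R n G X)). Qed.

Lemma Ad_exp_fix X Y : br X Y = 0 -> Ad (exp X) Y = Y.
Proof.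
move=> h.
have := cdiff0_cst (c := fun s : R => Ad (exp (s *: X)) Y) _ 1.
rewrite scale0r scale1r expG0 Ad1; apply => t.
have := Ad_exp_deriv X Y t; rewrite h.
by have [_ _ _ ->] := Ad_lin (exp (t *: X)).
Qed.

(** The curve [expR (- m s) *: Ad (exp (s X)) Y] has zero derivative, hence is constant. *)
Lemma Ad_exp_eigen X Y (m : R) : br X Y = m *: Y -> Ad (exp X) Y = expR m *: Y.
Proof.
move=> h.
pose c s := expR (- m * s) *: Ad (exp (s *: X)) Y.
have hc : c 1 = c 0.
  apply: cdiff0_cst => t.
  have d1 := Ad_exp_deriv X Y t; rewrite h in d1.
  have [_ _ lZ _] := Ad_lin (exp (t *: X)); rewrite lZ in d1.
  have d2 : cdiff (fun s : R => expR (- m * s) : R^o) t (- m * expR (- m * t)).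
    apply: is_derive_cdiff.
    have h1 : is_derive t (1 : R) (fun s : R => - m * s) (- m).
      apply: cdiff_is_derive => e ep; exists 1 => // s _.
      by rewrite -mulrBr [(s - t) *: _]mulrC subrr normr0 mulr_ge0 // ltW.
    have := is_derive1_comp (f := expR) (g := fun s => - m * s) (is_derive_expR _) h1.
    by rewrite mulrC.
  have d3 := cdiff_pair d2 d1.
  have hs : sdiff (fun p : R^o * V => p.1 *: p.2) (expR (- m * t), Ad (exp (t *: X)) Y)
    (fun p => p.1 *: Ad (exp (t *: X)) Y + expR (- m * t) *: p.2).
    apply: (@sdiff_scale _ _ _ (fun p : R^o * V => p.1) (fun p : R^o * V => p.2) _ (fun p => p.1) (fun p => p.2)).
      by apply: (@linear_sdiff _ _ _ _ 1) => // v; rewrite mul1r norm_pairE le_max lexx.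
    by apply: (@linear_sdiff _ _ _ _ 1) => // v; rewrite mul1r norm_pairE le_max lexx orbT.
  have := cdiff_comp d3 hs; rewrite /=.
  set a := expR (- m * t); set b := Ad _ Y.
  have -> : (- m * a) *: b + a *: (m *: b) = 0.
    by rewrite scalerA -scalerDl mulNr mulrC addNr scale0r.
  by [].
move: hc; rewrite /c mulr1 mulr0 expR0 !scale1r scale0r expG0 Ad1 expRN => hc.
have -> : Ad (exp X) Y = expR m *: ((expR m)^-1 *: Ad (exp X) Y).
  by rewrite scalerA divff ?scale1r // gt_eqF // expR_gt0.
by congr (_ *: _).
Qed.

Lemma expG_comm X Y : br X Y = 0 -> (exp X * exp Y = exp Y * exp X)%g.
Proof.
move=> h; have := expG_conj (exp X) Y; rewrite (Ad_exp_fix h) => e.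
by rewrite -[in RHS]e mulgVK.
Qed.

Lemma expG_addC X Y : br X Y = 0 -> exp (X + Y) = (exp X * exp Y)%g.
Proof.
move=> h.
have o : one_param (X + Y) (fun t : R => exp (t *: X) * exp (t *: Y))%g.
  have [t0 c0 d0] := tangent_mul (expG_tangent X) (expG_tangent Y).
  have [cX mX _] := (@expGP R n G X); have [cY mY _] := (@expGP R n G Y); split.
  - exact: cont_mul.
  - move=> s t; rewrite mX mY !mulgA; congr (_ * _)%g; rewrite -!mulgA; congr (_ * _)%g.
    by apply: expG_comm; rewrite lbrZl lbrZr h !scaler0.
  - exact: cdiff_is_derive.
by have := expG_one_param 1 o; rewrite !scale1r.
Qed.

Lemma Ad_exp_center X Z : (forall Y, br Z Y = 0) -> Ad (exp (X + Z)) =1 Ad (exp X).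
Proof.
move=> h Y; rewrite expG_addC ?AdM ?(Ad_exp_fix (h _)) //.
by rewrite lbrC h oppr0.
Qed.

Definition cont0 (f : V -> G) := forall O, nbhs (f 0) O -> \forall w \near (0 : V), O (f w).

Lemma cont0_mul (f g : V -> G) : cont0 f -> cont0 g -> cont0 (fun w => f w * g w)%g.
Proof.
move=> cf cg O /mul_near [[A B] [/= nA nB] AB].
have h1 := cf A nA; have h2 := cg B nB.
by move: h1 h2; apply: filterS2 => w a b; apply: (AB (_, _)).
Qed.

Lemma cont0_inv (f : V -> G) : cont0 f -> cont0 (fun w => (f w)^-1)%g.
Proof. by move=> cf O /inv_near hO; have := cf _ hO. Qed.

Lemma cont0_cst g : cont0 (fun=> g).
Proof. by move=> O /nbhs_singleton hO; apply/nbhs_norm_lt; exists 1. Qed.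

Lemma linear_cvg0 (M : V -> V) : linear M -> (exists K, forall v, `|M v| <= K * `|v|) ->
  sdiff M 0 M /\ M 0 = 0.
Proof.
move=> lM [K hK]; have sM := linear_sdiff 0 lM hK; split=> //.
by have [] := sdiff_lin sM.
Qed.

(* Near [h] every element is conjugate to some [h * exp Y] with [Y] in a
   complement [M2 V] of the image of [Ad h^-1 - 1]. *)
Lemma near_conj_exp (h : G) (M1 M2 : V -> V) (r : R) : linear M1 -> linear M2 ->
  (exists K, forall v, `|M1 v| <= K * `|v|) -> (exists K, forall v, `|M2 v| <= K * `|v|) ->
  (forall w, Ad (h^-1)%g (M1 w) - M1 w + M2 w = w) -> 0 < r ->
  \forall u \near h, exists x w, `|M2 w| < r /\ u = (x * (h * exp (M2 w)) * x^-1)%g.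
Proof.
move=> l1 l2 b1 b2 hM r0.
have [sM1 M10] := linear_cvg0 l1 b1; have [sM2 M20] := linear_cvg0 l2 b2.
have [cexp sexp] := @expG_facts R n G.
pose c e := phi 1%g (h^-1 * psi 1%g e * (h^-1)^-1)%g.
pose mu (p : V * V) := phi 1%g (psi 1%g p.1 * psi 1%g p.2)%g.
pose iot e := phi 1%g ((psi 1%g e)^-1)%g.
pose P1 (w : V) := e0 + M1 w.
have sP1 : sdiff P1 0 (fun w => 0 + M1 w) by apply: sdiff_add sM1; exact: sdiff_cst.
have P10 : P1 0 = e0 by rewrite /P1 M10 addr0.
have s2 : sdiff (c \o P1) 0 (Ad (h^-1)%g \o (fun w => 0 + M1 w)).
  by apply: sdiff_comp sP1 _; rewrite P10; exact: Ad_conj.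
have s3 : sdiff ((fun x => phi 1%g (exp x)) \o M2) 0 (id \o M2).
  by apply: sdiff_comp sM2 _; rewrite M20.
have v2 : (c \o P1) 0 = e0 by rewrite /= P10 /c psi_e0 mulg1 mulgV.
have v3 : ((fun x => phi 1%g (exp x)) \o M2) 0 = e0 by rewrite /= M20 expG0.
have s4 := sdiff_comp (g := mu) (M := fun p => p.1 + p.2) (sdiff_pair s2 s3).
rewrite v2 v3 in s4; have {}s4 := s4 (mu_sdiff G).
have s5 : sdiff (iot \o P1) 0 ((fun v => - v) \o (fun w => 0 + M1 w)).
  by apply: sdiff_comp sP1 _; rewrite P10; exact: iot_sdiffN.
have s6 := sdiff_comp (g := mu) (M := fun p => p.1 + p.2) (sdiff_pair s4 s5).
have v4 : (mu \o (fun e => ((c \o P1) e, ((fun x => phi 1%g (exp x)) \o M2) e))) 0 = e0.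
  rewrite [LHS]/(mu ((c \o P1) 0, ((fun x => phi 1%g (exp x)) \o M2) 0)) v2 v3 /mu /=.
  by rewrite psi_e0 mulg1.
have v5 : (iot \o P1) 0 = e0 by rewrite /= P10 /iot psi_e0 invg1.
rewrite v4 v5 in s6; have {}s6 := s6 (mu_sdiff G).
have v6 : (mu \o (fun e => ((mu \o (fun e => ((c \o P1) e, ((fun x => phi 1%g (exp x)) \o M2) e))) e, (iot \o P1) e))) 0 = e0.
  rewrite [LHS]/(mu ((mu \o (fun e => ((c \o P1) e, ((fun x => phi 1%g (exp x)) \o M2) e))) 0, (iot \o P1) 0)) v4 v5 /mu /=.
  by rewrite psi_e0 mulg1.
(* With [x = psi (e0 + M1 w)], the composite is [h^-1 x h exp (M2 w) x^-1] in the chart at 1. Its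
   differential [w |-> Ad h^-1 (M1 w) + M2 w - M1 w] is the identity by [hM], so every [h^-1 u] near
   1 is attained. *)
have hsurj := sdiff_surj s6 (M := id).
pose X w := psi 1%g (P1 w).
have X0 : X 0 = 1%g by rewrite /X P10 psi_e0.
have cX : cont0 X.
  move=> O; rewrite X0 => hO.
  have h1 : \forall e \near e0, O (psi 1%g e).
    by have := near_psi hO; apply: filterS => e [].
  have h2 : P1 @ (0 : V) --> e0 by rewrite -[X in _ --> X]P10; exact: sdiff_cont sP1.
  exact: (h2 _ h1).
have cE : cont0 (fun w => exp (M2 w)).
  move=> O; rewrite M20 expG0 => hO.
  have h2 := sdiff_cont sM2.
  have h3 : nbhs (exp (M2 0)) O by rewrite M20 expG0.
  exact: (h2 _ (cont_near (cexp (M2 0)) h3)).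
have dn := dom_nbhs (dom_center (1%g : G)).
have cA : cont0 (fun w => h^-1 * X w * (h^-1)^-1)%g.
  by apply: cont0_mul; [apply: cont0_mul => //; exact: cont0_cst|exact: cont0_cst].
have cB := cont0_mul cA cE.
have cC := cont0_inv cX.
have cD := cont0_mul cB cC.
have n1 := cA (dom 1%g) ltac:(by rewrite /= X0 mulg1 mulgV).
have n2 := cE (dom 1%g) ltac:(by rewrite /= M20 expG0).
have n3 := cB (dom 1%g) ltac:(by rewrite /= X0 M20 expG0 !mulg1 mulgV).
have n4 := cC (dom 1%g) ltac:(by rewrite /= X0 invg1).
have n5 := cD (dom 1%g) ltac:(by rewrite /= X0 M20 expG0 invg1 !mulg1 mulgV).
have n6 : \forall w \near (0 : V), `|M2 w| < r.
  have h2 : M2 @ (0 : V) --> (0 : V) by rewrite -[X in _ --> X]M20; exact: sdiff_cont sM2.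
  have n6 : nbhs (0 : V) [set v : V | `|v| < r].
    by apply/nbhs_norm_lt; exists r => // y; rewrite subr0.
  exact: (h2 _ n6).
have [d1 d1p g1] := (nbhs_norm_lt (0 : V) _).1 (filterI (filterI n1 n2) (filterI (filterI n3 n4) (filterI n5 n6))).
have [|||d d0 hd] := hsurj _ _ _ d1 d1p.
- by move=> a u v.
- by exists 1 => v; rewrite mul1r.
- move=> w /=; rewrite add0r -[RHS]hM addrAC.
  by [].
have n7 : \forall u \near h, dom 1%g (h^-1 * u)%g /\ `|phi 1%g (h^-1 * u)%g - e0| < d.
  have nO : nbhs (h^-1 * h)%g [set y | dom 1%g y /\ `|phi 1%g y - e0| < d].
    rewrite mulVg.
    have q : nbhs e0 [set v | `|v - e0| < d] by apply/nbhs_norm_lt; exists d.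
    have := cont_near (phi_cont (dom_center (1%g : G))) q => q2.
    by move: dn q2; apply: filterS2.
  exact: (cont_near (@cont_mull R n G (h^-1)%g h) nO).
move: n7; apply: filterS => u [du hu].
have [|w hw ew] := hd (phi 1%g (h^-1 * u)%g); first by rewrite v6.
have [[m1 m2] [[m3 m4] [m5 m6]]] := g1 w hw.
exists (X w), w; split=> //.
have : (h^-1 * u)%g = (h^-1 * X w * (h^-1)^-1 * exp (M2 w) * (X w)^-1)%g.
  rewrite -(phiK du) -ew /= /mu /=.
  by rewrite /c /iot -/(X w) !phiK.
move/(congr1 (fun y => h * y)%g); rewrite mulgA mulgV mul1g => ->.
by rewrite invgK !mulgA mulgV mul1g.
Qed.

End LieAlgebraFacts.

(** * Complex Lie algebras with a positive involution *)

Section DefinableSubspaces.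
Context {F : fieldType} {V : vectType F}.

Definition lin_closed (P : V -> Prop) :=
  P 0 /\ forall a x y, P x -> P y -> P (a *: x + y).

(** A subspace of maximal dimension inside [P] exhausts it: a further vector of [P] would enlarge
    it. *)
Lemma vspace_of (P : V -> Prop) : lin_closed P ->
  exists U : {vspace V}, forall x, x \in U <-> P x.
Proof.
move=> [P0 PD].
have PU (U : {vspace V}) x : (forall y, y \in U -> P y) -> P x -> forall y, y \in (U + <[x]>)%VS -> P y.
  move=> hU Px y /memv_addP [u uU [w /vlineP [k ->] ->]].
  by rewrite addrC; apply: PD => //; exact: hU.
pose Q (k : nat) := exists2 U : {vspace V}, (forall y, y \in U -> P y) & \dim U = k.
have Q0 : Q 0%N.
  by exists 0%VS; [move=> y; rewrite memv0 => /eqP ->|rewrite dimv0].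
have bQ k : `[< Q k >] -> (k <= \dim {: V})%N.
  by move=> /asboolP [U _ <-]; rewrite dimvS // subvf.
have [k /asboolP [U hU dU] kmax] := ex_maxnP (ex_intro _ 0%N (asboolT Q0)) bQ.
exists U => x; split; first exact: hU.
move=> Px; apply: contrapT => /negP xU.
have := kmax (\dim (U + <[x]>)%VS) (asboolT (ex_intro2 _ _ _ (PU U x hU Px) erefl)).
rewrite leqNgt dimv_disjoint_sum.
  have x0 : x != 0 by apply: contraNneq xU => ->; exact: mem0v.
  by rewrite dim_vline x0 dU addn1 ltnS leqnn.
apply/eqP; rewrite -subv0; apply/subvP => y /memv_capP [yU /vlineP [a ya]].
rewrite memv0 ya; have [->|a0] := eqVneq a 0; first by rewrite scale0r.
case/negP: xU; have -> : x = a^-1 *: y by rewrite ya scalerA mulVf // scale1r.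
by rewrite memvZ.
Qed.

(** The value is controlled by [P] only when [P] is [lin_closed]; if no subspace fits, it is the
    default 0. *)
Definition mkvs (P : V -> Prop) : {vspace V} :=
  xget 0%VS [set U : {vspace V} | forall x, x \in U <-> P x]%classic.

Lemma mem_mkvs (P : V -> Prop) : lin_closed P -> forall x, x \in mkvs P <-> P x.
Proof.
move=> /vspace_of [U hU] x; rewrite /mkvs; case: xgetP => [W _ /(_ x) //|].
by move=> /(_ U).
Qed.

Lemma subvPP (U W : {vspace V}) : (forall x, x \in U -> x \in W) -> (U <= W)%VS.
Proof. by move=> h; apply/subvP. Qed.

Lemma eqvPP (U W : {vspace V}) : (forall x, x \in U <-> x \in W) -> U = W.
Proof. by move=> h; apply/vspaceP => x; apply/idP/idP => /h. Qed.

End DefinableSubspaces.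

Section Brackets.
Context {F : fieldType} {V : vectType F} (br : V -> V -> V).
Context (brl : forall z a x y, br (a *: x + y) z = a *: br x z + br y z).
Context (brr : forall z a x y, br z (a *: x + y) = a *: br z x + br z y).
Implicit Types (U W X : {vspace V}).

Lemma br0l z : br 0 z = 0.
Proof. by have := brl z (-1) 0 0; rewrite scaler0 addr0 scaleN1r addNr. Qed.

Lemma br0r z : br z 0 = 0.
Proof. by have := brr z (-1) 0 0; rewrite scaler0 addr0 scaleN1r addNr. Qed.

Lemma brDl x y z : br (x + y) z = br x z + br y z.
Proof. by have := brl z 1 x y; rewrite !scale1r. Qed.

Lemma brDr x y z : br z (x + y) = br z x + br z y.
Proof. by have := brr z 1 x y; rewrite !scale1r. Qed.

Lemma brZl a x z : br (a *: x) z = a *: br x z.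
Proof. by have := brl z a x 0; rewrite br0l !addr0. Qed.

Lemma brZr a x z : br z (a *: x) = a *: br z x.
Proof. by have := brr z a x 0; rewrite br0r !addr0. Qed.

Lemma brNl x z : br (- x) z = - br x z.
Proof. by rewrite -scaleN1r brZl scaleN1r. Qed.

Lemma brNr x z : br z (- x) = - br z x.
Proof. by rewrite -scaleN1r brZr scaleN1r. Qed.

Lemma br_suml I (r : seq I) (P : pred I) f z :
  br (\sum_(i <- r | P i) f i) z = \sum_(i <- r | P i) br (f i) z.
Proof. by elim/big_rec2: _ => [|i u v _ <-]; rewrite ?br0l // brDl. Qed.

Lemma br_sumr I (r : seq I) (P : pred I) f z :
  br z (\sum_(i <- r | P i) f i) = \sum_(i <- r | P i) br z (f i).
Proof. by elim/big_rec2: _ => [|i u v _ <-]; rewrite ?br0r // brDr. Qed.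

Lemma vbasis_mem_ind U (Q : V -> Prop) : lin_closed Q ->
  (forall x, x \in vbasis U -> Q x) -> forall x, x \in U -> Q x.
Proof.
move=> [Q0 QD] h x /coord_vbasis ->.
elim/big_rec: _ => // i y _ Qy; apply: QD => //; apply: h.
by apply: mem_nth; rewrite size_tuple.
Qed.

Lemma mem_brv U W x y : x \in U -> y \in W -> br x y \in brv br U W.
Proof.
move=> xU yW; apply: (@vbasis_mem_ind U (fun x => br x y \in brv br U W)) xU.
  split=> [|a u v hu hv]; first by rewrite br0l mem0v.
  by rewrite brl memvD // memvZ.
move=> u hu; apply: (@vbasis_mem_ind W (fun y => br u y \in brv br U W)) yW.
  split=> [|a v w hv hw]; first by rewrite br0r mem0v.
  by rewrite brr memvD // memvZ.
move=> w hw; rewrite /brv memv_span //.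
exact: (allpairs_f (fun x y => br x y) hu hw).
Qed.

Lemma brv_sub U W X : (forall x y, x \in U -> y \in W -> br x y \in X) ->
  (brv br U W <= X)%VS.
Proof.
move=> h; apply/span_subvP => z /allpairsP [[x y] [/= hx hy ->]].
by apply: h; exact: vbasis_mem.
Qed.

Lemma brv_subP U W X : (brv br U W <= X)%VS ->
  forall x y, x \in U -> y \in W -> br x y \in X.
Proof. by move=> /subvP h x y xU yW; apply: h; exact: mem_brv. Qed.

Lemma brv_mono U U' W W' : (U <= U')%VS -> (W <= W')%VS -> (brv br U W <= brv br U' W')%VS.
Proof.
move=> /subvP h1 /subvP h2; apply: brv_sub => x y /h1 xU /h2 yW; exact: mem_brv.
Qed.

Lemma iter_brv_mono k U W : (U <= W)%VS ->
  (iter k (fun W => brv br W W) U <= iter k (fun W => brv br W W) W)%VS.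
Proof. by move=> h; elim: k => //= k IH; exact: brv_mono. Qed.

Lemma solvable_sub U W : (U <= W)%VS -> lie_solvable br W -> lie_solvable br U.
Proof.
move=> h [k hk]; exists k; apply/eqP.
by rewrite -subv0 -[X in (_ <= X)%VS]hk iter_brv_mono.
Qed.

Lemma solvable_ext U W k : (iter k (fun W => brv br W W) U <= W)%VS ->
  lie_solvable br W -> lie_solvable br U.
Proof.
move=> h [j hj]; exists (j + k)%N; apply/eqP.
by rewrite iterD -subv0 -[X in (_ <= X)%VS]hj iter_brv_mono.
Qed.

Lemma solvable_brv U W : (brv br U U <= W)%VS -> lie_solvable br W -> lie_solvable br U.
Proof. by move=> h; apply: (@solvable_ext _ _ 1%N). Qed.

Lemma solvable0 : lie_solvable br 0%VS. Proof. by exists 0%N. Qed.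

End Brackets.

Notation "x ^*" := (Num.conj_op x) : ring_scope.

Section StarLie.
Context {C : numClosedFieldType} {V : vectType C}.

(* [sl_star] is the conjugate-linear antiautomorphism [- theta o conj] of a
   complex reductive Lie algebra; [ad (z^* )] is adjoint to [ad z] for the
   hermitian form [sl_form]. *)
Record star_lie := StarLie {
  sl_br : V -> V -> V;
  sl_form : V -> V -> C;
  sl_star : V -> V;
  sl_brl : forall z a x y, sl_br (a *: x + y) z = a *: sl_br x z + sl_br y z;
  sl_brr : forall z a x y, sl_br z (a *: x + y) = a *: sl_br z x + sl_br z y;
  sl_brxx : forall x, sl_br x x = 0;
  sl_jac : forall x y z, sl_br x (sl_br y z) = sl_br (sl_br x y) z + sl_br y (sl_br x z);
  sl_forml : forall z a x y, sl_form (a *: x + y) z = a * sl_form x z + sl_form y z;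
  sl_formC : forall x y, sl_form y x = (sl_form x y)^*;
  sl_form_gt0 : forall x, x != 0 -> 0 < sl_form x x;
  sl_starl : forall a x y, sl_star (a *: x + y) = a^* *: sl_star x + sl_star y;
  sl_starK : forall x, sl_star (sl_star x) = x;
  sl_star_br : forall x y, sl_star (sl_br x y) = sl_br (sl_star y) (sl_star x);
  sl_adj : forall x y z, sl_form (sl_br z x) y = sl_form x (sl_br (sl_star z) y) }.

Context (L : star_lie).
Notation br := (sl_br L).
Notation H := (sl_form L).
Notation st := (sl_star L).
Implicit Types (U W X l m : {vspace V}).

Let brl := @sl_brl L.
Let brr := @sl_brr L.

Lemma brC x y : br x y = - br y x.
Proof.
have := sl_brxx L (x + y); rewrite (brDl brl) !(brDr brr) !sl_brxx add0r addr0.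
by move/eqP; rewrite addr_eq0 => /eqP.
Qed.

Lemma form0l y : H 0 y = 0.
Proof. by have := sl_forml L y (-1) 0 0; rewrite scaler0 addr0 mulN1r addNr. Qed.

Lemma form0r y : H y 0 = 0.
Proof. by rewrite sl_formC form0l conjC0. Qed.

Lemma formDl x y z : H (x + y) z = H x z + H y z.
Proof. by have := sl_forml L z 1 x y; rewrite scale1r mul1r. Qed.

Lemma formZl a x z : H (a *: x) z = a * H x z.
Proof. by have := sl_forml L z a x 0; rewrite form0l !addr0. Qed.

Lemma formDr x y z : H z (x + y) = H z x + H z y.
Proof. by rewrite sl_formC formDl rmorphD /= -!sl_formC. Qed.

Lemma formZr a x z : H z (a *: x) = a^* * H z x.
Proof. by rewrite sl_formC formZl rmorphM /= -!sl_formC. Qed.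

Lemma formBl x y z : H (x - y) z = H x z - H y z.
Proof. by rewrite addrC -[- y]scaleN1r sl_forml mulN1r addrC. Qed.

Lemma formBr x y z : H z (x - y) = H z x - H z y.
Proof. by rewrite sl_formC formBl rmorphB /= -!sl_formC. Qed.

Lemma form_eq0 x : H x x = 0 -> x = 0.
Proof.
by move=> h; apply: contrapT => /eqP /(sl_form_gt0 L); rewrite h ltxx.
Qed.

Lemma form_ge0 x : 0 <= H x x.
Proof.
by have [->|/(sl_form_gt0 L)/ltW //] := eqVneq x 0; rewrite form0l.
Qed.

Lemma star0 : st 0 = 0.
Proof. by have := sl_starl L (-1) 0 0; rewrite scaler0 addr0 rmorphN1 scaleN1r addNr. Qed.

Lemma starD x y : st (x + y) = st x + st y.
Proof. by have := sl_starl L 1 x y; rewrite conjC1 !scale1r. Qed.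

Lemma starZ a x : st (a *: x) = a^* *: st x.
Proof. by have := sl_starl L a x 0; rewrite star0 !addr0. Qed.

Definition star_closed U := forall x, x \in U -> st x \in U.

Definition orthv (a l : {vspace V}) := mkvs (fun y => y \in l /\ forall x, x \in a -> H y x = 0).

Lemma mem_orthv (a l : {vspace V}) y : y \in orthv a l <-> y \in l /\ forall x, x \in a -> H y x = 0.
Proof.
apply: mem_mkvs; split=> [|k u v [ul hu] [vl hv]].
  by split; [exact: mem0v|move=> x _; exact: form0l].
split; first by rewrite memvD // memvZ.
by move=> x xa; rewrite sl_forml hu // hv // mulr0 addr0.
Qed.

Lemma orthv_cap (a l : {vspace V}) : (a :&: orthv a l = 0)%VS.
Proof.
apply/eqP; rewrite -subv0; apply/subvP => x /memv_capP [xa /mem_orthv [_ h]].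
by rewrite memv0; apply/eqP; apply: form_eq0; exact: h.
Qed.

(** Pairing with a basis of [a] is injective on [a] by definiteness, hence onto by dimension count;
    so the pairing of any [x] is that of some [p] in [a], and [x - p] is orthogonal to [a]. *)
Lemma orthv_add (a l : {vspace V}) : (a <= l)%VS -> (a + orthv a l = l)%VS.
Proof.
move=> al; apply: eqvPP => x; split.
  move=> /memv_addP [u ua [w /mem_orthv [wl _] ->]].
  by rewrite memvD // (subvP al).
move=> xl; pose k := \dim a.
pose f (y : V) : 'rV[C]_k := \row_i H y (vbasis a)`_i.
have flin : linear f.
  by move=> t u v; apply/rowP => i; rewrite !mxE sl_forml.
pose fl : {linear V -> 'rV[C]_k} := HB.pack f (GRing.isLinear.Build _ _ _ _ f flin).
have fE y : linfun fl y = f y by rewrite lfunE.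
have f0 y : f y = 0 -> forall z, z \in a -> H y z = 0.
  move=> h z za; rewrite (coord_vbasis za).
  elim/big_rec: _ => [|i w _ hw]; first exact: form0r.
  rewrite formDr formZr hw addr0.
  by move/rowP: h => /(_ i); rewrite !mxE => ->; rewrite mulr0.
have inj : (a :&: lker (linfun fl) = 0)%VS.
  apply/eqP; rewrite -subv0; apply/subvP => y /memv_capP [ya].
  rewrite memv_ker fE memv0 => /eqP h; apply/eqP; apply: form_eq0.
  exact: f0.
have full : (linfun fl @: a = fullv)%VS.
  apply/eqP; rewrite eqEdim subvf /= dimvf (limg_dim_eq inj).
  by rewrite /dim /= mul1n.
have : f x \in (linfun fl @: a)%VS by rewrite full memvf.
move=> /memv_imgP [p pa]; rewrite fE => fp.
rewrite -[x](subrK p) addrC memv_add //; apply/mem_orthv; split.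
  by rewrite memvB // (subvP al).
apply: f0; have -> : f (x - p) = f x - f p by rewrite addrC -scaleN1r flin scaleN1r addrC.
by rewrite fp subrr.
Qed.

Definition subalg U := forall x y, x \in U -> y \in U -> br x y \in U.
Definition idealP j U := (j <= U)%VS /\ forall x y, x \in U -> y \in j -> br x y \in j.

Lemma subalgP U : lie_subalg br U <-> subalg U.
Proof.
split=> [/(brv_subP brl brr)|h]; first by [].
exact: brv_sub.
Qed.

Lemma idealPP j U : lie_ideal br j U <-> idealP j U.
Proof.
split=> [[h1 /(brv_subP brl brr) h2]|[h1 h2]]; split=> //.
exact: brv_sub.
Qed.

(** The adjoint of [ad x] is [ad (st x)], and [st x] stays in [l]; so orthogonality to an ideal is
    preserved by [ad x]. *)
Lemma orthv_ideal j l : subalg l -> star_closed l -> idealP j l -> idealP (orthv j l) l.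
Proof.
move=> sl cl [jl hj]; split=> [|x y xl /mem_orthv [yl hy]].
  by apply: subvPP => x /mem_orthv [].
apply/mem_orthv; split; first exact: sl.
by move=> z zj; rewrite sl_adj hy // hj // cl.
Qed.

Lemma star_reductive l : subalg l -> star_closed l -> lie_reductive br l.
Proof.
move=> sl cl; split; first exact/subalgP.
move=> j /idealPP hj; exists (orthv j l); first exact/idealPP/orthv_ideal.
by rewrite orthv_cap orthv_add //; case: hj.
Qed.

Definition centv l := mkvs (fun x => x \in l /\ forall y, y \in l -> br x y = 0).

Lemma mem_centv l x : x \in centv l <-> x \in l /\ forall y, y \in l -> br x y = 0.
Proof.
apply: mem_mkvs; split=> [|k u v [ul hu] [vl hv]].
  by split; [exact: mem0v|move=> y _; exact: br0l brl y].
split; first by rewrite memvD // memvZ.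
by move=> y yl; rewrite sl_brl hu // hv // scaler0 addr0.
Qed.

Lemma brv_ideal l : subalg l -> idealP (brv br l l) l.
Proof.
move=> sl; split; first by apply/subalgP.
by move=> x y xl yl; apply: mem_brv => //; apply: (subvP _ _ yl); apply/subalgP.
Qed.

(** The derived algebra and its orthogonal complement are both ideals of [l], so brackets of [l]
    with the complement lie in their zero intersection: the complement is central. *)
Lemma star_split l : subalg l -> star_closed l ->
  forall x, x \in l -> exists2 z, z \in centv l & x - z \in brv br l l.
Proof.
move=> sl cl x xl.
have hi := brv_ideal sl.
have : x \in (brv br l l + orthv (brv br l l) l)%VS by rewrite orthv_add //; case: hi.
move=> /memv_addP [y yb [z zo xE]]; exists z; last by rewrite xE addrK.
have [_ ho] := orthv_ideal sl cl hi.
have /mem_orthv [zl _] := zo.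
apply/mem_centv; split=> // w wl.
have h1 : br z w \in brv br l l by exact: mem_brv.
have h2 : br z w \in orthv (brv br l l) l by rewrite brC memvN ho.
by apply/eqP; rewrite -memv0 -(orthv_cap (brv br l l) l) memv_cap h1.
Qed.

(** By [star_split] the entries of a bracket may be replaced by their components in the derived
    algebra, since central components do not contribute. *)
Lemma brv_perfect l : subalg l -> star_closed l ->
  (brv br l l <= brv br (brv br l l) (brv br l l))%VS.
Proof.
move=> sl cl; apply: brv_sub => x y xl yl.
have [z /mem_centv [zl hz] xz] := star_split sl cl xl.
have [w /mem_centv [wl hw] yw] := star_split sl cl yl.
have -> : br x y = br (x - z) (y - w).
  rewrite (brDl brl) (brNl brl) (brDr brr) (brDr brr _ _ z) !(brNr brr).
  by rewrite [br x w]brC (hw _ xl) (hz _ yl) (hz _ wl) !(oppr0, subr0, addr0).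
exact: mem_brv.
Qed.

Lemma star_solvable_abelian l : subalg l -> star_closed l -> lie_solvable br l ->
  forall x y, x \in l -> y \in l -> br x y = 0.
Proof.
move=> sl cl [k hk] x y xl yl.
have h j : (brv br l l <= iter j (fun W => brv br W W) l)%VS.
  elim: j => [|j IH]; first exact/subalgP.
  by rewrite iterS (subv_trans (brv_perfect sl cl)) // brv_mono.
have := subvP (h k) _ (mem_brv brl brr xl yl).
by rewrite hk memv0 => /eqP.
Qed.

(** The square norm of [br x y] is the pairing of [y] with the bracket of [st x] and [br x y], two
    elements of the abelian [j]. *)
Lemma star_abelian_ideal_central j l : star_closed j -> idealP j l ->
  (forall x y, x \in j -> y \in j -> br x y = 0) ->
  forall x y, x \in j -> y \in l -> br x y = 0.
Proof.
move=> cj [jl hj] ha x y xj yl; apply: form_eq0.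
rewrite sl_adj ha ?form0r //; first exact: cj.
by rewrite brC memvN hj.
Qed.

(** A solvable ideal need not be star-closed, but [j + centv l] is: in the splitting of [st x] along
    [j] and its complement, the second component [w] commutes with [j], and the norm of [br w y2]
    vanishes because [x] commutes with the complement. The enlarged ideal is solvable and
    star-closed, hence abelian, hence central. *)
Lemma star_solvable_ideal_central j l : subalg l -> star_closed l -> idealP j l ->
  lie_solvable br j -> forall x y, x \in j -> y \in l -> br x y = 0.
Proof.
move=> sl cl hj sj.
have [jl jI] := hj; have [ol oI] := orthv_ideal sl cl hj.
have jo x y : x \in j -> y \in orthv j l -> br x y = 0.
  move=> xj yo; apply/eqP; rewrite -memv0 -(orthv_cap j l) memv_cap.
  rewrite {1}brC memvN jI ?(subvP ol) //=.
  by apply: oI => //; exact: (subvP jl).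
have lE x : x \in l -> exists u, exists2 w, u \in j /\ w \in orthv j l & x = u + w.
  by rewrite -{1}(orthv_add jl) => /memv_addP [u uj [w wo ->]]; exists u, w.
have starj x : x \in j -> exists2 u, u \in j & st x - u \in centv l.
  move=> xj; have [u [w [uj wo] xE]] := lE _ (cl _ (subvP jl _ xj)).
  exists u => //; rewrite xE addrC addKr.
  have wl := subvP ol _ wo.
  apply/mem_centv; split=> // y yl.
  have [y1 [y2 [y1j y2o] ->]] := lE y yl.
  rewrite (brDr brr) brC (jo _ _ y1j wo) oppr0 add0r.
  have b1 : br (st x) y2 = br w y2 by rewrite xE (brDl brl) (jo _ _ uj y2o) add0r.
  apply: form_eq0; rewrite -{1}b1 sl_adj sl_starK (jo x) ?form0r //.
  by apply: oI.
pose e := (j + centv l)%VS.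
have cc : star_closed (centv l).
  move=> x /mem_centv [xl hx]; apply/mem_centv; split; first exact: cl.
  move=> y yl; rewrite -[y](sl_starK L) -sl_star_br brC hx ?oppr0 ?star0 //.
  exact: cl.
have ce : star_closed e.
  move=> x /memv_addP [u uj [w wc ->]]; rewrite starD.
  have [u' u'j hu] := starj u uj.
  rewrite -[st u](subrK u') -addrA addrCA memv_add //.
  by rewrite memvD // cc.
have ie : idealP e l.
  split.
    rewrite subv_add jl /=; apply: subvPP => x /mem_centv [] //.
  move=> x y xl /memv_addP [u uj [w /mem_centv [wl hw] ->]].
  by rewrite (brDr brr) [br x w]brC hw // oppr0 addr0 (subvP (addvSl _ _)) // jI.
have se : subalg e.
  by move=> x y xe ye; have [el eI] := ie; apply: eI => //; exact: (subvP el).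
have sole : lie_solvable br e.
  apply: solvable_brv sj => //; apply: brv_sub => x y.
  move=> /memv_addP [u uj [w /mem_centv [wl hw] ->]] /memv_addP [u' u'j [w' /mem_centv [w'l hw'] ->]].
  have u'l := subvP jl _ u'j; have ul := subvP jl _ uj.
  rewrite (brDl brl) !(brDr brr) !(hw _ _) // ![br u w']brC hw' // oppr0 !addr0.
  by rewrite jI.
have ae := star_solvable_abelian se ce sole.
move=> x y xj yl; apply: (star_abelian_ideal_central ce ie ae) => //.
by apply: (subvP (addvSl _ _)).
Qed.

End StarLie.

(** * Parabolic and Borel subalgebras of a self-adjoint element *)

Section Triangular.
Context {C : numClosedFieldType} {V : vectType C} (L : @star_lie C V).
Notation br := (sl_br L).
Notation H := (sl_form L).
Notation st := (sl_star L).
Let brl := @sl_brl _ _ L.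
Let brr := @sl_brr _ _ L.
Context {N : nat} (v : 'I_N -> V) (co : 'I_N -> V -> C).
Context (coE : forall x, x = \sum_i co i x *: v i).
Context (co_lin : forall i a x y, co i (a *: x + y) = a * co i x + co i y).
Context (cov : forall i j, co i (v j) = (i == j)%:R).
Implicit Types (A B S : pred 'I_N) (U W : {vspace V}).

(** Encoded by vanishing coordinates, so that intersections, sums and gradings become conditions on
    indices. *)
Definition spanv S := mkvs (fun x => forall i, ~~ S i -> co i x = 0).

Lemma co0 i : co i 0 = 0.
Proof. by have := co_lin i (-1) 0 0; rewrite scaler0 addr0 mulN1r addNr. Qed.

Lemma coD i x y : co i (x + y) = co i x + co i y.
Proof. by have := co_lin i 1 x y; rewrite scale1r mul1r. Qed.

Lemma coZ i a x : co i (a *: x) = a * co i x.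
Proof. by have := co_lin i a x 0; rewrite co0 !addr0. Qed.

Lemma mem_spanv S x : x \in spanv S <-> forall i, ~~ S i -> co i x = 0.
Proof.
apply: mem_mkvs; split=> [i _|a u w hu hw i Si]; first exact: co0.
by rewrite co_lin hu // hw // mulr0 addr0.
Qed.

Lemma spanv_v S i : S i -> v i \in spanv S.
Proof.
move=> Si; apply/mem_spanv => j; rewrite cov.
by case: eqP => // -> /negP.
Qed.

Lemma spanv_ind S (Q : V -> Prop) : lin_closed Q -> (forall i, S i -> Q (v i)) ->
  forall x, x \in spanv S -> Q x.
Proof.
move=> [Q0 QD] h x /mem_spanv hx; rewrite (coE x).
elim/big_rec: _ => // i y _ Qy.
have [Si|/hx ->] := boolP (S i); first by apply: QD => //; exact: h.
by rewrite scale0r add0r.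
Qed.

Lemma spanv_cap A S : (spanv A :&: spanv S)%VS = spanv (predI A S).
Proof.
apply: eqvPP => x; split.
  move=> /memv_capP [/mem_spanv h1 /mem_spanv h2]; apply/mem_spanv => i /=.
  by rewrite negb_and => /orP[/h1|/h2].
move=> /mem_spanv h; rewrite memv_cap; apply/andP; split; apply/mem_spanv => i Ai; apply: h => /=.
  by rewrite (negbTE Ai).
by rewrite (negbTE Ai) andbF.
Qed.

Lemma spanv_mono A S : {subset A <= S} -> (spanv A <= spanv S)%VS.
Proof.
move=> h; apply: subvPP => x /mem_spanv hx; apply/mem_spanv => i Si; apply: hx.
by apply: contraNN Si; exact: (h i).
Qed.

Lemma spanv_add A B S : (forall i, S i = A i || B i) -> (spanv A + spanv B = spanv S)%VS.
Proof.
move=> h; apply: eqvPP => x; split.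
  move=> /memv_addP [a /mem_spanv ha [b /mem_spanv hb ->]]; apply/mem_spanv => i.
  by rewrite h negb_or coD => /andP[/ha -> /hb ->]; rewrite addr0.
move=> /(spanv_ind (Q := fun x => x \in (spanv A + spanv B)%VS)); apply.
  by split=> [|k y z hy hz]; [exact: mem0v|rewrite memvD // memvZ].
move=> i; rewrite h => /orP[Ai|Bi].
  by apply: (subvP (addvSl _ _)); exact: spanv_v.
by apply: (subvP (addvSr _ _)); exact: spanv_v.
Qed.

Lemma spanv_sub S U : (forall i, S i -> v i \in U) -> (spanv S <= U)%VS.
Proof.
move=> h; apply: subvPP => x; apply: (spanv_ind (Q := fun x => x \in U)) => //.
by split=> [|k y z hy hz]; [exact: mem0v|rewrite memvD // memvZ].
Qed.

Context (D : V) (d : 'I_N -> C).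
Context (starD : st D = D).
Context (dreal : forall i, d i \is Num.real).
Context (brD : forall i, br D (v i) = d i *: v i).

Lemma co_brD i x : co i (br D x) = d i * co i x.
Proof.
rewrite {1}(coE x) (br_sumr brr).
have -> : d i * co i x = \sum_j co i (br D (co j x *: v j)).
  rewrite (bigD1 i) //= big1 ?addr0; last first.
    move=> j ji; rewrite (brZr brr) brD !coZ cov eq_sym (negbTE ji).
    by rewrite !mulr0.
  by rewrite (brZr brr) brD !coZ cov eqxx mulr1 mulrC.
elim/big_rec2: _ => [|j y z _ <-]; first exact: co0.
by rewrite coD.
Qed.

Lemma eigen_co c x i : br D x = c *: x -> co i x != 0 -> d i = c.
Proof.
by move=> h ci; have := co_brD i x; rewrite h coZ => /(mulIf ci).
Qed.

Lemma spanv_stable S x : x \in spanv S -> br D x \in spanv S.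
Proof. by move=> /mem_spanv h; apply/mem_spanv => i /h; rewrite co_brD => ->; rewrite mulr0. Qed.

(** [ad D] is a derivation, so eigenvalues add under the bracket. *)
Lemma br_graded A B S : (forall i j k, A i -> B j -> d k = d i + d j -> S k) ->
  forall x y, x \in spanv A -> y \in spanv B -> br x y \in spanv S.
Proof.
move=> h x y xA yB.
apply: (spanv_ind (Q := fun x => br x y \in spanv S)) xA.
  split=> [|k u w hu hw]; first by rewrite (br0l brl) mem0v.
  by rewrite brl memvD // memvZ.
move=> i Ai; apply: (spanv_ind (Q := fun y => br (v i) y \in spanv S)) yB.
  split=> [|k u w hu hw]; first by rewrite (br0r brr) mem0v.
  by rewrite brr memvD // memvZ.
move=> j Bj; apply/mem_spanv => k; apply: contraNeq => ck; apply: (h i j) => //.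
apply: eigen_co ck; rewrite sl_jac !brD (brZl brl) (brZr brr) -scalerDl.
by [].
Qed.

Lemma real_argmin (P : pred 'I_N) i1 : P i1 -> exists2 i0, P i0 & forall j, P j -> d i0 <= d j.
Proof.
move=> Pi1; pose f i := #|[pred j | P j && (d j < d i)]|.
case: (arg_minnP f Pi1) => i0 Pi0 hmin; exists i0 => // j Pj.
rewrite real_leNgt //; apply/negP => ji.
have := hmin j Pj; rewrite leqNgt => /negP; apply.
apply: proper_card; apply/properP; split.
  by apply/fintype.subsetP => k; rewrite !inE => /andP[-> /lt_trans -> //].
by exists j; rewrite !inE Pj ?ji // ltxx.
Qed.

(** If [d i0] is the smallest eigenvalue above [t], a bracket of two such eigenvectors has
    eigenvalue above [d i0], as both summands are positive. So the derived algebra loses at least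
    the index [i0], and induction on the number of indices ends. *)
Lemma spanv_pos_solvable t : 0 <= t -> lie_solvable br (spanv (fun i => t < d i)).
Proof.
move: {2}_.+1 (ltnSn #|[pred i | t < d i]|) => k.
elim: k t => // k IH t kt t0.
have [i1 hi1|no] := pickP [pred i | t < d i]; last first.
  have -> : spanv (fun i => t < d i) = 0%VS.
    apply/eqP; rewrite -subv0; apply: spanv_sub => i ti.
    by have := no i; rewrite /= ti.
  exact: solvable0.
have [i0 hi0 hmin] := @real_argmin [pred i | t < d i] i1 hi1.
have d0 : 0 <= d i0 by rewrite (le_trans t0) // ltW.
apply: (@solvable_brv _ _ br brl brr _ (spanv (fun i => d i0 < d i))).
  apply: brv_sub; apply: br_graded => i j m ti tj ->.
  rewrite (le_lt_trans (hmin i ti)) // ltrDl.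
  exact: le_lt_trans t0 tj.
apply: IH => //; rewrite -ltnS; apply: leq_trans kt; rewrite ltnS.
apply: proper_card; apply/properP; split.
  by apply/fintype.subsetP => m; rewrite !inE; apply: lt_trans.
by exists i0; rewrite !inE ?ltxx.
Qed.

Notation q := (spanv (fun i => 0 <= d i)).
Notation l := (spanv (fun i => d i == 0)).
Notation u := (spanv (fun i => 0 < d i)).
Notation um := (spanv (fun i => d i < 0)).

Lemma mem_l x : x \in l <-> br D x = 0.
Proof.
split.
  move=> /mem_spanv h; rewrite (coE (br D x)) big1 // => i _; rewrite co_brD.
  by have [->|/h ->] := eqVneq (d i) 0; rewrite ?mul0r ?mulr0 scale0r.
move=> h; apply/mem_spanv => i di; have := co_brD i x; rewrite h co0 => /esym/eqP.
by rewrite mulf_eq0 (negbTE di) => /eqP.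
Qed.

Lemma star_l : star_closed L l.
Proof.
move=> x /mem_l h; apply/mem_l.
by rewrite brC -{1}starD -sl_star_br h star0 oppr0.
Qed.

Lemma subalg_l : subalg L l.
Proof. by move=> x y; apply: br_graded => i j k /eqP -> /eqP -> ->; rewrite addr0. Qed.

Lemma D_l : D \in l. Proof. by apply/mem_l; rewrite sl_brxx. Qed.

Lemma br_lu x y : x \in l -> y \in u -> br x y \in u.
Proof. by apply: br_graded => i j k /eqP -> dj ->; rewrite add0r. Qed.

Lemma br_uu x y : x \in u -> y \in u -> br x y \in u.
Proof. by apply: br_graded => i j k di dj ->; exact: addr_gt0. Qed.

Lemma q_split : (l + u)%VS = q.
Proof.
apply: spanv_add => i; rewrite le_eqVlt eq_sym; by case: eqP.
Qed.

Lemma lu_cap : (l :&: u)%VS = 0%VS.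
Proof.
rewrite spanv_cap; apply/eqP; rewrite -subv0; apply: spanv_sub => i /= /andP[/eqP ->].
by rewrite ltxx.
Qed.

Lemma u_solvable : lie_solvable br u.
Proof. exact: spanv_pos_solvable. Qed.

Lemma memq x : x \in q -> exists x0, exists2 x1, x0 \in l /\ x1 \in u & x = x0 + x1.
Proof. by rewrite -q_split => /memv_addP [x0 h0 [x1 h1 ->]]; exists x0, x1. Qed.

Lemma br_qu x y : x \in q -> y \in u -> br x y \in u.
Proof.
by move=> /memq [x0 [x1 [h0 h1] ->]] yu; rewrite (brDl brl); apply: memvD; [exact: br_lu|exact: br_uu].
Qed.

Lemma subalg_q : subalg L q.
Proof. by move=> x y; apply: br_graded => i j k di dj ->; exact: addr_ge0. Qed.

Lemma u_brD : forall i, 0 < d i -> v i \in u /\ v i = br D ((d i)^-1 *: v i).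
Proof.
move=> i di; split; first exact: spanv_v.
by rewrite (brZr brr) brD scalerA mulVf ?scale1r // gt_eqF.
Qed.

(** The radical of [q] is [centv L l + u]. Bracketing with [q] sends it into [u], and onto [u]
    because [D] belongs to [l] and acts on [u] with nonzero eigenvalues. *)
Theorem spanv_levi : levi_decomposition br q l u.
Proof.
have lq : (l <= q)%VS by rewrite -q_split addvSl.
have uq : (u <= q)%VS by rewrite -q_split addvSr.
pose r := (centv L l + u)%VS.
have cl : (centv L l <= l)%VS by apply: subvPP => x /mem_centv [].
have rq : (r <= q)%VS by rewrite subv_add uq (subv_trans cl).
have qr x y : x \in q -> y \in r -> br x y \in u.
  move=> /memq [x0 [x1 [h0 h1] ->]] /memv_addP [z zc [w wu ->]].
  have /mem_centv [zl hz] := zc.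
  rewrite (brDr brr) (brDl brl) [br x0 z]brC hz // oppr0 add0r.
  rewrite memvD //; first by rewrite brC memvN br_lu.
  by rewrite (brDl brl); apply: memvD; [exact: br_lu|exact: br_uu].
have ur : (u <= r)%VS by rewrite addvSr.
split.
- exists r; last first.
    apply: eqvPP => x; split; last first.
      by apply/subvP; apply: brv_sub.
    apply/subvP; apply: spanv_sub => i di; have [vu ->] := u_brD di.
    apply: mem_brv => //; first exact: (subvP lq _ D_l).
    by rewrite memvZ // (subvP ur).
  split.
  + apply/idealPP; split=> // x y xq yr.
    by apply: (subvP ur); exact: qr.
  + apply: (@solvable_brv _ _ br brl brr _ u) u_solvable; apply: brv_sub => x y xr yr.
    by apply: qr => //; exact: (subvP rq).
  + move=> j /idealPP [jq jI] [k hk].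
    (* [j'] is the projection of [j] to [l] along [u]. It is a solvable ideal of the star-closed
       [l], hence central, which places [j] in [centv L l + u]. *)
    pose j' := ((j + u) :&: l)%VS.
    have hj' : idealP L j' l.
      split; first exact: capvSr.
      move=> x y xl /memv_capP [/memv_addP [y0 y0j [y1 y1u ->]] yl].
      rewrite memv_cap; apply/andP; split; last exact: subalg_l.
      by rewrite (brDr brr) memv_add ?br_lu // jI // (subvP lq).
    have sj' : lie_solvable br j'.
      apply: (@solvable_sub _ _ br brl brr _ (j + u)%VS); first exact: capvSl.
      apply: (@solvable_ext _ _ br brl brr _ u k); last exact: u_solvable.
      have hW m : (iter m (fun W => brv br W W) j <= j)%VS.
        elim: m => [|m IH] //=; apply: brv_sub => x y xW yW.
        apply: jI; last exact: (subvP IH).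
        by apply: (subvP jq); exact: (subvP IH).
      (* Modulo [u], an ideal of [q], the derived series of [j + u] is that of [j]. *)
      suff h m : (iter m (fun W => brv br W W) (j + u) <= iter m (fun W => brv br W W) j + u)%VS.
        by rewrite (subv_trans (h k)) // hk add0v.
      elim: m => [|m IH] //=; apply: (subv_trans (brv_mono brl brr IH IH)).
      apply: brv_sub => x y /memv_addP [x0 x0W [x1 x1u ->]] /memv_addP [y0 y0W [y1 y1u ->]].
      have x0q : x0 \in q by apply: (subvP jq); exact: (subvP (hW m)).
      have y0q : y0 \in q by apply: (subvP jq); exact: (subvP (hW m)).
      rewrite (brDl brl) (brDr brr) -addrA memv_add ?mem_brv //.
      apply: memvD; first exact: br_qu.
      by rewrite brC memvN; apply: br_qu => //; rewrite memvD // (subvP uq).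
    apply: subvPP => x xj; have [x0 [x1 [h0 h1] xE]] := memq (subvP jq _ xj).
    rewrite xE memv_add //; apply/mem_centv; split=> // y yl.
    apply: (star_solvable_ideal_central subalg_l star_l hj' sj') => //.
    rewrite memv_cap h0 andbT; have -> : x0 = x + (- x1) by rewrite xE addrK.
    by rewrite memv_add // memvN.
- exact: star_reductive subalg_l star_l.
- exact: q_split.
- exact: lu_cap.
Qed.

Definition stv U := mkvs (fun x => st x \in U).

Lemma mem_stv U x : x \in stv U <-> st x \in U.
Proof.
apply: mem_mkvs; split=> [|k y z hy hz]; first by rewrite star0 mem0v.
by rewrite sl_starl memvD // memvZ.
Qed.

(** A nonzero vector of [E] with fewest nonzero coordinates is an eigenvector: subtracting [d i]
    times it from its image kills coordinate [i] and creates none. *)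
Lemma stable_eigenvector (E : {vspace V}) : (forall x, x \in E -> br D x \in E) ->
  (E <= um)%VS -> E != 0%VS ->
  exists x c, [/\ x \in E, x != 0, c < 0 & br D x = c *: x].
Proof.
move=> hE Eu E0.
pose supp x := #|[pred i | co i x != 0]|.
pose P k := exists x, [/\ x \in E, x != 0 & supp x = k].
have exP : exists k, `[< P k >].
  have [x xE x0] : exists2 x, x \in E & x != 0.
    by exists (vpick E); [exact: memv_pick|rewrite vpick0].
  by exists (supp x); apply/asboolP; exists x.
have [k /asboolP [x [xE x0 sx]] kmin] := ex_minnP exP.
have [i ci|no] := pickP [pred i | co i x != 0]; last first.
  case/eqP: x0; rewrite (coE x) big1 // => i _.
  by have /negbFE/eqP -> := no i; rewrite scale0r.
have di : d i < 0.
  have /mem_spanv h := subvP Eu _ xE.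
  by apply: contraNT ci => /h ->.
exists x, (d i); split=> //; apply/eqP; rewrite -subr_eq0; apply/negPn/negP => y0.
set y := _ - _ in y0.
have cy m : co m y = (d m - d i) * co m x.
  by rewrite /y -scaleNr coD coZ co_brD; ring.
have := kmin (supp y) (asboolT _); rewrite -sx => /(_ _) h.
have yE : y \in E by rewrite memvB // ?hE // memvZ.
have /h : P (supp y) by exists y.
rewrite leqNgt => /negP; apply; apply: proper_card; apply/properP; split.
  by apply/fintype.subsetP => m; rewrite !inE cy mulf_eq0 negb_or => /andP[].
by exists i => //; rewrite !inE cy subrr mul0r eqxx.
Qed.

Theorem spanv_borel S : subalg L (spanv S) -> star_closed L (spanv S) -> D \in spanv S ->
  (forall x y, x \in (l :&: spanv S)%VS -> y \in (l :&: spanv S)%VS -> br x y = 0) ->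
  borel_in br (spanv S) (q :&: spanv S)%VS.
Proof.
move=> sU cU DU hab; set U := spanv S.
have DqU : D \in (q :&: U)%VS.
  by rewrite memv_cap DU andbT -q_split (subvP (addvSl _ _)) // D_l.
split.
- exact: capvSr.
- apply/subalgP => x y /memv_capP [xq xU] /memv_capP [yq yU].
  by rewrite memv_cap subalg_q // sU.
- apply: (@solvable_brv _ _ br brl brr _ u) u_solvable; apply: brv_sub => x y.
  rewrite !spanv_cap => xA yA.
  apply: (spanv_ind (Q := fun x => br x y \in u)) xA.
    split=> [|k w z hw hz]; first by rewrite (br0l brl) mem0v.
    by rewrite brl memvD // memvZ.
  move=> i /andP[/= di Si]; apply: (spanv_ind (Q := fun y => br (v i) y \in u)) yA.
    split=> [|k w z hw hz]; first by rewrite (br0r brr) mem0v.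
    by rewrite brr memvD // memvZ.
  move=> j /andP[/= dj Sj].
  have [di0|di0] := eqVneq (d i) 0; last first.
    apply: (br_graded (A := fun i => 0 < d i) (B := fun i => 0 <= d i)); rewrite ?spanv_v //.
      by move=> ? ? ? h1 h2 ->; exact: ltr_wpDr.
    by rewrite lt_def di0.
  have [dj0|dj0] := eqVneq (d j) 0.
    by rewrite hab ?mem0v // spanv_cap spanv_v //= ?di0 ?dj0 eqxx.
  apply: (br_graded (A := fun i => 0 <= d i) (B := fun i => 0 < d i)); rewrite ?spanv_v //.
    by move=> ? ? ? h1 h2 ->; exact: ltr_wpDl.
  by rewrite lt_def dj0.
- move=> c qc cU' /subalgP sc solc; apply: eqvPP => x; split; last by move/(subvP qc).
  move=> xc; apply: contrapT => /negP xq.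
  pose E := (c :&: um)%VS.
  have Dc : D \in c by exact: (subvP qc).
  have hE y : y \in E -> br D y \in E.
    by move=> /memv_capP [yc yu]; rewrite memv_cap sc //= spanv_stable.
  have E0 : E != 0%VS.
    apply: contraNneq xq => E0.
    have xU := subvP cU' _ xc.
    have : x \in (spanv (predI (fun i => (0 <= d i)%R) S) + spanv (predI (fun i => (d i < 0)%R) S))%VS.
      rewrite (@spanv_add _ _ S) // => i /=.
      by rewrite -andb_orl real_leNgt // orNb.
    move=> /memv_addP [x0 x0q [x1 x1u xE]].
    have x1E : x1 \in E.
      rewrite memv_cap; apply/andP; split.
        have -> : x1 = x - x0 by rewrite xE addrC addKr.
        by rewrite memvB // (subvP qc) // spanv_cap.
      by move: x1u; rewrite -spanv_cap => /memv_capP [].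
    by move: x1E; rewrite E0 memv0 => /eqP x10; rewrite xE x10 addr0 spanv_cap.
  have [z [k [zE z0 k0 Dz]]] := stable_eigenvector hE (capvSr _ _) E0.
  have /memv_capP [zc zu] := zE.
  have kr : k^* = k by apply/CrealP; rewrite ltr0_real.
  have Dz' : br D (st z) = - k *: st z.
    have : st (br D z) = k *: st z by rewrite Dz starZ kr.
    by rewrite sl_star_br starD brC => /(congr1 -%R); rewrite opprK scaleNr.
  have zsU : st z \in U by apply: cU; exact: (subvP cU').
  have zsc : st z \in c.
    apply: (subvP qc); rewrite memv_cap zsU andbT; apply/mem_spanv => i.
    apply: contraNeq => /(eigen_co Dz') ->.
    by rewrite oppr_ge0 ltW.
  pose e := (c :&: stv c)%VS.
  have se : subalg L e.
    move=> a b /memv_capP [ac /mem_stv a'c] /memv_capP [bc /mem_stv b'c].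
    by rewrite memv_cap sc //=; apply/mem_stv; rewrite sl_star_br sc.
  have ce : star_closed L e.
    move=> a /memv_capP [ac /mem_stv a'c]; rewrite memv_cap a'c /=.
    by apply/mem_stv; rewrite sl_starK.
  have ae := star_solvable_abelian se ce (solvable_sub brl brr (capvSl _ _) solc).
  have z0' : br z (st z) = 0.
    apply: ae; rewrite memv_cap; apply/andP; split=> //; apply/mem_stv => //.
    by rewrite sl_starK.
  have : H (br z (st z)) D = k * H z z.
    rewrite brC -scaleN1r formZl sl_adj sl_starK [br z D]brC Dz -scaleNr formZr.
    by have -> : (- k)^* = - k; [rewrite rmorphN /= kr|rewrite mulN1r mulNr opprK].
  rewrite z0' form0l => /esym/eqP; rewrite mulf_eq0 (lt_eqF k0) /= => /eqP /form_eq0 h.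
  by rewrite h eqxx in z0.
Qed.

End Triangular.

Section EigenBasis.
Context {C : numClosedFieldType} {V : vectType C}.
Context {N : nat} (v : 'I_N -> V) (co : 'I_N -> V -> C).
Context (coE : forall x, x = \sum_i co i x *: v i).
Context (co_lin : forall i a x y, co i (a *: x + y) = a * co i x + co i y).
Context (cov : forall i j, co i (v j) = (i == j)%:R).
Context (A : V -> V) (lam : 'I_N -> C).
Context (Al : forall a x y, A (a *: x + y) = a *: A x + A y).
Context (Av : forall i, A (v i) = lam i *: v i).

Lemma co_inj x y : (forall i, co i x = co i y) -> x = y.
Proof. by move=> h; rewrite (coE x) (coE y); apply: eq_bigr => i _; rewrite h. Qed.

Lemma lin0 : A 0 = 0.
Proof. by have := Al (-1) 0 0; rewrite scaler0 addr0 scaleN1r addNr. Qed.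

Lemma lin_sum I (r : seq I) (P : pred I) f :
  A (\sum_(i <- r | P i) f i) = \sum_(i <- r | P i) A (f i).
Proof.
elim/big_rec2: _ => [|i u w _ <-]; first exact: lin0.
by have := Al 1 (f i) w; rewrite !scale1r.
Qed.

Lemma linZ a x : A (a *: x) = a *: A x.
Proof.
by have := Al a x 0; rewrite lin0 !addr0.
Qed.

Lemma co_sum i I (r : seq I) (P : pred I) f :
  co i (\sum_(j <- r | P j) f j) = \sum_(j <- r | P j) co i (f j).
Proof.
elim/big_rec2: _ => [|j u w _ <-]; first exact: (co0 co_lin).
exact: (coD co_lin).
Qed.

Lemma co_map i x : co i (A x) = lam i * co i x.
Proof.
rewrite {1}(coE x) lin_sum co_sum (bigD1 i) //= big1 ?addr0; last first.
  move=> j ji; rewrite linZ Av !(coZ co_lin) cov eq_sym (negbTE ji).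
  by rewrite !mulr0.
by rewrite linZ Av !(coZ co_lin) cov eqxx mulr1 mulrC.
Qed.

Lemma eigen_coP c x : A x = c *: x <-> forall i, lam i != c -> co i x = 0.
Proof.
split=> h.
  move=> i ic; have := co_map i x; rewrite h (coZ co_lin) => /eqP.
  rewrite -subr_eq0 -mulrBl mulf_eq0 subr_eq0 eq_sym (negbTE ic) /=.
  by move/eqP.
apply: co_inj => i; rewrite co_map (coZ co_lin).
by have [->//|/h ->] := eqVneq (lam i) c; rewrite !mulr0.
Qed.

Definition eproj c x := \sum_(i | lam i == c) co i x *: v i.

Lemma co_eproj c i x : co i (eproj c x) = if lam i == c then co i x else 0.
Proof.
rewrite /eproj co_sum; case: ifP => hi.
  rewrite (bigD1 i) //= big1 ?addr0; first by rewrite (coZ co_lin) cov eqxx mulr1.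
  by move=> j /andP[_ ji]; rewrite (coZ co_lin) cov eq_sym (negbTE ji) mulr0.
rewrite big1 // => j hj; rewrite (coZ co_lin) cov.
by have [ij|_] := eqVneq i j; rewrite ?mulr0 //; move: hj; rewrite -ij hi.
Qed.

Lemma eproj_lin c a x y : eproj c (a *: x + y) = a *: eproj c x + eproj c y.
Proof.
apply: co_inj => i; rewrite co_lin !co_eproj co_lin.
by case: ifP => _ //; rewrite mulr0 addr0.
Qed.

Lemma eproj0 c : eproj c 0 = 0.
Proof.
by have := eproj_lin c (-1) 0 0; rewrite scaler0 addr0 scaleN1r addNr.
Qed.

Lemma eproj_eigen c x : A (eproj c x) = c *: eproj c x.
Proof. by apply/eigen_coP => i hi; rewrite co_eproj (negbTE hi). Qed.

Lemma eproj_id c x : A x = c *: x -> eproj c x = x.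
Proof.
move=> /eigen_coP h; apply: co_inj => i; rewrite co_eproj.
by case: ifP => // /negbT /h ->.
Qed.

Lemma eproj_id0 c c' x : A x = c' *: x -> c' != c -> eproj c x = 0.
Proof.
move=> /eigen_coP h cc; apply: co_inj => i; rewrite co_eproj (co0 co_lin).
case: ifP => // /eqP ic; rewrite h // ic eq_sym //.
Qed.

Lemma eproj_sum x : x = \sum_(c <- undup (codom lam)) eproj c x.
Proof.
apply: co_inj => i; rewrite co_sum (bigD1_seq (lam i)) ?undup_uniq //=; last first.
  by rewrite mem_undup codom_f.
rewrite co_eproj eqxx big1 ?addr0 // => c ci.
by rewrite co_eproj eq_sym (negbTE ci).
Qed.

Lemma eigen_mem c x : A x = c *: x -> x != 0 -> exists i, lam i = c.
Proof.
move=> /eigen_coP h x0.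
have [i /eqP ic|no] := pickP [pred i | lam i == c]; first by exists i.
case/eqP: x0; apply: co_inj => i; rewrite (co0 co_lin) h //.
by have := no i; rewrite /= => ->.
Qed.

(** Up to a nonzero scalar, the eigenprojection is the product of the operators [A - m] over the
    other eigenvalues [m], and each factor preserves [p]. *)
Lemma stable_eproj (p : {vspace V}) c x : (forall y, y \in p -> A y \in p) ->
  x \in p -> eproj c x \in p.
Proof.
move=> hA xp; pose f s := foldr (fun (m : C) y => A y - m *: y) x s.
have fp s : f s \in p by elim: s => //= m s IH; rewrite memvB ?hA // memvZ.
have cf s i : co i (f s) = (\prod_(m <- s) (lam i - m)) * co i x.
  elim: s => [|m s IH] /=; first by rewrite big_nil mul1r.
  by rewrite -scaleNr addrC co_lin co_map IH big_cons; ring.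
pose s := [seq m <- codom lam | m != c].
pose k := \prod_(m <- s) (c - m).
have k0 : k != 0.
  rewrite prodf_seq_neq0; apply/allP => m; rewrite mem_filter /= => /andP[mc _].
  by rewrite subr_eq0 eq_sym.
have -> : eproj c x = k^-1 *: f s; last by rewrite memvZ.
apply: co_inj => i; rewrite co_eproj (coZ co_lin) cf.
have [->|ic] := eqVneq; first by rewrite mulrA mulVf // mul1r.
suff -> : \prod_(m <- s) (lam i - m) = 0 by rewrite mul0r mulr0.
apply/eqP; rewrite prodf_seq_eq0; apply/hasP; exists (lam i); last by rewrite /= subrr.
by rewrite mem_filter /= ic codom_f.
Qed.

End EigenBasis.

(** * Automorphisms with few fixed vectors *)

Section FixedPointFree.
Context {C : numClosedFieldType}.
Implicit Types w : C.

(* [cot (t / 2)] for [w = exp (i t)]. *)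
Definition halfcot w : C := 'i * (w + 1) / (w - 1).

Lemma unit_neq0 w : `|w| = 1 -> w != 0.
Proof. by move=> h; rewrite -normr_eq0 h oner_neq0. Qed.

Lemma halfcot_real w : `|w| = 1 -> halfcot w \is Num.real.
Proof.
move=> w1; have w0 := unit_neq0 w1.
have wc : w^* = w^-1.
  by apply: (mulfI w0); rewrite divff // -normCK w1 expr1n.
have [->|wn] := eqVneq w 1; first by rewrite /halfcot subrr invr0 mulr0 real0.
have wn' : w - 1 != 0 by rewrite subr_eq0.
apply/CrealP; rewrite /halfcot !rmorphM /= fmorphV conjCi rmorphB rmorphD /= conjC1 wc.
field; rewrite w0 wn' /=.
have -> : 1 + -1 * w = - (w - 1) by ring.
by rewrite oppr_eq0.
Qed.

Lemma halfcot_inj w w' : w != 1 -> w' != 1 -> halfcot w = halfcot w' -> w = w'.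
Proof.
rewrite -subr_eq0 -[w' == 1]subr_eq0 => h h' e.
have : halfcot w - halfcot w' = 'i * 2 * (w' - w) / ((w - 1) * (w' - 1)).
  by rewrite /halfcot; field; rewrite h h'.
rewrite e subrr => /esym/eqP; rewrite !mulf_eq0 invr_eq0 mulf_eq0.
rewrite (negbTE h) (negbTE h') !orbF (negbTE (neq0Ci _)) /= pnatr_eq0 /= subr_eq0.
by move/eqP.
Qed.

(** The addition formula of the cotangent: with [a], [b], [c] the values at [w], [w'], [w * w'], one
    has [(a - c) (b - c) = 1 + c ^ 2 > 0], so [c] lies on the same side of [a] and [b]. *)
Lemma halfcot_mul w w' : `|w| = 1 -> `|w'| = 1 -> w != 1 -> w' != 1 -> w * w' != 1 ->
  halfcot (w * w') < halfcot w -> halfcot (w * w') < halfcot w'.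
Proof.
move=> w1 w1' wn wn' wwn.
have r1 := halfcot_real w1; have r2 := halfcot_real w1'.
have r3 : halfcot (w * w') \is Num.real by apply: halfcot_real; rewrite normrM w1 w1' mulr1.
have e : (halfcot w - halfcot (w * w')) * (halfcot w' - halfcot (w * w')) = 1 + halfcot (w * w') ^+ 2.
  have I2 := sqrCi C.
  have -> : 1 + halfcot (w * w') ^+ 2 = 1 - ((w * w' + 1) / (w * w' - 1)) ^+ 2.
    by rewrite /halfcot !exprMn I2; ring.
  have -> : (halfcot w - halfcot (w * w')) * (halfcot w' - halfcot (w * w')) =
    'i ^+ 2 * (((w + 1) / (w - 1) - (w * w' + 1) / (w * w' - 1)) *
            ((w' + 1) / (w' - 1) - (w * w' + 1) / (w * w' - 1))).
    by rewrite /halfcot; ring.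
  rewrite I2; field; rewrite !subr_eq0 wn wn' wwn //.
have : 0 < 1 + halfcot (w * w') ^+ 2 by rewrite ltr_pwDl // real_exprn_even_ge0.
rewrite -e -(subr_gt0 _ (halfcot w)) -(subr_gt0 _ (halfcot w')) => h hw; move: h; rewrite pmulr_rgt0 //.
Qed.

Context {V : vectType C} (L : @star_lie C V).
Notation br := (sl_br L).
Let brl := @sl_brl _ _ L.
Let brr := @sl_brr _ _ L.
Context {N : nat} (v : 'I_N -> V) (co : 'I_N -> V -> C).
Context (coE : forall x, x = \sum_i co i x *: v i).
Context (co_lin : forall i a x y, co i (a *: x + y) = a * co i x + co i y).
Context (cov : forall i j, co i (v j) = (i == j)%:R).
Context (A : V -> V) (lam : 'I_N -> C).
Context (Al : forall a x y, A (a *: x + y) = a *: A x + A y).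
Context (Av : forall i, A (v i) = lam i *: v i).
Context (lam1 : forall i, `|lam i| = 1).
Context (Abr : forall x y, A (br x y) = br (A x) (A y)).

Notation eproj := (eproj v co lam).

(* Kreknin's argument: [p] is generated by the eigenspaces of eigenvalue above
   any threshold of the order given by [halfcot], because in a product [w * w']
   the value of [halfcot] lies on the same side of those of [w] and [w']. *)
Lemma perfect_fixfree (p : {vspace V}) : subalg L p -> (p <= brv br p p)%VS ->
  (forall x, x \in p -> A x \in p) -> (forall x, x \in p -> A x = x -> x = 0) ->
  p = 0%VS.
Proof.
move=> sp pp pA p1.
(* The induction shrinks [S], an upward closed set of eigenvalues avoiding 1, while its eigenspaces
   keep generating [p]. When no eigenvalue of [A] is left in [S], the zero subspace already
   qualifies as [W]. *)
pose gen (S : pred C) := forall W : {vspace V}, subalg L W ->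
  (forall w x, S w -> x \in p -> A x = w *: x -> x \in W) -> (p <= W)%VS.
pose up (S : pred C) := ~~ S 1 /\
  forall w w', S w -> `|w'| = 1 -> w' != 1 -> halfcot w < halfcot w' -> S w'.
suff main k S : (#|[pred i | S (lam i)]| < k)%N -> up S -> gen S -> p = 0%VS.
  apply: (main _ (predC1 1) (ltnSn _)).
    by split=> [|w w' _ _ //]; rewrite /= eqxx.
  move=> W sW hW; apply: subvPP => x xp; rewrite (eproj_sum coE co_lin cov lam x).
  apply: memv_suml => c _.
  have cp := stable_eproj coE co_lin cov Al Av c pA xp.
  have ce := eproj_eigen coE co_lin cov Al Av c x.
  have [c1|c1] := eqVneq c 1; last by apply: (hW c).
  by rewrite (p1 _ cp) ?mem0v //; move: ce; rewrite c1 scale1r.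
elim: k S => // k IH S Sk [S1 Sup] Sgen.
have [i1 hi1|no] := pickP [pred i | S (lam i)]; last first.
  apply/eqP; rewrite -subv0; apply: Sgen => [x y|w x Sw xp Ax].
    by rewrite !memv0 => /eqP -> /eqP ->; rewrite (br0l brl).
  rewrite memv0; apply/negPn/negP => x0.
  have [i hi] := eigen_mem coE co_lin cov Al Av Ax x0.
  by have := no i; rewrite /= hi Sw.
have dr i : halfcot (lam i) \is Num.real by exact: halfcot_real.
have [i0 hi0 hmin] := real_argmin dr hi1.
set kap := lam i0 in hi0 hmin.
have Smin w x : S w -> A x = w *: x -> x != 0 -> halfcot kap <= halfcot w.
  move=> Sw Ax x0; have [i hi] := eigen_mem coE co_lin cov Al Av Ax x0.
  by rewrite -hi; apply: hmin; rewrite /= hi.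
have kap1 : kap != 1 by apply: contraNneq S1 => <-.
have Sn1 w : S w -> w != 1 by move=> Sw; apply: contraNneq S1 => <-.
pose S' : pred C := [pred w | S w && (halfcot kap < halfcot w)].
apply: (IH S').
- rewrite -ltnS; apply: leq_trans Sk; rewrite ltnS.
  apply: proper_card; apply/properP; split.
    by apply/fintype.subsetP => i; rewrite !inE => /andP[].
  by exists i0 => //; rewrite !inE /S' /= ltxx andbF.
- split=> [|w w' /andP[Sw kw] w1' wn' ww']; first by rewrite /S' /= (negbTE S1).
  by rewrite /S' /= (Sup _ _ Sw) // (lt_trans kw).
move=> W sW hW; apply: (Sgen) => // w x Sw xp Ax.
have [->|x0] := eqVneq x 0; first exact: mem0v.
have := Smin _ _ Sw Ax x0; rewrite le_eqVlt => /orP[/eqP kw|kw]; last first.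
  by apply: (hW w) => //; rewrite /S' /= Sw.
have {}kw : w = kap by apply: halfcot_inj => //; exact: Sn1.
rewrite {}kw in Sw Ax.
(* Eigenvectors for the lowest value [kap] must be recovered from the higher ones: as [p] is
   perfect, it is enough that the [kap]-component of every bracket of [p] lies in [W]. *)
pose M := mkvs (fun y => eproj kap y \in W).
have memM y : y \in M <-> eproj kap y \in W.
  apply: mem_mkvs; split.
    by rewrite (eproj0 coE co_lin cov) mem0v.
  by move=> a y1 z hy hz; rewrite (eproj_lin coE co_lin cov) memvD // memvZ.
suff /subvP h : (brv br p p <= M)%VS.
  have /memM := h _ (subvP pp _ xp).
  by rewrite (eproj_id coE co_lin cov Al Av Ax).
(* [Y] is a subalgebra by the Jacobi identity, so [Sgen] reduces the claim to eigenvectors [y] with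
   eigenvalue in [S]. *)
pose Y := mkvs (fun y => y \in p /\ forall a, a \in p -> br a y \in M).
have memY y : y \in Y <-> y \in p /\ forall a, a \in p -> br a y \in M.
  apply: mem_mkvs; split; first by split=> [|a _]; rewrite ?(br0r brr) mem0v.
  move=> c y1 z [yp hy] [zp hz]; split; first by rewrite memvD // memvZ.
  by move=> a ap; rewrite brr memvD ?memvZ ?hy ?hz.
suff pY : (p <= Y)%VS.
  by apply: brv_sub => a y ap /(subvP pY) /memY [_]; exact.
apply: Sgen => [y z /memY [yp hy] /memY [zp hz]|w' y Sw' yp Ay].
  apply/memY; split=> [|a ap]; first exact: sp.
  rewrite sl_jac memvD //; first by apply: hz; exact: sp.
  by rewrite brC memvN; apply: hy; exact: sp.
apply/memY; split=> // a ap; apply/memM.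
have [->|y0] := eqVneq y 0.
  by rewrite (br0r brr) (eproj0 coE co_lin cov) mem0v.
suff h c : eproj kap (br (eproj c a) y) \in W.
  have -> : a = \sum_(c <- undup (codom lam)) eproj c a by exact: (eproj_sum coE co_lin cov).
  rewrite (br_suml brl); elim/big_rec: _ => [|c z _ hz]; first by rewrite (eproj0 coE co_lin cov) mem0v.
  have := eproj_lin coE co_lin cov lam kap 1 (br (eproj c a) y) z.
  by rewrite !scale1r => ->; rewrite memvD.
have [z0|z0] := eqVneq (eproj c a) 0.
  by rewrite z0 (br0l brl) (eproj0 coE co_lin cov) mem0v.
have zp := stable_eproj coE co_lin cov Al Av c pA ap.
have ze := eproj_eigen coE co_lin cov Al Av c a.
have [i ci] := eigen_mem coE co_lin cov Al Av ze z0.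
have [j wj] := eigen_mem coE co_lin cov Al Av Ay y0.
have c1 : c != 1.
  by apply: contraNneq z0 => c1; apply/eqP/p1 => //; rewrite ze c1 scale1r.
have be : A (br (eproj c a) y) = (c * w') *: br (eproj c a) y.
  by rewrite Abr ze Ay (brZl brl) (brZr brr) scalerA.
have [ck|ck] := eqVneq (c * w') kap; last first.
  by rewrite (eproj_id0 coE co_lin cov Al Av be ck) mem0v.
rewrite (eproj_id coE co_lin cov Al Av) ?be ?ck //.
(* Equality would force [w' = kap] and then [c = 1], excluded for a nonzero vector of [p]. Next
   [halfcot_mul] puts [c] above [kap] too, so both factors of the bracket lie in [W]. *)
have kw : halfcot kap < halfcot w'.
  rewrite lt_neqAle (Smin _ _ Sw' Ay y0) andbT.
  apply: contraNneq c1 => /(halfcot_inj kap1 (Sn1 _ Sw')) kw.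
  move: ck; rewrite -kw -[RHS]mul1r => /(mulIf _) -> //.
  by apply: unit_neq0; exact: lam1.
have kc : halfcot kap < halfcot c.
  rewrite -ck mulrC; apply: halfcot_mul; rewrite -?ci -?wj ?lam1 //.
  - by rewrite wj; exact: Sn1.
  - by rewrite ci.
  - by rewrite ci wj mulrC ck.
  - by rewrite ci wj mulrC ck.
apply: sW; last by apply: (hW w') => //; rewrite /S' /= Sw'.
apply: (hW c) => //; rewrite /S' /= kc andbT.
by apply: (Sup kap) => //; rewrite -ci.
Qed.

(** The previous result applies to the derived algebra of [m]: a fixed vector [a] in it is central
    in [m], so by adjointness it is orthogonal to every bracket of [m], in particular to itself. *)
Theorem star_fixed_central_abelian (m : {vspace V}) : subalg L m -> star_closed L m ->
  (forall x, x \in m -> A x \in m) ->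
  (forall x y, x \in m -> A x = x -> y \in m -> br x y = 0) ->
  forall x y, x \in m -> y \in m -> br x y = 0.
Proof.
move=> sm cm mA m1 x y xm ym.
have [pm pI] := brv_ideal sm.
suff p0 : brv br m m = 0%VS.
  by apply/eqP; rewrite -memv0 -p0; exact: mem_brv.
apply: perfect_fixfree.
- by move=> a b ap bp; apply: pI => //; exact: (subvP pm).
- exact: brv_perfect.
- move=> b bp.
  have A0 := lin0 Al.
  pose W := mkvs (fun b => A b \in brv br m m).
  have memW b' : b' \in W <-> A b' \in brv br m m.
    apply: mem_mkvs; split=> [|k d c hb hc]; first by rewrite A0 mem0v.
    by rewrite Al memvD // memvZ.
  suff /subvP h : (brv br m m <= W)%VS by apply/memW; exact: h.
  by apply: brv_sub => d c dm cm'; apply/memW; rewrite Abr mem_brv // mA.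
- move=> a ap Aa; have am := subvP pm _ ap.
  have hW : (brv br m m <= orthv L <[a]>%VS fullv)%VS.
    apply: brv_sub => b c bm cm'; apply/mem_orthv; split; first exact: memvf.
    move=> z /vlineP [k ->]; rewrite formZr sl_adj.
    by rewrite brC (m1 a) ?cm // oppr0 form0r mulr0.
  have /mem_orthv [_ h] := subvP hW _ ap.
  by apply: (form_eq0 (L := L)); apply: h; exact: memv_line.
Qed.

End FixedPointFree.

(** * Simultaneous diagonalisation of commuting families closed under adjoints *)

Section JointEigenbasis.
Context {C : numClosedFieldType} {V : vectType C} (L : @star_lie C V).
Notation H := (sl_form L).
Implicit Types (U W : {vspace V}) (f g : V -> V).

Definition linP f := forall a x y, f (a *: x + y) = a *: f x + f y.

Lemma eigenvector_in W f : linP f -> (forall x, x \in W -> f x \in W) -> W != 0%VS ->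
  exists x c, [/\ x \in W, x != 0 & f x = c *: x].
Proof.
move=> lf sf W0; pose b := vbasis W.
pose M := \matrix_(i < \dim W, j < \dim W) coord b j (f b`_i).
have d0 : (0 < \dim W)%N by rewrite lt0n dimv_eq0.
have [a /eigenvalueP [u uM u0]] := eigenvalue_closed M d0.
have bW i : b`_i \in W.
  have [lt|ge] := ltnP i (\dim W); last by rewrite nth_default ?mem0v // size_tuple.
  by rewrite vbasis_mem // mem_nth // size_tuple.
exists (\sum_i u 0 i *: b`_i), a; split.
- by apply: memv_suml => i _; rewrite memvZ.
- apply: contraNneq u0 => e; apply/eqP/rowP => i; rewrite mxE.
  have /freeP := basis_free (vbasisP W); apply; exact: e.
- rewrite (lin_sum lf) scaler_sumr.
  transitivity (\sum_i \sum_j (u 0 i * M i j) *: b`_j).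
    apply: eq_bigr => i _; rewrite (linZ lf) (coord_vbasis (sf _ (bW i))) scaler_sumr.
    by apply: eq_bigr => j _; rewrite scalerA mxE.
  rewrite exchange_big /=; apply: eq_bigr => j _.
  move/rowP/(_ j): uM; rewrite !mxE => e; rewrite scalerA -e scaler_suml.
  by apply: eq_bigr.
Qed.

Context (F : (V -> V) -> Prop).
Context (Flin : forall f, F f -> linP f).
Context (Fcomm : forall f g, F f -> F g -> forall x, f (g x) = g (f x)).
Context (Fadj : forall f, F f -> exists2 g, F g & forall x y, H (f x) y = H x (g y)).

Definition stableF W := forall f x, F f -> x \in W -> f x \in W.

(** In a nonzero stable subspace of least dimension, an eigenspace of any [f] of the family is again
    stable by commutation, hence is everything. *)
Lemma common_eigenvector_in W : stableF W -> W != 0%VS ->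
  exists x, [/\ x \in W, x != 0 & forall f, F f -> exists c, f x = c *: x].
Proof.
move=> sW W0.
pose P k := exists2 U : {vspace V}, stableF U /\ (U <= W)%VS & (0 < k)%N && (\dim U == k).
have exP : exists k, `[< P k >].
  by exists (\dim W); apply/asboolP; exists W; rewrite // eqxx andbT lt0n dimv_eq0.
have [k /asboolP [U [sU UW] /andP[k0 /eqP dU]] kmin] := ex_minnP exP.
have U0 : U != 0%VS by rewrite -dimv_eq0 dU -lt0n.
exists (vpick U); split; [exact/(subvP UW)/memv_pick|by rewrite vpick0|move=> f Ff].
have lf := Flin Ff.
have [x [c [xU x0 fx]]] := eigenvector_in lf (fun x => sU f x Ff) U0.
pose U' := mkvs (fun y => y \in U /\ f y = c *: y).
have memU' y : y \in U' <-> y \in U /\ f y = c *: y.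
  apply: mem_mkvs; split; first by rewrite mem0v (lin0 lf) scaler0.
  move=> a y1 z [y1U fy] [zU fz]; rewrite memvD ?memvZ //; split=> //.
  by rewrite lf fy fz scalerDr !scalerA mulrC.
have U'U : (U' <= U)%VS by apply: subvPP => y /memU' [].
have sU' : stableF U'.
  move=> g y Fg /memU' [yU fy]; apply/memU'; split; first exact: sU.
  by rewrite -(Fcomm Fg Ff) fy (linZ (Flin Fg)).
have dU' : (k <= \dim U')%N.
  apply: kmin; apply/asboolP; exists U'; first by split=> //; exact: subv_trans UW.
  rewrite eqxx andbT lt0n dimv_eq0; apply: contraNneq x0 => U'0.
  by rewrite -memv0 -U'0; apply/memU'.
have e : U' = U by apply/eqP; rewrite eqEdim U'U dU.
by exists c; have := memv_pick U; rewrite -{2}e => /memU' [].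
Qed.

Definition eigtuple k (v : 'I_k -> V) :=
  [/\ forall i, v i != 0, forall i j, i != j -> H (v i) (v j) = 0 &
      forall i f, F f -> exists c, f (v i) = c *: v i].

(** Adjoints belong to the family, so the orthogonal complement of the vectors already found is
    stable and supplies the next one. *)
Lemma joint_eigenvectors k : (k <= \dim {:V})%N -> exists v : 'I_k -> V, eigtuple v.
Proof.
elim: k => [|k IH] kV.
  by exists (fun=> 0); split=> [[]|[]|[]].
have [v [v0 vo ve]] := IH (ltnW kV).
pose s := [seq v i | i : 'I_k]; pose U := span s.
have vU i : v i \in U by apply: memv_span; exact: codom_f.
have sU : stableF U.
  move=> f x Ff; pose Wf := mkvs (fun y => f y \in U).
  have memW y : y \in Wf <-> f y \in U.
    apply: mem_mkvs; split; first by rewrite (lin0 (Flin Ff)) mem0v.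
    by move=> a y1 z h1 h2; rewrite (Flin Ff) memvD // memvZ.
  suff /subvP h : (U <= Wf)%VS by move/h/memW.
  apply/span_subvP => y /codomP [i ->]; apply/memW.
  by have [c ->] := ve i f Ff; rewrite memvZ.
have dU : (\dim U <= k)%N by rewrite (leq_trans (dim_span _)) // size_codom card_ord.
pose O := orthv L U fullv.
have O0 : O != 0%VS.
  apply/negP => /eqP O0; have := orthv_add L (subvf U); rewrite -/O O0 addv0 => e.
  by move: kV; rewrite -e ltnNge dU.
have sO : stableF O.
  move=> f x Ff /mem_orthv [_ h]; apply/mem_orthv; split; first exact: memvf.
  by move=> y yU; have [g Fg ->] := Fadj Ff; apply: h; exact: sU.
have [x [/mem_orthv [_ xo] x0 xe]] := common_eigenvector_in sO O0.
exists (fun i : 'I_k.+1 => if unlift ord_max i is Some j then v j else x); split.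
- by move=> i; case: unliftP.
- move=> i j; case: unliftP => [i' ->|->]; case: unliftP => [j' ->|->].
  + by move=> ne; apply: vo; apply: contraNneq ne => ->.
  + by move=> _; rewrite sl_formC xo ?conjC0.
  + by move=> _; rewrite xo.
  + by rewrite eqxx.
- by move=> i f Ff; case: unliftP => [i' _|_]; [exact: ve|exact: xe].
Qed.

Notation N := (\dim {:V}).

(** Orthogonal but not normalised, which avoids square roots; coordinates are therefore quotients by
    [H (ob_v i) (ob_v i)]. *)
Record obasis := OBasis {
  ob_v : 'I_N -> V;
  ob_co : 'I_N -> V -> C;
  ob_coE : forall x, x = \sum_i ob_co i x *: ob_v i;
  ob_col : forall i a x y, ob_co i (a *: x + y) = a * ob_co i x + ob_co i y;
  ob_cov : forall i j, ob_co i (ob_v j) = (i == j)%:R;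
  ob_n0 : forall i, H (ob_v i) (ob_v i) != 0;
  ob_coH : forall i x, ob_co i x = H x (ob_v i) / H (ob_v i) (ob_v i) }.

Theorem joint_eigenbasis : exists b : obasis,
  forall i f, F f -> exists c, f (ob_v b i) = c *: ob_v b i.
Proof.
have [v [v0 vo ve]] := joint_eigenvectors (leqnn N).
have H0 i : H (v i) (v i) != 0 by apply: contraNneq (v0 i) => /form_eq0 ->.
pose co i x := H x (v i) / H (v i) (v i).
have cov i j : co i (v j) = (i == j)%:R.
  rewrite /co eq_sym; have [->|ne] := eqVneq j i; first by rewrite divff.
  by rewrite vo // mul0r.
have co_lin i a x y : co i (a *: x + y) = a * co i x + co i y.
  by rewrite /co sl_forml mulrDl mulrA.
have co_sum0 i (c : 'I_N -> C) : co i (\sum_j c j *: v j) = c i.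
  have co0 : co i 0 = 0 by have := co_lin i (-1) 0 0; rewrite scaler0 addr0 mulN1r addNr.
  rewrite (bigD1 i) //= co_lin cov eqxx mulr1.
  elim/big_rec: _ => [|j y ji hy]; first by rewrite co0 addr0.
  by rewrite co_lin cov eq_sym (negbTE ji) mulr0 add0r.
suff coE x : x = \sum_i co i x *: v i.
  by exists (@OBasis v co coE co_lin cov H0 (fun i x => erefl)).
pose X := [tuple v i | i < N].
have Xi (i : 'I_N) : X`_i = v i by rewrite (nth_mktuple _ _ i).
have fX : free X.
  apply/freeP => k hk i; have := co_sum0 i k.
  suff -> : \sum_j k j *: v j = 0.
    by move=> <-; have := co_lin i (-1) 0 0; rewrite scaler0 addr0 mulN1r addNr.
  by rewrite -[RHS]hk; apply: eq_bigr => j _; rewrite Xi.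
have bX : basis_of fullv X by rewrite basisEfree fX subvf size_tuple leqnn.
have e := coord_basis bX (memvf x); rewrite {1}e.
apply: eq_bigr => i _; rewrite Xi; congr (_ *: _).
rewrite [in RHS]e -[LHS](co_sum0 i (fun j => coord X j x)).
by congr (co i _); apply: eq_bigr => j _; rewrite Xi.
Qed.

End JointEigenbasis.

Section Weights.
Context {C : numClosedFieldType} {V : vectType C} {L : @star_lie C V}.
Notation H := (sl_form L).
Notation br := (sl_br L).
Notation st := (sl_star L).
Notation N := (\dim {:V}).

Lemma form_ob (b : obasis L) x y :
  H x y = \sum_i ob_co b i x * (ob_co b i y)^* * H (ob_v b i) (ob_v b i).
Proof.
rewrite {1}(ob_coE b x).
transitivity (\sum_i ob_co b i x * H (ob_v b i) y).
  elim/big_rec2: _ => [|i u w _ <-]; first exact: form0l.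
  exact: sl_forml.
apply: eq_bigr => i _; rewrite -mulrA; congr (_ * _).
rewrite sl_formC -{1}(divfK (ob_n0 b i) (H y (ob_v b i))) -ob_coH rmorphM /=.
by rewrite -sl_formC.
Qed.

Theorem weight_basis (m : {vspace V}) : star_closed L m ->
  (forall x y, x \in m -> y \in m -> br x y = 0) ->
  exists (b : obasis L) (wt : 'I_N -> V -> C),
  (forall z i, z \in m -> br z (ob_v b i) = wt i z *: ob_v b i) /\
  (forall z i, z \in m -> wt i (st z) = (wt i z)^*).
Proof.
move=> cm am.
have [||f [z zm ->]|b ve] :=
    @joint_eigenbasis _ _ L (fun f => exists2 z, z \in m & f = br z).
- by move=> f [z _ ->] a x y; exact: sl_brr.
- move=> f g [z zm ->] [w wm ->] x.
  by rewrite sl_jac (am z w) // (br0l (@sl_brl _ _ L)) add0r.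
- by exists (br (st z)); [exists (st z); rewrite // cm|move=> x y; rewrite sl_adj].
exists b, (fun i z => ob_co b i (br z (ob_v b i))).
have e z i : z \in m -> br z (ob_v b i) = ob_co b i (br z (ob_v b i)) *: ob_v b i.
  move=> zm; have [c ec] := ve i (br z) (ex_intro2 _ _ z zm erefl).
  by rewrite ec (coZ (ob_col b)) ob_cov eqxx mulr1.
split=> // z i zm.
have H0 := ob_n0 b i.
have := sl_adj L (ob_v b i) (ob_v b i) z; have e1 := e _ i zm; have e2 := e _ i (cm _ zm).
move: (ob_co b i _) (ob_co b i _) e1 e2 => c d -> ->.
by rewrite formZl formZr => /(mulIf H0) ->; rewrite conjCK.
Qed.

End Weights.

(** * Traces and positive operators *)

Section Traces.
Context {C : numClosedFieldType} {V : vectType C} {L : @star_lie C V}.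
Notation H := (sl_form L).
Implicit Types (b : obasis L) (f g E k h : V -> V).

Definition adjP f g := forall x y, H (f x) y = H x (g y).

Lemma adj_sym f g : adjP f g -> adjP g f.
Proof. by move=> h x y; rewrite sl_formC -h -sl_formC. Qed.

Lemma adj_comp f f' g g' : adjP f f' -> adjP g g' -> adjP (f \o g) (g' \o f').
Proof. by move=> h1 h2 x y /=; rewrite h1 h2. Qed.

Lemma linP_comp f g : linP f -> linP g -> linP (f \o g).
Proof. by move=> lf lg a x y /=; rewrite lg lf. Qed.

Lemma formBB x y : H (x - y) (x - y) = H x x - H x y - H y x + H y y.
Proof. by rewrite -scaleN1r !formDl !formDr !formZl !formZr rmorphN1; ring. Qed.

Definition trb b f := \sum_i ob_co b i (f (ob_v b i)).

Lemma eq_trb b f g : (forall x, f x = g x) -> trb b f = trb b g.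
Proof. by move=> h; apply: eq_bigr => i _; rewrite h. Qed.

Lemma trbB b f g : trb b (fun x => f x - g x) = trb b f - trb b g.
Proof.
rewrite /trb -sumrB; apply: eq_bigr => i _.
by rewrite -scaleN1r addrC (ob_col b) mulN1r addrC.
Qed.

Lemma trbC b f g : linP f -> linP g -> trb b (f \o g) = trb b (g \o f).
Proof.
have aux f' g' : linP f' -> trb b (f' \o g') =
    \sum_j \sum_l ob_co b l (g' (ob_v b j)) * ob_co b j (f' (ob_v b l)).
  move=> lf; apply: eq_bigr => j _ /=.
  rewrite [in LHS](ob_coE b (g' _)) (lin_sum lf) (co_sum (ob_col b)).
  by apply: eq_bigr => l _; rewrite (linZ lf) (coZ (ob_col b)).
move=> lf lg; rewrite !aux // exchange_big /=.
by apply: eq_bigr => j _; apply: eq_bigr => l _; rewrite mulrC.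
Qed.

(** The squared Hilbert-Schmidt norm, [tr (f^* f)], computed in an orthogonal basis that is not
    normalised. *)
Definition nrm2 b f := \sum_i H (f (ob_v b i)) (f (ob_v b i)) / H (ob_v b i) (ob_v b i).

Lemma trb_adj b f f' : adjP f f' -> trb b (f' \o f) = nrm2 b f.
Proof.
move=> /adj_sym adj; apply: eq_bigr => i _ /=; rewrite ob_coH; congr (_ / _).
exact: adj.
Qed.

Lemma nrm2_ge0 b f : 0 <= nrm2 b f.
Proof. by apply: sumr_ge0 => i _; rewrite divr_ge0 // form_ge0. Qed.

Lemma nrm2_eq0 b f : linP f -> nrm2 b f <= 0 -> forall x, f x = 0.
Proof.
move=> lf le0 x; have /eqP : nrm2 b f = 0 by apply/eqP; rewrite eq_le le0 nrm2_ge0.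
rewrite psumr_eq0 => [/allP h|i _]; last by rewrite divr_ge0 // form_ge0.
rewrite (ob_coE b x) (lin_sum lf) big1 // => i _; rewrite (linZ lf).
have := h i (mem_index_enum i); rewrite /= mulf_eq0 invr_eq0 (negbTE (ob_n0 b i)) orbF.
by move=> /eqP/form_eq0 ->; rewrite scaler0.
Qed.

Lemma some_obasis : exists b : obasis L, True.
Proof.
have [||f []|b _] := @joint_eigenbasis _ _ L (fun=> False); by [|exists b].
Qed.

Lemma eigen_selfadj b f (c : 'I_(\dim {:V}) -> C) : linP f ->
  (forall i, f (ob_v b i) = c i *: ob_v b i) -> (forall i, c i \is Num.real) -> adjP f f.
Proof.
move=> lf fv cr x y; rewrite !(form_ob b); apply: eq_bigr => i _.
rewrite !(co_map (ob_coE b) (ob_col b) (ob_cov b) lf fv) rmorphM /=.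
by rewrite (CrealP (cr i)); congr (_ * _); ring.
Qed.

(* The inequality gives [tr (M^* M) <= 0] for [M = k E - E k]. *)
Lemma trace_min_commute b E k k' h : linP E -> linP k -> linP k' -> linP h ->
  adjP E E -> adjP k k' -> adjP h h ->
  (forall x, k (k' x) = x) -> (forall x, k' (k x) = x) -> (forall x, h (h x) = E x) ->
  nrm2 b (k \o E) <= nrm2 b (h \o (k \o h)) -> forall x, k (E x) = E (k x).
Proof.
move=> lE lk lk' lh aE ak ah kk' k'k hh.
pose M x := k (E x) - E (k x); pose M' x := E (k' x) - k' (E x).
have lM : linP M.
  by move=> a x y; rewrite /M !(lE, lk) scalerBr opprD addrACA.
have aM : adjP M M'.
  move=> x y; by rewrite /M /M' formBl formBr ak aE aE ak.
have n1 : nrm2 b (k \o E) = trb b (E \o E).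
  rewrite -(trb_adj b (adj_comp ak aE)); apply: eq_trb => x /=.
  by rewrite k'k.
have n2 : nrm2 b (h \o (k \o h)) = trb b (k' \o (E \o (k \o E))).
  rewrite -(trb_adj b (adj_comp ah (adj_comp ak ah))).
  transitivity (trb b (h \o (k' \o (E \o (k \o h))))).
    by apply: eq_trb => x /=; rewrite hh.
  rewrite (trbC _ lh (linP_comp lk' (linP_comp lE (linP_comp lk lh)))).
  by apply: eq_trb => x /=; rewrite hh.
rewrite n1 n2 => le x; apply/eqP; rewrite -subr_eq0; apply/eqP; move: x.
apply: (nrm2_eq0 (b := b) lM); rewrite -(trb_adj b aM).
have -> : trb b (M' \o M) = (trb b (E \o E) - trb b (E \o (k' \o (E \o k)))) -
    (trb b (k' \o (E \o (k \o E))) - trb b (k' \o (E \o (E \o k)))).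
  rewrite -!trbB; apply: eq_trb => x /=; rewrite /M' /M.
  rewrite -[- E (k x)]scaleN1r [k (E x) + _]addrC !(lk', lE) k'k !scaleN1r.
  by rewrite [- _ + E (E x)]addrC [- _ + k' (E (k _))]addrC.
rewrite (trbC _ lE (linP_comp lk' (linP_comp lE lk))).
rewrite [X in _ - (_ - X)](trbC _ lk' (linP_comp lE (linP_comp lE lk))).
have -> : trb b ((k' \o (E \o k)) \o E) = trb b (k' \o (E \o (k \o E))) by [].
have -> : trb b ((E \o (E \o k)) \o k') = trb b (E \o E).
  by apply: eq_trb => x /=; rewrite kk'.
have -> (u v : C) : u - v - (v - u) = (u - v) + (u - v) by ring.
by rewrite -oppr_ge0 opprD addr_ge0 // oppr_ge0 subr_le0.
Qed.

(** [k E] is normal, so its fixed vector [x] is also fixed by the adjoint [E k']; hence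
    [E (E x) = x]. As the eigenvalues of [E] are positive, [-1] is excluded and [E x = x]. *)
Lemma normal_fix_abs b E k k' (c : 'I_(\dim {:V}) -> C) x : linP E -> linP k -> linP k' ->
  (forall i, E (ob_v b i) = c i *: ob_v b i) -> (forall i, 0 < c i) -> adjP k k' ->
  (forall x, k (k' x) = x) -> (forall x, k' (k x) = x) ->
  (forall x, k (E x) = E (k x)) -> k (E x) = x -> E x = x /\ k x = x.
Proof.
move=> lE lk lk' Ev c0 ak kk' k'k kE hx.
have aE : adjP E E by apply: eigen_selfadj lE Ev _ => i; rewrite gtr0_real.
have k'E y : k' (E y) = E (k' y) by rewrite -{1}(kk' y) -kE k'k.
have aA : adjP (k \o E) (E \o k') := adj_comp ak aE.
have hx2 : E (k' x) = x.
  apply/eqP; rewrite -subr_eq0; apply/eqP; apply: (form_eq0 (L := L)).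
  have h1 y : H (E (k' y)) x = H y x by have := adj_sym aA y x; rewrite /= hx.
  have h2 y : H x (E (k' y)) = H x y by have := aA x y; rewrite /= hx.
  have h4 : H (E (k' x)) (E (k' x)) = H x x.
    have := adj_sym aA x (E (k' x)); rewrite /= => ->.
    have -> : k (E (E (k' x))) = E (k' x) by rewrite !kE kk' -[in k' x]hx k'k.
    exact: h2.
  by rewrite formBB h4 h1 h2; ring.
have hE2 : E (E x) = x.
  have -> : E (E x) = E (k' (k (E x))) by rewrite k'k.
  by rewrite hx.
have hEx : E x = x.
  rewrite -[RHS]scale1r; apply/(eigen_coP (ob_coE b) (ob_col b) (ob_cov b) lE Ev) => i ci.
  have cE z := co_map (ob_coE b) (ob_col b) (ob_cov b) lE Ev i z.
  have := congr1 (ob_co b i) hE2; rewrite !cE mulrA => /eqP.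
  rewrite -subr_eq0 -{2}[ob_co b i x]mul1r -mulrBl mulf_eq0 => /orP[|/eqP //].
  rewrite -expr2 subr_eq0 sqrf_eq1 (negbTE ci) /= => /eqP e.
  by have := c0 i; rewrite e oppr_gt0 ltr10.
by split=> //; rewrite -{1}hEx hx.
Qed.

End Traces.

(** * Characteristic polynomials and simultaneous triangular form *)

Section CharPoly.
Context {F : fieldType} {n : nat}.
Implicit Types (A P : 'M[F]_n).

Lemma horner_char_poly A a : (char_poly A).[a] = \det (a%:M - A).
Proof.
rewrite -[LHS]/(horner_eval a _) /char_poly -det_map_mx; congr (\det _).
by apply/matrixP => i j; rewrite !mxE -[LHS]/((_ *+ _ - _).[a]) !(hornerE, hornerMn).
Qed.

Lemma char_poly_conj A P : P \in unitmx -> char_poly (P *m A *m invmx P) = char_poly A.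
Proof.
move=> uP; pose Q := map_mx (@polyC F) P; pose Q' := map_mx (@polyC F) (invmx P).
have QQ : Q *m Q' = 1%:M by rewrite -map_mxM mulmxV // map_mx1.
rewrite /char_poly; have -> : char_poly_mx (P *m A *m invmx P) = Q *m char_poly_mx A *m Q'.
  by rewrite /char_poly_mx mulmxBr mulmxBl scalar_mxC -[X in _ = X - _]mulmxA QQ mulmx1 !map_mxM.
by rewrite !det_mulmx mulrC mulrA -det_mulmx (mulmx1C QQ) det1 mul1r.
Qed.

End CharPoly.

Lemma char_poly_ext (F : numFieldType) n (A A' : 'M[F]_n) :
  (forall a, \det (a%:M - A) = \det (a%:M - A')) -> char_poly A = char_poly A'.
Proof.
move=> h; apply/eqP; rewrite -subr_eq0; apply/eqP.
pose p := char_poly A - char_poly A'.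
apply: (@roots_geq_poly_eq0 _ _ [seq i%:R | i <- iota 0 (size p)]).
- apply/allP => x _; rewrite /root hornerD hornerN !horner_char_poly h subrr //.
- by rewrite map_inj_uniq ?iota_uniq // => i j /eqP; rewrite eqr_nat => /eqP.
- by rewrite size_map size_iota.
Qed.

Section TrigProducts.
Context {F : comNzRingType} {n : nat}.
Implicit Types (A P : 'M[F]_n).

Lemma trig_mulE A P i : is_trig_mx A -> is_trig_mx P -> (A *m P) i i = A i i * P i i.
Proof.
move=> /is_trig_mxP tA /is_trig_mxP tP; rewrite mxE (bigD1 i) //= big1 ?addr0 // => j ji.
have [ij|ge] := ltnP i j; first by rewrite tA // mul0r.
by rewrite tP ?mulr0 // ltn_neqAle ge andbT.
Qed.

Lemma trig_mulmx A P : is_trig_mx A -> is_trig_mx P -> is_trig_mx (A *m P).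
Proof.
move=> /is_trig_mxP tA /is_trig_mxP tP; apply/is_trig_mxP => i k ik.
rewrite mxE big1 // => j _; have [ij|ji] := ltnP i j; first by rewrite tA // mul0r.
by rewrite tP ?mulr0 //; exact: leq_ltn_trans ji ik.
Qed.

End TrigProducts.

(* For commuting [A], [P], [D], [M] in simultaneous triangular form, the
   eigenvalue 1 of [A] marks the range of the projection [P]. If [M] has no
   eigenvalue 1 off this range but at least as many as [A] in total, then it is
   unipotent on the range. *)
Lemma unipotent_trace (C : numClosedFieldType) n (A P D M : 'M[C]_n) r :
  A *m P = P *m A -> A *m D = D *m A -> A *m M = M *m A -> P *m D = D *m P ->
  P *m M = M *m P -> D *m M = M *m D ->
  P *m P = P -> A *m P = P -> \det (A - 1%:M + P) != 0 ->
  \det ((M - 1%:M) *m (1%:M - P) + P) != 0 ->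
  ('X - 1%:P) ^+ r %| char_poly M -> ~~ (('X - 1%:P) ^+ r.+1 %| char_poly A) ->
  \tr (D *m D *m M *m P) = \tr (D *m D *m P) /\ \tr (M *m P) = \tr P.
Proof.
move=> AP AD AM PD PM DM PP AP1 d1 d2 hM hA.
have [|Q uQ] := @cotrigonalization C n [:: A; P; D; M].
  by move=> X Y; rewrite !inE => /or4P[] /eqP -> /or4P[] /eqP ->.
move=> /and5P[tA tP tD tM _].
have uQ' : Q \in unitmx by exact: unitarymx_unit.
pose c (X : 'M[C]_n) := Q *m X *m invmx Q.
have {tA}tA : is_trig_mx (c A) by move: tA; rewrite /similar_to /= conjumx.
have {tP}tP : is_trig_mx (c P) by move: tP; rewrite /similar_to /= conjumx.
have {tD}tD : is_trig_mx (c D) by move: tD; rewrite /similar_to /= conjumx.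
have {tM}tM : is_trig_mx (c M) by move: tM; rewrite /similar_to /= conjumx.
have cM X Y : c (X *m Y) = c X *m c Y by rewrite /c !mulmxA mulmxKV.
have cB X Y : c (X - Y) = c X - c Y by rewrite /c mulmxBr mulmxBl.
have cD X Y : c (X + Y) = c X + c Y by rewrite /c mulmxDr mulmxDl.
have c1 : c 1%:M = 1%:M by rewrite /c mulmx1 mulmxV.
have trc X : \tr (c X) = \tr X by rewrite /c mxtrace_mulC mulmxA mulVmx // mul1mx.
have detc X : \det (c X) = \det X.
  by rewrite /c !det_mulmx mulrC mulrA -det_mulmx mulVmx // det1 mul1r.
have tB (X Y : 'M[C]_n) : is_trig_mx X -> is_trig_mx Y -> is_trig_mx (X - Y).
  move=> /is_trig_mxP tX /is_trig_mxP tY; apply/is_trig_mxP => i j ij.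
  by rewrite !mxE tX // tY // subrr.
have tDd (X Y : 'M[C]_n) : is_trig_mx X -> is_trig_mx Y -> is_trig_mx (X + Y).
  move=> /is_trig_mxP tX /is_trig_mxP tY; apply/is_trig_mxP => i j ij.
  by rewrite !mxE tX // tY // addr0.
have t1 : is_trig_mx (1%:M : 'M[C]_n) by exact: scalar_mx_is_trig.
have pp i : c P i i = c P i i * c P i i by rewrite -trig_mulE // -cM PP.
have ap i : c P i i = c A i i * c P i i by rewrite -trig_mulE // -cM AP1.
have h1 i : c A i i - 1 + c P i i != 0.
  move: d1; rewrite -detc cD cB c1 det_trig; last by apply: tDd => //; exact: tB.
  by move=> /prodf_neq0 /(_ i isT); rewrite !mxE eqxx.
have h2 i : (c M i i - 1) * (1 - c P i i) + c P i i != 0.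
  move: d2; rewrite -detc cD cM !cB c1 det_trig; last first.
    by apply: tDd => //; apply: trig_mulmx; exact: tB.
  move=> /prodf_neq0 /(_ i isT).
  by rewrite mxE trig_mulE ?tB // !mxE eqxx.
(* The hypothesis [d1] excludes a diagonal one of [A] where the projection has entry 0, and
   [A P = P] excludes an entry 1 of [P] elsewhere. *)
have p01 i : c P i i = (c A i i == 1)%:R.
  have [a1|an] := eqVneq (c A i i) 1.
    have := h1 i; rewrite a1 subrr add0r => p0.
    by have := pp i; rewrite -{1}[c P i i]mulr1 => /(mulfI p0) <-.
  have := ap i; rewrite -{1}[c P i i]mul1r => /eqP.
  by rewrite -subr_eq0 -mulrBl mulf_eq0 subr_eq0 eq_sym (negbTE an) => /eqP.
have m1 i : c M i i = 1 -> c A i i = 1.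
  move=> mi; have := h2 i; rewrite mi subrr mul0r add0r p01.
  by case: (c A i i =P 1) => // _; rewrite /= eqxx.
have cpE X : is_trig_mx (c X) -> char_poly X = \prod_(y <- [seq c X i i | i <- enum 'I_n]) ('X - y%:P).
  by move=> tX; rewrite -(char_poly_conj _ uQ') char_poly_trig // big_map big_enum.
have cnt X : is_trig_mx (c X) -> mup 1 (char_poly X) = #|[pred i | c X i i == 1]|.
  move=> tX; rewrite cpE // mu_prod_XsubC count_map -sum1_count big_enum_cond /=.
  by rewrite sum1_card; apply: eq_card => i; rewrite !inE.
have cp0 X : char_poly X != 0 by rewrite monic_neq0 // char_poly_monic.
(* [M] has at least [r] diagonal ones, by [m1] all at places where [A] has one, and [A] has at most
   [r]; so the places coincide. *)
have hM' : (r <= #|[pred i | c M i i == 1%R]|)%N by rewrite -cnt // mup_geq ?cp0.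
have hA' : (#|[pred i | c A i i == 1%R]| <= r)%N.
  by rewrite -ltnS -cnt // mup_ltn ?cp0.
have MA : [pred i | c M i i == 1] \subset [pred i | c A i i == 1].
  by apply/fintype.subsetP => i; rewrite !inE => /eqP/m1 ->.
have /fintype.subset_cardP e : #|[pred i | c M i i == 1]| = #|[pred i | c A i i == 1]|.
  by apply/eqP; rewrite eqn_leq subset_leq_card // (leq_trans hA').
have mp i : c M i i * c P i i = c P i i.
  rewrite p01; have := e MA i; rewrite !inE => <-.
  by case: eqP => [->|]; rewrite ?mulr1 ?mulr0.
split.
  rewrite -(trc (D *m D *m M *m P)) -(trc (D *m D *m P)) !cM /mxtrace; apply: eq_bigr => i _.
  have t2 := trig_mulmx tD tD; have t3 := trig_mulmx t2 tM.
  by rewrite (trig_mulE i t3 tP) (trig_mulE i t2 tM) (trig_mulE i t2 tP) -mulrA mp.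
rewrite -(trc (M *m P)) -(trc P) !cM /mxtrace; apply: eq_bigr => i _.
by rewrite trig_mulE // mp.
Qed.

Lemma unipotent_trace_real (R : realType) n (A P D M : 'M[R]_n) r :
  A *m P = P *m A -> A *m D = D *m A -> A *m M = M *m A -> P *m D = D *m P ->
  P *m M = M *m P -> D *m M = M *m D ->
  P *m P = P -> A *m P = P -> \det (A - 1%:M + P) != 0 ->
  \det ((M - 1%:M) *m (1%:M - P) + P) != 0 ->
  ('X - 1%:P) ^+ r %| char_poly M -> ~~ (('X - 1%:P) ^+ r.+1 %| char_poly A) ->
  \tr (D *m D *m M *m P) = \tr (D *m D *m P) /\ \tr (M *m P) = \tr P.
Proof.
move=> AP AD AM PD PM DM PP AP1 d1 d2 hM hA.
pose f := real_complex R : {rmorphism R -> R[i]}.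
have inj : injective f by exact: fmorph_inj.
have cX k : ('X - 1%:P) ^+ k = map_poly f (('X - 1%:P) ^+ k).
  by rewrite rmorphXn /= rmorphB /= map_polyX map_polyC /= rmorph1.
have := @unipotent_trace R[i] n (map_mx f A) (map_mx f P) (map_mx f D) (map_mx f M) r.
rewrite -!map_mxM /=.
have <- : map_mx f (A - 1%:M + P) = map_mx f A - 1%:M + map_mx f P.
  by rewrite map_mxD map_mxB map_mx1.
have -> : (map_mx f M - 1%:M) *m (1%:M - map_mx f P) + map_mx f P =
    map_mx f ((M - 1%:M) *m (1%:M - P) + P).
  by rewrite map_mxD map_mxM !map_mxB map_mx1.
rewrite !det_map_mx !fmorph_eq0 !cX -!map_char_poly !dvdp_map !trace_map_mx.
rewrite AP AD AM PD PM DM PP.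
move=> /(_ erefl erefl erefl erefl erefl erefl erefl).
rewrite -AP AP1 => /(_ erefl d1 d2 hM hA) [h1 h2].
by split; apply: inj.
Qed.

(** * The complexified Lie algebra of a reductive group *)

Section ComplexVectors.
Context {R : realType} {n : nat}.
Notation V := 'rV[R]_n.
Notation VC := 'rV[R[i]]_n.
Implicit Types (X Y : V) (Z W : VC) (a : R[i]).

Lemma reV_cplx X Y : reV (cplxV X Y) = X.
Proof. by apply/rowP => i; rewrite !mxE. Qed.

Lemma imV_cplx X Y : imV (cplxV X Y) = Y.
Proof. by apply/rowP => i; rewrite !mxE. Qed.

Lemma cplxV_ext Z W : reV Z = reV W -> imV Z = imV W -> Z = W.
Proof.
move=> /rowP h1 /rowP h2; apply/rowP => i; have := h1 i; have := h2 i; rewrite !mxE.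
by case: (Z 0 i) (W 0 i) => [a b] [c d] /= -> ->.
Qed.

Lemma reV_lin a Z W :
  reV (a *: Z + W) = complex.Re a *: reV Z - complex.Im a *: imV Z + reV W.
Proof.
apply/rowP => i; rewrite !mxE; case: (Z 0 i) (W 0 i) a => [a b] [c d] [e f] /=.
by [].
Qed.

Lemma imV_lin a Z W :
  imV (a *: Z + W) = complex.Re a *: imV Z + complex.Im a *: reV Z + imV W.
Proof.
by apply/rowP => i; rewrite !mxE; case: (Z 0 i) (W 0 i) a => [a b] [c d] [e f] /=.
Qed.

Lemma reV0 : reV (0 : VC) = 0. Proof. by apply/rowP => i; rewrite !mxE. Qed.
Lemma imV0 : imV (0 : VC) = 0. Proof. by apply/rowP => i; rewrite !mxE. Qed.

Lemma reVZ a Z : reV (a *: Z) = complex.Re a *: reV Z - complex.Im a *: imV Z.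
Proof. by have := reV_lin a Z 0; rewrite reV0 !addr0. Qed.

Lemma imVZ a Z : imV (a *: Z) = complex.Re a *: imV Z + complex.Im a *: reV Z.
Proof. by have := imV_lin a Z 0; rewrite imV0 !addr0. Qed.

Lemma reVD Z W : reV (Z + W) = reV Z + reV W.
Proof. by have := reV_lin 1 Z W; rewrite /= !scale1r scale0r subr0. Qed.

Lemma imVD Z W : imV (Z + W) = imV Z + imV W.
Proof. by have := imV_lin 1 Z W; rewrite /= !scale1r scale0r addr0. Qed.

Lemma reVN Z : reV (- Z) = - reV Z.
Proof. by apply/rowP => i; rewrite !mxE; case: (Z 0 i). Qed.

Lemma imVN Z : imV (- Z) = - imV Z.
Proof. by apply/rowP => i; rewrite !mxE; case: (Z 0 i). Qed.

Definition rlV X : VC := cplxV X 0.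

Lemma reV_rl X : reV (rlV X) = X. Proof. exact: reV_cplx. Qed.
Lemma imV_rl X : imV (rlV X) = 0. Proof. exact: imV_cplx. Qed.

Lemma rlV_lin (a : R) X Y : rlV (a *: X + Y) = (a%:C)%C *: rlV X + rlV Y.
Proof.
apply: cplxV_ext; rewrite ?reV_lin ?imV_lin !reV_rl !imV_rl /=.
  by rewrite scaler0 subr0.
by rewrite scaler0 scale0r !addr0.
Qed.

Lemma rlV0 : rlV 0 = 0.
Proof. by apply: cplxV_ext; rewrite ?reV_rl ?imV_rl ?reV0 ?imV0. Qed.

Lemma rlV_coord X j : rlV X 0 j = ((X 0 j)%:C)%C.
Proof. by rewrite /rlV /cplxV !mxE. Qed.

Lemma rlV_delta j : rlV (delta_mx 0 j) = delta_mx 0 j.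
Proof. by apply/rowP => l; rewrite /rlV /cplxV !mxE /=; case: (l == j). Qed.

Lemma rlV_eq0 X : rlV X = 0 -> X = 0.
Proof. by move=> /(congr1 (@reV R n)); rewrite reV_rl reV0. Qed.

Lemma rlV_inj X Y : rlV X = rlV Y -> X = Y.
Proof. by move=> /(congr1 (@reV R n)); rewrite !reV_rl. Qed.

Lemma cplxVE Z : Z = rlV (reV Z) + (0 +i* 1)%C *: rlV (imV Z).
Proof.
apply: cplxV_ext; rewrite ?reVD ?imVD ?reVZ ?imVZ !reV_rl !imV_rl /=.
  by rewrite scale0r scaler0 subr0 addr0.
by rewrite scaler0 !add0r scale1r.
Qed.

End ComplexVectors.

Section Complexify.
Context {R : realType} {n : nat}.
Notation V := 'rV[R]_n.
Notation VC := 'rV[R[i]]_n.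
Context (br : V -> V -> V) (ip : V -> V -> R) (th : V -> V).
Context (brl : forall z a x y, br (a *: x + y) z = a *: br x z + br y z).
Context (brr : forall z a x y, br z (a *: x + y) = a *: br z x + br z y).
Context (brxx : forall x, br x x = 0).
Context (jac : forall x y z, br x (br y z) = br (br x y) z + br y (br x z)).
Context (ipl : forall z a x y, ip (a *: x + y) z = a * ip x z + ip y z).
Context (ipC : forall x y, ip x y = ip y x).
Context (ip_gt0 : forall x, x != 0 -> 0 < ip x x).
Context (thl : forall a x y, th (a *: x + y) = a *: th x + th y).
Context (thK : forall x, th (th x) = x).
Context (th_br : forall x y, th (br x y) = br (th x) (th y)).
Context (ip_adj : forall x y z, ip (br z x) y = ip x (br (- th z) y)).

(** The hermitian extension of [ip], linear in the first variable and antilinear in the second. *)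
Definition hform (Z W : VC) : R[i] :=
  ((ip (reV Z) (reV W) + ip (imV Z) (imV W)) +i*
   (ip (imV Z) (reV W) - ip (reV Z) (imV W)))%C.

Definition cstar (Z : VC) : VC := cplxV (- th (reV Z)) (th (imV Z)).

Let cbr := cplx_br br.

Let ip0 z : ip 0 z = 0.
Proof. by have := ipl z (-1) 0 0; rewrite scaler0 addr0 mulN1r addNr. Qed.
Let ipD x y z : ip (x + y) z = ip x z + ip y z.
Proof. by have := ipl z 1 x y; rewrite scale1r mul1r. Qed.
Let ipZ a x z : ip (a *: x) z = a * ip x z.
Proof. by have := ipl z a x 0; rewrite ip0 !addr0. Qed.
Let ipN x z : ip (- x) z = - ip x z.
Proof. by rewrite -scaleN1r ipZ mulN1r. Qed.
Let ipDr x y z : ip z (x + y) = ip z x + ip z y.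
Proof. by rewrite ipC ipD !(ipC z). Qed.
Let ipNr x z : ip z (- x) = - ip z x.
Proof. by rewrite ipC ipN (ipC z). Qed.
Let brDl' := brDl brl.
Let brDr' := brDr brr.
Let brZl' := brZl brl.
Let brZr' := brZr brr.
Let brNl' := brNl brl.
Let brNr' := brNr brr.
Let brV := (brDl', brDr', brNl', brNr', brZl', brZr').
Let ipV := (ipD, ipZ, ipN, ipDr, ipNr).
Let reimV := (@reV_cplx R n, @imV_cplx R n, @reVD R n, @imVD R n, @reVN R n, @imVN R n,
  @reVZ R n, @imVZ R n).
Let brC' x y : br x y = - br y x.
Proof.
have := brxx (x + y); rewrite brDl' !brDr' !brxx.
by rewrite add0r addr0 => /eqP; rewrite addr_eq0 => /eqP.
Qed.

Lemma cbr_l z a x y : cbr (a *: x + y) z = a *: cbr x z + cbr y z.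
Proof.
rewrite /cbr /cplx_br; apply: cplxV_ext; rewrite !reimV !brV;
  apply/rowP => i; rewrite !mxE; ring.
Qed.

Lemma cbr_r z a x y : cbr z (a *: x + y) = a *: cbr z x + cbr z y.
Proof.
rewrite /cbr /cplx_br; apply: cplxV_ext; rewrite !reimV !brV;
  apply/rowP => i; rewrite !mxE; ring.
Qed.

Lemma cbr_xx x : cbr x x = 0.
Proof.
rewrite /cbr /cplx_br; apply: cplxV_ext; rewrite !reimV ?reV0 ?imV0 ?brxx ?subr0 //.
by rewrite brC' addNr.
Qed.

Lemma cbr_jac x y z : cbr x (cbr y z) = cbr (cbr x y) z + cbr y (cbr x z).
Proof.
rewrite /cbr /cplx_br; apply: cplxV_ext; rewrite !reimV !brV !(jac (reV x)) !(jac (imV x));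
  apply/rowP => i; rewrite !mxE; ring.
Qed.

Lemma hform_l z a x y : hform (a *: x + y) z = a * hform x z + hform y z.
Proof.
rewrite /hform !reimV !ipV; case: a => a b /=.
by congr (_ +i* _)%C; rewrite /=; ring.
Qed.

Lemma hformC x y : hform y x = Num.conj_op (hform x y).
Proof.
rewrite /hform /= (ipC (reV y)) (ipC (imV y)) (ipC (imV y)) (ipC (reV y)).
by congr (_ +i* _)%C; ring.
Qed.

Lemma hform_gt0 x : x != 0 -> 0 < hform x x.
Proof.
move=> x0; rewrite ltcE /= ipC subrr eqxx /=.
have ge0 y : 0 <= ip y y by have [->|/ip_gt0/ltW//] := eqVneq y 0; rewrite ip0.
have [r0|/ip_gt0 r0] := eqVneq (reV x) 0; last by rewrite ltr_pwDl.
have [i0|/ip_gt0 i0] := eqVneq (imV x) 0; last by rewrite ltr_wpDl.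
by case/eqP: x0; apply: cplxV_ext; rewrite ?r0 ?i0 ?reV0 ?imV0.
Qed.

Let th0 : th 0 = 0.
Proof. by have := thl (-1) 0 0; rewrite scaler0 addr0 scaleN1r addNr. Qed.
Let thD x y : th (x + y) = th x + th y.
Proof. by have := thl 1 x y; rewrite !scale1r. Qed.
Let thZ a x : th (a *: x) = a *: th x.
Proof. by have := thl a x 0; rewrite th0 !addr0. Qed.
Let thN x : th (- x) = - th x.
Proof. by rewrite -scaleN1r thZ scaleN1r. Qed.

Lemma cstar_l a x y : cstar (a *: x + y) = Num.conj_op a *: cstar x + cstar y.
Proof.
rewrite /cstar; apply: cplxV_ext; rewrite !reimV !(thD, thZ, thN); case: a => a b /=;
  apply/rowP => i; rewrite !mxE; ring.
Qed.

Lemma cstarK x : cstar (cstar x) = x.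
Proof.
by rewrite /cstar; apply: cplxV_ext; rewrite !reimV ?thN !thK ?opprK.
Qed.

Lemma cstar_br x y : cstar (cbr x y) = cbr (cstar y) (cstar x).
Proof.
rewrite /cstar /cbr /cplx_br; apply: cplxV_ext; rewrite !reimV !(thD, thN) !th_br !brV.
  by rewrite (brC' (th (reV y))) (brC' (th (imV y))); apply/rowP => i; rewrite !mxE; ring.
by rewrite (brC' (th (reV y))) (brC' (th (imV y))); apply/rowP => i; rewrite !mxE; ring.
Qed.

Lemma hform_adj x y z : hform (cbr z x) y = hform x (cbr (cstar z) y).
Proof.
rewrite /hform /cbr /cplx_br /cstar !reimV !ipV !ip_adj !brV !ipV.
by congr (_ +i* _)%C; ring.
Qed.

Definition cplx_star_lie : @star_lie R[i] VC :=
  StarLie cbr_l cbr_r cbr_xx cbr_jac hform_l hformC hform_gt0 cstar_l cstarK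
    cstar_br hform_adj.

End Complexify.

Section ReductiveFacts.
Context {R : realType} {n : nat} {G : lieGroupType R n}.
Context {K : set G} {theta : {linear 'rV[R]_n -> 'rV[R]_n}}.
Context {B : 'rV[R]_n -> 'rV[R]_n -> R}.
Context (HG : reductive_group K theta B).
Notation V := 'rV[R]_n.
Notation VC := 'rV[R[i]]_n.
Notation br := (lbr G).
Notation exp := (expG G).
Implicit Types (g k : G) (X Y Z : V).

Lemma B0r X : B X 0 = 0.
Proof. by have := red_B_lin HG X (-1) 0 0; rewrite scaler0 addr0 mulN1r addNr. Qed.

Lemma BDr X Y Z : B X (Y + Z) = B X Y + B X Z.
Proof. by have := red_B_lin HG X 1 Y Z; rewrite scale1r mul1r. Qed.

Lemma BZr (a : R) X Y : B X (a *: Y) = a * B X Y.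
Proof. by have := red_B_lin HG X a Y 0; rewrite B0r !addr0. Qed.

Lemma BNr X Y : B X (- Y) = - B X Y.
Proof. by rewrite -scaleN1r BZr mulN1r. Qed.

Lemma BDl X Y Z : B (Y + Z) X = B Y X + B Z X.
Proof. by rewrite !(red_B_sym HG _ X) BDr. Qed.

Lemma BZl (a : R) X Y : B (a *: Y) X = a * B Y X.
Proof. by rewrite !(red_B_sym HG _ X) BZr. Qed.

Lemma thetaK X : theta (theta X) = X. Proof. exact: red_theta_inv HG X. Qed.

Lemma kp_split X : exists Xk Xp, [/\ X = Xk + Xp, theta Xk = Xk & theta Xp = - Xp].
Proof.
exists (2^-1 *: (X + theta X)), (2^-1 *: (X - theta X)); split.
- by apply/rowP => i; rewrite !mxE; field.
- by rewrite linearZ /= linearD /= thetaK addrC.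
- rewrite linearZ /= linearB /= thetaK -scalerN; congr (_ *: _).
  by apply/rowP => i; rewrite !mxE; ring.
Qed.

Definition ip X Y := - B X (theta Y).

Lemma ipl Z (a : R) X Y : ip (a *: X + Y) Z = a * ip X Z + ip Y Z.
Proof. by rewrite /ip BDl BZl; ring. Qed.

Lemma ipC X Y : ip X Y = ip Y X.
Proof. by rewrite /ip -(red_B_theta HG X) thetaK (red_B_sym HG). Qed.

Lemma ip_gt0 X : X != 0 -> 0 < ip X X.
Proof.
have [Y [Z [-> hY hZ]]] := kp_split X => X0.
rewrite /ip linearD /= hY hZ.
have o := red_B_orth HG hY hZ.
rewrite !(BDl, BDr, BNr) (red_B_sym HG Z Y) o.
have [Y0|/(red_B_k0 HG hY) kn] := eqVneq Y 0.
  have Z0 : Z != 0 by apply: contraNneq X0 => Z0; rewrite Y0 Z0 addr0.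
  have := red_B_p0 HG hZ Z0; rewrite Y0 B0r; lra.
have [Z0|/(red_B_p0 HG hZ) pp] := eqVneq Z 0.
  by rewrite Z0 B0r; lra.
lra.
Qed.

Lemma B_bounded X : exists C, forall Y, `|B X Y : R^o| <= C * `|Y|.
Proof.
have e Y : B X Y = \sum_i Y 0 i * B X (delta_mx 0 i).
  rewrite [in LHS](row_sum_delta Y); elim/big_rec2: _ => [|i u w _ <-].
    exact: B0r.
  by rewrite BDr BZr.
exists (\sum_i `|B X (delta_mx 0 i)|) => Y; rewrite e mulr_suml.
apply: le_trans (ler_norm_sum _ _ _) _; apply: ler_sum => i _.
by rewrite normrM mulrC ler_wpM2l // le_mx_norm.
Qed.

(** Differentiate [B (Ad (exp (s Z)) X) Y = B X (Ad (exp (- s Z)) Y)] at 0. *)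
Lemma B_inv X Y Z : B (br Z X) Y = - B X (br Z Y).
Proof.
have [C1 h1] := B_bounded Y; have [C2 h2] := B_bounded X.
have l1 : linear (fun W => B Y W : R^o) by move=> a u w; rewrite BDr BZr.
have l2 : linear (fun W => B X W : R^o) by move=> a u w; rewrite BDr BZr.
have d1 := cdiff_linear l1 h1 (tangent_Ad X (expG_tangent (G := G) Z)).
have d2 := cdiff_linear l2 h2 (tangent_Ad Y (expG_tangent (G := G) (- Z))).
rewrite (red_B_sym HG) -BNr -lbrNl; apply: cdiff_uniq d1 _.
apply: cdiff_ext d2 => s /=; rewrite scalerN expGN.
rewrite (red_B_sym HG Y) -(red_B_Ad HG (exp (s *: Z))^-1%g (Ad (exp (s *: Z)) X)).
by rewrite AdVK.
Qed.

Lemma ip_adj X Y Z : ip (br Z X) Y = ip X (br (- theta Z) Y).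
Proof.
by rewrite /ip B_inv (red_theta_br HG) [theta (- theta Z)]linearN /= thetaK lbrNl BNr opprK.
Qed.

Definition Lred : @star_lie R[i] VC :=
  cplx_star_lie (fun z a x y => eq_trans (lbrDl _ _ _) (congr1 (+%R^~ _) (lbrZl _ _ _)))
   (fun z a x y => lbr_linr z a x y) (@lbrXX _ _ _) (@lbr_jacobi _ _ _)
   ipl ipC ip_gt0 (fun a x y => linearP theta a x y) thetaK (red_theta_br HG) ip_adj.

Lemma k0_exp Z (s : R) : theta Z = Z -> K (exp (s *: Z)).
Proof. by move/(red_k0 HG). Qed.

Lemma Ad_k0 k Z : K k -> theta Z = Z -> theta (Ad k Z) = Ad k Z.
Proof.
move=> Kk /(red_k0 HG) hZ; apply/(red_k0 HG) => t.
have [_ _ <- _] := Ad_lin k; rewrite -expG_conj.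
by apply: (red_KM HG); [apply: (red_KM HG)|exact: (red_KV HG)].
Qed.

(** If [U] is the k-part of [Ad k Y], moving [Ad k] to the other side turns [B U U] into the pairing
    of an element of the k-part with [Y], which is zero; [B] is negative definite on the k-part. *)
Lemma Ad_p0 k Y : K k -> theta Y = - Y -> theta (Ad k Y) = - Ad k Y.
Proof.
move=> Kk hY; have [U [W [e hU hW]]] := kp_split (Ad k Y).
suff U0 : U = 0 by rewrite e U0 !add0r.
apply: contrapT => /eqP /(red_B_k0 HG hU).
have o := red_B_orth HG hU hW.
have -> : B U U = B U (Ad k Y) by rewrite e BDr o addr0.
rewrite -(red_B_Ad HG k^-1%g) AdVK.
rewrite (red_B_orth HG) ?ltxx //; apply: Ad_k0 => //.
exact: (red_KV HG).
Qed.

Lemma Ad_theta k X : K k -> Ad k (theta X) = theta (Ad k X).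
Proof.
move=> Kk; have [AD AB _ _] := Ad_lin k.
have [Y [Z [-> hY hZ]]] := kp_split X.
rewrite linearD /= hY hZ AB AD linearD /= Ad_k0 // Ad_p0 //.
Qed.

Lemma ip_Ad k X Y : K k -> ip (Ad k X) (Ad k Y) = ip X Y.
Proof. by move=> Kk; rewrite /ip -Ad_theta // (red_B_Ad HG). Qed.

Lemma k_of_pp X Y : theta X = - X -> theta Y = - Y -> theta (br X Y) = br X Y.
Proof. by move=> hX hY; rewrite (red_theta_br HG) hX hY lbrNl lbrNr opprK. Qed.

Lemma k_of_kk X Y : theta X = X -> theta Y = Y -> theta (br X Y) = br X Y.
Proof. by move=> hX hY; rewrite (red_theta_br HG) hX hY. Qed.

End ReductiveFacts.

Section ComplexMaps.
Context {R : realType} {n : nat}.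
Notation V := 'rV[R]_n.
Notation VC := 'rV[R[i]]_n.
Implicit Types (f g : V -> V).

Lemma reV_map f Z : reV (cplx_map f Z) = f (reV Z). Proof. exact: reV_cplx. Qed.
Lemma imV_map f Z : imV (cplx_map f Z) = f (imV Z). Proof. exact: imV_cplx. Qed.

Lemma cplx_map_lin f : (forall (a : R) x y, f (a *: x + y) = a *: f x + f y) ->
  linP (cplx_map f).
Proof.
move=> lf a x y; have f0 : f 0 = 0 by have := lf (-1) 0 0; rewrite scaler0 addr0 scaleN1r addNr.
have fD u w : f (u + w) = f u + f w by have := lf 1 u w; rewrite !scale1r.
have fZ c u : f (c *: u) = c *: f u by have := lf c u 0; rewrite f0 !addr0.
have fN u : f (- u) = - f u by rewrite -scaleN1r fZ scaleN1r.
by apply: cplxV_ext; rewrite !(reV_map, imV_map, reV_lin, imV_lin, fD, fN, fZ).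
Qed.

Lemma cplx_map_comp f g Z : cplx_map f (cplx_map g Z) = cplx_map (f \o g) Z.
Proof. by apply: cplxV_ext; rewrite !(reV_map, imV_map). Qed.

Lemma cplx_map_id f Z : (forall x, f x = x) -> cplx_map f Z = Z.
Proof. by move=> h; apply: cplxV_ext; rewrite !(reV_map, imV_map) h. Qed.

Lemma cplx_map_ext f g Z : (forall x, f x = g x) -> cplx_map f Z = cplx_map g Z.
Proof. by move=> h; apply: cplxV_ext; rewrite !(reV_map, imV_map) h. Qed.

Lemma cplx_map_rl f X : f 0 = 0 -> cplx_map f (rlV X) = rlV (f X).
Proof. by move=> f0; apply: cplxV_ext; rewrite !(reV_map, imV_map, reV_rl, imV_rl). Qed.

Lemma cplx_map_eq0 f Z : cplx_map f Z = 0 <-> f (reV Z) = 0 /\ f (imV Z) = 0.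
Proof.
split=> [h|[h1 h2]].
  by rewrite -reV_map -imV_map h reV0 imV0.
by apply: cplxV_ext; rewrite !(reV_map, imV_map) ?h1 ?h2 ?reV0 ?imV0.
Qed.

Lemma cplx_map_id_iff f Z : cplx_map f Z = Z <-> f (reV Z) = reV Z /\ f (imV Z) = imV Z.
Proof.
split=> [h|[h1 h2]]; first by rewrite -reV_map -imV_map h.
by apply: cplxV_ext; rewrite !(reV_map, imV_map).
Qed.

Lemma hform_map (ip : V -> V -> R) f Z W : (forall x y, ip (f x) (f y) = ip x y) ->
  hform ip (cplx_map f Z) (cplx_map f W) = hform ip Z W.
Proof. by move=> h; rewrite /hform !reV_map !imV_map !h. Qed.

Definition trc (f : VC -> VC) := \sum_j f (delta_mx 0 j) 0 j.

Lemma cplx_map_br f (b : V -> V -> V) Z W :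
  (forall x y, f (x + y) = f x + f y) -> (forall x y, f (x - y) = f x - f y) ->
  (forall x y, f (b x y) = b (f x) (f y)) ->
  cplx_map f (cplx_br b Z W) = cplx_br b (cplx_map f Z) (cplx_map f W).
Proof.
move=> fD fB fb; apply: cplxV_ext; rewrite !(reV_map, imV_map) !(reV_cplx, imV_cplx).
  by rewrite fB !fb.
by rewrite fD !fb.
Qed.

Lemma cplx_br_rl (b : V -> V -> V) X Z : (forall y, b 0 y = 0) ->
  cplx_br b (rlV X) Z = cplx_map (b X) Z.
Proof.
by move=> b0; apply: cplxV_ext; rewrite !(reV_map, imV_map) !(reV_cplx, imV_cplx) !b0 ?subr0 ?addr0.
Qed.

(** This makes [trb] independent of the basis, so that a norm defined with one basis can be computed
    in an eigenbasis. *)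
Lemma trc_ob (L : @star_lie R[i] VC) (b : obasis L) (f : VC -> VC) : linP f ->
  trc f = trb b f.
Proof.
move=> lf; transitivity (\sum_i \sum_j ob_v b i 0 j * ob_co b i (f (delta_mx 0 j))).
  rewrite exchange_big /=; apply: eq_bigr => j _.
  rewrite [in LHS](ob_coE b (f _)) summxE.
  by apply: eq_bigr => i _; rewrite mxE mulrC.
apply: eq_bigr => i _.
rewrite [in RHS](row_sum_delta (ob_v b i)) (lin_sum lf) (co_sum (ob_col b)).
by apply: eq_bigr => j _; rewrite (linZ lf) (coZ (ob_col b)).
Qed.

Lemma scaleC_map f (c : R) x : cplx_map f x = (c%:C)%C *: x <->
  f (reV x) = c *: reV x /\ f (imV x) = c *: imV x.
Proof.
split=> [h|[h1 h2]].
  rewrite -reV_map -imV_map h reVZ imVZ /= !scale0r subr0.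
  by split=> //; apply/rowP => i; rewrite !mxE addr0.
apply: cplxV_ext; rewrite !(reV_map, imV_map, reVZ, imVZ) /= !scale0r ?h1 ?h2 ?subr0 //.
by apply/rowP => i; rewrite !mxE addr0.
Qed.

End ComplexMaps.

Opaque reV imV cplxV cplx_map cplx_br rlV.

Section ComplexAd.
Context {R : realType} {n : nat} {G : lieGroupType R n}.
Notation V := 'rV[R]_n.
Notation VC := 'rV[R[i]]_n.
Implicit Types (g h : G) (X Y Z : V) (x y z : VC).

Definition cAd (g : G) : VC -> VC := cplx_map (Ad g).

Lemma Ad_linP g (a : R) X Y : Ad g (a *: X + Y) = a *: Ad g X + Ad g Y.
Proof. by have [AD _ AZ _] := Ad_lin g; rewrite AD AZ. Qed.

Lemma Ad0 g : Ad g 0 = 0. Proof. by have [_ _ _] := Ad_lin g. Qed.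

Lemma cAd_lin g : linP (cAd g). Proof. apply: cplx_map_lin; exact: Ad_linP. Qed.

Lemma reV_cAd g x : reV (cAd g x) = Ad g (reV x). Proof. exact: reV_map. Qed.
Lemma imV_cAd g x : imV (cAd g x) = Ad g (imV x). Proof. exact: imV_map. Qed.

Lemma cAd1 x : cAd 1%g x = x.
Proof. by apply: cplx_map_id => X; rewrite Ad1. Qed.

Lemma cAdM g h x : cAd (g * h)%g x = cAd g (cAd h x).
Proof. by rewrite /cAd cplx_map_comp; apply: cplx_map_ext => X; rewrite /= AdM. Qed.

Lemma cAdVK g x : cAd g^-1%g (cAd g x) = x.
Proof. by rewrite -cAdM mulVg cAd1. Qed.

Lemma cAdKV g x : cAd g (cAd g^-1%g x) = x.
Proof. by rewrite -cAdM mulgV cAd1. Qed.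

Lemma cAd_rl g X : cAd g (rlV X) = rlV (Ad g X).
Proof. exact: cplx_map_rl (Ad0 g). Qed.

Lemma cAd_gbr g x y : cAd g (gbr G x y) = gbr G (cAd g x) (cAd g y).
Proof.
have [AD AB _ _] := Ad_lin g.
by apply: cplx_map_br => // X Y; exact: Ad_br.
Qed.

Lemma cAd_id g x : cAd g x = x <-> Ad g (reV x) = reV x /\ Ad g (imV x) = imV x.
Proof. exact: cplx_map_id_iff. Qed.

Lemma gbr_rl X x : gbr G (rlV X) x = cplx_map (lbr G X) x.
Proof. by apply: cplx_br_rl => Y; exact: lbr0l. Qed.

Lemma gbr_rl2 X Y : gbr G (rlV X) (rlV Y) = rlV (lbr G X Y).
Proof. by rewrite gbr_rl cplx_map_rl // lbr0r. Qed.

Lemma gbr_rl_eq0 X x :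
  gbr G (rlV X) x = 0 <-> lbr G X (reV x) = 0 /\ lbr G X (imV x) = 0.
Proof. by rewrite gbr_rl; exact: cplx_map_eq0. Qed.

Lemma cAd_exp_eigen X v (d : R) : gbr G (rlV X) v = (d%:C)%C *: v ->
  cAd (expG G X) v = ((expR d)%:C)%C *: v.
Proof.
rewrite gbr_rl => /scaleC_map [h1 h2]; apply/scaleC_map.
by split; apply: Ad_exp_eigen.
Qed.

Lemma cAd_exp_half X x :
  cAd (expG G (2^-1 *: X)) (cAd (expG G (2^-1 *: X)) x) = cAd (expG G X) x.
Proof.
rewrite -cAdM -expGD; congr (cAd (expG G _) x).
by apply/rowP => i; rewrite !mxE; field.
Qed.

End ComplexAd.

Section LredFacts.
Context {R : realType} {n : nat} {G : lieGroupType R n}.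
Context {K : set G} {theta : {linear 'rV[R]_n -> 'rV[R]_n}}.
Context {B : 'rV[R]_n -> 'rV[R]_n -> R}.
Context (HG : reductive_group K theta B).
Notation L := (Lred HG).

Lemma H_cAd k x y : K k -> sl_form L (cAd k x) (cAd k y) = sl_form L x y.
Proof. by move=> Kk; apply: hform_map => X Y; exact: (ip_Ad HG). Qed.

Lemma star_rl X : sl_star L (rlV X) = rlV (- theta X).
Proof.
apply: cplxV_ext; rewrite !(reV_cplx, imV_cplx) ?reV_rl ?imV_rl //; exact: linear0.
Qed.

Lemma brL : sl_br L = gbr G. Proof. by []. Qed.

Lemma form_rl X Y : sl_form L (rlV X) (rlV Y) = ((@ip _ _ theta B X Y)%:C)%C.
Proof.
rewrite /= /hform !reV_rl !imV_rl.
have i0 Z : @ip _ _ theta B 0 Z = 0 by have := ipl HG Z (-1) 0 0; rewrite scaler0 addr0 mulN1r addNr.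
by rewrite (ipC HG X 0) !i0 subrr addr0.
Qed.

Lemma formL z w : sl_form L z w = hform (@ip _ _ theta B) z w. Proof. by []. Qed.

End LredFacts.

Opaque cAd Lred gbr.

(** * Polar decomposition under the adjoint representation *)

Section PolarDecomposition.
Context {R : realType} {n : nat} {G : lieGroupType R n}.
Context {K : set G} {theta : {linear 'rV[R]_n -> 'rV[R]_n}}.
Context {B : 'rV[R]_n -> 'rV[R]_n -> R}.
Context (HG : reductive_group K theta B).
Notation V := 'rV[R]_n.
Notation VC := 'rV[R[i]]_n.
Notation br := (lbr G).
Notation exp := (expG G).
Notation L := (Lred HG).
Notation H := (sl_form L).
Implicit Types (g k : G) (X Y Z xi : V) (x y z v : VC).

Lemma cAd_br g x y : cAd g (sl_br L x y) = sl_br L (cAd g x) (cAd g y).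
Proof. by rewrite brL cAd_gbr. Qed.

Lemma cAd_adj k : K k -> @adjP _ _ L (cAd k) (cAd k^-1%g).
Proof. by move=> Kk x y; rewrite -{1}(cAdKV k y) H_cAd. Qed.

Lemma ad_linP X : linP (gbr G (rlV X)).
Proof. by move=> a u w; rewrite -(brL HG) (sl_brr L). Qed.

(** For [xi] in the p-part, [rlV xi] is fixed by the star, so its adjoint action is self-adjoint and
    has real weights. *)
Lemma ad_p_eigenbasis xi : theta xi = - xi ->
  exists (b : obasis L) (d : 'I__ -> R),
    forall i, gbr G (rlV xi) (ob_v b i) = ((d i)%:C)%C *: ob_v b i.
Proof.
move=> hxi; pose m := <[rlV xi]>%VS : {vspace VC}.
have sxi : sl_star L (rlV xi) = rlV xi by rewrite star_rl hxi opprK.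
have [||b [wt [h1 h2]]] := @weight_basis _ _ L m.
- by move=> x /vlineP [a ->]; rewrite starZ sxi memvZ // memv_line.
- move=> x y /vlineP [a ->] /vlineP [c ->].
  by rewrite (brZl (@sl_brl _ _ L)) (brZr (@sl_brr _ _ L)) sl_brxx !scaler0.
exists b, (fun i => complex.Re (wt i (rlV xi))) => i.
have := h1 (rlV xi) i (memv_line _); rewrite brL => ->; congr (_ *: _).
have := h2 (rlV xi) i (memv_line _); rewrite sxi; case: (wt i _) => u w /=.
move=> /eqP; rewrite eq_complex /= => /andP[_ /eqP e].
by congr (_ +i* _)%C; lra.
Qed.

Lemma expRC_gt0 (d : R) : 0 < ((expR d)%:C)%C :> R[i].
Proof. by rewrite ltcE /= eqxx expR_gt0. Qed.

Lemma cAd_exp_adj xi : theta xi = - xi -> @adjP _ _ L (cAd (exp xi)) (cAd (exp xi)).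
Proof.
move=> /ad_p_eigenbasis [b [d hd]].
apply: (eigen_selfadj (cAd_lin (exp xi)) (fun i => cAd_exp_eigen (hd i))) => i.
by rewrite gtr0_real // expRC_gt0.
Qed.

Lemma polar_min_commute (b : obasis L) k xi : K k -> theta xi = - xi ->
  nrm2 b (cAd (k * exp xi)%g) <=
    nrm2 b (cAd (exp (2^-1 *: xi) * k * exp (2^-1 *: xi))%g) ->
  forall x, cAd k (cAd (exp xi) x) = cAd (exp xi) (cAd k x).
Proof.
move=> Kk hxi le.
have hh : theta (2^-1 *: xi) = - (2^-1 *: xi) by rewrite linearZ /= hxi scalerN.
apply: (trace_min_commute (b := b) (cAd_lin (exp xi)) (cAd_lin k) (cAd_lin k^-1%g)
  (cAd_lin (exp (2^-1 *: xi))) (cAd_exp_adj hxi) (cAd_adj Kk) (cAd_exp_adj hh)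
  (cAdKV k) (cAdVK k) (cAd_exp_half xi)).
have e1 : cAd (k * exp xi)%g = cAd k \o cAd (exp xi) by apply/funext => x; exact: cAdM.
have e2 : cAd (exp (2^-1 *: xi) * k * exp (2^-1 *: xi))%g =
    cAd (exp (2^-1 *: xi)) \o (cAd k \o cAd (exp (2^-1 *: xi))).
  by apply/funext => x; rewrite cAdM cAdM.
by rewrite -e1 -e2.
Qed.

Lemma exp_fix_ad xi x : theta xi = - xi -> cAd (exp xi) x = x -> gbr G (rlV xi) x = 0.
Proof.
move=> /ad_p_eigenbasis [b [d hd]].
have {1}-> : x = 1 *: x by rewrite scale1r.
rewrite -[in X in _ -> X](scale0r x) scale1r => hx.
have /(eigen_coP (ob_coE b) (ob_col b) (ob_cov b) (cAd_lin (exp xi))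
  (fun i => cAd_exp_eigen (hd i))) h : cAd (exp xi) x = 1 *: x by rewrite scale1r.
apply/(eigen_coP (ob_coE b) (ob_col b) (ob_cov b) (ad_linP xi) hd) => i di.
apply: h; apply: contraNneq di => /(congr1 (@complex.Re R)) /=.
by rewrite -[RHS]expR0 => /expR_inj ->.
Qed.

(** Both adjoint actions are diagonalisable with real eigenvalues and [expR] is injective on the
    reals, so the eigenvectors of the common exponential carry the same eigenvalues for both. *)
Lemma log_uniq xi xi' : theta xi = - xi -> theta xi' = - xi' ->
  (forall x, cAd (exp xi) x = cAd (exp xi') x) -> forall Y, br xi Y = br xi' Y.
Proof.
move=> hx hx' e.
have [b [d hd]] := ad_p_eigenbasis hx; have [b' [d' hd']] := ad_p_eigenbasis hx'.
suff h x : gbr G (rlV xi) x = gbr G (rlV xi') x.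
  by move=> Y; have := h (rlV Y); rewrite !gbr_rl2; exact: rlV_inj.
rewrite [in LHS](ob_coE b' x) [in RHS](ob_coE b' x).
rewrite (lin_sum (ad_linP xi)) (lin_sum (ad_linP xi')).
apply: eq_bigr => i _; rewrite (linZ (ad_linP xi)) (linZ (ad_linP xi')) hd'; congr (_ *: _).
apply/(eigen_coP (ob_coE b) (ob_col b) (ob_cov b) (ad_linP xi) hd) => j dj.
have Ev : cAd (exp xi) (ob_v b' i) = ((expR (d' i))%:C)%C *: ob_v b' i.
  by rewrite e; exact: cAd_exp_eigen.
have /(eigen_coP (ob_coE b) (ob_col b) (ob_cov b) (cAd_lin (exp xi))
  (fun i => cAd_exp_eigen (hd i))) h := Ev.
by apply: h; apply: contraNneq dj => /(congr1 (@complex.Re R)) /= /expR_inj ->.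
Qed.

Lemma normal_fix k xi x : K k -> theta xi = - xi ->
  (forall x, cAd k (cAd (exp xi) x) = cAd (exp xi) (cAd k x)) ->
  cAd (k * exp xi)%g x = x -> gbr G (rlV xi) x = 0 /\ cAd k x = x.
Proof.
move=> Kk hxi comm; rewrite cAdM => hx; have [b [d hd]] := ad_p_eigenbasis hxi.
have [h1 h2] := normal_fix_abs (cAd_lin (exp xi)) (cAd_lin k) (cAd_lin k^-1%g)
  (fun i => cAd_exp_eigen (hd i)) (fun i => expRC_gt0 (d i)) (cAd_adj Kk) (cAdKV k) (cAdVK k) comm hx.
by split=> //; exact: exp_fix_ad.
Qed.

End PolarDecomposition.

Lemma compact_min (R : realType) (T : topologicalType) (f : T -> R) (A : set T) :
  A !=set0 -> compact A -> continuous f -> exists2 c, A c & forall t, A t -> f c <= f t.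
Proof.
move=> A0 cA cf; have [c cA' h] := compact_EVT_min A0 cA (continuous_subspaceT cf).
by exists c => [|t At]; [rewrite inE in cA'|apply: h; rewrite inE].
Qed.

(** * Normal representatives of conjugacy classes *)

Section FiniteDimension.
Context {R : realType} {n : nat}.
Notation V := 'rV[R]_n.

Lemma rV_lin_bounded (E : normedModType R) (f : V -> E) : linear f ->
  exists K, forall X, `|f X| <= K * `|X|.
Proof.
move=> lf; pose fl : {linear V -> E} := HB.pack f (GRing.isLinear.Build _ _ _ _ f lf).
exists (\sum_i `|f (delta_mx 0 i)|) => X.
have -> : f X = \sum_i X 0 i *: f (delta_mx 0 i).
  rewrite [in LHS](row_sum_delta X) -[f]/(fl : V -> E) linear_sum /=.
  by apply: eq_bigr => i _; rewrite -[f (_ *: _)]/(fl _) linearZ.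
rewrite mulr_suml; apply: le_trans (ler_norm_sum _ _ _) _; apply: ler_sum => i _.
by rewrite normrZ mulrC ler_wpM2l // le_mx_norm.
Qed.

Lemma rV_lin_cont (E : normedModType R) (f : V -> E) : linear f -> continuous f.
Proof.
move=> lf; have [K hK] := rV_lin_bounded lf => X.
exact: sdiff_cont (linear_sdiff X lf hK).
Qed.

Lemma lin_closed_closed (P : V -> Prop) : lin_closed P -> closed [set X | P X].
Proof.
move=> /vspace_of [U hU].
have -> : [set X | P X] = (fun X => projv U X - X) @^-1` [set 0].
  apply/seteqP; split=> X /=.
    by move/hU => XU; rewrite projv_id // subrr.
  by move/eqP; rewrite subr_eq0 => /eqP <-; apply/hU; exact: memv_proj.
apply: preimage_closed => [|]; last exact/accessible_closed_set1/hausdorff_accessible/norm_hausdorff.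
move=> X _; apply: rV_lin_cont => a u w.
by rewrite linearP /=; apply/rowP => i; rewrite !mxE; ring.
Qed.

Lemma quadratic_cont (b : V -> V -> R) : (forall z a x y, b (a *: x + y) z = a * b x z + b y z) ->
  (forall z a x y, b z (a *: x + y) = a * b z x + b z y) -> continuous (fun X => b X X).
Proof.
move=> bl br.
have e X : b X X = \sum_i X 0 i * b (delta_mx 0 i) X.
  rewrite {1}(row_sum_delta X); elim/big_rec2: _ => [|i y u _ <-].
    by have := bl X (-1) 0 0; rewrite scaler0 addr0 mulN1r addNr.
  by rewrite bl.
rewrite (_ : (fun X => b X X) = fun X => \sum_i X 0 i * b (delta_mx 0 i) X); last first.
  by apply/funext.
apply: continuous_big; first exact: add_continuous.
move=> i _ X; apply: continuousM; first exact: coord_continuous.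
by apply: (@rV_lin_cont R^o) => a u w; exact: br.
Qed.

Lemma sphere_min (P : V -> Prop) (f : V -> R) : lin_closed P -> continuous f ->
  (forall X, P X -> X != 0 -> 0 < f X) -> (forall (a : R) X, f (a *: X) = a ^+ 2 * f X) ->
  exists2 c, 0 < c & forall X, P X -> c * `|X| ^+ 2 <= f X.
Proof.
move=> lP cf fpos fhom; have [P0 PD] := lP.
have PZ (a : R) X : P X -> P (a *: X) by move=> h; have := PD a X 0 h P0; rewrite addr0.
have f0 : f 0 = 0 by have := fhom 0 0; rewrite scale0r expr2 mul0r mul0r.
pose S := [set X | P X] `&` [set X : V | `|X| = 1].
have unit (X : V) : X != 0 -> P X -> S (`|X|^-1 *: X).
  move=> X0 PX; split; first exact: PZ.
  by rewrite /= normrZ normfV normr_id mulVf // normr_eq0.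
have hX (X : V) : X != 0 -> X = `|X| *: (`|X|^-1 *: X).
  by move=> X0; rewrite scalerA divff ?scale1r // normr_eq0.
have [S0|/set0P S0] := eqVneq S set0.
  exists 1 => // X PX; have [->|X0] := eqVneq X 0.
    by rewrite normr0 expr2 !mulr0 f0.
  by have := unit X X0 PX; rewrite S0.
have cS : compact S.
  apply: bounded_closed_compact.
    exists 1; split; first exact: num_real.
    by move=> M M1 X [_ /= ->]; exact: ltW.
  apply: closedI; first exact: lin_closed_closed.
  rewrite (_ : [set X : V | `|X| = 1] = (fun X : V => `|X|) @^-1` [set 1]) //.
  apply: preimage_closed; last exact: closed_eq.
  by move=> X _; exact: norm_continuous.
have [c cS' cmin] := compact_EVT_min S0 cS (continuous_subspaceT cf).
have [Pc c1] : S c by rewrite inE in cS'.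
have c0 : c != 0 by rewrite -normr_eq0 c1 oner_neq0.
exists (f c); first exact: fpos.
move=> X PX; have [->|X0] := eqVneq X 0; first by rewrite normr0 expr2 !mulr0 f0.
rewrite (hX X X0) fhom mulrC normrZ normr_id; have [_ ->] := unit X X0 PX.
rewrite mulr1 ler_pM2l ?exprn_gt0 ?normr_gt0 //; apply: cmin.
by rewrite inE; exact: unit.
Qed.

End FiniteDimension.

Section Minimization.
Context {R : realType} {n : nat} {G : lieGroupType R n}.
Context {K : set G} {theta : {linear 'rV[R]_n -> 'rV[R]_n}}.
Context {B : 'rV[R]_n -> 'rV[R]_n -> R}.
Context (HG : reductive_group K theta B).
Notation V := 'rV[R]_n.
Notation VC := 'rV[R[i]]_n.
Notation br := (lbr G).
Notation exp := (expG G).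
Notation L := (Lred HG).
Notation H := (sl_form L).
Notation ip := (@ip _ _ theta B).
Implicit Types (g k : G) (X Y Z xi : V) (x y z v : VC).

Lemma ipr Z (a : R) X Y : ip Z (a *: X + Y) = a * ip Z X + ip Z Y.
Proof. by rewrite !(ipC HG Z) (ipl HG). Qed.

Lemma ip0l X : ip 0 X = 0.
Proof. by have := ipl HG X (-1) 0 0; rewrite scaler0 addr0 mulN1r addNr. Qed.

Lemma ipZl (a : R) X Y : ip (a *: X) Y = a * ip X Y.
Proof. by have := ipl HG Y a X 0; rewrite ip0l !addr0. Qed.

Lemma ipBl X Y Z : ip (X - Y) Z = ip X Z - ip Y Z.
Proof. by rewrite -scaleN1r addrC (ipl HG) mulN1r addrC. Qed.

Lemma ip_theta X Y : ip (theta X) (theta Y) = ip X Y.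
Proof. by rewrite /ip (red_B_theta HG). Qed.

Lemma ip_thetal X Y : ip (theta X) Y = ip X (theta Y).
Proof. by rewrite -ip_theta (thetaK HG). Qed.

Lemma ip_ge0 X : 0 <= ip X X.
Proof. by have [->|/(ip_gt0 HG)/ltW //] := eqVneq X 0; rewrite ip0l. Qed.

Lemma ip_eq0 X : ip X X = 0 -> X = 0.
Proof. by move=> h; apply: contrapT => /eqP /(ip_gt0 HG); rewrite h ltxx. Qed.

Lemma ip_cont : continuous (fun X => ip X X).
Proof. by apply: quadratic_cont => z a x y; [exact: (ipl HG)|exact: ipr]. Qed.

Lemma ReM (u w : R[i]) : complex.Re (u * w) =
  complex.Re u * complex.Re w - complex.Im u * complex.Im w.
Proof. by case: u; case: w. Qed.

Lemma Re_form v : complex.Re (H v v) = ip (reV v) (reV v) + ip (imV v) (imV v).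
Proof. by rewrite formL. Qed.

Lemma Im_form v : complex.Im (H v v) = 0.
Proof. by rewrite formL /= (ipC HG) subrr. Qed.

Lemma Re_sum I (r : seq I) (P : pred I) (f : I -> R[i]) :
  complex.Re (\sum_(i <- r | P i) f i) = \sum_(i <- r | P i) complex.Re (f i).
Proof. by elim/big_rec2: _ => [//|i u w _ <-]; case: (f i); case: w. Qed.

Lemma leC_Re (u w : R[i]) : 0 <= u -> 0 <= w -> (u <= w) = (complex.Re u <= complex.Re w).
Proof. by rewrite !lecE /= => /andP[/eqP <- _] /andP[/eqP <- _]; rewrite eqxx. Qed.

Definition frob (b : obasis L) g : R := complex.Re (nrm2 b (cAd g)).

Lemma le_nrm2 (b : obasis L) g h : (nrm2 b (cAd g) <= nrm2 b (cAd h)) = (frob b g <= frob b h).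
Proof. by rewrite leC_Re // nrm2_ge0. Qed.

Lemma frob_cont (b : obasis L) : continuous (frob b).
Proof.
pose w i := complex.Re ((H (ob_v b i) (ob_v b i))^-1).
have e : frob b = fun g => \sum_i (ip (Ad g (reV (ob_v b i))) (Ad g (reV (ob_v b i))) +
   ip (Ad g (imV (ob_v b i))) (Ad g (imV (ob_v b i)))) * w i.
  apply/funext => g; rewrite /frob /nrm2 Re_sum; apply: eq_bigr => i _.
  by rewrite ReM Im_form mul0r subr0 Re_form reV_cAd imV_cAd.
have ipA X : continuous (fun g => ip (Ad g X) (Ad g X)).
  move=> g; apply: (@continuous_comp _ _ _ (fun g => Ad g X) (fun X => ip X X)).
    exact: Ad_cont.
  exact: ip_cont.
rewrite e; apply: continuous_big; first exact: add_continuous.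
move=> i _ g; apply: cvgM; last exact: cvg_cst.
by apply: cvgD; exact: ipA.
Qed.

Lemma frob_ext (b : obasis L) g h : (forall X, Ad g X = Ad h X) -> frob b g = frob b h.
Proof.
move=> e; rewrite /frob; suff -> : cAd g = cAd h by [].
by apply/funext => x; apply: cplxV_ext; [rewrite !reV_cAd|rewrite !imV_cAd]; exact: e.
Qed.

Lemma frobK (b : obasis L) k g : K k -> frob b (k * g)%g = frob b g.
Proof.
move=> Kk; rewrite /frob; suff -> : nrm2 b (cAd (k * g)%g) = nrm2 b (cAd g) by [].
by apply: eq_bigr => i _; rewrite cAdM H_cAd.
Qed.

Definition central Z := forall Y, br Z Y = 0.

(* The part of [p] orthogonal to the center, on which [ad] is injective. *)
Definition pss xi := theta xi = - xi /\ forall Z, central Z -> ip xi Z = 0.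

Lemma pss_lin : lin_closed pss.
Proof.
split; first by split; [rewrite linear0 oppr0|move=> Z _; exact: ip0l].
move=> a X Y [tX cX] [tY cY]; split.
  by rewrite linearP /= tX tY scalerN -opprD.
by move=> Z cZ; rewrite (ipl HG) cX // cY // mulr0 addr0.
Qed.

Lemma central_theta Z : central Z -> central (theta Z).
Proof.
move=> cZ Y; rewrite -(thetaK HG (br _ _)) (red_theta_br HG) (thetaK HG) cZ.
exact: linear0.
Qed.

Lemma central_Ad g Z : central Z -> central (Ad g Z).
Proof. by move=> cZ Y; rewrite -(AdKV g Y) -Ad_br cZ Ad0. Qed.

Lemma pss_Ad k xi : K k -> pss xi -> pss (Ad k xi).
Proof.
move=> Kk [tx cx]; split; first by rewrite -(Ad_theta HG) // tx -scaleN1r; have [_ _ -> _] := Ad_lin k; rewrite scaleN1r.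
move=> Z cZ; rewrite -(AdKV k Z) (ip_Ad HG) //; apply: cx.
exact: central_Ad.
Qed.

Lemma pss_inj xi : pss xi -> central xi -> xi = 0.
Proof. by move=> [_ h] c; apply: ip_eq0; exact: h. Qed.

Lemma center_split X : exists Z W, [/\ X = Z + W, central Z &
  forall Z', central Z' -> ip W Z' = 0].
Proof.
have cl : (centv L fullv <= fullv)%VS by exact: subvf.
have := memvf (rlV X : VC); rewrite -(orthv_add L cl).
move=> /memv_addP [z /mem_centv [_ hz] [w /mem_orthv [_ hw] e]].
exists (reV z), (reV w); split.
- by rewrite -reVD -e reV_rl.
- move=> Y; have := hz (rlV Y) (memvf _); rewrite brC brL => /eqP.
  by rewrite oppr_eq0 => /eqP/gbr_rl_eq0 [h _]; rewrite lbrC h oppr0.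
- move=> Z' cZ'; have : H w (rlV Z') = 0.
    apply: hw; apply/mem_centv; split; first exact: memvf.
    move=> y _; rewrite brL; apply/gbr_rl_eq0; split; exact: cZ'.
  rewrite formL /hform reV_rl imV_rl => /(congr1 (@complex.Re R)) /=.
  by rewrite (ipC HG _ 0) ip0l addr0.
Qed.

(** The central component of [xi] is discarded; it commutes with everything, so its exponential acts
    trivially. *)
Lemma pss_exists xi : theta xi = - xi ->
  exists2 xi', pss xi' & forall Y, Ad (exp xi) Y = Ad (exp xi') Y.
Proof.
move=> tx; have [Z [W [e cZ oW]]] := center_split xi.
pose Z' := 2^-1 *: (Z - theta Z); pose W' := 2^-1 *: (W - theta W).
have eW : xi = W' + Z'.
  have -> : xi = 2^-1 *: (xi - theta xi).
    by rewrite tx opprK; apply/rowP => i; rewrite !mxE; field.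
  have et : theta xi = theta Z + theta W by rewrite e linearD.
  by rewrite et {1}e; apply/rowP => i; rewrite !mxE; ring.
have cZ' : central Z'.
  move=> Y; rewrite /Z' lbrZl lbrDl lbrNl cZ (central_theta cZ) subr0; exact: scaler0.
exists W'; last by move=> Y; rewrite eW Ad_exp_center.
split.
  rewrite /W' linearZ /= linearB /= (thetaK HG) -scalerN; congr (_ *: _).
  by apply/rowP => i; rewrite !mxE; ring.
move=> Z1 cZ1; rewrite /W' ipZl ipBl ip_thetal (oW _ cZ1) (oW _ (central_theta cZ1)).
by rewrite subrr mulr0.
Qed.

Lemma polarP g : exists k xi, [/\ K k, theta xi = - xi & g = (k * exp xi)%g].
Proof.
have [kap [xi [_ _ h _]]] := red_polar HG; have [Kk tx e] := h g.
by exists (kap g), (xi g).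
Qed.

(** [theta] intertwines [ad xi] with [- ad xi]. Hence an upper bound on all eigenvalues also bounds
    them below. *)
Lemma ad_eigen_sym xi (b : obasis L) (d : 'I__ -> R) : theta xi = - xi ->
  (forall i, gbr G (rlV xi) (ob_v b i) = ((d i)%:C)%C *: ob_v b i) ->
  forall i, exists j, d j = - d i.
Proof.
move=> tx hd i; pose v := cplx_map theta (ob_v b i).
have hv : gbr G (rlV xi) v = ((- d i)%:C)%C *: v.
  rewrite gbr_rl /v; apply/scaleC_map; rewrite reV_map imV_map.
  have := hd i; rewrite gbr_rl => /scaleC_map [h1 h2].
  have e Y c : br xi Y = c *: Y -> br xi (theta Y) = (- c) *: theta Y.
    move=> h; rewrite -[in LHS](opprK xi) -tx lbrNl -(red_theta_br HG) h.
    by rewrite linearZ /= scaleNr.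
  by split; exact: e.
have v0 : v != 0.
  apply: contraNneq (ob_n0 b i) => /cplx_map_eq0 [h1 h2].
  have inj Y : theta Y = 0 -> Y = 0 by move=> h; rewrite -(thetaK HG Y) h linear0.
  suff -> : ob_v b i = 0 by rewrite form0l.
  by apply: cplxV_ext; [rewrite reV0|rewrite imV0]; apply: inj.
have [j hj] := eigen_mem (ob_coE b) (ob_col b) (ob_cov b) (ad_linP HG xi) hd hv v0.
by exists j; move: hj => /(congr1 (@complex.Re R)).
Qed.

Lemma nrm2_exp (b b' : obasis L) xi (d : 'I__ -> R) : theta xi = - xi ->
  (forall i, gbr G (rlV xi) (ob_v b' i) = ((d i)%:C)%C *: ob_v b' i) ->
  frob b (exp xi) = \sum_i expR (d i) ^+ 2.
Proof.
move=> tx hd; have lE := cAd_lin (exp xi).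
rewrite /frob -(trb_adj b (cAd_exp_adj HG tx)) -(trc_ob b (linP_comp lE lE)).
rewrite (trc_ob b' (linP_comp lE lE)) /trb Re_sum; apply: eq_bigr => i _ /=.
rewrite !(co_map (ob_coE b') (ob_col b') (ob_cov b') lE (fun i => cAd_exp_eigen (hd i))).
by rewrite ob_cov eqxx mulr1 ReM /= mul0r subr0.
Qed.

Lemma ad_bound (b : obasis L) xi (M : R) : theta xi = - xi -> frob b (exp xi) <= M ->
  forall Y, ip (br xi Y) (br xi Y) <= M ^+ 2 * ip Y Y.
Proof.
move=> tx; have [b' [d hd]] := ad_p_eigenbasis HG tx.
rewrite (nrm2_exp b tx hd) => hM Y.
have dM i : expR (d i) ^+ 2 <= M.
  apply: le_trans hM; rewrite (bigD1 i) //= lerDl.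
  by apply: sumr_ge0 => j _; rewrite exprn_ge0 // expR_ge0.
have dM1 i : d i <= M.
  have [d0|/ltW d0] := leP 0 (d i).
    apply: le_trans (dM i); apply: (@le_trans _ _ (expR (d i))).
      by have := expR_ge1Dx (d i); lra.
    by rewrite -[leLHS]mulr1 expr2 ler_pM2l ?expR_gt0 // -expR0 ler_expR.
  by apply: le_trans d0 _; apply: le_trans (dM i); rewrite exprn_ge0 // expR_ge0.
have dM2 i : (d i) ^+ 2 <= M ^+ 2.
  have [j hj] := ad_eigen_sym tx hd i.
  have := dM1 i; have := dM1 j; rewrite hj => h1 h2.
  by rewrite -[leLHS]real_normK ?num_real // lerXn2r ?nnegrE ?normr_ge0 // ?ler_norml; lra.
have : complex.Re (H (gbr G (rlV xi) (rlV Y)) (gbr G (rlV xi) (rlV Y))) <=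
       M ^+ 2 * complex.Re (H (rlV Y) (rlV Y)).
  rewrite !(form_ob b') !Re_sum mulr_sumr; apply: ler_sum => i _.
  rewrite !(co_map (ob_coE b') (ob_col b') (ob_cov b') (ad_linP HG xi) hd).
  set c := ob_co b' i _; have := form_ge0 L (ob_v b' i).
  rewrite lecE => /andP[/eqP im re].
  move: (H _ _) im re => [h1 h2] /= -> re; case: c => c1 c2 /=.
  have -> (u : R) : (u * c1 - 0 * c2) * (u * c1 - 0 * c2) - (u * c2 + 0 * c1) * - (u * c2 + 0 * c1) =
    u ^+ 2 * (c1 ^+ 2 + c2 ^+ 2) by ring.
  have -> : (c1 * c1 - c2 * - c2) * h1 - (c1 * - c2 + c2 * c1) * 0 = (c1 ^+ 2 + c2 ^+ 2) * h1 by ring.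
  rewrite !mulr0 !subr0 mulrA; apply: ler_wpM2r => //; apply: ler_wpM2r => //.
  by rewrite addr_ge0 // sqr_ge0.
by rewrite gbr_rl2 !form_rl.
Qed.

(** A bound on the norm of [Ad (exp xi)] bounds the eigenvalues of [ad xi], and [ad] is injective on
    [pss], so compactness of the unit sphere turns this into a bound on [xi]. A central component
    would escape any such bound. *)
Lemma pss_bounded (b : obasis L) (M : R) : exists Rb, forall xi, pss xi ->
  frob b (exp xi) <= M -> `|xi| <= Rb.
Proof.
pose f xi := \sum_j ip (br xi (delta_mx 0 j)) (br xi (delta_mx 0 j)).
have fc : continuous f.
  apply: continuous_big; first exact: add_continuous.
  move=> i _ X.
  apply: (@continuous_comp _ _ _ (fun X => br X (delta_mx 0 i)) (fun X => ip X X)).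
    by apply: rV_lin_cont => a u w; rewrite lbrDl lbrZl.
  exact: ip_cont.
have f0 xi : pss xi -> xi != 0 -> 0 < f xi.
  move=> px x0; rewrite lt_def sumr_ge0 ?andbT; last by move=> j _; exact: ip_ge0.
  apply: contraNneq x0 => /eqP; rewrite psumr_eq0; last by move=> j _; exact: ip_ge0.
  move=> /allP h; apply/eqP/(pss_inj px) => Y.
  have e j : br xi (delta_mx 0 j) = 0.
    by apply: ip_eq0; apply/eqP; exact: (h j (mem_index_enum j)).
  rewrite (row_sum_delta Y); elim/big_rec: _ => [|i y _ hy]; first exact: lbr0r.
  by rewrite lbr_linr e hy scaler0 addr0.
have fh (a : R) X : f (a *: X) = a ^+ 2 * f X.
  rewrite /f mulr_sumr; apply: eq_bigr => j _; rewrite lbrZl.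
  move: (br X _) => u; have h w : ip (a *: u) w = a * ip u w.
    by have := ipl HG w a u 0; rewrite ip0l !addr0.
  by rewrite h (ipC HG) h expr2 mulrA.
have [c c0 hc] := sphere_min pss_lin fc f0 fh.
pose T := \sum_j ip (delta_mx 0 j : V) (delta_mx 0 j).
exists (M ^+ 2 * T / c + 1) => xi px hM.
have h1 : f xi <= M ^+ 2 * T.
  by rewrite /f /T mulr_sumr; apply: ler_sum => j _; apply: (ad_bound (b := b)) => //; case: px.
have h2 : `|xi| ^+ 2 <= M ^+ 2 * T / c.
  by rewrite ler_pdivlMr // mulrC; exact: le_trans (hc _ px) h1.
(* From [2 |xi| <= |xi|^2 + 1] the bound [D] on the square gives [D + 1] on the norm, with no square
   root. *)
have := sqr_ge0 (`|xi| - 1); move: h2; move: (_ / c) => D h2 h3.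
have := normr_ge0 xi; nra.
Qed.

End Minimization.

Opaque frob.

Section NormalRepresentative.
Context {R : realType} {n : nat} {G : lieGroupType R n}.
Context {K : set G} {theta : {linear 'rV[R]_n -> 'rV[R]_n}}.
Context {B : 'rV[R]_n -> 'rV[R]_n -> R}.
Context (HG : reductive_group K theta B).
Notation V := 'rV[R]_n.
Notation br := (lbr G).
Notation exp := (expG G).
Notation L := (Lred HG).
Notation pss := (@pss _ _ G theta B).
Implicit Types (g k : G) (X Y Z xi : V).

Lemma frob_min_commute (b : obasis L) k xi : K k -> theta xi = - xi ->
  frob b (k * exp xi)%g <=
    frob b (exp (2^-1 *: xi) * (k * exp xi) * (exp (2^-1 *: xi))^-1)%g ->
  forall x, cAd k (cAd (exp xi) x) = cAd (exp xi) (cAd k x).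
Proof.
move=> Kk tx; set z := exp (2^-1 *: xi).
have -> : (z * (k * exp xi) * z^-1)%g = (z * k * z)%g.
  rewrite -!mulgA; congr (z * (k * _))%g.
  rewrite /z -expGN -scaleNr -{1}(scale1r xi) -expGD; congr (exp (_ *: xi)).
  by field.
rewrite -le_nrm2; exact: polar_min_commute.
Qed.

(** Conjugacy is tested through [Ad] alone, because dropping the central part of the hyperbolic
    factor changes the group element but not its adjoint action. *)
Definition conj_orbit g := [set y : G | exists x, forall X, Ad y X = Ad (x * g * x^-1)%g X].

Lemma conj_orbit_conj g y z : conj_orbit g y -> conj_orbit g (z * y * z^-1)%g.
Proof.
move=> [x hx]; exists (z * x)%g => X.
by rewrite !AdM hx !AdM invgM AdM.
Qed.

Lemma polar_pss g : exists k xi, [/\ K k, pss xi & forall X, Ad g X = Ad (k * exp xi)%g X].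
Proof.
have [k [xi [Kk tx ->]]] := polarP HG g; have [xi' px e] := pss_exists HG tx.
by exists k, xi'; split=> // X; rewrite AdM e -AdM.
Qed.

(* The representative minimises the trace norm of [Ad] on the closure of the
   conjugacy class; conjugating it by the square root of its hyperbolic part
   shows that it is normal. *)
Theorem normal_representative g0 : exists k xi,
  [/\ K k, pss xi, closure (conj_orbit g0) (k * exp xi)%g,
    forall x, cAd k (cAd (exp xi) x) = cAd (exp xi) (cAd k x) & Ad k xi = xi].
Proof.
have [b _] := @some_obasis _ _ L.
pose m (p : G * V) : G := (p.1 * exp p.2)%g.
pose S := [set p : G * V | [/\ K p.1, pss p.2 & conj_orbit g0 (m p)]].
have [k0 [xi0 [Kk0 px0 e0]]] := polar_pss g0.
pose M := frob b (k0 * exp xi0)%g.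
have [Rb hRb] := pss_bounded b M.
(* Minimising over polar pairs makes compactness available: [K] is compact and the sublevel
   condition bounds the other component through [pss_bounded]. *)
pose S' := S `&` [set p | frob b (m p) <= M].
pose Q := K `*` ([set xi | pss xi] `&` [set xi : V | `|xi| <= Rb]).
have cm : continuous m.
  apply: (@cont_mul _ _ _ (G * V)%type fst (fun p => exp p.2)); first by move=> p; exact: cvg_fst.
  move=> p; apply: (@continuous_comp _ _ _ snd exp); first exact: cvg_snd.
  by have [h _] := @expG_facts R n G; exact: h.
have cP : closed ([set xi | pss xi] `&` [set xi : V | `|xi| <= Rb]).
  apply: closedI; first exact: lin_closed_closed (pss_lin HG).
  rewrite (_ : [set xi : V | `|xi| <= Rb] = (fun xi : V => `|xi|) @^-1` [set x | x <= Rb]) //.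
  apply: preimage_closed; last exact: closed_le.
  by move=> X _; exact: norm_continuous.
have cK : closed K by apply: compact_closed (red_Kcompact HG); exact: lie_hausdorff.
have cQ : compact Q.
  apply: compact_setX; first exact: (red_Kcompact HG).
  apply: bounded_closed_compact => //.
  exists Rb; split; first exact: num_real.
  by move=> r hr X [_ /= hX]; exact: le_trans hX (ltW hr).
have S'Q : S' `<=` Q.
  move=> [k xi] [[/= Kp pp _] hp]; split; first exact: Kp.
  split; first exact: pp.
  by apply: (hRb _ pp); rewrite -(frobK b _ Kp).
have clS'Q : closure S' `<=` Q.
  move=> p hp; split; [apply: cK|apply: cP] => A nA.
    have n1 : nbhs p (fst @^-1` A) by exact: cvg_fst nA.
    by have [q [/S'Q [Kq _] Aq]] := hp _ n1; exists q.1.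
  have n2 : nbhs p (snd @^-1` A) by exact: cvg_snd nA.
  by have [q [/S'Q [_ Pq] Aq]] := hp _ n2; exists q.2.
have s0 : S' (k0, xi0).
  split; last by rewrite /= /m.
  split=> //; exists 1%g => X; rewrite /m /= -e0.
  by rewrite mul1g invg1 mulg1.
have fc : continuous (fun p => frob b (m p)).
  by move=> p; apply: (@continuous_comp _ _ _ m (frob b)); [exact: cm|exact: frob_cont].
have cA : compact (closure S') by apply: subclosed_compact cQ clS'Q; exact: closed_closure.
have A0 : closure S' !=set0 by exists (k0, xi0); exact: subset_closure.
have [[k xi] Akx kmin] := @compact_min R (G * V)%type _ _ A0 cA fc.
have [/= Kk [pxi _]] := clS'Q _ Akx; have [tx cx] := pxi.
have comm : forall x, cAd k (cAd (exp xi) x) = cAd (exp xi) (cAd k x).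
  (* The minimiser is only a limit of pairs of [S']. A strict decrease under conjugation by [z]
     would, by continuity, already occur at a nearby pair of [S']; a new polar decomposition of that
     conjugate gives a pair of [S'] below the minimum. *)
  apply: (frob_min_commute (b := b) Kk tx).
  set z := exp (2^-1 *: xi).
  rewrite leNgt; apply/negP => lt.
  have fc' : continuous (fun p => frob b (z * m p * z^-1)%g).
    move=> p; apply: (@continuous_comp _ _ _ (fun p => z * m p * z^-1)%g (frob b)).
      by apply: (@cont_mul _ _ _ (G * V)%type (fun p => z * m p)%g (fun=> z^-1)%g);
        [apply: (@cont_mul _ _ _ (G * V)%type (fun=> z) m) => //|]; exact: cst_continuous.
    exact: frob_cont.
  have nb : nbhs (k, xi) [set p | frob b (z * m p * z^-1)%g < frob b (k * exp xi)%g].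
    have nl : nbhs (frob b (z * m (k, xi) * z^-1)%g) [set x | x < frob b (k * exp xi)%g].
      by apply: open_nbhs_nbhs; split; [exact: open_lt|exact: lt].
    exact: (fc' (k, xi) _ nl).
  have [p [[[Kp pp op] _] /= hp]] := Akx _ nb.
  have [k2 [xi2 [Kk2 px2 e2]]] := polar_pss (z * m p * z^-1)%g.
  have f2 : frob b (m (k2, xi2)) < frob b (k * exp xi)%g.
    by rewrite -(frob_ext b e2).
  have S2 : S' (k2, xi2).
    split; last first.
      rewrite /=; apply/ltW/(lt_le_trans f2).
      by apply: (kmin (k0, xi0)); exact: subset_closure.
    split=> //; have [x hx] := conj_orbit_conj z op; exists x => X.
    by rewrite -hx e2.
  have := kmin (k2, xi2) (subset_closure S2).
  by rewrite leNgt f2.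
exists k, xi; split=> //.
- move=> A nA; have nA' : nbhs (k, xi) [set p | A (m p)] by exact: (cont_near (cm (k, xi)) nA).
  by have [p [[[_ _ op] _] Ap]] := Akx _ nA'; exists (m p).
- have pk := pss_Ad HG Kk pxi; have [tk ck] := pk.
  (* Commutation only says that the two exponentials have the same adjoint action; [log_uniq] and
     injectivity of [ad] on [pss] give equality of the vectors. *)
  have e : forall x, cAd (exp (Ad k xi)) x = cAd (exp xi) x.
    by move=> x; rewrite -expG_conj !cAdM comm cAdKV.
  have be := log_uniq HG tk tx e.
  apply/eqP; rewrite -subr_eq0; apply/eqP; apply: (pss_inj HG).
    have := (pss_lin HG).2 (-1) xi (Ad k xi) pxi pk.
    by rewrite scaleN1r addrC.
  by move=> Y; rewrite lbrDl lbrNl be subrr.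
Qed.

End NormalRepresentative.

(** * The fixed space of a generic element *)

Section MatrixOfMap.
Context {F : fieldType} {n : nat}.
Notation V := 'rV[F]_n.
Implicit Types (f g : V -> V).

Definition linmap f := forall a x y, f (a *: x + y) = a *: f x + f y.

(** Vectors are rows and matrices act on the right, so composition of maps reverses the order of the
    matrices. *)
Definition mxf f : 'M[F]_n := \matrix_(i, j) f (delta_mx 0 i) 0 j.

Lemma linmap0 f : linmap f -> f 0 = 0.
Proof. by move=> lf; have := lf (-1) 0 0; rewrite scaler0 addr0 scaleN1r addNr. Qed.

Lemma mul_mxf f u : linmap f -> u *m mxf f = f u.
Proof.
move=> lf; have -> : f u = \sum_i u 0 i *: f (delta_mx 0 i).
  rewrite {1}(row_sum_delta u); elim/big_rec2: _ => [|i x y _ <-]; first exact: linmap0.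
  by rewrite lf.
by apply/rowP => j; rewrite mxE summxE; apply: eq_bigr => i _; rewrite !mxE.
Qed.

Lemma mxf_comp f g : linmap f -> mxf g *m mxf f = mxf (f \o g).
Proof.
move=> lf; apply/matrixP => i j; rewrite !mxE /= -(mul_mxf (g _) lf) mxE.
by apply: eq_bigr => l _; rewrite !mxE.
Qed.

Lemma eq_mxf f g : (forall x, f x = g x) -> mxf f = mxf g.
Proof. by move=> h; apply/matrixP => i j; rewrite !mxE h. Qed.

Lemma mxf_id : mxf id = 1%:M.
Proof. by apply/matrixP => i j; rewrite !mxE eqxx /= eq_sym. Qed.

Lemma mxfD f g : mxf (fun x => f x + g x) = mxf f + mxf g.
Proof. by apply/matrixP => i j; rewrite !mxE. Qed.

Lemma mxfB f g : mxf (fun x => f x - g x) = mxf f - mxf g.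
Proof. by apply/matrixP => i j; rewrite !mxE. Qed.

Lemma det_mxf_neq0 f : linmap f -> (forall x, f x = 0 -> x = 0) -> \det (mxf f) != 0.
Proof.
move=> lf inj; apply/negP => /det0P [u u0]; rewrite mul_mxf // => /inj u00.
by rewrite u00 eqxx in u0.
Qed.

End MatrixOfMap.

Lemma det_cont (R : realType) (T : topologicalType) n (M : T -> 'M[R]_n) :
  (forall i j, continuous (fun x => M x i j)) -> continuous (fun x => \det (M x)).
Proof.
move=> h; rewrite /determinant; apply: continuous_big; first exact: add_continuous.
move=> s _; have hp (sg : 'I_n -> 'I_n) : continuous (fun x => \prod_i M x i (sg i)).
  by apply: continuous_big; [exact: mul_continuous|move=> i _; exact: h].
by move=> x; apply: cvgM; [exact: cvg_cst|exact: hp].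
Qed.

Section FixedSpace.
Context {R : realType} {n : nat} {G : lieGroupType R n}.
Context {K : set G} {theta : {linear 'rV[R]_n -> 'rV[R]_n}}.
Context {B : 'rV[R]_n -> 'rV[R]_n -> R}.
Context (HG : reductive_group K theta B).
Notation V := 'rV[R]_n.
Notation br := (lbr G).
Notation exp := (expG G).
Notation L := (Lred HG).
Notation ip := (@ip _ _ theta B).
Implicit Types (g k : G) (X Y Z xi : V).

Lemma Ad_linmap g : linmap (Ad g). Proof. exact: Ad_linP. Qed.

Lemma real_complex_inj (a b : R) : (a%:C)%C = (b%:C)%C -> a = b.
Proof. by move=> /(congr1 (@complex.Re R)). Qed.

Lemma ip_exp_adj xi X Y : theta xi = - xi -> ip (Ad (exp xi) X) Y = ip X (Ad (exp xi) Y).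
Proof.
move=> tx; apply: real_complex_inj; rewrite -!(form_rl HG) -!cAd_rl.
exact: (cAd_exp_adj HG tx).
Qed.

Lemma ip_Ad_adj k X Y : K k -> ip (Ad k X) Y = ip X (Ad k^-1%g Y).
Proof. by move=> Kk; rewrite -{1}(AdKV k Y) (ip_Ad HG). Qed.

Context (k : G) (xi : V).
Context (Kk : K k).
Context (txi : theta xi = - xi).
Context (comm : forall x, cAd k (cAd (exp xi) x) = cAd (exp xi) (cAd k x)).
Notation h := (k * exp xi)%g.

Definition fixedP X := Ad h X = X.

Lemma fixed_facts X : fixedP X -> [/\ br xi X = 0, Ad k X = X, Ad (exp xi) X = X,
  Ad k^-1%g X = X & Ad h^-1%g X = X].
Proof.
move=> hX; have [|h1 h2] := normal_fix HG (x := rlV X) Kk txi comm.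
  by rewrite cAd_rl hX.
have kX : Ad k X = X by apply: rlV_inj; rewrite -cAd_rl.
have bX : br xi X = 0 by apply: rlV_eq0; rewrite -gbr_rl2.
split; [exact: bX|exact: kX|exact: Ad_exp_fix| |].
  by rewrite -{1}kX AdVK.
by rewrite -{1}hX AdVK.
Qed.

Lemma fixed_theta X : fixedP X -> fixedP (theta X).
Proof.
move=> /fixed_facts [bX kX _ _ _].
have e : br xi (theta X) = 0.
  have := red_theta_br HG xi X; rewrite bX linear0 txi lbrNl => /esym/eqP.
  by rewrite oppr_eq0 => /eqP.
by rewrite /fixedP AdM (Ad_exp_fix e) (Ad_theta HG X Kk) kX.
Qed.

Lemma ip_fixed X U : fixedP X -> ip (Ad h U) X = ip U X /\ ip (Ad h^-1%g U) X = ip U X.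
Proof.
move=> /fixed_facts [bX kX eX kX' _]; split.
  by rewrite AdM ip_Ad_adj // kX' ip_exp_adj // eX.
have tx' : theta (- xi) = - - xi by rewrite linearN /= txi.
rewrite invgM AdM -expGN ip_exp_adj // Ad_exp_fix; last by rewrite lbrNl bX oppr0.
by rewrite ip_Ad_adj ?invgK ?kX //; exact: (red_KV HG).
Qed.

Lemma fixed_lin : lin_closed fixedP.
Proof.
split; first exact: Ad0.
by move=> a X Y hX hY; rewrite /fixedP Ad_linP hX hY.
Qed.

(** Normality makes the image [W] of [Ad h^-1 - 1] orthogonal to the fixed space, which is the
    kernel of the same map; by dimension they are complementary. [P] is thus an orthogonal
    projection, and [M1] inverts the map on [W], as [near_conj_exp] requires. *)
Lemma fixed_projection : exists P M1 : V -> V,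
  [/\ linmap P, linmap M1 & [/\ forall w, fixedP (P w), forall x, fixedP x -> P x = x,
      forall w, Ad h^-1%g (M1 w) - M1 w + P w = w,
      forall x y, ip (P x) y = ip x (P y) & forall x, P (Ad h x) = P x]].
Proof.
pose t := mkvs fixedP; have memt := mem_mkvs fixed_lin.
pose f0 X := Ad h^-1%g X - X.
have lf0 : linear f0.
  by move=> a X Y; rewrite /f0 (Ad_linP h^-1%g a X Y) scalerBr opprD addrACA.
pose fl : {linear V -> V} := HB.pack f0 (GRing.isLinear.Build _ _ _ _ f0 lf0).
pose f := linfun fl; pose W := limg f.
have fE X : f X = Ad h^-1%g X - X by rewrite lfunE.
have tker : t = lker f.
  apply: eqvPP => X; rewrite memv_ker fE; split.
    by move=> /memt /fixed_facts [_ _ _ _ ->]; rewrite subrr.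
  rewrite subr_eq0 => /eqP e; apply/memt.
  by rewrite /fixedP -{1}e AdKV.
have orth X Y : X \in W -> fixedP Y -> ip X Y = 0.
  move=> /memv_imgP [U _ ->] hY; rewrite fE (ipBl HG).
  by have [_ ->] := ip_fixed U hY; rewrite subrr.
have tW : (t :&: W = 0)%VS.
  apply/eqP; rewrite -subv0; apply/subvP => X /memv_capP [/memt hX XW].
  by rewrite memv0; apply/eqP; apply: (ip_eq0 HG); exact: orth.
have full : (t + W = fullv)%VS.
  apply/eqP; rewrite eqEdim subvf /= dimv_disjoint_sum // tker.
  by have := limg_ker_dim f fullv; rewrite capfv => ->.
pose P w := daddv_pi t W w; pose M1 w := (f^-1)%VF (daddv_pi W t w).
have PE w : f (M1 w) + P w = w.
  rewrite /M1 limg_lfunVK ?memv_pi // addrC daddv_pi_add // full memvf //.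
have Pt w : fixedP (P w) by apply/memt; exact: memv_pi.
have PM w : w - P w \in W by rewrite -{1}(PE w) addrK memv_img // memvf.
have self x y : ip (P x) y = ip x (P y).
  have h1 u w : ip (u - P u) (P w) = 0 by exact: orth.
  transitivity (ip (P x) (P y)).
    apply/eqP; rewrite -subr_eq0 (ipC HG) (ipC HG _ (P y)) -(ipBl HG) h1 //.
  by apply/esym/eqP; rewrite -subr_eq0 -(ipBl HG) h1.
exists P, M1; split; [by move=> a x y; rewrite /P linearP|by move=> a x y; rewrite /M1 !linearP|].
split=> //.
- by move=> x /memt xt; rewrite /P daddv_pi_id.
- by move=> w; rewrite -fE PE.
- move=> x; apply/eqP; rewrite -subr_eq0; apply/eqP; apply: (ip_eq0 HG).
  have hP : P (Ad h x) - P x = P (Ad h x - x) by rewrite /P linearB.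
  rewrite {1}hP self (ipBl HG).
  have [-> _] := ip_fixed x (Pt (P (Ad h x) - P x)).
  by rewrite subrr.
Qed.

End FixedSpace.

Section MatrixAd.
Context {R : realType} {n : nat} {G : lieGroupType R n}.
Notation V := 'rV[R]_n.
Implicit Types (g h : G).

Definition mxAd g : 'M[R]_n := mxf (Ad g).

Lemma mxAdM g h : mxAd (g * h)%g = mxAd h *m mxAd g.
Proof.
by rewrite /mxAd (mxf_comp _ (Ad_linmap g)); apply: eq_mxf => X; rewrite /= AdM.
Qed.

Lemma mxAd1 : mxAd 1%g = 1%:M.
Proof. by rewrite -mxf_id; apply: eq_mxf => X; rewrite Ad1. Qed.

Lemma mxAd_ext g h : (forall X, Ad g X = Ad h X) -> mxAd g = mxAd h.
Proof. exact: eq_mxf. Qed.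

Lemma mxAdE g i j : mxAd g i j = Ad g (delta_mx 0 i) 0 j.
Proof. by rewrite mxE. Qed.

Lemma mxAd_comp g f : mxf f *m mxAd g = mxf (fun v => Ad g (f v)).
Proof. exact: mxf_comp (Ad_linmap g). Qed.

Lemma mxAd_comp' g f : linmap f -> mxAd g *m mxf f = mxf (fun v => f (Ad g v)).
Proof. exact: mxf_comp. Qed.

Lemma mxAd_commute g f : linmap f -> (forall v, Ad g (f v) = f (Ad g v)) ->
  mxAd g *m mxf f = mxf f *m mxAd g.
Proof. by move=> lf e; rewrite mxAd_comp mxAd_comp' //; apply: eq_mxf. Qed.

Definition cpAd g := char_poly (mxAd g).

Lemma horner_cpAd g a : (cpAd g).[a] = \det (a%:M - mxAd g).
Proof. exact: horner_char_poly. Qed.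

End MatrixAd.

Opaque mxAd.

Lemma char_poly_similar (F : fieldType) n (A X X' : 'M[F]_n) : X' *m X = 1%:M ->
  char_poly (X' *m (A *m X)) = char_poly A.
Proof.
move=> XX; have [u1 u2] := mulmx1_unit XX.
have -> : X = invmx X' by rewrite -[RHS]mulmx1 -XX mulKmx.
by rewrite mulmxA char_poly_conj.
Qed.

Lemma cont_closure_eq (R : realType) (T : topologicalType) (f : T -> R) (A : set T) c x :
  continuous f -> (forall y, A y -> f y = c) -> closure A x -> f x = c.
Proof.
move=> cf fA ch; apply/eqP; rewrite -subr_eq0 -normr_le0; apply/ler_addgt0Pr => e e0.
have nb : nbhs (f x) [set z | `|f x - z| < e] by apply/nbhs_ballP; exists e.
have [y [/fA <- /= hy]] := ch _ (cf x _ nb).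
by rewrite add0r; exact: ltW.
Qed.

Lemma cont_addc (R : realType) (T : topologicalType) (f : T -> R) c :
  continuous f -> continuous (fun x => f x + c).
Proof. by move=> cf x; apply: cvgD; [exact: cf|exact: cvg_cst]. Qed.

Section CharPolyAd.
Context {R : realType} {n : nat} {G : lieGroupType R n}.
Notation V := 'rV[R]_n.
Implicit Types (g h x y : G).

Lemma cpAd_conj g x y : (forall X, Ad y X = Ad (x * g * x^-1)%g X) -> cpAd y = cpAd g.
Proof.
move=> /mxAd_ext e; rewrite /cpAd e !mxAdM; apply: char_poly_similar.
by rewrite -mxAdM mulgV mxAd1.
Qed.

Lemma det_Ad_cont a : continuous (fun u : G => \det (a%:M - mxAd u)).
Proof.
apply: det_cont => i j u.
have -> : (fun u : G => (a%:M - mxAd u) i j) =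
    (fun u : G => (a *+ (i == j)) - Ad u (delta_mx 0 i) 0 j).
  by apply/funext => w; rewrite !mxE -mxAdE.
apply: cvgB; first exact: cvg_cst.
apply: (@continuous_comp _ _ _ (fun u : G => Ad u (delta_mx 0 i)) (fun v : V => v 0 j)).
  exact: Ad_cont.
exact: coord_continuous.
Qed.

(** Values of the characteristic polynomial are continuous functions of the group element and
    constant on the orbit. *)
Lemma cpAd_closure g h : closure (conj_orbit g) h -> cpAd h = cpAd g.
Proof.
move=> ch; apply: char_poly_ext => a.
apply: (cont_closure_eq (@det_Ad_cont a) _ ch) => y [x hx].
transitivity (cpAd y).[a]; first exact/esym/horner_cpAd.
by rewrite (cpAd_conj hx); exact: horner_cpAd.
Qed.

End CharPolyAd.

Opaque cpAd.

Section UnipotentOnFixedSpace.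
Context {R : realType} {n : nat} {G : lieGroupType R n}.
Notation V := 'rV[R]_n.
Notation br := (lbr G).
Notation exp := (expG G).
Implicit Types (g : G) (X Y Z u v w : V).

Context (h : G) (P : V -> V) (r : nat).
Context (lP : linmap P).
Context (hP : forall w, Ad h (P w) = P w).
Context (PAd : forall x, P (Ad h x) = P x).
Context (Pid : forall x, Ad h x = x -> P x = x).
Context (Psplit : forall w, exists u, w = (Ad h u - u) + P w).
Context (cp_h : ~~ (('X - 1%:P) ^+ r.+1 %| cpAd h)).

Lemma linB (f : V -> V) x y : linmap f -> f (x - y) = f x - f y.
Proof. by move=> lf; have := lf (-1) y x; rewrite !scaleN1r addrC => ->; rewrite addrC. Qed.

Lemma linD (f : V -> V) x y : linmap f -> f (x + y) = f x + f y.
Proof. by move=> lf; have := lf 1 x y; rewrite !scale1r. Qed.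

Let PP x : P (P x) = P x. Proof. by rewrite Pid. Qed.

(** [Ad (h exp Y) - 1] on the range of [1 - P], completed by the identity on the range of [P]. Its
    determinant is nonzero at [Y = 0], hence near 0, and there [h exp Y] has no eigenvalue 1 off the
    fixed space of [h]. *)
Definition nres Y v := Ad (h * exp Y)%g (v - P v) - (v - P v) + P v.

Lemma nres_lin Y : linmap (nres Y).
Proof.
have lA := Ad_linmap (h * exp Y)%g => a u w; rewrite /nres.
have -> : a *: u + w - P (a *: u + w) = a *: (u - P u) + (w - P w).
  by rewrite lP; apply/rowP => i; rewrite !mxE; ring.
rewrite lA lP; move: (Ad _ _) (Ad _ _) => p q; apply/rowP => i; rewrite !mxE; ring.
Qed.

Lemma nres0 : \det (mxf (nres 0)) != 0.
Proof.
apply: det_mxf_neq0 => [|v]; first exact: nres_lin.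
rewrite /nres expG0 mulg1 => e.
have Pv : P v = 0.
  have := congr1 P e; rewrite (linmap0 lP) (linD _ _ lP) (linB _ _ lP) PAd subrr add0r.
  by rewrite PP.
move: e; rewrite Pv subr0 addr0 => /eqP; rewrite subr_eq0 => /eqP/Pid.
by rewrite Pv.
Qed.

Lemma nres_near : exists2 d, 0 < d & forall Y, `|Y| < d -> \det (mxf (nres Y)) != 0.
Proof.
have cd : continuous (fun Y => \det (mxf (nres Y))).
  apply: det_cont => i j; set v : V := delta_mx 0 i.
  have -> : (fun Y => mxf (nres Y) i j) =
      (fun Y => Ad (h * exp Y)%g (v - P v) 0 j + (- (v - P v) + P v) 0 j).
    by apply/funext => w; rewrite mxE /nres -addrA mxE.
  apply: cont_addc => Y.
  apply: (@continuous_comp _ _ _ (fun Y => Ad (h * exp Y)%g (v - P v)) (fun v : V => v 0 j)).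
    apply: (@continuous_comp _ _ _ (fun Y => h * exp Y)%g (fun g => Ad g (v - P v))).
      by apply: (@cont_mul _ _ _ V (fun=> h) exp); [exact: cst_continuous|have [] := @expG_facts R n G].
    exact: Ad_cont.
  exact: coord_continuous.
have nz : nbhs (\det (mxf (nres 0))) [set x : R | x != 0].
  by apply: open_nbhs_nbhs; split; [exact: open_neq|exact: nres0].
have /nbhs_norm_lt [d d0 hd] := cd 0 _ nz.
by exists d => // Y hY; apply: hd; rewrite subr0.
Qed.

(** [P] kills the image of [Ad h - 1] and fixes the fixed space, both of which are preserved by any
    linear map commuting with [Ad h]. *)
Lemma P_comm f X : linmap f -> (forall v, Ad h (f v) = f (Ad h v)) -> P (f X) = f (P X).
Proof.
move=> lf fA; have [u e] := Psplit X.
rewrite {1}e (linD _ _ lf) (linB _ _ lf) -fA (linD _ _ lP) (linB _ _ lP) PAd subrr add0r.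
by apply: Pid; rewrite fA hP.
Qed.

Lemma br_linmap Y : linmap (br Y).
Proof. by move=> a u w; exact: lbr_linr. Qed.

Lemma adY_comm Y X : Ad h Y = Y -> Ad h (br Y X) = br Y (Ad h X).
Proof. by move=> hY; rewrite Ad_br hY. Qed.

Lemma expY_comm Y X : Ad h Y = Y -> Ad h (Ad (h * exp Y)%g X) = Ad (h * exp Y)%g (Ad h X).
Proof.
move=> hY; rewrite -!AdM; congr (Ad _ X).
have e := expG_conj h Y; rewrite hY in e.
by rewrite -mulgA; congr (h * _)%g; rewrite -{2}e mulgVK.
Qed.

Lemma br_exp_comm Y X : Ad h Y = Y -> br Y (Ad (h * exp Y)%g X) = Ad (h * exp Y)%g (br Y X).
Proof.
move=> hY; have e : Ad (h * exp Y)%g Y = Y by rewrite AdM Ad_exp_self.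
by rewrite Ad_br e.
Qed.

Lemma mxf_commute (f g : V -> V) : linmap f -> linmap g -> (forall v, f (g v) = g (f v)) ->
  mxf f *m mxf g = mxf g *m mxf f.
Proof. by move=> lf lg e; rewrite !mxf_comp //; apply: eq_mxf => v /=; rewrite e. Qed.

Definition trf (f : V -> V) := \sum_j f (delta_mx 0 j) 0 j.

Lemma tr_mxf f : \tr (mxf f) = trf f.
Proof. by apply: eq_bigr => j _; rewrite mxE. Qed.

Lemma trf_unipotent Y : Ad h Y = Y -> \det (mxf (nres Y)) != 0 ->
  ('X - 1%:P) ^+ r %| cpAd (h * exp Y)%g ->
  trf (fun v => P (Ad (h * exp Y)%g (br Y (br Y v)))) = trf (fun v => P (br Y (br Y v))) /\
  trf (fun v => P (Ad (h * exp Y)%g v)) = trf P.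
Proof.
move=> hY dY cpY.
have lA := Ad_linmap h; have lM := Ad_linmap (h * exp Y)%g; have lD := br_linmap Y.
have eP : mxAd h *m mxf P = mxf P by rewrite (mxAd_comp' _ lP); exact: eq_mxf.
have eP' : mxf P *m mxAd h = mxf P by rewrite mxAd_comp; exact: eq_mxf.
set k := (h * exp Y)%g in lM cpY *.
have hk : (h * k = k * h)%g.
  have e := expG_conj h Y; rewrite hY in e.
  by rewrite /k -mulgA; congr (h * _)%g; rewrite -{2}e mulgVK.
have kP : mxAd k *m mxf P = mxf P *m mxAd k.
  apply: mxAd_commute lP _ => v; apply/esym/P_comm; first exact: lM.
  by move=> w; exact: expY_comm.
have [||||||||||||h1 h2] := @unipotent_trace_real R n (mxAd h) (mxf P) (mxf (br Y)) (mxAd k) r.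
- by rewrite eP eP'.
- by apply: mxAd_commute lD _ => v; exact: adY_comm.
- by rewrite -!mxAdM hk.
- apply: mxf_commute lP (br_linmap Y) _ => v; apply: P_comm (br_linmap Y) _ => w.
  exact: adY_comm.
- by rewrite kP.
- apply/esym/mxAd_commute; first exact: lD.
  by move=> v; apply/esym; exact: br_exp_comm.
- by rewrite (mxf_comp _ lP); exact: eq_mxf.
- exact: eP.
- have -> : mxAd h - 1%:M + mxf P = mxf (fun v => Ad h v - v + P v).
    by rewrite mxfD mxfB mxf_id.
  apply: det_mxf_neq0 => [a u w|v e].
    rewrite lA lP; move: (Ad h u) (Ad h w) (P u) (P w) => p1 p2 p3 p4.
    by apply/rowP => i; rewrite !mxE; ring.
  have Pv : P v = 0.
    have := congr1 P e; rewrite (linmap0 lP) (linD _ _ lP) (linB _ _ lP) PAd subrr add0r.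
    by rewrite PP.
  move: e; rewrite Pv addr0 => /eqP; rewrite subr_eq0 => /eqP/Pid.
  by rewrite Pv.
- suff -> : (mxAd k - 1%:M) *m (1%:M - mxf P) + mxf P = mxf (nres Y) by exact: dY.
  rewrite /nres -/k mxfD mxfB -mxAd_comp mxfB mxf_id; congr (_ + _).
  rewrite mulmxBr mulmx1 !mulmxBl !mul1mx kP.
  by apply/matrixP => i j; rewrite !mxE; ring.
- exact: cpY.
- exact: cp_h.
split.
  rewrite -2!tr_mxf; move: h1; rewrite (mxf_comp _ lD) mxAd_comp (mxf_comp _ lP) (mxf_comp _ lP).
  exact.
by rewrite -2!tr_mxf; move: h2; rewrite (mxAd_comp' _ lP); exact.
Qed.

End UnipotentOnFixedSpace.

Section TraceCurves.
Context {R : realType} {n : nat} {G : lieGroupType R n}.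
Notation V := 'rV[R]_n.
Notation br := (lbr G).
Notation exp := (expG G).
Implicit Types (X Y Z u v w : V).

Lemma cdiff_add (F : normedModType R) (c c' : R -> F) t (X Y : F) :
  cdiff c t X -> cdiff c' t Y -> cdiff (fun s => c s + c' s) t (X + Y).
Proof.
move=> /cdiff_is_derive d1 /cdiff_is_derive d2; exact: is_derive_cdiff.
Qed.

Lemma cdiff_bigsum (F : normedModType R) I (r : seq I) (c : I -> R -> F) t (X : I -> F) :
  (forall i, cdiff (c i) t (X i)) ->
  cdiff (fun s => \sum_(i <- r) c i s) t (\sum_(i <- r) X i).
Proof.
move=> h; elim: r => [|i r IH].
  rewrite big_nil; apply: cdiff_ext (cdiff_cst 0 t) => s.
  by rewrite big_nil.
rewrite big_cons; apply: cdiff_ext (cdiff_add (h i) IH) => s.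
by rewrite big_cons.
Qed.

Lemma cdiff_Ad_sum (l : 'I_n -> V -> R) (w : 'I_n -> V) Y t :
  (forall j (a : R) x y, l j (a *: x + y) = a * l j x + l j y) ->
  cdiff (fun s => (\sum_j l j (Ad (exp (s *: Y)) (w j)) : R^o)) t
    (\sum_j l j (Ad (exp (t *: Y)) (br Y (w j)))).
Proof.
move=> ll; apply: cdiff_bigsum => j.
have lj : linear (l j : V -> R^o) by move=> a x y; exact: ll.
have [C hC] := rV_lin_bounded lj.
exact: (cdiff_linear lj hC (Ad_exp_deriv Y (w j) t)).
Qed.

(** Differentiating along the one-parameter group inserts [br Y] each time, so the expression in the
    conclusion is the second derivative at [s = 1] of a locally constant sum. *)
Lemma second_derivative_zero (l : 'I_n -> V -> R) Y c0 (e : R) :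
  (forall j (a : R) x y, l j (a *: x + y) = a * l j x + l j y) -> 0 < e ->
  (forall s, `|s - 1| < e -> \sum_j l j (Ad (exp (s *: Y)) (delta_mx 0 j)) = c0) ->
  \sum_j l j (Ad (exp Y) (br Y (br Y (delta_mx 0 j)))) = 0.
Proof.
move=> ll e0 hc.
(* Each differentiation halves the radius, so that around every remaining [s] the function is still
   constant. *)
have step (c c' : R -> R^o) (x : R) e1 : 0 < e1 -> (forall s, `|s - 1| < e1 -> c s = x) ->
    (forall s, cdiff c s (c' s)) -> forall s, `|s - 1| < e1 / 2 -> c' s = 0.
  move=> e10 h d s hs; apply: (@cdiff_uniq _ _ c s) (d s) _.
  apply: (@cdiff_near _ _ (fun=> x)); last exact: cdiff_cst.
  apply/nbhs_norm_lt; exists (e1 / 2); first by rewrite divr_gt0.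
  move=> s' hs'; apply/esym/h.
  have -> : s' - 1 = (s' - s) + (s - 1) by ring.
  apply: le_lt_trans (ler_normD _ _) _.
  have -> : e1 = e1 / 2 + e1 / 2 by field.
  exact: ltrD.
have d1 s := cdiff_Ad_sum (fun j => delta_mx 0 j) Y s ll.
have d2 s := cdiff_Ad_sum (fun j => br Y (delta_mx 0 j)) Y s ll.
have e2 : 0 < e / 2 by rewrite divr_gt0.
have := step _ _ _ _ e2 (step _ _ _ _ e0 hc d1) d2 1.
by rewrite subrr normr0 scale1r; apply; rewrite divr_gt0.
Qed.

End TraceCurves.

(** A quadratic form vanishing at [Y0] and at [Y0 + a Z], [Y0 - a Z] vanishes at [Z]: in the sum of
    the two expansions the cross terms [b1], [b2] cancel. *)
Lemma quadratic_pm (R : realFieldType) (a q b1 b2 : R) : 0 < a ->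
  - a * (- a * q + b1) + (- a * b2 + 0) = 0 -> a * (a * q + b1) + (a * b2 + 0) = 0 -> q = 0.
Proof.
move=> a0 h1 h2; have : a ^+ 2 * q = 0 by rewrite expr2; lra.
by move/eqP; rewrite mulf_eq0 expf_eq0 /= gt_eqF //= => /eqP.
Qed.

Section FixedAbelian.
Context {R : realType} {n : nat} {G : lieGroupType R n}.
Notation V := 'rV[R]_n.
Notation br := (lbr G).
Notation exp := (expG G).
Implicit Types (g : G) (X Y Z u v w : V).
Context (h : G) (P : V -> V) (r : nat).
Context (lP : linmap P).
Context (hP : forall w, Ad h (P w) = P w).
Context (PAd : forall x, P (Ad h x) = P x).
Context (Pid : forall x, Ad h x = x -> P x = x).
Context (Psplit : forall w, exists u, w = (Ad h u - u) + P w).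
Context (cp_h : ~~ (('X - 1%:P) ^+ r.+1 %| cpAd h)).

(** A Killing form compressed to the fixed space: the trace of [P (ad X) (ad Y)]. *)
Definition kil X Y := trf (fun v => P (br X (br Y v))).

Lemma trfD (f g : V -> V) : trf (fun v => f v + g v) = trf f + trf g.
Proof. by rewrite /trf -big_split; apply: eq_bigr => j _; rewrite mxE. Qed.

Lemma trfZ (a : R) (f : V -> V) : trf (fun v => a *: f v) = a * trf f.
Proof. by rewrite /trf mulr_sumr; apply: eq_bigr => j _; rewrite mxE. Qed.

Lemma eq_trf (f g : V -> V) : (forall v, f v = g v) -> trf f = trf g.
Proof. by move=> e; apply: eq_bigr => j _; rewrite e. Qed.

Lemma kil_linl (a : R) X X' Y : kil (a *: X + X') Y = a * kil X Y + kil X' Y.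
Proof.
rewrite /kil -trfZ -trfD; apply: eq_trf => v.
by rewrite lbrDl lbrZl lP.
Qed.

Lemma kil_linr (a : R) X Y Y' : kil X (a *: Y + Y') = a * kil X Y + kil X Y'.
Proof.
rewrite /kil -trfZ -trfD; apply: eq_trf => v.
by rewrite lbrDl lbrZl lbr_linr lP.
Qed.

(** [trf_unipotent] is used twice: its second part keeps the trace of [P Ad (h exp (s Y))] equal to
    that of [P] for [s] near 1, so a second derivative vanishes; its first part removes the factor
    [Ad (h exp Y)] from that derivative and leaves [kil Y Y]. *)
Lemma kil_local (d : R) Y : (forall Y, `|Y| < d -> \det (mxf (nres h P Y)) != 0) ->
  Ad h Y = Y ->
  (\forall X \near Y, `|X| < d /\ (Ad h X = X -> ('X - 1%:P) ^+ r %| cpAd (h * exp X)%g)) ->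
  kil Y Y = 0.
Proof.
move=> hd hY nY; have hs (s : R) : Ad h (s *: Y) = s *: Y by have [_ _ -> _] := Ad_lin h; rewrite hY.
have cs : {for (1 : R), continuous (fun s : R => s *: Y)}.
  apply: cont_eps => e e0; exists (e / (`|Y| + 1)); first by rewrite divr_gt0 // ltr_wpDl.
  move=> s h1; rewrite -scalerBl normrZ.
  have Y1 : 0 < `|Y| + 1 by rewrite ltr_wpDl.
  apply: (@le_trans _ _ (`|s - 1| * (`|Y| + 1))); first by rewrite ler_wpM2l // lerDl.
  by rewrite -ler_pdivlMr // ltW.
have n1 : nbhs ((1 : R) *: Y) [set X | `|X| < d /\ (Ad h X = X -> ('X - 1%:P) ^+ r %| cpAd (h * exp X)%g)].
  by rewrite scale1r.
have /nbhs_norm_lt [e e0 he] := cs _ n1.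
have good s : `|s - 1| < e -> trf (fun v => P (Ad (h * exp (s *: Y))%g v)) = trf P.
  move=> /he [h1 h2].
  by have [_] := trf_unipotent lP hP PAd Pid Psplit cp_h (hs s) (hd _ h1) (h2 (hs s)).
have [h1 h2] : `|Y| < d /\ (Ad h Y = Y -> ('X - 1%:P) ^+ r %| cpAd (h * exp Y)%g).
  exact: (nbhs_singleton nY).
rewrite /kil; have [<- _] := trf_unipotent lP hP PAd Pid Psplit cp_h hY (hd _ h1) (h2 hY).
pose l (j : 'I_n) v := P (Ad h v) 0 j.
have ll j (a : R) x y : l j (a *: x + y) = a * l j x + l j y.
  by rewrite /l (Ad_linmap h) lP !mxE.
have e1 s v : P (Ad (h * exp (s *: Y))%g v) = P (Ad h (Ad (exp (s *: Y)) v)) by rewrite AdM.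
have := @second_derivative_zero R n G l Y (trf P) e ll e0.
rewrite /l => z; rewrite -[RHS]z.
  by apply: eq_bigr => j _; rewrite AdM.
move=> s /good <-; rewrite /trf; apply: eq_bigr => j _.
exact: (congr1 (fun w : V => w 0 j) (esym (e1 s _))).
Qed.

Lemma kil_fixed Y0 : Ad h Y0 = Y0 ->
  (\forall Y \near Y0, Ad h Y = Y -> kil Y Y = 0) ->
  forall Z, Ad h Z = Z -> kil Z Z = 0.
Proof.
move=> h0 /nbhs_norm_lt [e e0 he] Z hZ.
have [a a0 aZ] : exists2 a : R, 0 < a & a * `|Z| < e.
  exists (e / (`|Z| + 1)); first by rewrite divr_gt0 // ltr_wpDl.
  rewrite mulrAC -mulrA gtr_pMr // ltr_pdivrMr ?ltr_wpDl // mul1r.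
  by rewrite ltrDl.
have k1 (b : R) : `|b| = a -> kil (b *: Z + Y0) (b *: Z + Y0) = 0.
  move=> ba; apply: he; first by rewrite addrK normrZ ba.
  by rewrite (Ad_linmap h) hZ h0.
have k0 : kil Y0 Y0 = 0 by apply: he => //; rewrite subrr normr0.
have := k1 a (gtr0_norm a0); have := k1 (- a); rewrite normrN (gtr0_norm a0) => /(_ erefl).
rewrite !kil_linl !kil_linr k0.
exact: quadratic_pm a0.
Qed.

End FixedAbelian.

Lemma trc_map (R : realType) n (f : 'rV[R]_n -> 'rV[R]_n) : f 0 = 0 ->
  trc (cplx_map f) = ((trf f)%:C)%C.
Proof.
move=> f0; rewrite /trc /trf rmorph_sum /=; apply: eq_bigr => j _.
by rewrite -rlV_delta cplx_map_rl // rlV_coord.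
Qed.

Section FixedSpaceAbelian.
Context {R : realType} {n : nat} {G : lieGroupType R n}.
Context {K : set G} {theta : {linear 'rV[R]_n -> 'rV[R]_n}}.
Context {B : 'rV[R]_n -> 'rV[R]_n -> R}.
Context (HG : reductive_group K theta B).
Notation V := 'rV[R]_n.
Notation VC := 'rV[R[i]]_n.
Notation br := (lbr G).
Notation exp := (expG G).
Notation L := (Lred HG).
Notation ip := (@ip _ _ theta B).
Implicit Types (g k : G) (X Y Z xi : V).

Lemma cplx_adj (f f' : V -> V) : (forall X Y, ip (f X) Y = ip X (f' Y)) ->
  @adjP _ _ L (cplx_map f) (cplx_map f').
Proof. by move=> a x y; rewrite !formL /hform !reV_map !imV_map !a. Qed.

Context (P : V -> V).
Context (lP : linmap P).
Context (PP : forall x, P (P x) = P x).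
Context (Pself : forall x y, ip (P x) y = ip x (P y)).

(** [c * kil Z Z] is the squared Hilbert-Schmidt norm of [ad Z] composed with [P]. The sign [c] is 1
    for [Z] in the p-part and -1 in the k-part. *)
Lemma kil_definite Z (c : R) : (forall X Y, ip (br Z X) Y = c * ip X (br Z Y)) ->
  kil (G := G) P Z Z = 0 -> forall v, br Z (P v) = 0.
Proof.
move=> adZ kZ v.
pose f v := br Z (P v); pose f' v := P (c *: br Z v).
have lf : linmap f by move=> a x y; rewrite /f lP lbr_linr.
have lf' : linmap f'.
  by move=> a x y; rewrite /f' lbr_linr scalerDr scalerA mulrC -scalerA lP.
have adj : @adjP _ _ L (cplx_map f) (cplx_map f').
  apply: cplx_adj => X Y; rewrite /f /f' adZ -(Pself X).
  by rewrite (ipC HG (P X) (c *: _)) (ipZl HG) (ipC HG _ (P X)).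
have [b _] := @some_obasis _ _ L.
have clf := cplx_map_lin lf; have clf' := cplx_map_lin lf'.
have n0 : nrm2 b (cplx_map f) = 0.
  rewrite -(trb_adj b adj) -(trc_ob b (linP_comp clf' clf)).
  have -> : cplx_map f' \o cplx_map f = cplx_map (f' \o f).
    by apply/funext => x; exact: cplx_map_comp.
  rewrite trc_map; last by rewrite /= (linmap0 lf) (linmap0 lf').
  suff -> : trf (f' \o f) = 0 by [].
  transitivity (c * kil (G := G) P Z Z); last by rewrite kZ mulr0.
  have lD : linmap (br Z) := br_linmap Z.
  rewrite /kil -trfZ -!tr_mxf.
  have -> : mxf (f' \o f) = mxf P *m (mxf (fun v => c *: P (br Z (br Z v)))).
    rewrite mxf_comp; last first.
      move=> a x y; rewrite !lbr_linr lP scalerDr !scalerA; congr (_ + _).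
      by rewrite mulrC.
    apply: eq_mxf => x; rewrite /= /f /f'.
    by have := lP c (br Z (br Z (P x))) 0; rewrite (linmap0 lP) !addr0.
  rewrite mxtrace_mulC (mxf_comp _ lP); congr (\tr _).
  apply: eq_mxf => x /=.
  by have := lP c (P (br Z (br Z x))) 0; rewrite (linmap0 lP) !addr0 PP.
have := nrm2_eq0 (b := b) clf; rewrite n0 => /(_ (lexx _)) h.
apply: (@rlV_eq0 R n); exact: etrans (esym (cplx_map_rl v (linmap0 lf))) (h (rlV v)).
Qed.

Lemma kil_fixed_abelian (t : V -> Prop) : lin_closed t -> (forall X, t X -> t (theta X)) ->
  (forall X, t X -> P X = X) -> (forall Z, t Z -> kil (G := G) P Z Z = 0) ->
  forall X Y, t X -> t Y -> br X Y = 0.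
Proof.
move=> [t0 tD] tth tP tk X Y tX tY.
have cZ (c : R) U : t U -> t (c *: U) by move=> h; have := tD c U 0 h t0; rewrite addr0.
have part (c : R) : (c = 1) \/ (c = -1) -> t (2^-1 *: (X + c *: theta X)) /\
    theta (2^-1 *: (X + c *: theta X)) = c *: (2^-1 *: (X + c *: theta X)).
  move=> hc; split.
    by apply: (cZ); rewrite addrC; apply: tD => //; exact: tth.
  have c2 : c * c = 1 by case: hc => ->; ring.
  rewrite linearZ linearD linearZ /= (thetaK HG) scalerA mulrC -scalerA; congr (_ *: _).
  by rewrite scalerDr scalerA c2 scale1r addrC.
have vanish (c : R) U : t U -> theta U = c *: U -> br U Y = 0.
  move=> tU hU; rewrite -(tP _ tY); apply: (fun a => kil_definite (Z := U) (c := - c) a (tk _ tU) Y) => A D.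
  rewrite (ip_adj HG) hU -scaleNr lbrZl (ipC HG) (ipZl HG) (ipC HG A).
  by [].
have [t1 h1] := part 1 (or_introl erefl); have [t2 h2] := part (-1) (or_intror erefl).
have -> : X = 2^-1 *: (X + 1 *: theta X) + 2^-1 *: (X + (-1) *: theta X).
  by apply/rowP => i; rewrite !mxE; field.
by rewrite lbrDl (vanish _ _ t1 h1) (vanish _ _ t2 h2) addr0.
Qed.

End FixedSpaceAbelian.

Section CentralizerAbelian.
Context {R : realType} {n : nat} {G : lieGroupType R n}.
Context {K : set G} {theta : {linear 'rV[R]_n -> 'rV[R]_n}}.
Context {B : 'rV[R]_n -> 'rV[R]_n -> R}.
Context (HG : reductive_group K theta B).
Notation V := 'rV[R]_n.
Notation VC := 'rV[R[i]]_n.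
Notation br := (lbr G).
Notation exp := (expG G).
Notation L := (Lred HG).
Implicit Types (g k : G) (X Y Z xi : V) (x y z : VC).

Definition ccent (t : V -> Prop) z := forall X, t X -> gbr G (rlV X) z = 0.

Lemma Ad_K_eigenbasis k : K k -> exists (b : obasis L) (lam : 'I__ -> R[i]),
  (forall i, cAd k (ob_v b i) = lam i *: ob_v b i) /\ (forall i, `|lam i| = 1).
Proof.
move=> Kk; have Kk' : K k^-1%g by exact: (red_KV HG).
have [|||b hb] := @joint_eigenbasis _ _ L (fun f => f = cAd k \/ f = cAd k^-1%g).
- by move=> f [] ->; exact: cAd_lin.
- move=> f g [->|->] [->|->] x; [by []| | |by []].
    exact: etrans (cAdKV k x) (esym (cAdVK k x)).
  exact: etrans (cAdVK k x) (esym (cAdKV k x)).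
- move=> f [] ->; first by exists (cAd k^-1%g); [right|exact: cAd_adj].
  by exists (cAd k); [left|move=> x y; rewrite (cAd_adj HG Kk') invgK].
exists b, (fun i => ob_co b i (cAd k (ob_v b i))).
have e i : cAd k (ob_v b i) = ob_co b i (cAd k (ob_v b i)) *: ob_v b i.
  have [c ec] := hb i _ (or_introl erefl).
  by rewrite ec (coZ (ob_col b)) ob_cov eqxx mulr1.
split=> // i; have := H_cAd HG (ob_v b i) (ob_v b i) Kk.
move: (ob_co b i _) (e i) => c ->; rewrite formZl formZr mulrA -normCK => h.
have : `|c| ^+ 2 = 1 by apply: (mulIf (ob_n0 b i)); rewrite h mul1r.
by move=> /eqP; rewrite sqrf_eq1 => /orP[/eqP //|/eqP c1]; have := normr_ge0 c; rewrite c1 oppr_ge0 ler10.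
Qed.

(** [star_fixed_central_abelian] is applied to the centralizer of [t] and the unitary automorphism
    [Ad k]. The real and imaginary parts of a [k]-fixed element of it commute with [xi], which lies
    in [t], and are fixed by [k]; so they lie in [t] and centralise everything there. *)
Lemma centralizer_abelian (t : V -> Prop) k xi : K k -> lin_closed t ->
  (forall X, t X -> t (theta X)) -> (forall X Y, t X -> t Y -> br X Y = 0) ->
  (forall X, t X -> Ad k X = X) -> t xi ->
  (forall X, br xi X = 0 -> Ad k X = X -> t X) ->
  forall z w, ccent t z -> ccent t w -> gbr G z w = 0.
Proof.
move=> Kk [t0 tD] tth tab tk txi tfix z w hz hw.
have [b [lam [hb l1]]] := Ad_K_eigenbasis Kk.
have brl := @sl_brl _ _ L; have brr := @sl_brr _ _ L.
have lcc : lin_closed (ccent t).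
  split=> [X _|a u v hu hv X tX]; first by rewrite -(brL HG) (br0r brr).
  by rewrite -(brL HG) brr !(brL HG) hu // hv // scaler0 addr0.
pose m := mkvs (ccent t); have memm := mem_mkvs lcc.
rewrite -(brL HG); apply: (star_fixed_central_abelian (ob_coE b) (ob_col b) (ob_cov b)
  (cAd_lin k) hb l1 (cAd_br HG k) (m := m)); try exact/memm.
- move=> x y /memm hx /memm hy; apply/memm => X tX.
  by rewrite -(brL HG) sl_jac !(brL HG) hx // hy // -(brL HG) (br0l brl) (br0r brr) addr0.
- move=> x /memm hx; apply/memm => X tX; rewrite -(brL HG).
  have -> : rlV X = sl_star L (rlV (- theta X)) by rewrite star_rl linearN /= (thetaK HG) opprK.
  have tX' : t (- theta X) by have := tD (-1) _ 0 (tth _ tX) t0; rewrite scaleN1r addr0.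
  by rewrite -sl_star_br brC (brL HG) (hx _ tX') oppr0 star0.
- move=> x /memm hx; apply/memm => X tX.
  have kX : cAd k (rlV X) = rlV X by rewrite cAd_rl tk.
  by rewrite -{1}kX -cAd_gbr hx // (lin0 (cAd_lin k)).
- move=> x y /memm hx /cAd_id [kr ki] /memm hy.
  have /gbr_rl_eq0 [xr xi0] := hx _ txi.
  have tr := tfix _ xr kr; have ti := tfix _ xi0 ki.
  rewrite (cplxVE x) (brDl brl) (brZl brl) !(brL HG) (hy _ tr) (hy _ ti).
  by rewrite scaler0 addr0.
Qed.

End CentralizerAbelian.

Section GenericElement.
Context {R : realType} {n : nat} {G : lieGroupType R n}.
Context {K : set G} {theta : {linear 'rV[R]_n -> 'rV[R]_n}}.
Context {B : 'rV[R]_n -> 'rV[R]_n -> R}.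
Context (HG : reductive_group K theta B).
Notation V := 'rV[R]_n.
Notation br := (lbr G).
Notation exp := (expG G).
Implicit Types (g k u x : G) (X Y Z xi : V).

Definition sat (O : set G) := [set u : G | exists2 u0, O u0 & conj_orbit u0 u].

(** [u] differs from a genuine conjugate of a point of [O] only by a factor [z] with trivial [Ad];
    dividing by [z] and conjugating back is continuous and maps [u] into [O]. *)
Lemma sat_nbhs O u : open O -> sat O u -> nbhs u (sat O).
Proof.
move=> oO [u0 Ou0 [x hx]].
pose z := ((x * u0 * x^-1)^-1 * u)%g.
have hz X : Ad z X = X.
  by rewrite /z AdM hx AdVK.
pose f v := (x^-1 * (v * (z^-1 * x)))%g.
have cf : continuous f.
  move=> v; apply: (@continuous_comp _ _ _ (fun v => v * (z^-1 * x))%g (fun w => x^-1 * w)%g).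
    exact: cont_mulr.
  exact: cont_mull.
have fu : f u = u0.
  by rewrite /f /z [((_^-1 * u)^-1)%g]invgM invgK !mulgA mulgK mulVg mul1g mulgVK.
have nO : nbhs (f u) O by rewrite fu; apply: open_nbhs_nbhs.
have nf : nbhs u (f @^-1` O) := cf u O nO.
apply: filterS nf => v Ov; exists (f v) => //; exists x => X.
have -> : (x * f v * x^-1)%g = (v * z^-1)%g.
  by rewrite /f !mulgA mulgV mul1g mulgK.
rewrite AdM; congr (Ad v _); apply: esym.
by rewrite -[in LHS](hz X) AdVK.
Qed.

Lemma sat_orbit O g y : sat O g -> conj_orbit g y -> sat O y.
Proof.
move=> [u0 Ou0 [x hx]] [x' hx']; exists u0 => //; exists (x' * x)%g => X.
by rewrite hx' !AdM hx invgM !AdM.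
Qed.

Lemma sat_conj O y z : sat O y -> sat O (z * y * z^-1)%g.
Proof. by move=> sy; apply: sat_orbit sy _; exists z. Qed.

Lemma cpAd_neq0 u : cpAd u != 0 :> {poly R}.
Proof. exact: (monic_neq0 (char_poly_monic _)). Qed.

Lemma size_cpAd u : size (cpAd u : {poly R}) = n.+1.
Proof. exact: size_char_poly. Qed.

Theorem generic_fixed_torus (O : set G) : open O -> O !=set0 -> exists t : V -> Prop,
  [/\ lin_closed t, forall X, t X -> t (theta X),
      forall X Y, t X -> t Y -> br X Y = 0,
      forall z w, ccent (G := G) t z -> ccent (G := G) t w -> gbr G z w = 0 &
      exists u x, O u /\ forall X, t X -> Ad (x * u * x^-1)%g X = X].
Proof.
move=> oO [a0 Oa0].
pose Q r := forall u, sat O u -> ('X - 1%:P) ^+ r %| (cpAd u : {poly R}).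
have so : sat O a0 by exists a0 => //; exists 1%g => X; rewrite mul1g invg1 mulg1.
have Q0 : exists r, `[< Q r >] by exists 0%N; apply/asboolP => u _; rewrite expr0 dvd1p.
have bQ r : `[< Q r >] -> (r <= n)%N.
  move=> /asboolP /(_ a0 so) /(dvdp_leq (cpAd_neq0 a0)); rewrite size_cpAd.
  by rewrite size_exp_XsubC.
have [r /asboolP Qr rmax] := ex_maxnP Q0 bQ.
have [g sg hg] : exists2 g, sat O g & ~~ (('X - 1%:P) ^+ r.+1 %| (cpAd g : {poly R})).
  apply: contrapT => h; have := rmax r.+1; rewrite ltnn; suff -> : `[< Q r.+1 >] by move=> /(_ isT).
  apply/asboolP => u su; apply: contrapT => /negP hu; apply: h; by exists u.
have [k [xi [Kk pxi clh comm kxi]]] := normal_representative HG g; have [txi _] := pxi.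
set h := (k * exp xi)%g in clh.
have cph : ~~ (('X - 1%:P) ^+ r.+1 %| (cpAd h : {poly R})) by rewrite (cpAd_closure clh).
have [P [M1 [lP lM1 [hP Pid hM Pself PAd]]]] := fixed_projection HG Kk txi comm.
have Psplit (w : V) : exists v : V, w = (Ad h v - v) + P w.
  exists (- Ad h^-1%g (M1 w)); rewrite -[LHS](hM w); congr (_ + P w).
  have -> : Ad h (- Ad h^-1%g (M1 w)) = - M1 w.
    by rewrite -scaleN1r; have [_ _ -> _] := Ad_lin h; rewrite AdKV scaleN1r.
  by rewrite opprK addrC.
have [d d0 hd] := nres_near (h := h) lP hP PAd Pid.
have nh := near_conj_exp lM1 lP (rV_lin_bounded (E := V) lM1) (rV_lin_bounded (E := V) lP) hM d0.
(* [h] itself may lie outside the saturation of [O]. An orbit element [y] close to it is conjugate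
   to [h exp Y0] with [Y0] fixed by [Ad h], and this element does belong to the saturation. *)
have [y [oy [x [w [wd yE]]]]] := clh _ nh.
have sy : sat O y := sat_orbit sg oy.
set Y0 := P w in wd yE.
have sY0 : sat O (h * exp Y0)%g.
  have -> : (h * exp Y0)%g = (x^-1 * y * x^-1^-1)%g.
    by rewrite yE invgK !mulgA mulVg mul1g mulgVK.
  exact: sat_conj.
have fY0 : Ad h Y0 = Y0 by exact: hP.
have ce : continuous (fun Y : V => h * exp Y)%g.
  by apply: (@cont_mul _ _ _ V (fun=> h) exp); [exact: cst_continuous|have [] := @expG_facts R n G].
have nY : \forall Y \near Y0, `|Y| < d /\ (Ad h Y = Y -> ('X - 1%:P) ^+ r %| (cpAd (h * exp Y)%g : {poly R})).
  have n1 : \forall Y \near Y0, sat O (h * exp Y)%g.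
    by apply: (ce Y0); exact: sat_nbhs.
  have n2 : \forall Y \near Y0, `|Y| < d.
    have nl : nbhs `|Y0| [set x : R | x < d].
      by apply: open_nbhs_nbhs; split; [exact: open_lt|exact: wd].
    exact: (@norm_continuous R V Y0 _ nl).
  by apply: filterS2 n1 n2 => Y s1 s2; split=> // _; exact: Qr.
(* [kil_local] needs the divisibility on a whole neighbourhood of each [Y], not only of [Y0];
   [near_join] supplies it. *)
have kilnear : \forall Y \near Y0, Ad h Y = Y -> kil (G := G) P Y Y = 0.
  have := near_join nY; apply: filterS => Y nYY hY.
  exact: (kil_local lP hP PAd Pid Psplit cph hd hY nYY).
have kil0 := kil_fixed lP fY0 kilnear.
pose t X := Ad h X = X.
have lt : lin_closed t := fixed_lin k xi.
have tth X : t X -> t (theta X) := fixed_theta HG Kk txi comm (X := X).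
have PP (v : V) : P (P v) = P v by rewrite Pid.
have tab := kil_fixed_abelian HG lP PP Pself lt tth Pid kil0.
have tfacts X : t X -> Ad k X = X by move=> /(fixed_facts HG Kk txi comm) [].
have txi' : t xi by rewrite /t /h AdM Ad_exp_self.
exists t; split=> //.
- apply: (centralizer_abelian HG Kk lt tth tab tfacts txi') => X bX kX.
  by rewrite /t /h AdM Ad_exp_fix.
(* [h] fixes [t] by definition, and [exp Y0] fixes it because [Y0] lies in the abelian [t]. *)
- have [u Ou [x1 hx1]] := sY0; exists u, x1; split=> // X tX.
  by rewrite -hx1 AdM Ad_exp_fix //; exact: tab.
Qed.

End GenericElement.

(** * The Borel subalgebra attached to a torus *)

Section Images.
Context {R : realType} {n : nat}.
Notation VC := 'rV[R[i]]_n.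
Implicit Types (f g : VC -> VC) (U W : {vspace VC}).

(** Leaving the scalar unspecified treats linear maps and the antilinear conjugation together;
    images of subspaces need no more. *)
Definition semilin f := (forall x y, f (x + y) = f x + f y) /\
  (forall a x, exists c, f (a *: x) = c *: f x).

Lemma semilin0 f : semilin f -> f 0 = 0.
Proof. by move=> [fD _]; have := fD 0 0; rewrite addr0 => e; apply: (addrI (f 0)); rewrite addr0 -e. Qed.

Lemma semilin_pre f W : semilin f -> lin_closed (fun x => f x \in W).
Proof.
move=> sf; have [fD fZ] := sf; split; first by rewrite (semilin0 sf) mem0v.
by move=> a x y hx hy; have [c e] := fZ a x; rewrite fD e memvD // memvZ.
Qed.

Lemma linP_semilin f : linP f -> semilin f.
Proof.
move=> lf; split=> [x y|a x]; first by have := lf 1 x y; rewrite !scale1r.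
by exists a; exact: linZ.
Qed.

Lemma mem_imgv f U x : semilin f -> x \in U -> f x \in imgv f U.
Proof.
move=> sf; apply: (vbasis_mem_ind (semilin_pre (imgv f U) sf)) => y yU.
by rewrite /imgv memv_span // map_f.
Qed.

Lemma imgv_sub f U W : (forall x, x \in U -> f x \in W) -> (imgv f U <= W)%VS.
Proof. by move=> h; apply/span_subvP => y /mapP [x /vbasis_mem xU ->]; exact: h. Qed.

Lemma imgv_id f g U : semilin f -> (forall x, x \in U -> f x \in U) ->
  (forall x, x \in U -> g x \in U) -> (forall x, f (g x) = x) -> imgv f U = U.
Proof.
move=> sf hf hg fg; apply: eqvPP => x; split; first exact: (subvP (imgv_sub hf)).
by move=> xU; rewrite -(fg x); apply: mem_imgv => //; exact: hg.
Qed.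

Lemma mem_imgv_inv f U x : semilin f -> (forall x, f (f x) = x) ->
  x \in imgv f U <-> f x \in U.
Proof.
move=> sf ff; split; last by move=> h; rewrite -(ff x); exact: mem_imgv.
have hs : (imgv f U <= mkvs (fun y => f y \in U))%VS.
  by apply: imgv_sub => y yU; apply/(mem_mkvs (semilin_pre U sf)); rewrite ff.
by move=> /(subvP hs) /(mem_mkvs (semilin_pre U sf)).
Qed.

Lemma reV_conj (z : VC) : reV (conjV z) = reV z. Proof. exact: reV_cplx. Qed.
Lemma imV_conj (z : VC) : imV (conjV z) = - imV z. Proof. exact: imV_cplx. Qed.

Lemma conjVD (x y : VC) : conjV (x + y) = conjV x + conjV y.
Proof.
apply: cplxV_ext; rewrite ?(reV_conj, imV_conj, reVD, imVD) //.
exact: opprD.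
Qed.

Lemma conjVZ (a : R[i]) (x : VC) : conjV (a *: x) = conjc a *: conjV x.
Proof.
case: a => p q; apply: cplxV_ext; rewrite ?(reV_conj, imV_conj, reVZ, imVZ) /=.
  by rewrite scaleNr scalerN !opprK.
by rewrite opprD scalerN scaleNr.
Qed.

Lemma conjVK (x : VC) : conjV (conjV x) = x.
Proof. by apply: cplxV_ext; rewrite !(reV_conj, imV_conj) ?opprK. Qed.

Lemma conjV_semilin : semilin (@conjV R n).
Proof. by split=> [|a x]; [exact: conjVD|exists (conjc a); exact: conjVZ]. Qed.

Lemma cplx_map_conj (f : 'rV[R]_n -> 'rV[R]_n) (x : VC) : (forall u, f (- u) = - f u) ->
  cplx_map f (conjV x) = conjV (cplx_map f x).
Proof.
move=> fN; apply: cplxV_ext.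
  by rewrite reV_map reV_conj reV_conj reV_map.
by rewrite imV_map imV_conj imV_conj imV_map.
Qed.

Lemma real_part (x : VC) : rlV (reV x) = (2^-1 : R[i]) *: (x + conjV x).
Proof.
have e : x + conjV x = rlV (reV x) + rlV (reV x).
  by apply: cplxV_ext; rewrite !(reVD, imVD, reV_conj, imV_conj, reV_rl, imV_rl) ?subrr ?addr0.
rewrite e; move: (rlV _) => y.
by apply/rowP => i; rewrite !mxE; field.
Qed.

(** The real points of [l] span it: the real part of [z] is the mean of [z] and its conjugate, and
    the imaginary part is the real part of [-i z]. *)
Lemma cplx_vspace_stable (l : {vspace VC}) :
  (forall z, z \in l -> conjV z \in l) ->
  exists l0 : {vspace 'rV[R]_n}, l = cplx_vspace l0 /\ forall X, X \in l0 <-> rlV X \in l.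
Proof.
move=> lc; pose P0 (X : 'rV[R]_n) := rlV X \in l.
have lP0 : lin_closed P0.
  split; first by rewrite /P0 rlV0 mem0v.
  by move=> a X Y hX hY; rewrite /P0 rlV_lin memvD // memvZ.
pose l0 := mkvs P0; have meml0 := mem_mkvs lP0.
exists l0; split=> //.
have sub X : X \in l0 -> rlV X \in cplx_vspace l0.
  apply: (vbasis_mem_ind (Q := fun X => rlV X \in cplx_vspace l0)).
    split; first by rewrite rlV0 mem0v.
    by move=> a Y Z hY hZ; rewrite rlV_lin memvD // memvZ.
  by move=> Y hY; rewrite /cplx_vspace memv_span // (map_f (@rlV R n)).
apply: eqvPP => z; split; last first.
  have : (cplx_vspace l0 <= l)%VS.
    by apply/span_subvP => y /mapP [X /vbasis_mem /meml0 Xl ->].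
  by move=> /subvP; apply.
have rl z' : z' \in l -> reV z' \in l0.
  by move=> zl; apply/meml0; rewrite /P0 real_part memvZ // memvD // lc.
move=> zl; have il : imV z \in l0.
  have -> : imV z = reV ((0 +i* (-1))%C *: z).
    by rewrite reVZ /= scale0r sub0r scaleN1r opprK.
  by apply: rl; rewrite memvZ.
by rewrite (cplxVE z) memvD ?memvZ ?sub // rl.
Qed.

End Images.

Section GenericReal.
Context {R : realType}.

Lemma small_scalar N (x y : 'I_N -> R) : exists2 c : R, 0 < c &
  forall i, x i != 0 -> `|c * y i| < `|x i|.
Proof.
pose S := \sum_i `|y i| / `|x i|.
have S0 : 0 <= S by apply: sumr_ge0 => i _; rewrite divr_ge0.
exists ((1 + S)^-1); first by rewrite invr_gt0 ltr_wpDr.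
move=> i xi; have x0 : 0 < `|x i| by rewrite normr_gt0.
have S1 : 0 < 1 + S by rewrite ltr_wpDr.
rewrite normrM gtr0_norm ?invr_gt0 // mulrC ltr_pdivrMr // mulrC -ltr_pdivrMr //.
apply: (@le_lt_trans _ _ S); last by rewrite ltrDr.
by rewrite /S (bigD1 i) //= lerDl; apply: sumr_ge0 => j _; rewrite divr_ge0.
Qed.

(** The functionals are treated one at a time: a vector on which the new one is nonzero is added
    with a coefficient so small that the functionals already nonzero stay so. *)
Lemma generic_element (V : vectType R) (t : V -> Prop) N (f : 'I_N -> V -> R) : lin_closed t ->
  (forall i a X Y, t X -> t Y -> f i (a *: X + Y) = a * f i X + f i Y) ->
  exists2 X, t X & forall i, f i X = 0 -> forall Y, t Y -> f i Y = 0.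
Proof.
move=> [t0 tD] fl.
suff h k : exists2 X, t X & forall i : 'I_N, (i < k)%N -> f i X = 0 -> forall Y, t Y -> f i Y = 0.
  by have [X tX hX] := h N; exists X => // i; exact: hX.
elim: k => [|k [X tX hX]]; first by exists 0.
have [kN|kN] := ltnP k N; last first.
  by exists X => // i ik; apply: hX; apply: leq_trans (ltn_ord i) kN.
pose ik := Ordinal kN.
have [[Y tY fY]|no] := pselect (exists2 Y, t Y & f ik X = 0 /\ f ik Y != 0); last first.
  exists X => // i; rewrite ltnS leq_eqVlt => /orP[/eqP ei|]; last exact: hX.
  have -> : i = ik by exact: val_inj.
  move=> fX Y tY; apply: contrapT => /eqP fY; apply: no; by exists Y.
have [c c0 hc] := small_scalar (fun i => f i X) (fun i => f i Y).
exists (c *: Y + X); first exact: tD.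
move=> i; rewrite ltnS leq_eqVlt => /orP[/eqP ei|ik'].
  have -> : i = ik by exact: val_inj.
  rewrite fl // fY.1 addr0 => /eqP; rewrite mulf_eq0 (negbTE fY.2) orbF.
  by rewrite gt_eqF.
rewrite fl // => e.
have [fX|fX] := eqVneq (f i X) 0; first exact: hX.
have := hc i fX; move/eqP: e; rewrite addr_eq0 => /eqP ->.
by rewrite normrN ltxx.
Qed.

End GenericReal.

Section SelfAdjointElement.
Context {C : numClosedFieldType} {V : vectType C} {L : @star_lie C V}.
Notation br := (sl_br L).
Notation N := (\dim {:V}).
Context (b : obasis L) (D : V) (d : 'I_N -> C).
Context (brD : forall i, br D (ob_v b i) = d i *: ob_v b i).

Lemma star_fixed_real : sl_star L D = D -> forall i, d i \is Num.real.
Proof.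
move=> sD i; apply/CrealP; have := sl_adj L (ob_v b i) (ob_v b i) D.
by rewrite sD brD formZl formZr => /(mulIf (ob_n0 b i)) <-.
Qed.

Lemma spanv_commuting (S : pred 'I_N) (f : V -> V) : lin_closed (fun x => f x \in spanv (ob_co b) S) ->
  (forall i, S i -> br D (f (ob_v b i)) = d i *: f (ob_v b i)) ->
  (forall i j, S i -> d j = d i -> S j) ->
  forall x, x \in spanv (ob_co b) S -> f x \in spanv (ob_co b) S.
Proof.
move=> lf fD hS x xS; apply: (spanv_ind (ob_coE b) (ob_col b) (Q := fun x => f x \in spanv (ob_co b) S) lf _ xS) => i Si.
apply/(mem_spanv (ob_col b)) => j Sj; apply: contraNeq Sj => cj.
have := eigen_co (L := L) (ob_coE b) (ob_col b) (ob_cov b) brD (fD i Si) cj.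
exact: hS.
Qed.

End SelfAdjointElement.

Section GoodTorus.
Context {R : realType} {n : nat} {G : lieGroupType R n}.
Context {K : set G} {theta : {linear 'rV[R]_n -> 'rV[R]_n}}.
Context {B : 'rV[R]_n -> 'rV[R]_n -> R}.
Context (HG : reductive_group K theta B).
Notation V := 'rV[R]_n.
Notation VC := 'rV[R[i]]_n.
Notation L := (Lred HG).
Notation N := (\dim {:VC}).
Notation II := (0 +i* 1)%C.
Notation cth := (cplx_map theta).
Implicit Types (g : G) (X Y Z : V) (x y z : VC).

Lemma cth_lin : linP cth. Proof. by apply: cplx_map_lin => a X Y; exact: linearP. Qed.

Lemma cthK x : cth (cth x) = x.
Proof. by rewrite cplx_map_comp; apply: cplx_map_id => X; exact: (thetaK HG). Qed.

Lemma cth_rl X : cth (rlV X) = rlV (theta X).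
Proof. by apply: cplx_map_rl; exact: linear0. Qed.

Lemma cth_gbr x y : cth (gbr G x y) = gbr G (cth x) (cth y).
Proof. by apply: cplx_map_br => X Y; [exact: linearD|exact: linearB|exact: (red_theta_br HG)]. Qed.

Lemma conj_gbr_rl X x : conjV (gbr G (rlV X) x) = gbr G (rlV X) (conjV x).
Proof. by rewrite !gbr_rl cplx_map_conj // => Y; exact: lbrNr. Qed.

Lemma lbrN_eq0 X Y : lbr G (- X) Y = 0 -> lbr G X Y = 0.
Proof. by move=> h; rewrite -[X]opprK lbrNl h oppr0. Qed.

Lemma ccent_theta (s : V -> Prop) : (forall X, s X -> s (theta X) \/ s (- theta X)) ->
  forall z, ccent (G := G) s z -> ccent (G := G) s (cth z).
Proof.
move=> sth z hz X sX; rewrite -(cthK (rlV X)) cth_rl -cth_gbr.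
suff -> : gbr G (rlV (theta X)) z = 0 by exact: (lin0 cth_lin).
case: (sth X sX) => [/hz //|/hz /gbr_rl_eq0 [h1 h2]].
by apply/gbr_rl_eq0; split; exact: lbrN_eq0.
Qed.

Lemma theta_stable_real_ccent (s : V -> Prop) (l : {vspace VC}) :
  (forall X, s X -> s (theta X) \/ s (- theta X)) ->
  (forall z, z \in l <-> ccent (G := G) s z) -> theta_stable_real theta l.
Proof.
move=> sth hl; have [|l0 [e hl0]] := @cplx_vspace_stable R n l.
  by move=> z /hl hz; apply/hl => X sX; rewrite -conj_gbr_rl hz // (semilin0 (@conjV_semilin R n)).
exists l0 => // X /hl0 Xl; apply/hl0/hl.
by rewrite -cth_rl; apply: (ccent_theta sth); apply/hl.
Qed.

Context (t : V -> Prop) (b : obasis L).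
Context (lt : lin_closed t).
Context (tth : forall X, t X -> t (theta X)).
Context (tab : forall X Y, t X -> t Y -> lbr G X Y = 0).
Context (tcc : forall z w, ccent (G := G) t z -> ccent (G := G) t w -> gbr G z w = 0).
Context (tb : forall X, t X -> forall i, exists c, gbr G (rlV X) (ob_v b i) = c *: ob_v b i).
Notation v := (ob_v b).
Notation co := (ob_co b).
Notation spn := (spanv co).

Let ev X i := co i (gbr G (rlV X) (v i)).

Lemma evE X i : t X -> gbr G (rlV X) (v i) = ev X i *: v i.
Proof.
move=> tX; have [c e] := tb tX i.
by rewrite [in RHS]/ev e (coZ (ob_col b)) ob_cov eqxx mulr1.
Qed.

Lemma ev_lin i a X Y : ev (a *: X + Y) i = (a%:C)%C * ev X i + ev Y i.
Proof.
by rewrite /ev rlV_lin -(brL HG) sl_brl (ob_col b).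
Qed.

Lemma rlVZ (a : R) X : rlV (a *: X) = (a%:C)%C *: rlV X.
Proof. by have := rlV_lin a X 0; rewrite rlV0 !addr0. Qed.

Lemma evZ i a X : ev (a *: X) i = (a%:C)%C * ev X i.
Proof. by rewrite /ev rlVZ -(brL HG) (brZl (sl_brl L)) (coZ (ob_col b)). Qed.

Lemma tD X Y : t X -> t Y -> t (X + Y).
Proof. by move=> hX hY; have := lt.2 1 X Y hX hY; rewrite scale1r. Qed.

Lemma tZ a X : t X -> t (a *: X).
Proof. by move=> hX; have := lt.2 a X 0 hX lt.1; rewrite addr0. Qed.

Let xi X i := complex.Re (ev X i).
(** The eigenvalue of [i Y] is [i] times that of [Y], with real part minus the imaginary part. *)
Let yi Y i := - complex.Im (ev Y i).

Lemma evp X i : t X -> theta X = - X -> gbr G (rlV X) (v i) = ((xi X i)%:C)%C *: v i.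
Proof.
move=> tX hX; rewrite evE //; congr (_ *: _).
have /CrealP : ev X i \is Num.real.
  apply: (star_fixed_real (L := L) (b := b) (D := rlV X) (fun j => evE j tX)).
  by rewrite star_rl hX opprK.
by rewrite /xi; case: (ev X i) => u w /eqP; rewrite eq_complex /= => /andP[_ /eqP e]; congr (_ +i* _)%C; lra.
Qed.

Lemma star_irl Y : theta Y = Y -> sl_star L (II *: rlV Y) = II *: rlV Y.
Proof.
move=> hY; rewrite starZ star_rl hY.
have -> : rlV (- Y) = - rlV Y.
  by have := rlV_lin (-1) Y 0; rewrite rlV0 !addr0 scaleN1r => ->; rewrite rmorphN1 scaleN1r.
have -> : (Num.conj_op II : R[i]) = - II by apply/eqP; rewrite eq_complex /= oppr0 !eqxx.
by rewrite scaleNr scalerN opprK.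
Qed.

Lemma evk Y i : t Y -> theta Y = Y -> gbr G (II *: rlV Y) (v i) = ((yi Y i)%:C)%C *: v i.
Proof.
move=> tY hY.
have e j : gbr G (II *: rlV Y) (v j) = (II * ev Y j) *: v j.
  by rewrite -(brL HG) (brZl (sl_brl L)) (brL HG) evE // scalerA.
rewrite e; congr (_ *: _).
have /CrealP : II * ev Y i \is Num.real.
  exact: (star_fixed_real (L := L) (b := b) (D := II *: rlV Y) e (star_irl hY)).
rewrite /yi; case: (ev Y i) => u w /eqP; rewrite eq_complex /= => /andP[_ /eqP h].
by apply/eqP; rewrite eq_complex /=; apply/andP; split; apply/eqP; lra.
Qed.

Lemma II_neq0 : II != 0 :> R[i].
Proof. by rewrite eq_complex /= oner_eq0 andbF. Qed.

(* The eigenvalues of [X + 'i Y] have the sign of those of [X] wherever the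
   latter do not vanish. *)
Lemma generic_pair : exists X Y (x y : 'I_N -> R),
  [/\ t X, theta X = - X, t Y & theta Y = Y] /\
  [/\ forall i, gbr G (rlV X) (v i) = ((x i)%:C)%C *: v i,
      forall i, gbr G (II *: rlV Y) (v i) = ((y i)%:C)%C *: v i,
      forall i, x i != 0 -> `|y i| < `|x i| &
      forall i, x i = 0 -> y i = 0 -> forall Z, t Z -> gbr G (rlV Z) (v i) = 0].
Proof.
have lp : lin_closed (fun X => t X /\ theta X = - X).
  split; first by rewrite linear0 oppr0; split=> //; exact: lt.1.
  move=> a X Y [tX hX] [tY hY]; split; first exact: lt.2.
  by rewrite linearP /= hX hY scalerN opprD.
have lk : lin_closed (fun X => t X /\ theta X = X).
  split; first by rewrite linear0; split=> //; exact: lt.1.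
  move=> a X Y [tX hX] [tY hY]; split; first exact: lt.2.
  by rewrite linearP /= hX hY.
have [|X [tX hX] gX] := generic_element (f := fun i X => xi X i) lp.
  move=> i a X Y _ _; rewrite /xi ev_lin; case: (ev X i) => u w; case: (ev Y i) => u' w' /=.
  by rewrite mul0r subr0.
have [|Y [tY hY] gY] := generic_element (f := fun i X => yi X i) lk.
  move=> i a X1 Y _ _; rewrite /yi ev_lin; case: (ev X1 i) => u w; case: (ev Y i) => u' w' /=.
  by rewrite mul0r; ring.
have [c c0 hc] := small_scalar (xi X) (yi Y).
have tcY : t (c *: Y) by exact: tZ.
have hcY : theta (c *: Y) = c *: Y by rewrite linearZ /= hY.
have ey i : yi (c *: Y) i = c * yi Y i.
  by rewrite /yi evZ; case: (ev Y i) => u w /=; rewrite mul0r addr0 mulrN.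
exists X, (c *: Y), (xi X), (yi (c *: Y)); split; first by [].
split=> [i|i|i xi0|i x0 y0 Z tZ'].
- exact: evp.
- exact: evk.
- by rewrite ey; exact: hc.
have {}y0 : yi Y i = 0 by move/eqP: y0; rewrite ey mulf_eq0 gt_eqF //= => /eqP.

have [U [W [e hU hW]]] := kp_split HG Z.
have eU : U = 2^-1 *: (Z + theta Z).
  by rewrite e [theta (U + W)]linearD hU hW; apply/rowP => j; rewrite !mxE; field.
have eW : W = 2^-1 *: (Z + (-1) *: theta Z).
  by rewrite e [theta (U + W)]linearD hU hW; apply/rowP => j; rewrite !mxE; field.
have tU : t U by rewrite eU; apply: tZ; apply: tD => //; exact: tth.
have tW : t W by rewrite eW; apply: tZ; apply: tD => //; apply: tZ; exact: tth.
have hWi := gX i x0 W (conj tW hW); have hUi := gY i y0 U (conj tU hU).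
have e1 : gbr G (rlV W) (v i) = 0 by rewrite evp // hWi scale0r.
have e2 : gbr G (rlV U) (v i) = 0.
  have : II *: gbr G (rlV U) (v i) = 0.
    by rewrite -(brL HG) -(brZl (sl_brl L)) (brL HG) evk // hUi scale0r.
  by move=> /eqP; rewrite scaler_eq0 (negbTE II_neq0) => /eqP.
have -> : rlV Z = rlV U + rlV W by have := rlV_lin 1 U W; rewrite !scale1r e.
by rewrite -(brL HG) (brDl (sl_brl L)) !(brL HG) e1 e2 addr0.
Qed.

End GoodTorus.

Section GoodTorusBorel.
Context {R : realType} {n : nat} {G : lieGroupType R n}.
Context {K : set G} {theta : {linear 'rV[R]_n -> 'rV[R]_n}}.
Context {B : 'rV[R]_n -> 'rV[R]_n -> R}.
Context (HG : reductive_group K theta B).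
Notation V := 'rV[R]_n.
Notation VC := 'rV[R[i]]_n.
Notation L := (Lred HG).
Notation N := (\dim {:VC}).
Notation II := (0 +i* 1)%C.
Notation cth := (cplx_map theta).
Implicit Types (g : G) (X Y Z : V) (z w : VC).
Context (t : V -> Prop) (b : obasis L).
Context (lt : lin_closed t).
Context (tth : forall X, t X -> t (theta X)).
Context (tab : forall X Y, t X -> t Y -> lbr G X Y = 0).
Context (tcc : forall z w, ccent (G := G) t z -> ccent (G := G) t w -> gbr G z w = 0).
Notation v := (ob_v b).
Notation co := (ob_co b).
Notation spn := (spanv co).
Context (X Y : V) (x y : 'I_N -> R).
Context (tX : t X).
Context (hX : theta X = - X).
Context (tY : t Y).
Context (hY : theta Y = Y).
Context (eX : forall i, gbr G (rlV X) (v i) = ((x i)%:C)%C *: v i).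
Context (eY : forall i, gbr G (II *: rlV Y) (v i) = ((y i)%:C)%C *: v i).
Context (xy : forall i, x i != 0 -> `|y i| < `|x i|).
Context (gxy : forall i, x i = 0 -> y i = 0 -> forall Z, t Z -> gbr G (rlV Z) (v i) = 0).

Let D : VC := rlV X + II *: rlV Y.
Let d i : R[i] := ((x i + y i)%:C)%C.
Let dx i : R[i] := ((x i)%:C)%C.
(** For the zero element every eigenvalue is 0, so [spanv_levi] also yields the Levi decomposition
    of the whole algebra needed at stage 0 of the chain. *)
Let d0 (i : 'I_N) : R[i] := 0.

Let real_C (u : R) : (u%:C)%C \is Num.real. Proof. by apply/complex_realP; exists u. Qed.

Lemma br_Dv i : sl_br L D (v i) = d i *: v i.
Proof.
by rewrite (brDl (sl_brl L)) !(brL HG) eX eY /d rmorphD scalerDl.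
Qed.

Lemma star_X : sl_star L (rlV X) = rlV X. Proof. by rewrite star_rl hX opprK. Qed.

Lemma star_D : sl_star L D = D.
Proof. by rewrite starD star_X (star_irl HG hY). Qed.

Lemma star_zero : sl_star L 0 = 0. Proof. exact: star0. Qed.

Lemma br_0v i : sl_br L 0 (v i) = d0 i *: v i.
Proof. by rewrite (br0l (sl_brl L)) scale0r. Qed.

Lemma sign_xy i : x i != 0 -> (0 <= x i + y i) = (0 <= x i).
Proof.
move=> xi0; have := xy xi0; case: (ltrgtP 0 (x i)) xi0 => [xp|xn|//] _ h.
  by apply/idP; move: h; rewrite (gtr0_norm xp) ltr_norml => /andP[h _]; lra.
by apply/negbTE; rewrite -ltNge; move: h; rewrite (ltr0_norm xn) ltr_norml => /andP[_ h]; lra.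
Qed.

Lemma x0_of_sum i : x i + y i = 0 -> x i = 0.
Proof.
move=> h; apply: contrapT => /eqP /[dup] xi0 /xy.
have -> : y i = - x i by lra.
by rewrite normrN ltxx.
Qed.

Notation qX := (spn (fun i => 0 <= dx i)).
Notation lX := (spn (fun i => dx i == 0)).
Notation qD := (spn (fun i => 0 <= d i)).
Notation lD := (spn (fun i => d i == 0)).

Lemma d_ge0 i : (0 <= d i) = (0 <= x i + y i). Proof. by rewrite /d lecR. Qed.
Lemma dx_ge0 i : (0 <= dx i) = (0 <= x i). Proof. by rewrite /dx lecR. Qed.
Lemma d_eq0 i : (d i == 0) = (x i + y i == 0). Proof. by rewrite /d eq_complex /= eqxx andbT. Qed.
Lemma dx_eq0 i : (dx i == 0) = (x i == 0). Proof. by rewrite /dx eq_complex /= eqxx andbT. Qed.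

Lemma spanv_full (S : pred 'I_N) : (forall i, S i) -> spn S = fullv.
Proof.
move=> h; apply: eqvPP => z; split=> _; first exact: memvf.
by apply/(mem_spanv (ob_col b)) => i; rewrite h.
Qed.

(** If [x i + y i = 0] then [x i = 0], because [y] is strictly smaller where [x] is nonzero; so both
    vanish, and genericity makes the weight vanish on all of [t]. *)
Lemma mem_lD z : z \in lD <-> ccent (G := G) t z.
Proof.
split.
  apply: (spanv_ind (ob_coE b) (ob_col b) (Q := ccent (G := G) t)).
    split=> [Z _|a u w hu hw Z tZ]; first by rewrite -(brL HG) (br0r (sl_brr L)).
    by rewrite -(brL HG) sl_brr !(brL HG) hu // hw // scaler0 addr0.
  move=> i; rewrite d_eq0 => /eqP h Z tZ; have xi0 := x0_of_sum h.
  by apply: gxy => //; move: h; rewrite xi0 add0r.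
move=> hz; apply/(mem_l (ob_coE b) (ob_col b) (ob_cov b) br_Dv).
rewrite (brDl (sl_brl L)) (brZl (sl_brl L)) !(brL HG) !hz //.
by rewrite scaler0 addr0.
Qed.

Lemma mem_lX z : z \in lX <-> ccent (G := G) (fun Z => exists c, Z = c *: X) z.
Proof.
have hl := mem_l (L := L) (ob_coE b) (ob_col b) (ob_cov b) (D := rlV X) eX z.
split=> [/hl hz Z [c ->]|hz].
  have -> : rlV (c *: X) = (c%:C)%C *: rlV X.
    by have := rlV_lin c X 0; rewrite rlV0 !addr0.
  by rewrite -(brL HG) (brZl (sl_brl L)) hz scaler0.
by apply/hl; rewrite (brL HG); apply: hz; exists 1; rewrite scale1r.
Qed.

Lemma real_lD : theta_stable_real theta lD.
Proof. by apply: (theta_stable_real_ccent HG _ mem_lD) => Z /tth; left. Qed.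

Lemma real_lX : theta_stable_real theta lX.
Proof.
apply: (theta_stable_real_ccent HG _ mem_lX) => Z [c ->]; left; exists (- c).
by rewrite linearZ /= hX scalerN scaleNr.
Qed.

Lemma real_full : theta_stable_real theta (fullv : {vspace VC}).
Proof.
apply: (theta_stable_real_ccent HG (s := fun=> False)) => // z.
by split=> [_ Z []|_]; exact: memvf.
Qed.

Lemma dreal i : d i \is Num.real. Proof. exact: real_C. Qed.
Lemma dxreal i : dx i \is Num.real. Proof. exact: real_C. Qed.
Lemma d0real i : d0 i \is Num.real. Proof. exact: real0. Qed.

Let leviD := spanv_levi (L := L) (ob_coE b) (ob_col b) (ob_cov b) star_D dreal br_Dv.
Let leviX := spanv_levi (L := L) (ob_coE b) (ob_col b) (ob_cov b) star_X dxreal eX.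
Let levi0 := spanv_levi (L := L) (ob_coE b) (ob_col b) (ob_cov b) star_zero d0real br_0v.

Lemma subalg_full : subalg L fullv. Proof. by move=> z w _ _; exact: memvf. Qed.

Lemma borel_qD : borel_in (gbr G) fullv qD.
Proof.
have e : spn predT = fullv by exact: spanv_full.
have h := spanv_borel (L := L) (ob_coE b) (ob_col b) (ob_cov b) star_D dreal br_Dv (S := predT).
rewrite e !capvf in h; rewrite -(brL HG); apply: h.
- exact: subalg_full.
- by move=> z _; exact: memvf.
- exact: memvf.
- by rewrite (brL HG) => z w /mem_lD hz /mem_lD hw; exact: tcc.
Qed.

Lemma qD_qX : (qD <= qX)%VS.
Proof.
apply: (spanv_mono (ob_col b)) => i; rewrite !unfold_in /= d_ge0 dx_ge0 => h.
by have [->//|/sign_xy <-] := eqVneq (x i) 0.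
Qed.

Lemma parabolic_of q : lie_subalg (gbr G) q -> (qD <= q)%VS -> parabolic_in (gbr G) fullv q.
Proof. by move=> sq h; split=> //; [exact: subvf|exists qD => //; exact: borel_qD]. Qed.

Lemma parabolic_qX : parabolic_in (gbr G) fullv qX.
Proof.
apply: parabolic_of qD_qX; rewrite -(brL HG); apply/subalgP.
exact: (subalg_q (L := L) (ob_coE b) (ob_col b) (ob_cov b) eX).
Qed.

Lemma parabolic_qD : parabolic_in (gbr G) fullv qD.
Proof. by apply: parabolic_of (subvv _); have [] := borel_qD. Qed.

Lemma parabolic_full : parabolic_in (gbr G) fullv fullv.
Proof. by apply: parabolic_of (subvf _); exact: subvf. Qed.

Lemma DlX : D \in lX.
Proof.
apply/mem_lX => Z [c ->]; have tcX : t (c *: X) by have := lt.2 c X 0 tX lt.1; rewrite addr0.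
rewrite -(brL HG) (brDr (sl_brr L)) (brZr (sl_brr L)) !(brL HG) !gbr_rl2 !tab //.
by rewrite rlV0 scaler0 addr0.
Qed.

Lemma parabolic_lX : parabolic_in (gbr G) lX (qD :&: lX)%VS.
Proof.
have h : borel_in (gbr G) lX (qD :&: lX)%VS.
  rewrite -(brL HG); apply: (spanv_borel (L := L) (ob_coE b) (ob_col b) (ob_cov b) star_D dreal br_Dv).
  - exact: (subalg_l (L := L) (ob_coE b) (ob_col b) (ob_cov b) eX).
  - exact: (star_l (L := L) (ob_coE b) (ob_col b) (ob_cov b) star_X eX).
  - exact: DlX.
  - move=> z w /memv_capP [/mem_lD hz _] /memv_capP [/mem_lD hw _].
    by rewrite (brL HG); exact: tcc.
have [h1 h2 _ _] := h.
by split=> //; exists (qD :&: lX)%VS.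
Qed.

(** [X] is real, so conjugation commutes with [ad X] and preserves its eigenspaces, whose
    eigenvalues are real. *)
Lemma conj_qX : conj_stable qX.
Proof.
have hc z : z \in qX -> conjV z \in qX.
  apply: (spanv_commuting (L := L) (D := rlV X) (d := dx) eX).
  - exact: (semilin_pre qX (@conjV_semilin R n)).
  - move=> i _; rewrite (brL HG) -conj_gbr_rl eX conjVZ; congr (_ *: _).
    by apply/eqP; rewrite eq_complex /= oppr0 !eqxx.
  - by move=> i j; rewrite !dx_ge0 => hi [->].
by apply: (imgv_id (@conjV_semilin R n) hc hc); exact: conjVK.
Qed.

Lemma cth_semilin : semilin cth.
Proof. by apply: linP_semilin; exact: cth_lin. Qed.

(** Inside [lX] the eigenvalue of [D] is that of [i Y], and [theta] fixes [Y], so it preserves the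
    sign condition there. *)
Lemma theta_qD : theta_stable theta (qD :&: lX)%VS.
Proof.
have hc z : z \in (qD :&: lX)%VS -> cth z \in (qD :&: lX)%VS.
  have -> : (qD :&: lX)%VS = (spn (fun i => (0 <= (y i)%:C%C)%R) :&: lX)%VS.
    rewrite !(spanv_cap (ob_col b)); congr (spn _); apply/funext => i /=.
    rewrite dx_eq0 d_ge0 lecR; have [->|_] := eqVneq (x i) 0; last by rewrite !andbF.
    by rewrite add0r.
  move=> /memv_capP [z1 z2]; rewrite memv_cap; apply/andP; split.
    apply: (spanv_commuting (L := L) (D := II *: rlV Y) (d := fun i => ((y i)%:C)%C) eY) z1.
    - exact: (semilin_pre _ cth_semilin).
    - move=> i _; rewrite (brL HG) -(linZ (cth_lin (theta := theta))) -eY (cth_gbr HG).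
      by rewrite (linZ (cth_lin (theta := theta))) cth_rl hY.
    - by move=> i j; rewrite !lecR => hi [->].
  apply/mem_lX; apply: (ccent_theta HG); last exact/mem_lX.
  by move=> Z [c ->]; left; exists (- c); rewrite linearZ /= hX scalerN scaleNr.
by apply: (imgv_id cth_semilin hc hc); exact: (cthK HG).
Qed.

Theorem constructible_qD : constructible G theta qD.
Proof.
have ld : levi_decomposition (gbr G) qD lD (spn (fun i => 0 < d i)) by exact: leviD.
split; first by split; [exact: parabolic_qD|exists lD, (spn (fun i => 0 < d i)); split; [|exact: real_lD]].
pose nth0 (s : seq {vspace VC}) i := nth 0%VS s i.
exists 2, (nth0 [:: fullv; qX; qD]), (nth0 [:: fullv; lX; lD]).
exists (nth0 [:: spn (fun i => 0 < d0 i); spn (fun i => 0 < dx i); spn (fun i => 0 < d i)]).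
split=> //.
- case=> [_|[_|[_|//]]] /=.
  + split; [exact: parabolic_full| |exact: real_full].
    rewrite -(brL HG); move: levi0.
    by rewrite (@spanv_full (fun i => 0 <= d0 i)) ?(@spanv_full (fun i => d0 i == 0)) // => i; rewrite /d0 ?lexx ?eqxx.
  + by split; [exact: parabolic_qX|rewrite -(brL HG); exact: leviX|exact: real_lX].
  + by split; [exact: parabolic_qD|exact: ld|exact: real_lD].
- case=> [_|[_|//]] /=.
  + rewrite capvf; split; [exact: subvf|exact: parabolic_qX|left; exact: conj_qX].
  + split; [exact: qD_qX|exact: parabolic_lX|right; exact: theta_qD].
Qed.

Lemma commuting_qD (f : VC -> VC) : linP f ->
  (forall z, f (gbr G D z) = gbr G D (f z)) -> forall z, z \in qD -> f z \in qD.
Proof.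
move=> lf fD; apply: (spanv_commuting (L := L) (D := D) (d := d) br_Dv).
- exact: (semilin_pre qD (linP_semilin lf)).
- by move=> i _; rewrite (brL HG) -fD -(brL HG) br_Dv (linZ lf).
- by move=> i j hi ->.
Qed.

Lemma cAd_D g : (forall Z, t Z -> Ad g Z = Z) -> cAd g D = D /\ cAd g (cth D) = cth D.
Proof.
move=> hg; have lc := cth_lin (theta := theta); have lg := cAd_lin g.
have cD : cth D = rlV (theta X) + II *: rlV (theta Y).
  by rewrite -!cth_rl [RHS]addrC -lc /D addrC.
by rewrite cD /D; split; rewrite addrC lg !cAd_rl !hg //; exact: tth.
Qed.

(** An element fixing [t] fixes [D] and its image under [theta], so [Ad g] commutes with both
    adjoint actions and preserves the subalgebra and its [theta]-image. *)
Lemma levi_qD g : (forall Z, t Z -> Ad g Z = Z) -> levi_subgroup G theta qD g.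
Proof.
move=> hg; have [gD gD'] := cAd_D hg; have lc := cth_lin (theta := theta).
have hg' Z : t Z -> Ad g^-1%g Z = Z by move=> tZ; rewrite -{1}(hg Z tZ) AdVK.
have [kD kD'] := cAd_D hg'.
have comm (k : G) : cAd k D = D -> forall z, cAd k (gbr G D z) = gbr G D (cAd k z).
  by move=> e z; rewrite cAd_gbr e.
have comm' (k : G) : cAd k (cth D) = cth D ->
    forall z, cth (cAd k (cth (gbr G D z))) = gbr G D (cth (cAd k (cth z))).
  by move=> e z; rewrite (cth_gbr HG) cAd_gbr e (cth_gbr HG) (cthK HG).
have lcc (k : G) : linP (fun z => cth (cAd k (cth z))).
  by move=> a z w; rewrite lc (cAd_lin k) lc.
have mth z : z \in imgv cth qD <-> cth z \in qD.
  by apply: mem_imgv_inv; [exact: cth_semilin|exact: (cthK HG)].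
have stab (k : G) : cAd k (cth D) = cth D -> forall z, z \in imgv cth qD -> cAd k z \in imgv cth qD.
  move=> e z /mth hz; apply/mth; rewrite -{1}(cthK HG z).
  exact: (commuting_qD (lcc k) (comm' k e)).
have sg := linP_semilin (cAd_lin g).
split; apply: (imgv_id sg (g := cAd g^-1%g)); try exact: cAdKV.
- exact: (commuting_qD (cAd_lin g) (comm g gD)).
- exact: (commuting_qD (cAd_lin _) (comm _ kD)).
- exact: stab.
- exact: stab.
Qed.

End GoodTorusBorel.

Section GoodTorusTheorem.
Context {R : realType} {n : nat} {G : lieGroupType R n}.
Context {K : set G} {theta : {linear 'rV[R]_n -> 'rV[R]_n}}.
Context {B : 'rV[R]_n -> 'rV[R]_n -> R}.
Context (HG : reductive_group K theta B).

Theorem good_torus (t : 'rV[R]_n -> Prop) (b : obasis (Lred HG)) :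
  lin_closed t -> (forall X, t X -> t (theta X)) ->
  (forall X Y, t X -> t Y -> lbr G X Y = 0) ->
  (forall z w, ccent (G := G) t z -> ccent (G := G) t w -> gbr G z w = 0) ->
  (forall X, t X -> forall i, exists c, gbr G (rlV X) (ob_v b i) = c *: ob_v b i) ->
  exists S : pred 'I_(\dim {:'rV[R[i]]_n}),
  [/\ borel_in (gbr G) fullv (spanv (ob_co b) S), constructible G theta (spanv (ob_co b) S) &
      forall g, (forall X, t X -> Ad g X = X) -> levi_subgroup G theta (spanv (ob_co b) S) g].
Proof.
move=> lt tth tab tcc tb.
have [X [Y [x [y [[tX hX tY hY] [eX eY xy gxy]]]]]] := generic_pair lt tth tb.
exists (fun i => 0 <= ((x i + y i)%:C)%C); split.
- exact: (borel_qD tcc tX hX tY hY eX eY xy gxy).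
- exact: (constructible_qD lt tth tab tcc tX hX tY hY eX eY xy gxy).
- exact: (levi_qD tth tX tY eX eY).
Qed.

End GoodTorusTheorem.

(** * Conjugacy of tori *)

Section CriticalPoint.
Context {R : realType}.

Lemma cdiff_min (c : R -> R^o) (D : R^o) : cdiff c 0 D -> (forall s, c 0 <= c s) -> D = 0.
Proof.
move=> hc cmin; apply: contrapT => /eqP D0.
have Dp : 0 < `|D| by rewrite normr_gt0.
have [d d0 hd] := hc (`|D| / 2) (divr_gt0 Dp (ltr0n _ 2)).
(* A step against the sign of [D]: the linear term then exceeds the admissible error and the value
   would drop below the minimum. *)
pose s := - Num.sg D * (d / 2).
have ns : `|s| = d / 2.
  by rewrite /s normrM normrN normr_sg D0 mul1r ger0_norm // ltW // divr_gt0.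
have sD : s * D = - (d / 2 * `|D|).
  by rewrite /s (normrEsg D); ring.
have := hd s; rewrite subr0 ns => /(_ _) h.
have {}h : `|c s - c 0 - s *: D| <= `|D| / 2 * (d / 2).
  by apply: h; rewrite ltr_pdivrMr // ltr_pMr // ltr1n.
have dp : 0 < d * `|D| by exact: mulr_gt0.
have h1 := le_trans (ler_norm _) h; have h2 := cmin s.
have e : s *: D = s * D by [].
rewrite e sD in h1; nra.
Qed.

End CriticalPoint.

Section MaximalAbelian.
Context {R : realType} {n : nat} {G : lieGroupType R n}.
Context {K : set G} {theta : {linear 'rV[R]_n -> 'rV[R]_n}}.
Context {B : 'rV[R]_n -> 'rV[R]_n -> R}.
Context (HG : reductive_group K theta B).
Notation V := 'rV[R]_n.
Notation VC := 'rV[R[i]]_n.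
Notation br := (lbr G).
Notation exp := (expG G).
Notation L := (Lred HG).
Notation N := (\dim {:VC}).
Implicit Types (g k : G) (X Y Z U : V) (s t : V -> Prop).

Definition abelian_pred t := forall X Y, t X -> t Y -> br X Y = 0.

Lemma torus_basis t : lin_closed t -> (forall X, t X -> t (theta X)) -> abelian_pred t ->
  exists b : obasis L, forall X, t X -> forall i, exists c, gbr G (rlV X) (ob_v b i) = c *: ob_v b i.
Proof.
move=> lt tth tab.
have [|||b hb] := @joint_eigenbasis _ _ L (fun f => exists2 X, t X & f = gbr G (rlV X)).
- by move=> f [X _ ->]; exact: (ad_linP HG).
- move=> f f' [X tX ->] [Y tY ->] z; rewrite -!(brL HG) sl_jac !(brL HG) gbr_rl2 tab //.
  by rewrite rlV0 -(brL HG) (br0l (sl_brl L)) add0r.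
- move=> f [X tX ->]; exists (gbr G (rlV (- theta X))).
    by exists (- theta X) => //; have := lt.2 (-1) _ 0 (tth _ tX) lt.1; rewrite scaleN1r addr0.
  by move=> x y; rewrite -(star_rl HG) -(brL HG) sl_adj.
by exists b => X tX i; apply: hb; exists X.
Qed.

Lemma maximal_abelian s : lin_closed s -> exists m : V -> Prop,
  [/\ lin_closed m, forall X, m X -> s X, abelian_pred m &
      forall X, s X -> (forall Y, m Y -> br X Y = 0) -> m X].
Proof.
move=> ls.
pose P d := exists U : {vspace V}, [/\ \dim U = d, forall X, X \in U -> s X &
   forall X Y, X \in U -> Y \in U -> br X Y = 0].
have P0 : exists d, `[< P d >].
  exists 0%N; apply/asboolP; exists 0%VS; rewrite dimv0; split=> // X.
    by rewrite memv0 => /eqP ->; exact: ls.1.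
  by move=> Y; rewrite memv0 => /eqP -> _; exact: lbr0l.
have bP d : `[< P d >] -> (d <= \dim {:V})%N by move=> /asboolP [U [<- _ _]]; exact: dimvS (subvf _).
have [d /asboolP [U [dU Us Ua]] dmax] := ex_maxnP P0 bP.
exists (fun X => X \in U); split=> //.
  by split=> [|a X Y hX hY]; [exact: mem0v|rewrite memvD // memvZ].
move=> X sX hX; have UW : (U <= U + <[X]>)%VS by exact: addvSl.
have /dmax : `[< P (\dim (U + <[X]>)) >].
  apply/asboolP; exists (U + <[X]>)%VS; split=> //.
    move=> Y /memv_addP [u uU [w /vlineP [c ->] ->]]; rewrite addrC.
    by apply: ls.2 => //; exact: Us.
  move=> Y Z /memv_addP [u uU [_ /vlineP [c ->] ->]] /memv_addP [u' uU' [_ /vlineP [c' ->] ->]].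
  rewrite !lbrDl !lbrDr !lbrZl !lbrZr lbrXX Ua // hX // !scaler0.
  have -> : br u X = - br X u by rewrite lbrC.
  by rewrite hX // oppr0 !scaler0 !addr0.
rewrite -dU => dW.
have <- : (U + <[X]>)%VS = U by apply/esym/eqP; rewrite eqEdim UW dW.
by apply: (subvP (addvSr _ _)); exact: memv_line.
Qed.

(** A generic [X] of [t] has zero eigenvalue on a basis vector only if all of [t] has, so whatever
    commutes with [X] commutes with [t]. *)
Lemma regular_element t (c : R) : lin_closed t -> abelian_pred t ->
  (forall X, t X -> theta X = c *: X) -> c = 1 \/ c = -1 ->
  exists2 X, t X & forall Z, br X Z = 0 -> forall Y, t Y -> br Y Z = 0.
Proof.
move=> lt tab tc hc.
have tth X : t X -> t (theta X) by move=> tX; rewrite tc //; have := lt.2 c X 0 tX lt.1; rewrite addr0.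
have [b hb] := torus_basis lt tth tab.
pose ev X i := ob_co b i (gbr G (rlV X) (ob_v b i)).
have evE X i : t X -> gbr G (rlV X) (ob_v b i) = ev X i *: ob_v b i.
  by move=> tX; have [a e] := hb X tX i; rewrite [in RHS]/ev e (coZ (ob_col b)) ob_cov eqxx mulr1.
have evl i a X Y : ev (a *: X + Y) i = (a%:C)%C * ev X i + ev Y i.
  by rewrite /ev rlV_lin -(brL HG) sl_brl (ob_col b).
have ev_conj X i : t X -> ev X i = ((- c)%:C)%C * Num.conj_op (ev X i).
  move=> tX; have := sl_adj L (ob_v b i) (ob_v b i) (rlV X).
  rewrite star_rl tc // -scaleNr rlVZ (brZl (sl_brl L)) !(brL HG) evE // formZl !formZr mulrA.
  move/(mulIf (ob_n0 b i)) => e; rewrite [LHS]e; congr (_ * _).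
  by apply/eqP; rewrite eq_complex /= oppr0 !eqxx.
(* Eigenvalues are real for [c = -1] and imaginary for [c = 1]; the sum of real and imaginary part
   is a real functional that detects them in both cases. *)
have [|X tX gX] := generic_element (f := fun i X => complex.Re (ev X i) + complex.Im (ev X i)) lt.
  move=> i a X Y _ _; rewrite evl; case: (ev X i) => u w; case: (ev Y i) => u' w' /=.
  by ring.
exists X; first exact: tX.
move=> Z hZ Y tY.
have ev0 W i : t W -> complex.Re (ev W i) + complex.Im (ev W i) = 0 -> ev W i = 0.
  move=> tW; have := ev_conj W i tW; case: (ev W i) => u w /eqP.
  rewrite eq_complex /= => /andP[/eqP e1 /eqP e2] e3; apply/eqP; rewrite eq_complex /=.
  case: hc e1 e2 => -> e1 e2; apply/andP; split; apply/eqP; lra.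
have evD (W : V) i : t W -> gbr G (rlV W) (ob_v b i) = ev W i *: ob_v b i := evE W i.
have zX : gbr G (rlV X) (rlV Z) = 0 *: rlV Z by rewrite gbr_rl2 hZ rlV0 scale0r.
have /(eigen_coP (ob_coE b) (ob_col b) (ob_cov b) (ad_linP HG X) (fun i => evE X i tX)) h := zX.
apply: rlV_eq0; rewrite -gbr_rl2.
have : gbr G (rlV Y) (rlV Z) = 0 *: rlV Z.
  apply/(eigen_coP (ob_coE b) (ob_col b) (ob_cov b) (ad_linP HG Y) (fun i => evE Y i tY)) => i ei.
  apply: h; apply: contraNneq ei => ei; apply/eqP; apply: (ev0 Y i tY); apply: (gX i _ Y tY).
  by rewrite ei /= addr0.
by rewrite scale0r.
Qed.

(* At a minimum over [K'] of [B Y (Ad k X)], with [X] and [Y] regular, the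
   derivative in the direction [Z = [Ad k X, Y]] is [B Z Z], so [Z = 0]. *)
Lemma conj_into_maximal (K' : set G) s m t (c : R) :
  K' !=set0 -> (K' `<=` K) -> compact K' ->
  lin_closed s -> (forall X, s X -> theta X = c *: X) -> c = 1 \/ c = -1 ->
  (forall k X, K' k -> s X -> s (Ad k X)) ->
  (forall k X Y, K' k -> s X -> s Y -> forall a : R, K' (exp (a *: br X Y) * k)%g) ->
  lin_closed m -> (forall X, m X -> s X) -> abelian_pred m ->
  (forall X, s X -> (forall Y, m Y -> br X Y = 0) -> m X) ->
  lin_closed t -> (forall X, t X -> s X) -> abelian_pred t ->
  exists2 k, K' k & forall X, t X -> m (Ad k X).
Proof.
move=> K0 sK cK ls sc hc sAd sexp lm ms ma mmax lt ts ta.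
have [X tX regX] := regular_element lt ta (fun X tX => sc X (ts X tX)) hc.
have [Y mY regY] := regular_element lm ma (fun X mX => sc X (ms X mX)) hc.
have cB : continuous (fun k => B Y (Ad k X)).
  have lB : linear (fun W => B Y W : R^o) by move=> a u w; rewrite (BDr HG) (BZr HG).
  move=> k; apply: (@continuous_comp _ _ _ (fun k => Ad k X) (fun W => B Y W : R^o)).
    exact: Ad_cont.
  exact: rV_lin_cont.
have [k Kk kmin] := compact_min K0 cK cB.
pose U := Ad k X; have sU : s U by apply: sAd => //; exact: ts.
have Z0 : br U Y = 0.
  pose Z := br U Y.
  have hZ : theta Z = Z.
    rewrite /Z (red_theta_br HG) (sc U sU) (sc Y (ms Y mY)).
    have c2 : c * c = 1 by case: hc => ->; ring.
    by rewrite lbrZl lbrZr scalerA c2 scale1r.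
  have [C hC] := B_bounded HG Y.
  have lB : linear (fun W => B Y W : R^o) by move=> a u w; rewrite (BDr HG) (BZr HG).
  have d1 := cdiff_linear lB hC (tangent_Ad U (expG_tangent (G := G) Z)).
  have /(cdiff_min d1) : forall a, B Y (Ad (exp (0 *: Z)) U) <= B Y (Ad (exp (a *: Z)) U).
    move=> a; rewrite scale0r expG0 Ad1 /U -AdM; apply: kmin.
    by apply: sexp => //; exact: ms.
  have -> : B Y (br Z U) = B Z Z.
    by rewrite lbrC (BNr HG) -(B_inv HG) .
  move=> BZ; apply: contrapT => /eqP /(red_B_k0 HG hZ).
  by rewrite [X in X < 0]BZ ltxx.
have UY : br Y U = 0 by rewrite lbrC Z0 oppr0.
(* Regularity is used twice: [Y] makes [Ad k X] commute with all of [m], then, after pulling back by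
   [k], [X] makes all of [t] commute with the image of [m]. *)
exists k => // W tW; have sW : s (Ad k W) by apply: sAd => //; exact: ts.
apply: (mmax _ sW) => M mM.
have mU : br M U = 0 by exact: regY.
have XM : br X (Ad k^-1%g M) = 0.
  by rewrite -{1}(AdVK k X) -Ad_br -/U lbrC mU oppr0 Ad0.
by rewrite -(AdKV k M) -Ad_br (regX _ XM _ tW) Ad0.
Qed.

End MaximalAbelian.

Section TorusClasses.
Context {R : realType} {n : nat} {G : lieGroupType R n}.
Context {K : set G} {theta : {linear 'rV[R]_n -> 'rV[R]_n}}.
Context {B : 'rV[R]_n -> 'rV[R]_n -> R}.
Context (HG : reductive_group K theta B).
Notation V := 'rV[R]_n.
Notation VC := 'rV[R[i]]_n.
Notation br := (lbr G).
Notation exp := (expG G).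
Notation L := (Lred HG).
Notation N := (\dim {:VC}).
Implicit Types (g k : G) (A X Y Z U : V) (s t : V -> Prop).

Definition diagonal (b : obasis L) X :=
  forall i, exists c, gbr G (rlV X) (ob_v b i) = c *: ob_v b i.

Definition torus t := [/\ lin_closed t, forall X, t X -> t (theta X) & abelian_pred (G := G) t].

Lemma lin_closedZ t a X : lin_closed t -> t X -> t (a *: X).
Proof. by move=> lt tX; have := lt.2 a X 0 tX lt.1; rewrite addr0. Qed.

Lemma lin_closedD t X Y : lin_closed t -> t X -> t Y -> t (X + Y).
Proof. by move=> lt tX tY; have := lt.2 1 X Y tX tY; rewrite scale1r. Qed.

Lemma eigen_theta_lin (c : R) t : lin_closed t -> lin_closed (fun X => t X /\ theta X = c *: X).
Proof.
move=> lt; split=> [|a X Y [tX hX] [tY hY]]; first by rewrite linear0 scaler0; split=> //; exact: lt.1.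
split; first exact: lt.2.
by rewrite linearP /= hX hY scalerDr !scalerA mulrC.
Qed.

Lemma fixator_compact (a : V -> Prop) : compact [set k | K k /\ forall A, a A -> Ad k A = A].
Proof.
have -> : [set k | K k /\ forall A, a A -> Ad k A = A] =
    K `&` \bigcap_(A in [set A | a A]) ((fun k => Ad k A) @^-1` [set A]).
  by apply/seteqP; split=> k [Kk h]; split=> // A aA; apply: h.
apply: compact_closedI; first exact: (red_Kcompact HG).
apply: closed_bigI => A _; apply: preimage_closed.
  by move=> k _; exact: Ad_cont.
exact/accessible_closed_set1/hausdorff_accessible/norm_hausdorff.
Qed.

Lemma torus_split t X : torus t -> t X -> exists A Z,
  [/\ X = A + Z, t A /\ theta A = (-1) *: A & t Z /\ theta Z = 1 *: Z].
Proof.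
move=> [lt tth _] tX; have [Z [A [e hZ hA]]] := kp_split HG X.
have eZ : Z = 2^-1 *: (X + theta X).
  by rewrite e [theta (Z + A)]linearD hZ hA; apply/rowP => j; rewrite !mxE; field.
have eA : A = 2^-1 *: (X + (-1) *: theta X).
  by rewrite e [theta (Z + A)]linearD hZ hA; apply/rowP => j; rewrite !mxE; field.
exists A, Z; rewrite scaleN1r scale1r; split; first by rewrite addrC.
  split=> //; rewrite eA; apply: lin_closedZ => //; apply: lin_closedD => //.
  by apply: lin_closedZ => //; exact: tth.
split=> //; rewrite eZ; apply: lin_closedZ => //; apply: lin_closedD => //; exact: tth.
Qed.

(** The basis diagonalises [a] plus a maximal abelian subspace [m] of the centralizer of [a] in the
    k-part. The k-part of [t] centralises [a], so the compact group fixing [a] pointwise can move it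
    into [m] without disturbing the p-part, which lies in [a]. *)
Lemma compact_part (a : V -> Prop) : lin_closed a -> (forall A, a A -> theta A = (-1) *: A) ->
  abelian_pred (G := G) a -> exists b : obasis L, forall t, torus t ->
    (forall X, t X -> theta X = (-1) *: X -> a X) ->
    (forall Z, t Z -> theta Z = 1 *: Z -> forall A, a A -> br A Z = 0) ->
    exists2 k, K k & forall X, t X -> diagonal b (Ad k X).
Proof.
move=> la ap ab.
pose z Z := (forall A, a A -> br A Z = 0) /\ theta Z = 1 *: Z.
have lz : lin_closed z.
  apply: eigen_theta_lin; split=> [A _|c X Y hX hY A aA]; first exact: lbr0r.
  by rewrite lbr_linr hX // hY // scaler0 addr0.
have [m [lm mz ma mmax]] := maximal_abelian (G := G) lz.
pose h X := exists A Z, [/\ a A, m Z & X = A + Z].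
have th : torus h.
  split.
  - split; first by exists 0, 0; rewrite addr0; split=> //; [exact: la.1|exact: lm.1].
    move=> c X Y [A [Z [aA mZ ->]]] [A' [Z' [aA' mZ' ->]]].
    exists (c *: A + A'), (c *: Z + Z'); split; [exact: la.2|exact: lm.2|].
    by apply/rowP => i; rewrite !mxE; ring.
  - move=> X [A [Z [aA mZ ->]]]; exists ((-1) *: A), Z; split=> //; first exact: lin_closedZ.
    by rewrite linearD /= ap // (mz _ mZ).2 scale1r.
  - move=> X Y [A [Z [aA mZ ->]]] [A' [Z' [aA' mZ' ->]]].
    have e : br Z A' = 0 by rewrite lbrC (mz _ mZ).1 ?oppr0.
    by rewrite lbrDl !lbrDr (ab A A') // (ma Z Z') // e (mz _ mZ').1 // !addr0.
have [lh hth hab] := th; have [b hb] := torus_basis HG lh hth hab.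
exists b => t tt ta tz; have [lt tth tab] := tt.
have lk := eigen_theta_lin 1 lt.
pose K' := [set k | K k /\ forall A, a A -> Ad k A = A].
have [||||||k [Kk kA] hk] := conj_into_maximal HG (K' := K') (s := z) (m := m) (c := 1) _ _ (@fixator_compact a)
    lz (fun X => @proj2 _ _) (or_introl erefl) _ _ lm mz ma mmax lk _ _.
- by exists 1%g; split=> [|A _]; [exact: (red_K1 HG)|exact: Ad1].
- by move=> k [].
- move=> k X [Kk kA] [zX hX]; split=> [A aA|].
    by rewrite -(kA A aA) -Ad_br zX // Ad0.
  by rewrite -(Ad_theta HG) // hX scale1r scale1r.
- move=> k X Y [Kk kA] [zX hX] [zY hY] c; rewrite scale1r in hX; rewrite scale1r in hY; split.
    by apply: (red_KM HG) => //; apply: (k0_exp HG); exact: (k_of_kk HG).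
  move=> A aA; rewrite AdM kA // Ad_exp_fix // lbrZl lbrC lbr_jacobi (zX A aA) (zY A aA).
  by rewrite lbr0l lbr0r addr0 oppr0 scaler0.
- by move=> X [tX hX]; split=> // A aA; exact: tz.
- by move=> X Y [tX _] [tY _]; exact: tab.
exists k => // X tX; have [A [Z [-> [tA hA] [tZ hZ]]]] := torus_split tt tX.
have [AD _ _ _] := Ad_lin k; rewrite AD; apply: hb; exists A, (Ad k Z); split.
- exact: ta.
- exact: hk.
- by rewrite kA //; exact: ta.
Qed.

Lemma torus_conj t k : K k -> torus t -> torus (fun X => t (Ad k^-1%g X)).
Proof.
move=> Kk [lt tth tab]; have Kk' : K k^-1%g by exact: (red_KV HG).
split.
- by split=> [|c X Y hX hY]; [rewrite Ad0; exact: lt.1|rewrite Ad_linP; exact: lt.2].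
- by move=> X hX; rewrite (Ad_theta HG) //; exact: tth.
- by move=> X Y hX hY; rewrite -(AdKV k X) -(AdKV k Y) -Ad_br tab // Ad0.
Qed.

(* The split part [t /\ p] moves into a fixed
   maximal abelian subspace [a0] of [p], and the centralizer of a subspace of
   [a0] depends only on the set [J] of weights of [a0] that vanish on it. *)
Theorem torus_classes : exists bs : {set 'I_N} -> obasis L, forall t, torus t ->
  exists J k, K k /\ forall X, t X -> diagonal (bs J) (Ad k X).
Proof.
have lp : lin_closed (fun X => True /\ theta X = (-1) *: X) by exact: eigen_theta_lin.
have [a0 [la0 a0p a0a a0max]] := maximal_abelian (G := G) lp.
have a0th X : a0 X -> a0 (theta X).
  by move=> aX; rewrite (a0p X aX).2; exact: lin_closedZ.
have [b0 hb0] := torus_basis HG la0 a0th a0a.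
pose ev X i := ob_co b0 i (gbr G (rlV X) (ob_v b0 i)).
have evE X i : a0 X -> gbr G (rlV X) (ob_v b0 i) = ev X i *: ob_v b0 i.
  by move=> tX; have [c e] := hb0 X tX i; rewrite [in RHS]/ev e (coZ (ob_col b0)) ob_cov eqxx mulr1.
pose aJ (J : {set 'I_N}) A := a0 A /\ forall i, i \in J -> gbr G (rlV A) (ob_v b0 i) = 0.
have laJ J : lin_closed (aJ J).
  split=> [|c X Y [aX hX] [aY hY]].
    by split=> [|i _]; [exact: la0.1|rewrite rlV0 -(brL HG) (br0l (sl_brl L))].
  split=> [|i iJ]; first exact: la0.2.
  by rewrite rlV_lin -(brL HG) sl_brl !(brL HG) hX // hY // scaler0 addr0.
have /choice [bs hbs] : forall J, exists b : obasis L, forall t, torus t ->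
    (forall X, t X -> theta X = (-1) *: X -> aJ J X) ->
    (forall Z, t Z -> theta Z = 1 *: Z -> forall A, aJ J A -> br A Z = 0) ->
    exists2 k, K k & forall X, t X -> diagonal b (Ad k X).
  move=> J; apply: compact_part; first exact: laJ.
    by move=> A [/a0p []].
  by move=> X Y [aX _] [aY _]; exact: a0a.
exists bs => t tt; have [lt tth tab] := tt.
have lkp := eigen_theta_lin (-1) lt.
have [||||||k1 Kk1 hk1] := conj_into_maximal HG (K' := K) (s := fun X => True /\ theta X = (-1) *: X) (m := a0) (c := -1) _ _ (red_Kcompact HG)
    lp (fun X => @proj2 _ _) (or_intror erefl) _ _ la0 a0p a0a a0max lkp _ _.
- by exists 1%g; exact: (red_K1 HG).
- by [].
- move=> k X Kk [_ hX]; split=> //; rewrite -(Ad_theta HG) // hX.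
  by have [_ _ -> _] := Ad_lin k.
- move=> k X Y Kk [_ hX] [_ hY] c; apply: (red_KM HG) => //; apply: (k0_exp HG).
  by apply: (k_of_pp HG); rewrite ?hX ?hY scaleN1r.
- by move=> X [].
- by move=> X Y [tX _] [tY _]; exact: tab.
pose t1 X := t (Ad k1^-1%g X).
have tt1 : torus t1 := torus_conj Kk1 tt.
(* [aJ J] may be larger than the p-part of [t1], but it is killed by the same weights of [a0]. So
   the k-part of [t1], whose coordinates outside [J] vanish because it commutes with the p-part,
   commutes with [aJ J] as well. *)
pose J : {set 'I_N} := [set i | `[< forall A, t1 A -> theta A = (-1) *: A -> gbr G (rlV A) (ob_v b0 i) = 0 >]]%SET.
have t1a0 A : t1 A -> theta A = (-1) *: A -> a0 A.
  move=> tA hA; rewrite -(AdKV k1 A); apply: hk1; split=> //.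
  rewrite -(Ad_theta HG); last exact: (red_KV HG).
  by rewrite hA; have [_ _ -> _] := Ad_lin k1^-1%g.
have [||k Kk hk] := hbs J t1 tt1.
- move=> A tA hA; split; first exact: t1a0.
  by move=> i; rewrite inE => /asboolP; apply.
- move=> Z tZ hZ A [aA hA].
  have : gbr G (rlV A) (rlV Z) = 0 *: rlV Z.
    apply/(eigen_coP (ob_coE b0) (ob_col b0) (ob_cov b0) (ad_linP HG A) (fun i => evE A i aA)) => i ei.
    have : i \notin J by apply: contraNN ei => /hA; rewrite /ev => ->; rewrite (co0 (ob_col b0)).
    rewrite inE => /asboolP iJ; apply: contrapT => ci; apply: iJ => A' tA' hA'.
    have aA' := t1a0 A' tA' hA'; rewrite evE //.
    have zA' : gbr G (rlV A') (rlV Z) = 0 *: rlV Z.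
      have [_ _ tab1] := tt1.
      by rewrite gbr_rl2 (tab1 _ _ tA' tZ) rlV0 scale0r.
    have /(eigen_coP (ob_coE b0) (ob_col b0) (ob_cov b0) (ad_linP HG A') (fun i => evE A' i aA')) h := zA'.
    have [->|/h //] := eqVneq (ev A' i) 0; by rewrite scale0r.
  by rewrite gbr_rl2 scale0r; exact: rlV_eq0.
exists J, (k * k1)%g; split; first exact: (red_KM HG).
by move=> X tX; rewrite AdM; apply: hk; rewrite /t1 AdVK.
Qed.

End TorusClasses.

Theorem proposition3p4 (R : realType) (n : nat) (G : lieGroupType R n)
    (K : set G) (theta : {linear 'rV[R]_n -> 'rV[R]_n})
    (B : 'rV[R]_n -> 'rV[R]_n -> R)
    (HG : reductive_group K theta B) :
  exists (r : nat) (q : 'I_r -> {vspace 'rV[R[i]]_n}),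
    (forall j, borel_in (gbr G) fullv (q j) /\ constructible G theta (q j)) /\
    dense (\bigcup_(j in [set: 'I_r]) conjugates_of (levi_subgroup G theta (q j))).
Proof.
have [bs hbs] := torus_classes HG.
(* Each candidate is spanned by part of one of finitely many bases, so pairs of index sets form a
   finite type; the pairs whose span is not both Borel and constructible are filtered out. *)
pose T := ({set 'I_(\dim {:'rV[R[i]]_n})} * {set 'I_(\dim {:'rV[R[i]]_n})})%type.
pose Q (p : T) := spanv (ob_co (bs p.1)) (fun i => i \in p.2).
pose good q := borel_in (gbr G) fullv q /\ constructible G theta q.
pose s := [seq p <- enum {: T} | `[< good (Q p) >]].
exists (size s), (fun j => Q (tnth (in_tuple s) j)); split.
  by move=> j; have := mem_tnth j (in_tuple s); rewrite mem_filter => /andP[/asboolP].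
move=> O O0 oO.
have [t [lt tth tab tcc [u [x [Ou fu]]]]] := generic_fixed_torus HG oO O0.
have tt : torus (G := G) (theta := theta) t by [].
have [J [k [Kk hk]]] := hbs t tt.
have [lt' tth' tab'] := torus_conj HG Kk tt.
have [|X tX|S [hb hc hL]] := good_torus (b := bs J) lt' tth' tab'.
- have cc z : ccent (G := G) (fun X => t (Ad k^-1%g X)) z -> ccent (G := G) t (cAd k^-1%g z).
    move=> hz X tX; rewrite -(AdVK k X) -cAd_rl -cAd_gbr hz ?(lin0 (cAd_lin _)) //.
    by rewrite AdVK.
  move=> z w /cc hz /cc hw; have := tcc _ _ hz hw; rewrite -cAd_gbr => h.
  by rewrite -(cAdKV k (gbr G z w)) h (lin0 (cAd_lin _)).
- by move=> i; rewrite -(AdKV k X); exact: hk.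
pose p : T := (J, [set i | S i]%SET).
have eQ : Q p = spanv (ob_co (bs J)) S.
  by rewrite /Q; congr (spanv _ _); apply/funext => i; rewrite inE.
have ps : p \in s by rewrite mem_filter mem_enum andbT; apply/asboolP; rewrite /good eQ.
have lt_ps : (index p s < size s)%N by rewrite index_mem.
exists u; split=> //; exists (Ordinal lt_ps) => //.
rewrite (tnth_nth p) /= nth_index // eQ.
(* Conjugation by [x] brings [u] into the centralizer of [t], and [k] then moves [t] to the torus
   diagonal in [bs J]; so [k x] conjugates [u] into the Levi factor. *)
exists (k * x)^-1%g => //; exists ((k * x) * u * (k * x)^-1)%g.
  apply: hL => X tX.
  have -> : ((k * x) * u * (k * x)^-1)%g = (k * ((x * u * x^-1) * k^-1))%g.
    by rewrite invgM !mulgA.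
  by rewrite AdM AdM fu // AdKV.
by move: (k * x)%g => y; rewrite invgK !mulgA mulVg mul1g mulgVK.
Qed.
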